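(* Suppose $a\not\equiv0$ and $$\varepsilon^{-1}\eta(\varepsilon)\to\alpha=\mathrm{const}\ge0,\qquad \varepsilon\to+0 .$$ Let $\mathcal{H}^{\mathrm R}_0$ be the operator described in the context with the coefficient $$a_0(x_1):=a(x_1,0)\int_0^1\sqrt{1+\alpha^2\big(b'(t)\big)^2}\,dt .$$ Then there exist constants $\varepsilon_0>0$ and $C>0$ such that for all $0<\varepsilon<\varepsilon_0$ and all $f\in L_2(\Omega_0)$, $$\big\|(\mathcal{H}^{\mathrm R}_{\varepsilon,\eta}-\mathrm{i})^{-1}f-(\mathcal{H}^{\mathrm R}_0-\mathrm{i})^{-1}f\big\|_{W_2^1(\Omega_\varepsilon)}\le C\big(\eta^{1/2}(\varepsilon)+|\varepsilon^{-2}\eta^2(\varepsilon)-\alpha^2|\big)\|f\|_{L_2(\Omega_0)} .$$ In particular $C$ is independent of $\varepsilon$ and $f$.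
   Context: Coordinates are $x=(x_1,x_2)\in\mathbb{R}^2$; $\varepsilon>0$ is a small parameter; $\eta=\eta(\varepsilon)\ge 0$ is a function (bounded for small $\varepsilon$); $b\in C^2(\mathbb{R})$ is real, non-negative and $1$-periodic; $d>0$ is a constant. Put $$\Omega_0=\{x:0<x_2<d\},\quad \Omega_\varepsilon=\{x:\eta(\varepsilon)b(x_1\varepsilon^{-1})<x_2<d\},$$ $$\Gamma=\{x_2=d\},\quad \Gamma_0=\{x_2=0\},\quad \Gamma_\varepsilon=\{x_2=\eta(\varepsilon)b(x_1\varepsilon^{-1})\}.$$ $W_2^j$ are the usual $L_2$-based Sobolev spaces (of complex-valued functions), $W_\infty^j$ the $L_\infty$-based ones, and $W_{2,0}^j(\Omega,S)$ is the space of functions in $W_2^j(\Omega)$ with zero trace on the curve $S$. Coefficients ($i,j=1,2$): $A_{ij}\in W_\infty^2(\Omega_0)$ and $A_j\in W_\infty^1(\Omega_0)$ are complex-valued, $A_0\in L_\infty(\Omega_0)$ is real-valued, and for some constant $c_0>0$ $$A_{ij}=\overline{A_{ji}},\qquad \sum_{i,j=1}^2A_{ij}(x)z_i\overline{z_j}\ge c_0(|z_1|^2+|z_2|^2),\quad x\in\Omega_0,\ z_1,z_2\in\mathbb{C}.$$ The function $a=a(x)$ is real and belongs to $W_\infty^1(\{x:0<x_2<\delta_0\})$ for some small fixed $\delta_0>0$ (it is identified with its Lipschitz continuous representative on the closed strip). For $\Omega\in\{\Omega_\varepsilon,\Omega_0\}$ consider the sesquilinear form $$\mathfrak{h}_\Omega(u,v)=\sum_{i,j=1}^2\Big(A_{ij}\tfrac{\partial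 u}{\partial x_j},\tfrac{\partial v}{\partial x_i}\Big)_{L_2(\Omega)}+\sum_{j=1}^2\Big(A_j\tfrac{\partial u}{\partial x_j},v\Big)_{L_2(\Omega)}+\sum_{j=1}^2\Big(u,A_j\tfrac{\partial v}{\partial x_j}\Big)_{L_2(\Omega)}+(A_0u,v)_{L_2(\Omega)} .$$ $\mathcal{H}^{\mathrm R}_{\varepsilon,\eta}$ is the self-adjoint lower-semibounded operator in $L_2(\Omega_\varepsilon)$ associated with the form $\mathfrak{h}_{\Omega_\varepsilon}(u,v)+(au,v)_{L_2(\Gamma_\varepsilon)}$ with domain $W_{2,0}^1(\Omega_\varepsilon,\Gamma)$ (Dirichlet condition on $\Gamma$, Robin condition with coefficient $a$ on $\Gamma_\varepsilon$; $L_2(\Gamma_\varepsilon)$ is taken with respect to arc length). Given $a_0\in W_\infty^1(\Gamma_0)$, $\mathcal{H}^{\mathrm R}_0$ is the self-adjoint operator in $L_2(\Omega_0)$ associated with the lower-semibounded form $\mathfrak{h}_{\Omega_0}(u,v)+(a_0u,v)_{L_2(\Gamma_0)}$ with domain $W_{2,0}^1(\Omega_0,\Gamma)$. For $f\in L_2(\Omega_0)$, $(\mathcal{H}^{\mathrm R}_{\varepsilon,\eta}-\mathrm i)^{-1}f$ means the resolvent applied to the restriction $f|_{\Omega_\varepsilon}$, and $(\mathcal{H}^{\mathrm R}_0-\mathrm i)^{-1}f$ is restricted to $\Omega_\varepsilon$ when the norm of $W_2^1(\Omega_\varepsilon)$ is taken. *)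

(* Defs.v *)
From HB Require Import structures.
From mathcomp Require Import all_boot all_order all_algebra.
From mathcomp Require Import complex.
From mathcomp Require Import all_classical all_reals all_analysis.

Set Implicit Arguments.
Unset Strict Implicit.
Unset Printing Implicit Defensive.

Import Order.TTheory GRing.Theory Num.Theory.
Import numFieldNormedType.Exports.

Local Open Scope classical_set_scope.
Local Open Scope ring_scope.
Local Open Scope complex_scope.

(* Functions on a domain Omega of the plane are represented by functions on the
   whole plane; only their values on Omega matter. *)

Section ComplexIntegrals.
Context {R : realType} {disp : measure_display} {T : measurableType disp}.
Variable mu : {measure set T -> \bar R}.

Definition sqmod (z : R[i]) : R := complex.Re z ^+ 2 + complex.Im z ^+ 2.

Definition cmeasurable (D : set T) (f : T -> R[i]) : Prop :=
  measurable_fun D (fun x => complex.Re (f x)) /\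
  measurable_fun D (fun x => complex.Im (f x)).

Definition cintegrable (D : set T) (f : T -> R[i]) : Prop :=
  mu.-integrable D (fun x => (complex.Re (f x))%:E) /\
  mu.-integrable D (fun x => (complex.Im (f x))%:E).

Definition cintegral (D : set T) (f : T -> R[i]) : R[i] :=
  (\int[mu]_(x in D) complex.Re (f x)) +i*
  (\int[mu]_(x in D) complex.Im (f x)).

(* Extended-real valued: +oo when f is not square-integrable. *)
Definition L2normsq (D : set T) (f : T -> R[i]) : \bar R :=
  (\int[mu]_(x in D) (sqmod (f x))%:E)%E.

Definition inL2 (D : set T) (f : T -> R[i]) : Prop :=
  cmeasurable D f /\ (L2normsq D f < +oo)%E.

(* sqmod z is |z|^2, so the bound is on |f x|. *)
Definition inLinf (D : set T) (f : T -> R[i]) : Prop :=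
  cmeasurable D f /\
  exists M : R, {ae mu, forall x, D x -> Num.sqrt (sqmod (f x)) <= M}.

Definition inner (D : set T) (f g : T -> R[i]) : R[i] :=
  cintegral D (fun x => f x * conjc (g x)).

End ComplexIntegrals.

Section Sobolev.
Context {R : realType}.

Definition area : {measure set (measurableTypeR R * measurableTypeR R) -> \bar R} :=
  (@lebesgue_measure R \x @lebesgue_measure R)%E.

Implicit Types (Omega : set (R * R)) (u v f g : R * R -> R[i]) (j : 'I_2).

Definition evec j : R * R := if j == ord0 then (1, 0) else (0, 1).

Definition partial j (phi : R * R -> R) : R * R -> R :=
  fun x => 'D_(evec j) phi x.

Definition smooth (phi : R * R -> R) : Prop :=
  forall s : seq 'I_2,
    continuous (foldr partial phi s) /\
    (forall j x, derivable (foldr partial phi s) x (evec j)).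

Definition test_function Omega (phi : R * R -> R) : Prop :=
  [/\ smooth phi,
      compact (closure [set x | phi x != 0]) &
      closure [set x | phi x != 0] `<=` Omega].

Definition locally_int Omega u : Prop :=
  forall K : set (R * R), compact K -> K `<=` Omega -> cintegrable area K u.

Definition is_weak_deriv Omega j u g : Prop :=
  [/\ locally_int Omega u, locally_int Omega g &
      forall phi, test_function Omega phi ->
        cintegral area Omega (fun x => u x * (partial j phi x)%:C) =
        - cintegral area Omega (fun x => g x * (phi x)%:C)].

(* The weak derivative (unique up to a null set), 0 if there is none. *)
Definition weak_deriv Omega j u : R * R -> R[i] :=
  xget (fun=> 0) [set g | is_weak_deriv Omega j u g].

Fixpoint sobolev (L : (R * R -> R[i]) -> Prop) Omega (k : nat) u : Prop :=
  L u /\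
  if k is k'.+1 then
    forall j, exists2 g, is_weak_deriv Omega j u g & sobolev L Omega k' g
  else True.

Definition W2 Omega k u : Prop := sobolev (inL2 area Omega) Omega k u.

Definition Winf Omega k u : Prop := sobolev (inLinf area Omega) Omega k u.

Definition L2norm Omega u : \bar R := poweR (L2normsq area Omega u) 2^-1.

Definition W12norm Omega u : \bar R :=
  poweR (L2normsq area Omega u +
         \sum_(j < 2) L2normsq area Omega (weak_deriv Omega j u))%E 2^-1.

(* Curves are graphs x_2 = gamma x_1; functions on such a curve are represented
   as functions of x_1, and integrated against the arc length. *)
Implicit Types (gamma : R -> R) (s t : R -> R[i]).

Definition arc_density gamma (y : R) : R := Num.sqrt (1 + derive1 gamma y ^+ 2).

Definition arc_inner gamma s t : R[i] :=
  cintegral (@lebesgue_measure R) setT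
    (fun y => s y * conjc (t y) * (arc_density gamma y)%:C).

Definition arc_L2normsq gamma t : \bar R :=
  (\int[@lebesgue_measure R]_(y in setT)
     (sqmod (t y) * arc_density gamma y)%:E)%E.

Definition arc_inL2 gamma t : Prop :=
  cmeasurable setT t /\ (arc_L2normsq gamma t < +oo)%E.

(* The trace is the continuous extension to W_2^1(Omega) of the restriction
   to the curve of smooth functions with compact support in the plane. *)
Definition is_trace Omega gamma u t : Prop :=
  arc_inL2 gamma t /\
  exists phi : nat -> R * R -> R[i],
    [/\ forall n, test_function setT (fun x => complex.Re (phi n x)) /\
                  test_function setT (fun x => complex.Im (phi n x)),
        (fun n => W12norm Omega (fun x => phi n x - u x)) @ \oo --> 0%E &
        (fun n => arc_L2normsq gamma (fun y => phi n (y, gamma y) - t y))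
          @ \oo --> 0%E].

Definition trace Omega gamma u : R -> R[i] :=
  xget (fun=> 0) [set t | is_trace Omega gamma u t].

Definition W12_zero_trace Omega gamma u : Prop :=
  W2 Omega 1 u /\ is_trace Omega gamma u (fun=> 0).

(* The graph of the operator in L_2(Omega) associated with the sesquilinear
   form q with domain dom. *)
Definition form_operator Omega (dom : set (R * R -> R[i]))
    (q : (R * R -> R[i]) -> (R * R -> R[i]) -> R[i]) u f : Prop :=
  [/\ dom u, inL2 area Omega f &
      forall v, dom v -> q u v = inner area Omega f v].

(* (H - z)^-1 f for an operator H given by its graph: the u (unique up to a
   null set when H is self-adjoint and z is not real) with H u = f + z u. *)
Definition resolvent (H : (R * R -> R[i]) -> (R * R -> R[i]) -> Prop)
    (z : R[i]) f : R * R -> R[i] :=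
  xget (fun=> 0) [set u | H u (fun x => f x + z * u x)].

Definition layer gamma (d : R) : set (R * R) :=
  [set x | gamma x.1 < x.2 < d].

Definition osc_curve (eta b : R -> R) (eps : R) : R -> R :=
  fun y => eta eps * b (y * eps^-1).

Section Operators.
Variables (A : 'I_2 -> 'I_2 -> R * R -> R[i]) (A1 : 'I_2 -> R * R -> R[i])
          (A0 : R * R -> R).

Definition bulk_form Omega u v : R[i] :=
  \sum_(i < 2) \sum_(j < 2)
     inner area Omega (fun x => A i j x * weak_deriv Omega j u x)
                      (weak_deriv Omega i v)
  + \sum_(j < 2) inner area Omega (fun x => A1 j x * weak_deriv Omega j u x) v
  + \sum_(j < 2) inner area Omega u (fun x => A1 j x * weak_deriv Omega j v x)
  + inner area Omega (fun x => (A0 x)%:C * u x) v.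

(* kappa is the Robin coefficient on x_2 = gamma x_1, as a function of x_1. *)
Definition robin_form Omega gamma (kappa : R -> R) u v : R[i] :=
  bulk_form Omega u v
  + arc_inner gamma (fun y => (kappa y)%:C * trace Omega gamma u y)
                    (trace Omega gamma v).

Definition robin_operator (d : R) gamma (kappa : R -> R) u f : Prop :=
  form_operator (layer gamma d) (W12_zero_trace (layer gamma d) (fun=> d))
    (robin_form (layer gamma d) gamma kappa) u f.

Definition robin_operator_eps (d : R) (eta b : R -> R) (a : R * R -> R)
    (eps : R) u f : Prop :=
  robin_operator d (osc_curve eta b eps)
    (fun y => a (y, osc_curve eta b eps y)) u f.

Definition robin_operator0 (d : R) (a0 : R -> R) u f : Prop :=
  robin_operator d (fun=> 0) a0 u f.

End Operators.

Definition homogenized_coef (alpha : R) (b : R -> R) (a : R * R -> R) : R -> R :=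
  fun y => a (y, 0) *
    \int[@lebesgue_measure R]_(t in `[0, 1])
       Num.sqrt (1 + alpha ^+ 2 * derive1 b t ^+ 2).

End Sobolev.

(* Main.v *)
(* The operator H - i is treated as a real system for the real and
   imaginary parts, solved by Lax-Milgram; it is stable with respect to the W_2^1
   norm.  Let s be the maximal height of the oscillating curve and S the affine
   vertical map of 0 < x_2 < d onto s < x_2 < d.  No second derivatives of the
   limit solution u_0 are needed: comparing the energies of u_0 and u_0 o S in the
   equation tested with u_0 - u_0 o S shows that both |grad (u_0 - u_0 o S)|^2 and
   the energy of u_0 in the strip 0 < x_2 < s are O(s |f|^2).  A test function v on
   the perturbed domain is admissible for the limit problem after composition with
   S, so the difference of the two solutions has a residual of order s^(1/2), up to
   the difference of the boundary terms.  The latter consists of terms of order s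
   and |eta^2/eps^2 - alpha^2|, and of the integral over the flat boundary of
   a(y, 0) g(y/eps) u v with g periodic of mean zero; an approximate primitive of
   a(y, 0) g(y/eps) of size eps, integrated by parts and averaged over
   0 < x_2 < eps, bounds it by eps^(1/2).  If alpha > 0 then eps = O(eta), and if
   alpha = 0 then g = 0. *)

Require Import Defs.
From HB Require Import structures.
From mathcomp Require Import all_boot all_order all_algebra.
From mathcomp Require Import complex ring lra.
From mathcomp Require Import all_classical all_reals all_analysis measurable_realfun.

Set Implicit Arguments.
Unset Strict Implicit.
Unset Printing Implicit Defensive.

Import Order.TTheory GRing.Theory Num.Theory.
Import numFieldNormedType.Exports.

Local Open Scope classical_set_scope.
Local Open Scope ring_scope.

(** The obstacle is the strip below the curve: W_2^1 regularity alone makes the energy of u_0 there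
    small, but with no rate. Put W = u_0 - u_0 o S. By symmetry of the form Q, Q(W) = 2 Q(u_0, W) -
    Q(u_0) + Q(u_0 o S). The first term is the equation tested with W; it involves only the L2 norm
    of W, which is O(s). By the change of variables the energy difference is minus the strip energy,
    up to O(s). The trace of W on the boundary is at most the square root of s times the strip
    energy, so the Robin terms are absorbed, and both W and the strip energy are bounded. The
    coefficient A_0 is only bounded, but it multiplies undifferentiated functions, for which u - u o
    S is already O(s).

    Coercivity of the real system comes from the term -i u: testing with i u gives minus the squared
    L2 norm, so a multiple of i u in the test function pays for all indefinite lower-order and
    boundary terms.

    All inequalities are proved on vertical lines for smooth functions of compact support. They pass
    to limits because form domains are encoded as closures of such functions, traces included. *)

Lemma cvg_eqr {R : realType} (l l' : R) (u : nat -> R) :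
  l = l' -> u @ \oo --> l -> u @ \oo --> l'.
Proof. by move=> ->. Qed.

Lemma squeeze0 {R : realType} (u v : nat -> R) :
  (forall n, 0 <= u n <= v n) -> v @ \oo --> 0 -> u @ \oo --> 0.
Proof.
move=> uv v0; apply: (squeeze_cvgr _ (cvg_cst 0) v0).
by apply: nearW.
Qed.

Lemma cvgn_EFin {R : realType} (u : nat -> R) l :
  u @ \oo --> l -> (fun n => (u n)%:E) @ \oo --> l%:E.
Proof. by move=> ul; apply: cvg_EFin => //; exact: nearW. Qed.

(** * The real space L2 *)

Section AlmostEverywhere.
Context {disp : measure_display} {T : measurableType disp} {R : realType}.
Variables (mu : {measure set T -> \bar R}).

Lemma aeS (P Q : T -> Prop) : (forall x, P x -> Q x) ->
  {ae mu, forall x, P x} -> {ae mu, forall x, Q x}.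
Proof. exact: filterS. Qed.

Lemma aeI (P Q : T -> Prop) : {ae mu, forall x, P x} ->
  {ae mu, forall x, Q x} -> {ae mu, forall x, P x /\ Q x}.
Proof. exact: filterI. Qed.

Lemma aeS2 (P Q S : T -> Prop) : (forall x, P x -> Q x -> S x) ->
  {ae mu, forall x, P x} -> {ae mu, forall x, Q x} -> {ae mu, forall x, S x}.
Proof. by move=> H hP hQ; apply: aeS (aeI hP hQ) => x []; exact: H. Qed.

(** Countable additivity through [pickle]: a natural number that codes no index imposes an empty
    condition. *)
Lemma ae_countable (U : countType) (P : U -> T -> Prop) :
  (forall i, {ae mu, forall x, P i x}) -> {ae mu, forall x, forall i, P i x}.
Proof.
move=> H.
have H' n : {ae mu, forall x, forall i, pickle i = n -> P i x}.
  have [j|] := pselect (exists i : U, pickle i = n).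
    have [i0 i0n] := j; apply: aeS (H i0) => x Pi i.
    by rewrite -i0n => /(pcan_inj pickleK) ->.
  by move=> nx; apply: aeW => x i ni; exfalso; apply: nx; exists i.
apply: (@aeS (fun x => forall n i, pickle i = n -> P i x)); first by move=> x h i; exact: h.
have := negligible_bigcup H'; apply: negligibleS => x /= /existsNP[n hn].
by exists n.
Qed.

End AlmostEverywhere.

Section SquareIntegrable.
Context {disp : measure_display} {T : measurableType disp} {R : realType}.
Variables (mu : {measure set T -> \bar R}) (D : set T).
Hypothesis mD : measurable D.
Implicit Types f g : T -> R.

Definition sqi f : Prop :=
  measurable_fun D f /\ (\int[mu]_(x in D) ((f x ^+ 2)%:E) < +oo)%E.

Definition ip f g : R := \int[mu]_(x in D) (f x * g x).

(** A squared norm. As a real integral it takes the default value 0 where the true value is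
    infinite, so its comparisons go together with [sqi]. *)
Definition nn f : R := ip f f.

Lemma sqi_meas f : sqi f -> measurable_fun D f.
Proof. by case. Qed.

Lemma sqi_int f : sqi f -> mu.-integrable D (EFin \o (fun x => f x * f x)).
Proof.
move=> [mf lf]; apply/integrableP; split.
  by apply/measurable_EFinP; apply: measurable_funM.
apply: le_lt_trans lf; rewrite le_eqVlt; apply/orP; left; apply/eqP.
by apply: eq_integral => x _ /=; rewrite -expr2 ger0_norm// sqr_ge0.
Qed.

Lemma int_sqi f : measurable_fun D f ->
  mu.-integrable D (EFin \o (fun x => f x * f x)) -> sqi f.
Proof.
move=> mf /integrableP[_ lf]; split=> //; apply: le_lt_trans lf.
rewrite le_eqVlt; apply/orP; left; apply/eqP.
by apply: eq_integral => x _ /=; rewrite -expr2 ger0_norm// sqr_ge0.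
Qed.

Lemma ip_int f g : sqi f -> sqi g ->
  mu.-integrable D (EFin \o (fun x => f x * g x)).
Proof.
move=> sf sg.
have := integrableD mD (sqi_int sf) (sqi_int sg).
apply: le_integrable => //.
  by apply/measurable_EFinP; apply: measurable_funM; apply: sqi_meas.
move=> x _ /=; rewrite lee_fin.
rewrite [leRHS]ger0_norm; last by rewrite addr_ge0// -expr2 sqr_ge0.
by rewrite ler_norml; nra.
Qed.

Lemma sqi0 : sqi (fun=> 0).
Proof.
split; first exact: measurable_cst.
by under eq_integral do rewrite expr0n; rewrite integral0.
Qed.

Lemma sqiZ a f : sqi f -> sqi (fun x => a * f x).
Proof.
move=> sf; apply: int_sqi.
  by apply: measurable_funM => //; apply: sqi_meas.
have := integrableZl mD (a ^+ 2) (sqi_int sf).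
by apply: eq_integrable => // x _ /=; rewrite -EFinM; congr (_%:E); ring.
Qed.

Lemma sqiD f g : sqi f -> sqi g -> sqi (fun x => f x + g x).
Proof.
move=> sf sg; apply: int_sqi.
  by apply: measurable_funD; apply: sqi_meas.
have := integrableD mD (integrableD mD (sqi_int sf) (sqi_int sg))
  (integrableZl mD 2 (ip_int sf sg)).
by apply: eq_integrable => // x _ /=; congr (_%:E); ring.
Qed.

Lemma sqiN f : sqi f -> sqi (fun x => - f x).
Proof.
by move=> /(sqiZ (-1)); under eq_fun do rewrite mulN1r.
Qed.

Lemma sqiB f g : sqi f -> sqi g -> sqi (fun x => f x - g x).
Proof. by move=> sf sg; apply: sqiD => //; apply: sqiN. Qed.

Lemma sqi_mulM (m : T -> R) (M : R) f : measurable_fun D m ->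
  {ae mu, forall x, D x -> `|m x| <= M} -> sqi f -> sqi (fun x => m x * f x).
Proof.
move=> mm mM [mf lf]; split; first exact: measurable_funM.
apply: (@le_lt_trans _ _ (\int[mu]_(x in D) ((M ^+ 2)%:E * (f x ^+ 2)%:E))%E).
  apply: ae_ge0_le_integral => //.
  - by move=> x _; rewrite lee_fin sqr_ge0.
  - apply/measurable_EFinP; apply: measurable_funX; exact: measurable_funM.
  - by move=> x _; rewrite -EFinM lee_fin mulr_ge0// sqr_ge0.
  - apply/measurable_EFinP; apply: measurable_funM => //.
    exact: measurable_funX.
  - move: mM; apply: filterS => x mM Dx; move: (mM Dx) => {}mM.
    rewrite -EFinM lee_fin exprMn ler_wpM2r ?sqr_ge0//.
    by rewrite -real_normK ?num_real// lerXn2r ?nnegrE// (le_trans _ mM).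
have -> : (\int[mu]_(x in D) ((M ^+ 2)%:E * (f x ^+ 2)%:E) =
    (M ^+ 2)%:E * \int[mu]_(x in D) (f x ^+ 2)%:E)%E.
  apply: ge0_integralZl_EFin => //; last by rewrite sqr_ge0.
    by move=> x _; rewrite lee_fin sqr_ge0.
  by apply/measurable_EFinP; exact: measurable_funX.
by rewrite lte_mul_pinfty// lee_fin sqr_ge0.
Qed.

Lemma nn_ge0 f : 0 <= nn f.
Proof. by apply: Rintegral_ge0 => x _; rewrite -expr2 sqr_ge0. Qed.

Lemma nnE f : sqi f -> (nn f)%:E = (\int[mu]_(x in D) ((f x ^+ 2)%:E))%E.
Proof.
move=> sf; rewrite /nn /ip /Rintegral fineK.
  by apply: eq_integral => x _; rewrite expr2.
by apply: integrable_fin_num => //; exact: sqi_int.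
Qed.

Lemma ipC f g : ip f g = ip g f.
Proof. by apply: eq_Rintegral => x _; rewrite mulrC. Qed.

Lemma ipDl f g h : sqi f -> sqi g -> sqi h ->
  ip (fun x => f x + g x) h = ip f h + ip g h.
Proof.
move=> sf sg sh; rewrite /ip -RintegralD//; try exact: ip_int.
by apply: eq_Rintegral => x _; rewrite mulrDl.
Qed.

Lemma ipZl a f h : sqi f -> sqi h ->
  ip (fun x => a * f x) h = a * ip f h.
Proof.
move=> sf sh; rewrite /ip -RintegralZl//; try exact: ip_int.
by apply: eq_Rintegral => x _; rewrite mulrA.
Qed.

Lemma nnD f g : sqi f -> sqi g ->
  nn (fun x => f x + g x) = nn f + nn g + 2 * ip f g.
Proof.
move=> sf sg; rewrite /nn ipDl//; last exact: sqiD.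
rewrite ![ip _ (fun x => f x + g x)]ipC !ipDl// (ipC g f); ring.
Qed.

Lemma nnZ a f : sqi f -> nn (fun x => a * f x) = a ^+ 2 * nn f.
Proof.
move=> sf; rewrite /nn ipZl//; last exact: sqiZ.
rewrite ipC ipZl//; ring.
Qed.

Lemma ip_AMGM f g : sqi f -> sqi g -> 2 * `|ip f g| <= nn f + nn g.
Proof.
move=> sf sg.
have h1 := nn_ge0 (fun x => f x + g x).
have h2 := nn_ge0 (fun x => f x + (-1) * g x).
move: h1 h2; rewrite !nnD// ?nnZ//; last exact: sqiZ.
rewrite [ip f (fun x => -1 * g x)]ipC ipZl// (ipC g f).
by case: (ger0P (ip f g)) => _; lra.
Qed.

Lemma ip_CS f g : sqi f -> sqi g ->
  `|ip f g| <= Num.sqrt (nn f) * Num.sqrt (nn g).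
Proof.
move=> sf sg.
rewrite -sqrtrM ?nn_ge0// -[leLHS]sqrtr_sqr ler_sqrt; last first.
  by rewrite mulr_ge0// nn_ge0.
have H a b : 0 <= a ^+ 2 * nn f + b ^+ 2 * nn g + 2 * (a * b * ip f g).
  have := nn_ge0 (fun x => a * f x + b * g x).
  rewrite nnD; try exact: sqiZ.
  rewrite !nnZ// ipZl//; try exact: sqiZ.
  by rewrite ipC ipZl// (ipC g f) !mulrA.
have := nn_ge0 f; rewrite le_eqVlt => /predU1P[f0|f0].
  have [->|i0] := eqVneq (ip f g) 0.
    by rewrite expr0n/= -f0 mul0r.
  (* Where [nn f] is 0 the quadratic is affine in [a], and this choice gives it the value -1. *)
  have := H (- (nn g + 1) / (2 * ip f g)) 1.
  rewrite -f0 mulr0 add0r expr1n mul1r mulr1.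
  have -> : 2 * (- (nn g + 1) / (2 * ip f g) * ip f g) = - (nn g + 1) by field.
  lra.
have := H (- ip f g / nn f) 1.
have -> : (- ip f g / nn f) ^+ 2 * nn f + 1 ^+ 2 * nn g +
   2 * (- ip f g / nn f * 1 * ip f g) = (nn f * nn g - ip f g ^+ 2) / nn f.
  by field; rewrite gt_eqF.
by rewrite pmulr_lge0 ?invr_gt0// subr_ge0.
Qed.

Lemma nn_tri f g : sqi f -> sqi g ->
  Num.sqrt (nn (fun x => f x + g x)) <= Num.sqrt (nn f) + Num.sqrt (nn g).
Proof.
move=> sf sg; rewrite -[leRHS]ger0_norm ?addr_ge0 ?sqrtr_ge0//.
rewrite -sqrtr_sqr ler_sqrt ?sqr_ge0// nnD// sqrrD !sqr_sqrtr ?nn_ge0//.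
have := ip_CS sf sg; have := ler_norm (ip f g); lra.
Qed.

Lemma nn_mulM (m : T -> R) (M : R) f : 0 <= M -> measurable_fun D m ->
  {ae mu, forall x, D x -> `|m x| <= M} -> sqi f ->
  nn (fun x => m x * f x) <= M ^+ 2 * nn f.
Proof.
move=> M0 mm mM sf; rewrite -nnZ// -lee_fin nnE ?nnE//; last 2 first.
- exact: sqiZ.
- exact: sqi_mulM mM sf.
have [mf lf] := sf.
apply: ae_ge0_le_integral => //.
- by move=> x _; rewrite lee_fin sqr_ge0.
- by apply/measurable_EFinP; apply: measurable_funX; exact: measurable_funM.
- by move=> x _; rewrite lee_fin sqr_ge0.
- by apply/measurable_EFinP; apply: measurable_funX; exact: measurable_funM.
- move: mM; apply: filterS => x mM Dx; move: (mM Dx) => {}mM.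
  rewrite lee_fin !exprMn ler_wpM2r ?sqr_ge0//.
  by rewrite -real_normK ?num_real// lerXn2r ?nnegrE// (le_trans _ mM).
Qed.

Lemma eq_nn f g : {in D, f =1 g} -> nn f = nn g.
Proof. by move=> fg; apply: eq_Rintegral => x xD; rewrite fg. Qed.

Definition cvgL2 (fn : nat -> T -> R) f : Prop :=
  [/\ forall n, sqi (fn n), sqi f &
      (fun n => nn (fun x => fn n x - f x)) @ \oo --> 0].

Lemma sqrt_cvg0 (u : nat -> R) : u @ \oo --> 0 ->
  (fun n => Num.sqrt (u n)) @ \oo --> 0.
Proof.
move=> u0; rewrite -[X in _ --> X]sqrtr0.
exact: (continuous_cvg _ (@sqrt_continuous R 0) u0).
Qed.

Lemma cvgL2_lim fn f : cvgL2 fn f -> sqi f.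
Proof. by case. Qed.

Lemma cvgL2_nn fn f : cvgL2 fn f -> (fun n => nn (fn n)) @ \oo --> nn f.
Proof.
move=> [sfn sf cf].
have E n : nn (fn n) = nn f + nn (fun x => fn n x - f x) +
    2 * ip f (fun x => fn n x - f x).
  rewrite -nnD//; last exact: sqiB.
  by apply: eq_nn => x _; ring.
have c2 : (fun n => ip f (fun x => fn n x - f x)) @ \oo --> 0.
  apply: norm_cvg0; apply: (@squeeze0 _ _
    (fun n => Num.sqrt (nn f) * Num.sqrt (nn (fun x => fn n x - f x)))).
    by move=> n; rewrite normr_ge0/= ip_CS//; exact: sqiB.
  by apply: cvg_eqr (mulr0 (Num.sqrt (nn f))) _; apply: cvgMr; exact: sqrt_cvg0.
under eq_fun do rewrite E.
apply: (@cvg_eqr _ (nn f + 0 + 2 * 0)); first by ring.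
by apply: cvgD; [apply: cvgD => //; exact: cvg_cst|apply: cvgMr].
Qed.

Lemma cvgL2D fn f gn g : cvgL2 fn f -> cvgL2 gn g ->
  cvgL2 (fun n x => fn n x + gn n x) (fun x => f x + g x).
Proof.
move=> [sfn sf cf] [sgn sg cg]; split; first by move=> n; exact: sqiD.
  exact: sqiD.
apply: (@squeeze0 _ _ (fun n =>
  2 * (nn (fun x => fn n x - f x) + nn (fun x => gn n x - g x)))).
  move=> n; rewrite nn_ge0/=.
  have -> : nn (fun x => fn n x + gn n x - (f x + g x)) =
      nn (fun x => (fn n x - f x) + (gn n x - g x)).
    by apply: eq_nn => x _; ring.
  have s1 := sqiB (sfn n) sf; have s2 := sqiB (sgn n) sg.
  rewrite nnD//; have := ip_AMGM s1 s2; have := ler_norm (ip (fun x => fn n x - f x) (fun x => gn n x - g x)); lra.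
apply: (@cvg_eqr _ (2 * (0 + 0))); first by ring.
by apply: cvgMr; exact: cvgD.
Qed.

Lemma cvgL2Z a fn f : cvgL2 fn f ->
  cvgL2 (fun n x => a * fn n x) (fun x => a * f x).
Proof.
move=> [sfn sf cf]; split; first by move=> n; exact: sqiZ.
  exact: sqiZ.
rewrite (_ : (fun n => _) = (fun n => a ^+ 2 * nn (fun x => fn n x - f x))).
  by rewrite -[X in _ --> X](mulr0 (a ^+ 2)); exact: cvgMr.
apply/funext => n; rewrite -nnZ; last exact: sqiB.
by apply: eq_nn => x _; ring.
Qed.

Lemma cvgL2B fn f gn g : cvgL2 fn f -> cvgL2 gn g ->
  cvgL2 (fun n x => fn n x - gn n x) (fun x => f x - g x).
Proof.
move=> cf /(cvgL2Z (-1)) cg; have := cvgL2D cf cg.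
congr cvgL2; last by apply/funext => x; ring.
by apply/funext => n; apply/funext => x; ring.
Qed.

Lemma cvgL2_cst f : sqi f -> cvgL2 (fun=> f) f.
Proof.
move=> sf; split => //.
rewrite (_ : (fun n => _) = (fun=> 0)); first exact: cvg_cst.
apply/funext => n; rewrite (_ : (fun x => f x - f x) = (fun x => 0 * f x)).
  by rewrite nnZ// expr0n mul0r.
by apply/funext => x; ring.
Qed.

Lemma cvgL2_mulM (m : T -> R) (M : R) fn f : 0 <= M -> measurable_fun D m ->
  {ae mu, forall x, D x -> `|m x| <= M} -> cvgL2 fn f ->
  cvgL2 (fun n x => m x * fn n x) (fun x => m x * f x).
Proof.
move=> M0 mm mM [sfn sf cf]; split.
- by move=> n; exact: sqi_mulM mM (sfn n).
- exact: sqi_mulM mM sf.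
apply: (@squeeze0 _ _ (fun n => M ^+ 2 * nn (fun x => fn n x - f x))).
  move=> n; rewrite nn_ge0/=.
  rewrite (_ : (fun x => _) = (fun x => m x * (fn n x - f x))).
    by apply: nn_mulM => //; exact: sqiB.
  by apply/funext => x; ring.
by apply: cvg_eqr (mulr0 (M ^+ 2)) _; exact: cvgMr.
Qed.

Lemma cvgL2_ip fn f gn g : cvgL2 fn f -> cvgL2 gn g ->
  (fun n => ip (fn n) (gn n)) @ \oo --> ip f g.
Proof.
move=> cf cg; have cfg := cvgL2_nn (cvgL2D cf cg).
have E u v : sqi u -> sqi v ->
    ip u v = 2^-1 * (nn (fun x => u x + v x) - nn u - nn v).
  by move=> su sv; rewrite nnD//; field.
rewrite E; [|exact: cvgL2_lim cf|exact: cvgL2_lim cg].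
rewrite (_ : (fun n => _) = (fun n => 2^-1 *
   (nn (fun x => fn n x + gn n x) - nn (fn n) - nn (gn n)))).
  by apply: cvgMr; apply: cvgB; [apply: cvgB => //; exact: cvgL2_nn|exact: cvgL2_nn].
by apply/funext => n; apply: E; [case: cf|case: cg].
Qed.

Lemma ae_sqi f g : measurable_fun D g -> {ae mu, forall x, D x -> f x = g x} ->
  sqi f -> sqi g.
Proof.
move=> mg fg [mf lf]; split => //; apply: le_lt_trans lf.
apply: ae_ge0_le_integral => //.
- by move=> x _; rewrite lee_fin sqr_ge0.
- by apply/measurable_EFinP; exact: measurable_funX.
- by move=> x _; rewrite lee_fin sqr_ge0.
- by apply/measurable_EFinP; exact: measurable_funX.
- by apply: filterS fg => x fg Dx; rewrite fg.
Qed.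

Lemma ae_Rintegral f g : measurable_fun D f -> measurable_fun D g ->
  {ae mu, forall x, D x -> f x = g x} ->
  \int[mu]_(x in D) f x = \int[mu]_(x in D) g x.
Proof.
move=> mf mg fg; congr fine; apply: ae_eq_integral => //.
- exact/measurable_EFinP.
- exact/measurable_EFinP.
- by apply: filterS fg => x fg Dx; rewrite fg.
Qed.

Lemma ae_nn f g : measurable_fun D f -> measurable_fun D g ->
  {ae mu, forall x, D x -> f x = g x} -> nn f = nn g.
Proof.
move=> mf mg fg; apply: ae_Rintegral; try exact: measurable_funM.
by apply: filterS fg => x fg Dx; rewrite fg.
Qed.

(** Riesz-Fischer. A subsequence with squared increments at most 8^-k converges almost everywhere,
    and Fatou's lemma along it turns the Cauchy bound into convergence of the whole sequence. *)
Lemma L2_complete (fn : nat -> T -> R) : (forall n, sqi (fn n)) ->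
  (forall e : R, 0 < e -> exists N, forall m n, (N <= m)%N -> (N <= n)%N ->
     nn (fun x => fn m x - fn n x) <= e) ->
  exists f, cvgL2 fn f.
Proof.
move=> sfn cau.
have [N NP] : exists N : nat -> nat, forall k m n, (N k <= m)%N -> (N k <= n)%N ->
    nn (fun x => fn m x - fn n x) <= 8^-1 ^+ k.
  have H k : exists N, forall m n, (N <= m)%N -> (N <= n)%N ->
      nn (fun x => fn m x - fn n x) <= 8^-1 ^+ k by apply: cau; rewrite exprn_gt0.
  by exists (fun k => sval (cid (H k))) => k; case: cid.
(* The sum puts [nk k] above every [N i] with i <= k, and the successors make [nk] grow at least
   like the identity. *)
pose nk k := (\sum_(i < k.+1) (N i).+1)%N.
have Nnk k : (N k <= nk k)%N by rewrite /nk big_ord_recr/= (leq_trans (leqnSn _))// leq_addl.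
have nknk k : (nk k <= nk k.+1)%N by rewrite {2}/nk big_ord_recr leq_addr.
have nkge k : (N k <= nk k.+1)%N by apply: leq_trans (nknk k).
have nkh k m : (k <= m)%N -> (N k <= nk m)%N.
  elim: m => [|m IH]; first by rewrite leqn0 => /eqP ->.
  by rewrite leq_eqVlt => /predU1P[->//|/IH h]; apply: leq_trans (nknk m).
pose g k := fn (nk k); pose d k x := g k.+1 x - g k x.
have sg k : sqi (g k) by exact: sfn.
have sd k : sqi (d k) by exact: sqiB.
have h0R k x : 0 <= 2 ^+ k * d k x ^+ 2 by rewrite mulr_ge0 ?sqr_ge0// exprn_ge0.
(* The weight 2^k still leaves integrals of at most 4^-k. Pointwise |d_k| <= 2^k d_k^2 + 2^-k, so a
   finite sum gives absolute convergence of the increments. *)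
pose h k x : \bar R := (2 ^+ k * d k x ^+ 2)%:E.
have mh k : measurable_fun D (h k).
  apply/measurable_EFinP; apply: measurable_funM => //.
  by apply: measurable_funX; exact: sqi_meas.
have h0 k x : D x -> (0 <= h k x)%E.
  by move=> _; rewrite lee_fin mulr_ge0 ?sqr_ge0// exprn_ge0.
have ih : (\int[mu]_(x in D) (\sum_(k <oo) h k x) < +oo)%E.
  rewrite integral_nneseries//.
  apply: (@le_lt_trans _ _ (\sum_(k <oo) (4^-1 ^+ k)%:E)%E).
    apply: lee_nneseries => k _; first by move=> _; apply: integral_ge0 => x; exact: h0.
    rewrite /h; under eq_integral do rewrite EFinM.
    rewrite ge0_integralZl_EFin//; [|by move=> x _; rewrite lee_fin sqr_ge0|
      by apply/measurable_EFinP; apply: measurable_funX; exact: sqi_meas].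
    rewrite -nnE// -EFinM lee_fin.
    have -> : (4^-1 : R) = 2 * 8^-1 by field.
    rewrite exprMn ler_wpM2l ?exprn_ge0//.
    by apply: NP => //; exact: Nnk.
  have := @cvg_geometric_series R 1 (4^-1) _.
  rewrite ger0_norm// invf_lt1// ltr1n => /(_ isT) c4.
  have c4' := cvgn_EFin c4.
  rewrite (_ : limn _ = (1 * (1 - 4^-1)^-1)%:E) ?ltry//.
  apply/cvg_lim => //; apply: cvg_trans c4'.
  apply: near_eq_cvg; apply: nearW => n /=.
  rewrite /series/= -sumEFin; apply: eq_bigr => k _.
  by rewrite mul1r.
have aeH : {ae mu, forall x, D x -> (\sum_(k <oo) h k x < +oo)%E}.
  have : mu.-integrable D (fun x => \sum_(k <oo) h k x)%E.
    apply/integrableP; split.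
      by apply: ge0_emeasurable_sum => // k x Dx _; exact: h0.
    apply: le_lt_trans ih; rewrite le_eqVlt; apply/orP; left; apply/eqP.
    apply: eq_integral => x /set_mem Dx; rewrite gee0_abs//.
    by apply: nneseries_ge0 => k _ _; exact: h0.
  by move=> /(integrable_ae mD); apply: filterS => x + Dx => /(_ Dx); rewrite fin_numE ltey => /andP[].
(* The upper limit is measurable without removing a null set, and it equals the limit wherever the
   latter exists. *)
pose f x := fine (limn_esup (fun k => (g k x)%:E)).
have mf : measurable_fun D f.
  apply: (@measurableT_comp _ _ _ _ _ _ (@fine R)) => //.
  by apply: measurable_fun_limn_esup => k; apply/measurable_EFinP; exact: sqi_meas.
have aef : {ae mu, forall x, D x -> g ^~ x @ \oo --> f x}.
  apply: filterS aeH => x + Dx => /(_ Dx) Hx.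
  suff : cvgn (g ^~ x).
    move=> /cvg_ex[l gl]; rewrite /f.
    have [_ ->] := cvg_limn_einf_sup (cvgn_EFin gl).
    by [].
  have c1 : cvgn (series (fun k => 2 ^+ k * d k x ^+ 2)).
    apply: nondecreasing_is_cvgn.
      by apply: nondecreasing_series => k _ _; exact: h0R.
    exists (fine (\sum_(k <oo) h k x)%E) => _ [n _ <-].
    rewrite -lee_fin fineK; last first.
      by rewrite ge0_fin_numE//; apply: nneseries_ge0 => k _ _; exact: h0.
    rewrite /series/= -sumEFin; apply: nneseries_lim_ge => k _ _; exact: h0.
  have c2 : cvgn (series (geometric 1 (2^-1 : R))).
    by apply: is_cvg_geometric_series; rewrite ger0_norm// invf_lt1// ltr1n.
  have c3 : cvgn (series (d ^~ x)).
    apply: normed_cvg; apply: (series_le_cvg _ _ _ (is_cvg_seriesD c1 c2)).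
    - by move=> k; exact: normr_ge0.
    - by move=> k; apply: addr_ge0 => //=; rewrite mul1r exprn_ge0.
    - move=> k; rewrite [leRHS]/GRing.add/= mul1r exprVn.
      have p0 : 0 < 2 ^+ k :> R by rewrite exprn_gt0.
      rewrite -(ler_pM2l p0) mulrDr mulfV ?gt_eqF//.
      rewrite -[d k x ^+ 2]real_normK ?num_real//.
      set a := `|_|; set b := 2 ^+ k.
      have := sqr_ge0 (b * a - 2^-1); nra.
  rewrite (_ : g ^~ x = (fun n => series (d ^~ x) n + g 0%N x)).
    by apply: is_cvgD => //; exact: is_cvg_cst.
  by apply/funext => n; rewrite /series/= /d telescope_sumr// subrK.
have key n e : (forall m, (n <= m)%N -> True) -> 0 <= e ->
    (exists K, forall m, (K <= m)%N -> nn (fun x => fn n x - g m x) <= e) ->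
    (\int[mu]_(x in D) ((fn n x - f x) ^+ 2)%:E <= e%:E)%E.
  move=> _ e0 [K HK].
  apply: (@le_trans _ _ (\int[mu]_(x in D)
     limn_einf (fun m => ((fn n x - g m x) ^+ 2)%:E))%E).
    apply: ae_ge0_le_integral => //.
    - by move=> x _; rewrite lee_fin sqr_ge0.
    - apply/measurable_EFinP; apply: measurable_funX.
      by apply: measurable_funB => //; exact: sqi_meas.
    - move=> x _; rewrite limn_einf_lim; apply: lime_ge; first exact: is_cvg_einfs.
      apply: nearW => m; apply: le_ereal_inf_tmp => _ [k /= _ <-].
      by rewrite lee_fin sqr_ge0.
    - rewrite (_ : (fun x => _) = (fun x =>
          - limn_esup (fun m => - ((fn n x - g m x) ^+ 2)%:E))%E); last first.
        by apply/funext => x; rewrite -limn_einfN; congr limn_einf; apply/funext => m /=; rewrite opprK.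
      apply: measurableT_comp => //; apply: measurable_fun_limn_esup => m.
      apply: measurableT_comp => //; apply/measurable_EFinP; apply: measurable_funX.
      by apply: measurable_funB => //; exact: sqi_meas.
    - apply: filterS aef => x + Dx => /(_ Dx) gx.
      have c : (fun m => (fn n x - g m x) ^+ 2) @ \oo --> (fn n x - f x) ^+ 2.
        by apply: cvgM; apply: cvgB => //; exact: cvg_cst.
      have [-> _] := cvg_limn_einf_sup (cvgn_EFin c).
      by [].
  apply: (le_trans (fatou _ _ _ _)) => //.
  - move=> m; apply/measurable_EFinP; apply: measurable_funX.
    by apply: measurable_funB; exact: sqi_meas.
  - by move=> m x _; rewrite lee_fin sqr_ge0.
  rewrite limn_einf_lim; apply: lime_le; first exact: is_cvg_einfs.
  apply: nearW => m; apply: (@le_trans _ _ (\int[mu]_(x in D) ((fn n x - g (maxn m K) x) ^+ 2)%:E)%E).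
    by apply: ereal_inf_lbound; exists (maxn m K) => //=; rewrite leq_maxl.
  by rewrite -nnE; [rewrite lee_fin; apply: HK; rewrite leq_maxr|exact: sqiB].
have sB n : (exists e, 0 <= e /\ exists K, forall m, (K <= m)%N -> nn (fun x => fn n x - g m x) <= e) ->
    sqi (fun x => fn n x - f x).
  move=> [e [e0 He]]; split.
    by apply: measurable_funB => //; exact: sqi_meas.
  by apply: le_lt_trans (key n e _ e0 He) _ => //; rewrite ltry.
have sf : sqi f.
  have s0 : sqi (fun x => fn (N 0%N) x - f x).
    apply: sB; exists 1; split => //; exists 0%N => m _.
    by rewrite -(expr0 8^-1); apply: NP => //; exact: nkh.
  have := sqiB (sfn (N 0%N)) s0; congr sqi; apply/funext => x; ring.
exists f; split => //.
apply/cvgrPdist_le => e e0; have [K HK] := cau _ e0.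
near=> n; rewrite sub0r normrN ger0_norm ?nn_ge0//.
rewrite -lee_fin nnE; last exact: sqiB.
apply: key => //; first exact: ltW.
exists K => m Km; apply: HK; first by near: n; exists K.
apply: leq_trans Km _; elim: m => [//|m IH].
by apply: leq_ltn_trans IH _; rewrite /nk [ltnRHS]big_ord_recr/= addnS ltnS leq_addr.
Unshelve. all: by end_near. Qed.

Lemma intZ (r : R) f : mu.-integrable D (EFin \o f) ->
  mu.-integrable D (EFin \o (fun x => r * f x)).
Proof. by move=> /(integrableZl mD r); apply: eq_integrable. Qed.

Lemma intD f g : mu.-integrable D (EFin \o f) -> mu.-integrable D (EFin \o g) ->
  mu.-integrable D (EFin \o (fun x => f x + g x)).
Proof. by move=> i1 i2; have := integrableD mD i1 i2; apply: eq_integrable. Qed.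

Lemma intB f g : mu.-integrable D (EFin \o f) -> mu.-integrable D (EFin \o g) ->
  mu.-integrable D (EFin \o (fun x => f x - g x)).
Proof. by move=> i1 i2; have := integrableB mD i1 i2; apply: eq_integrable. Qed.

Lemma int_abs f : mu.-integrable D (EFin \o f) ->
  mu.-integrable D (EFin \o (fun x => `|f x|)).
Proof. by move=> /integrable_abse; apply: eq_integrable. Qed.

Lemma int_le f g : measurable_fun D f -> (forall x, D x -> `|f x| <= g x) ->
  mu.-integrable D (EFin \o g) -> mu.-integrable D (EFin \o f).
Proof.
move=> mf fg; apply: le_integrable => //; first exact/measurable_EFinP.
by move=> x Dx /=; rewrite lee_fin (le_trans (fg _ Dx))// ler_norm.
Qed.

End SquareIntegrable.

(** * Bounded coercive problems on a complete space *)

Section LaxMilgram.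
Context {R : realType} {V : lmodType R}.
Variables (P : set V) (b : V -> V -> R).
Hypothesis PD : forall u v, P u -> P v -> P (u + v).
Hypothesis PZ : forall a u, P u -> P (a *: u).
Hypothesis bD : forall u v w, P u -> P v -> P w -> b (u + v) w = b u w + b v w.
Hypothesis bZ : forall a u w, P u -> P w -> b (a *: u) w = a * b u w.
Hypothesis bC : forall u w, P u -> P w -> b u w = b w u.
Hypothesis b_ge0 : forall u, P u -> 0 <= b u u.

(** Only a seminorm: [b] is not assumed definite, because functions equal almost everywhere remain
    distinct. Limits and solutions below are therefore not claimed to be unique. *)
Definition snorm u : R := Num.sqrt (b u u).

Lemma snorm_ge0 u : 0 <= snorm u.
Proof. exact: sqrtr_ge0. Qed.

Lemma sqr_snorm u : P u -> snorm u ^+ 2 = b u u.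
Proof. by move=> Pu; rewrite sqr_sqrtr// b_ge0. Qed.

Let PN u : P u -> P (- u).
Proof. by rewrite -scaleN1r; exact: PZ. Qed.

Let PB u v : P u -> P v -> P (u - v).
Proof. by move=> Pu Pv; apply: PD => //; exact: PN. Qed.

Lemma bDZ u v s t : P u -> P v ->
  b (s *: u + t *: v) (s *: u + t *: v) =
  s ^+ 2 * b u u + t ^+ 2 * b v v + 2 * (s * t * b u v).
Proof.
move=> Pu Pv; have su := PZ s Pu; have tv := PZ t Pv.
rewrite bD//; last exact: PD.
rewrite ![b _ (_ + _)]bC//; try exact: PD.
rewrite !bD// !bZ// ![b _ (_ *: _)]bC// !bZ// (bC Pv Pu); ring.
Qed.

Lemma b_CS u v : P u -> P v -> `|b u v| <= snorm u * snorm v.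
Proof.
move=> Pu Pv; rewrite -sqrtrM ?b_ge0// -[leLHS]sqrtr_sqr ler_sqrt; last first.
  by rewrite mulr_ge0// b_ge0.
have H s t : 0 <= s ^+ 2 * b u u + t ^+ 2 * b v v + 2 * (s * t * b u v).
  by rewrite -bDZ//; apply: b_ge0; apply: PD; exact: PZ.
have := b_ge0 Pu; rewrite le_eqVlt => /predU1P[f0|f0].
  have [->|i0] := eqVneq (b u v) 0.
    by rewrite expr0n/= -f0 mul0r.
  have := H (- (b v v + 1) / (2 * b u v)) 1.
  rewrite -f0 mulr0 add0r expr1n mul1r mulr1.
  have -> : 2 * (- (b v v + 1) / (2 * b u v) * b u v) = - (b v v + 1) by field.
  lra.
have := H (- b u v / b u u) 1.
have -> : (- b u v / b u u) ^+ 2 * b u u + 1 ^+ 2 * b v v +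
   2 * (- b u v / b u u * 1 * b u v) = (b u u * b v v - b u v ^+ 2) / b u u.
  by field; rewrite gt_eqF.
by rewrite pmulr_lge0 ?invr_gt0// subr_ge0.
Qed.

Lemma snormD u v : P u -> P v -> snorm (u + v) <= snorm u + snorm v.
Proof.
move=> Pu Pv; rewrite -[leRHS]ger0_norm ?addr_ge0 ?sqrtr_ge0//.
rewrite -sqrtr_sqr ler_sqrt ?sqr_ge0// sqrrD !sqr_snorm//.
have := bDZ 1 1 Pu Pv; rewrite !scale1r => ->.
have := b_CS Pu Pv; have := ler_norm (b u v); lra.
Qed.

Lemma snormZ a u : P u -> snorm (a *: u) = `|a| * snorm u.
Proof.
move=> Pu; rewrite /snorm bZ//; last exact: PZ.
rewrite bC//; last exact: PZ.
by rewrite bZ// mulrA -expr2 sqrtrM ?sqr_ge0// sqrtr_sqr.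
Qed.

Hypothesis b_complete : forall u : nat -> V, (forall n, P (u n)) ->
  (forall e : R, 0 < e -> exists N, forall m n : nat, (N <= m)%N -> (N <= n)%N ->
     b (u m - u n) (u m - u n) <= e) ->
  exists2 v, P v & (fun n => b (u n - v) (u n - v)) @ \oo --> 0.

Let bBl u v w : P u -> P v -> P w -> b (u - v) w = b u w - b v w.
Proof.
by move=> Pu Pv Pw; rewrite bD//; [rewrite -(scaleN1r v) bZ// mulN1r|exact: PN].
Qed.

Lemma b_cvgl (u : nat -> V) v w : (forall n, P (u n)) -> P v -> P w ->
  (fun n => b (u n - v) (u n - v)) @ \oo --> 0 ->
  (fun n => b (u n) w) @ \oo --> b v w.
Proof.
move=> Pu Pv Pw uv; apply/subr_cvg0; apply: norm_cvg0.
apply: (@squeeze0 _ _ (fun n => snorm (u n - v) * snorm w)).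
  by move=> n; rewrite normr_ge0/= -bBl// b_CS//; exact: PB.
apply: cvg_eqr (mul0r (snorm w)) _; apply: cvgMl.
exact: sqrt_cvg0.
Qed.

Lemma quad_lin_eq0 (x y : R) : 0 <= y -> (forall t : R, 0 <= 2 * (t * x) + t ^+ 2 * y) -> x = 0.
Proof.
move=> y0 H; apply/eqP; apply/negP => /negP x0.
have := H (- x / (y + 1)).
have -> : 2 * (- x / (y + 1) * x) + (- x / (y + 1)) ^+ 2 * y =
  - ((x / (y + 1)) ^+ 2 * (y + 2)) by field; lra.
rewrite oppr_ge0 leNgt mulr_gt0//; last lra.
by rewrite exprn_even_gt0//= mulf_neq0// invr_eq0; apply: lt0r_neq0; lra.
Qed.

(** The functional J(v) = b(v, v) - 2 F(v) is bounded below by -K^2. The parallelogram identity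
    makes a minimizing sequence Cauchy, and the first variation vanishes at its limit. *)
Lemma riesz (F : V -> R) (K : R) : (exists u, P u) ->
  (forall u v, P u -> P v -> F (u + v) = F u + F v) ->
  (forall a u, P u -> F (a *: u) = a * F u) ->
  (forall u, P u -> `|F u| <= K * snorm u) ->
  exists2 u, P u & forall v, P v -> b u v = F v.
Proof.
move=> [p0 Pp0] FD FZ FK.
pose J v := b v v - 2 * F v.
have JK v : P v -> - K ^+ 2 <= J v.
  move=> Pv; rewrite /J -sqr_snorm//.
  have := FK v Pv; have := ler_norm (F v); have := sqr_ge0 (snorm v - K).
  nra.
pose E := [set J v | v in P].
have lbE : has_lbound E by exists (- K ^+ 2) => _ [v Pv <-]; exact: JK.
have hiE : has_inf E by split => //; exists (J p0); exists p0.
have infJ v : P v -> inf E <= J v by move=> Pv; apply: ge_inf => //; exists v.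
have Hu n : exists v, P v /\ J v <= inf E + n.+1%:R^-1.
  have e0 : 0 < n.+1%:R^-1 :> R by rewrite invr_gt0.
  have [_ [v Pv <-] Hv] := inf_adherent e0 hiE.
  by exists v; split => //; exact: ltW.
pose u n := sval (cid (Hu n)).
have Pu n : P (u n) by rewrite /u; case: cid => v [].
have Ju n : J (u n) <= inf E + n.+1%:R^-1 by rewrite /u; case: cid => v [].
have Jpar v w : P v -> P w -> b (v - w) (v - w) <= 2 * (J v - inf E) + 2 * (J w - inf E).
  move=> Pv Pw.
  have := infJ (2^-1 *: v + 2^-1 *: w) (PD (PZ _ Pv) (PZ _ Pw)).
  rewrite /J bDZ// FD ?FZ//; try exact: PZ.
  have -> : v - w = 1 *: v + (-1) *: w by rewrite scale1r scaleN1r.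
  rewrite bDZ//; lra.
have cauE (e : R) : 0 < e -> exists N, forall m n : nat, (N <= m)%N -> (N <= n)%N ->
     b (u m - u n) (u m - u n) <= e.
  move=> e0; pose N := Num.truncn (4 / e).
  have HN m : (N <= m)%N -> m.+1%:R^-1 <= e / 4.
    move=> Nm; rewrite -[leRHS]invrK lef_pV2 ?posrE ?invr_gt0 ?divr_gt0//.
    rewrite invf_div; apply: ltW; apply: lt_le_trans (truncnS_gt _) _.
    by rewrite ler_nat ltnS.
  exists N => m n /HN hm /HN hn.
  apply: le_trans (Jpar _ _ (Pu m) (Pu n)) _.
  have := le_trans (Ju m) (lerD (lexx (inf E)) hm).
  have := le_trans (Ju n) (lerD (lexx (inf E)) hn); lra.
have [v Pv uv] := b_complete Pu cauE.
exists v => // w Pw.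
apply/eqP; rewrite -subr_eq0; apply/eqP; apply: (quad_lin_eq0 (b_ge0 Pw)) => t.
(* Near-minimality of u_n against u_n + t w. Passing to the limit in n leaves a nonnegative
   quadratic in t without constant term, so its linear coefficient is 0. *)
have H n : 0 <= n.+1%:R^-1 + (2 * (t * (b (u n) w - F w)) + t ^+ 2 * b w w).
  have := infJ (1 *: u n + t *: w) (PD (PZ _ (Pu n)) (PZ _ Pw)).
  rewrite /J bDZ// FD ?FZ//; try exact: PZ.
  have := Ju n; rewrite /J; set h : R := n.+1%:R^-1; lra.
have c : (fun n => n.+1%:R^-1 + (2 * (t * (b (u n) w - F w)) + t ^+ 2 * b w w)) @ \oo -->
    (0 + (2 * (t * (b v w - F w)) + t ^+ 2 * b w w)).
  apply: cvgD; first exact: cvg_harmonic.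
  apply: cvgD; last exact: cvg_cst.
  apply: cvgMr; apply: cvgMr; apply: cvgB; last exact: cvg_cst.
  exact: b_cvgl.
rewrite add0r in c.
by apply: (cvgr_to_ge c); apply: nearW.
Qed.

(** Iteration of T(u) = u - rho (r(u) - f), with r(u) and f the Riesz representatives of B(u, .) and
    F. Coercivity and boundedness of B make T a contraction for the seminorm. *)
Theorem lax_milgram (B : V -> V -> R) (F : V -> R) (K C c : R) :
  (exists u, P u) -> 0 < c ->
  (forall u v w, P u -> P v -> P w -> B (u + v) w = B u w + B v w) ->
  (forall a u w, P u -> P w -> B (a *: u) w = a * B u w) ->
  (forall u v w, P u -> P v -> P w -> B w (u + v) = B w u + B w v) ->
  (forall a u w, P u -> P w -> B w (a *: u) = a * B w u) ->
  (forall u v, P u -> P v -> `|B u v| <= C * (snorm u * snorm v)) ->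
  (forall u, P u -> c * b u u <= B u u) ->
  (forall u v, P u -> P v -> F (u + v) = F u + F v) ->
  (forall a u, P u -> F (a *: u) = a * F u) ->
  (forall u, P u -> `|F u| <= K * snorm u) ->
  exists2 u, P u & forall v, P v -> B u v = F v.
Proof.
move=> exP c0 BDl BZl BDr BZr BC Bc FD FZ FK.
have BNl v w : P v -> P w -> B (- v) w = - B v w.
  by move=> Pv Pw; rewrite -scaleN1r BZl// mulN1r.
have Hr u : exists v, P u -> P v /\ forall w, P w -> b v w = B u w.
  have [Pu|nPu] := pselect (P u); last by exists u.
  have [||| v Pv Hv] := @riesz (B u) (C * snorm u) exP.
  - by move=> v w Pv Pw; rewrite BDr.
  - by move=> a v Pv; rewrite BZr.
  - by move=> v Pv; rewrite -mulrA; exact: BC.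
  - by exists v.
pose r u := sval (cid (Hr u)).
have Pr u : P u -> P (r u).
  by move=> Pu; rewrite /r; case: cid => v /= /(_ Pu)[].
have rE u w : P u -> P w -> b (r u) w = B u w.
  by move=> Pu; rewrite /r; case: cid => v /= /(_ Pu)[_]; exact.
have [f Pf fE] := riesz exP FD FZ FK.
(* Enlarging the bound makes it positive and at least [c], so that 1 - (c / C1)^2 is nonnegative. *)
pose C1 := `|C| + c; have C1c : c <= C1 by rewrite /C1 lerDr.
have C10 : 0 < C1 by exact: lt_le_trans c0 C1c.
have BC1 u v : P u -> P v -> `|B u v| <= C1 * (snorm u * snorm v).
  move=> Pu Pv; apply: le_trans (BC _ _ Pu Pv) _.
  apply: ler_wpM2r; first by rewrite mulr_ge0// snorm_ge0.
  by rewrite /C1 (le_trans (ler_norm _))// lerDl ltW.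
(* The minimizer of 1 - 2 rho c + rho^2 C1^2, which bounds the squared contraction factor; the
   minimum is 1 - (c / C1)^2. *)
pose rho := c / C1 ^+ 2.
have rho0 : 0 < rho by rewrite divr_gt0// exprn_gt0.
pose T u := u - rho *: (r u - f).
have PT u : P u -> P (T u).
  by move=> Pu; apply: PB => //; apply: PZ; apply: PB => //; exact: Pr.
pose q := Num.sqrt (1 - (c / C1) ^+ 2).
have cC1 : (c / C1) ^+ 2 <= 1.
  by rewrite exprn_ile1// ?divr_ge0 ?(ltW c0) ?(ltW C10)// ler_pdivrMr// mul1r.
have q0 : 0 <= q by exact: sqrtr_ge0.
have q1 : q < 1.
  rewrite -[ltRHS]sqrtr1 ltr_sqrt// ltrBlDr ltrDl.
  by rewrite exprn_gt0// divr_gt0.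
have rB u v : P u -> P v -> snorm (r u - r v) <= C1 * snorm (u - v).
  move=> Pu Pv; have Pw := PB Pu Pv; have Pz := PB (Pr _ Pu) (Pr _ Pv).
  have E : b (r u - r v) (r u - r v) = B (u - v) (r u - r v).
    rewrite bBl//; try exact: Pr.
    rewrite !rE// BDl//; last exact: PN.
    by rewrite BNl.
  have [z0|z0] := eqVneq (snorm (r u - r v)) 0.
    by rewrite z0 mulr_ge0// ?snorm_ge0// ltW.
  have zp : 0 < snorm (r u - r v) by rewrite lt_def z0 snorm_ge0.
  rewrite -(ler_pM2r zp) -expr2 sqr_snorm// E -mulrA.
  exact: le_trans (ler_norm _) (BC1 _ _ Pw Pz).
have Tq u v : P u -> P v -> snorm (T u - T v) <= q * snorm (u - v).
  move=> Pu Pv; have Pw := PB Pu Pv; have Pz := PB (Pr _ Pu) (Pr _ Pv).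
  have -> : T u - T v = 1 *: (u - v) + (- rho) *: (r u - r v).
    rewrite /T scale1r scaleNr opprD addrACA -opprD -scalerBr.
    by congr (_ - _ *: _); rewrite opprB addrA subrK.
  have sE : q * snorm (u - v) = Num.sqrt (q ^+ 2 * b (u - v) (u - v)).
    by rewrite sqrtrM ?sqr_ge0// sqrtr_sqr ger0_norm.
  rewrite sE ler_sqrt; last by rewrite mulr_ge0 ?sqr_ge0// b_ge0.
  rewrite bDZ// sqr_sqrtr; last by rewrite subr_ge0.
  have E : b (u - v) (r u - r v) = B (u - v) (u - v).
    rewrite bC// bBl//; try exact: Pr.
    rewrite !rE// [in RHS]BDl//; last exact: PN.
    by rewrite BNl.
  have H1 : b (r u - r v) (r u - r v) <= C1 ^+ 2 * b (u - v) (u - v).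
    rewrite -!sqr_snorm// -exprMn lerXn2r ?nnegrE ?snorm_ge0 ?rB//.
    by rewrite mulr_ge0 ?snorm_ge0// ltW.
  have H2 := Bc _ Pw; rewrite E.
  have R1 : rho ^+ 2 * C1 ^+ 2 = (c / C1) ^+ 2.
    by rewrite /rho; field; rewrite gt_eqF.
  have R2 : rho * c = (c / C1) ^+ 2 by rewrite /rho; field; rewrite gt_eqF.
  have := ler_wpM2l (sqr_ge0 rho) H1; rewrite [leRHS]mulrA R1.
  have := ler_wpM2l (ltW rho0) H2; rewrite [leLHS]mulrA R2.
  rewrite expr1n mul1r mul1r sqrrN; lra.
have [p0 Pp0] := exP.
pose u n := iter n T p0.
have Pu n : P (u n) by elim: n => [//|n IH]; exact: PT.
have uq n : snorm (u n.+1 - u n) <= q ^+ n * snorm (u 1%N - u 0%N).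
  elim: n => [|n IH]; first by rewrite expr0 mul1r.
  apply: le_trans (Tq _ _ (Pu n.+1) (Pu n)) _.
  by rewrite exprS -mulrA ler_wpM2l.
have qn : (fun n => q ^+ n) @ \oo --> 0.
  have := @cvg_geometric R 1 q; rewrite ger0_norm// => /(_ q1).
  by rewrite (_ : geometric 1 q = (fun n => q ^+ n))//; apply/funext => n; rewrite /geometric/= mul1r.
have umn n k : snorm (u (n + k)%N - u n) <= q ^+ n / (1 - q) * snorm (u 1%N - u 0%N).
  have H : snorm (u (n + k)%N - u n) <= (q ^+ n - q ^+ (n + k)) / (1 - q) * snorm (u 1%N - u 0%N).
    elim: k => [|k IH].
      rewrite addn0 !subrr !mul0r /snorm.
      have := bZ 0 (Pu n) (Pu n).
      by rewrite scale0r mul0r => b0; rewrite [b _ _](_ : _ = 0) ?sqrtr0// -(scale0r (u n)) bZ ?mul0r//; exact: PZ.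
    have -> : u (n + k.+1)%N - u n = (u (n + k).+1%N - u (n + k)%N) + (u (n + k)%N - u n).
      by rewrite addnS addrA subrK.
    apply: le_trans (snormD (PB (Pu _) (Pu _)) (PB (Pu _) (Pu _))) _.
    apply: le_trans (lerD (uq _) IH) _.
    rewrite -mulrDl addnS [q ^+ (n + k).+1]exprS.
    rewrite le_eqVlt; apply/orP; left; apply/eqP; congr (_ * _); field.
    by rewrite subr_eq0 gt_eqF.
  apply: le_trans H _; apply: ler_wpM2r; first exact: snorm_ge0.
  apply: ler_wpM2r; first by rewrite invr_ge0 subr_ge0 ltW.
  by rewrite gerBl exprn_ge0.
pose D := (1 - q)^-1 * snorm (u 1%N - u 0%N).
have D0 : 0 <= D by rewrite mulr_ge0 ?snorm_ge0// invr_ge0 subr_ge0 ltW.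
have cauE (e : R) : 0 < e -> exists N, forall m n : nat, (N <= m)%N -> (N <= n)%N ->
     b (u m - u n) (u m - u n) <= e.
  move=> e0.
  have e1 : 0 < Num.sqrt e / (2 * (D + 1)).
    by rewrite divr_gt0 ?sqrtr_gt0// mulr_gt0//; lra.
  have [N _ HN] := cvgr0_norm_le _ qn _ e1.
  have HN' m : (N <= m)%N -> snorm (u m - u N) <= Num.sqrt e / 2.
    move=> Nm; rewrite -(subnKC Nm); apply: le_trans (umn _ _) _.
    rewrite -mulrA -/D; have := HN N (leqnn N); rewrite /= ger0_norm ?exprn_ge0// => h.
    apply: le_trans (ler_wpM2r D0 h) _.
    have -> : Num.sqrt e / (2 * (D + 1)) * D = Num.sqrt e / 2 * (D / (D + 1)) by field; lra.
    apply: ler_piMr; first by rewrite divr_ge0// sqrtr_ge0.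
    by rewrite ler_pdivrMr; lra.
  exists N => m n /HN' hm /HN' hn.
  have Pmn := PB (Pu m) (Pu n).
  have H : snorm (u m - u n) <= Num.sqrt e.
    have -> : u m - u n = (u m - u N) + (-1) *: (u n - u N).
      by rewrite scaleN1r opprB addrA subrK.
    apply: le_trans (snormD (PB (Pu _) (Pu _)) (PZ _ (PB (Pu _) (Pu _)))) _.
    rewrite snormZ ?normrN1 ?mul1r; last exact: PB.
    lra.
  by rewrite -ler_sqrt ?b_ge0// ltW.
have [v Pv uv] := b_complete Pu cauE.
exists v => // w Pw.
have c1 : (fun n => B (u n) w) @ \oo --> B v w.
  rewrite -rE//.
  have c1 : (fun n => b (r (u n)) w) @ \oo --> b (r v) w.
    apply: b_cvgl => //; [by move=> n; exact: Pr|exact: Pr|].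
    apply: (@squeeze0 _ _ (fun n => C1 ^+ 2 * b (u n - v) (u n - v))).
      move=> n; rewrite b_ge0 /=; last by apply: PB; exact: Pr.
      rewrite -!sqr_snorm//; try (by apply: PB => //; exact: Pr).
      rewrite -exprMn lerXn2r ?nnegrE ?snorm_ge0 ?rB//.
      by rewrite mulr_ge0 ?snorm_ge0// ltW.
    by apply: cvg_eqr (mulr0 (C1 ^+ 2)) _; exact: cvgMr.
  by move: c1; under eq_fun do rewrite rE//.
(* The residual B(u_n, w) - F(w) equals b(u_n - u_{n+1}, w) / rho, hence is of order q^n. This
   avoids a fixed-point equation, which a seminorm would give only up to vectors of norm zero. *)
have c2 : (fun n => B (u n) w) @ \oo --> F w.
  apply/subr_cvg0; apply: norm_cvg0.
  apply: (@squeeze0 _ _ (fun n => rho^-1 * snorm (u 1%N - u 0%N) * snorm w * q ^+ n)).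
    move=> n; rewrite normr_ge0/=.
    have -> : B (u n) w - F w = rho^-1 * b (u n - u n.+1) w.
      rewrite -rE// -fE// -bBl//; last exact: Pr.
      have -> : u n - u n.+1 = rho *: (r (u n) - f).
        by rewrite [u n.+1]/= /T opprB addrCA subrr addr0.
      rewrite bZ//; last by apply: PB => //; exact: Pr.
      by rewrite mulKf// gt_eqF.
    have r0 : 0 < rho^-1 by rewrite invr_gt0.
    rewrite normrM (gtr0_norm r0) -!mulrA; apply: ler_wpM2l; first exact: ltW.
    apply: le_trans (b_CS (PB (Pu _) (Pu _)) Pw) _.
    rewrite [leRHS]mulrCA mulrC ler_wpM2l ?snorm_ge0// mulrC.
    rewrite -(opprB (u n.+1)) -(scaleN1r (u n.+1 - u n)) snormZ; last exact: PB.
    by rewrite normrN1 mul1r; exact: uq.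
  by apply: cvg_eqr (mulr0 (rho^-1 * snorm (u 1%N - u 0%N) * snorm w)) _; exact: cvgMr.
exact: (cvg_unique _ c1 c2).
Qed.

End LaxMilgram.

(** * Inequalities on a line *)

Section Calculus1D.
Context {R : realType}.
Local Notation mu := (@lebesgue_measure R).
Implicit Types (f g F : R -> R).

Lemma cont_int f (p q : R) : continuous f ->
  mu.-integrable `[p, q] (EFin \o f).
Proof.
move=> cf; apply: continuous_compact_integrable; first exact: segment_compact.
exact: continuous_subspaceT.
Qed.

Lemma is_derive_cont f df (t : R) : is_derive t 1 f df -> {for t, continuous f}.
Proof. by move=> [h _]; apply/differentiable_continuous/derivable1_diffP. Qed.

Lemma isd_ext f g (t df dg : R) : is_derive t 1 f df -> f =1 g -> df = dg ->
  is_derive t 1 g dg.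
Proof. by move=> h /funext <- <-. Qed.

Lemma FTC2 g (g' : R -> R) (p q : R) : p <= q ->
  (forall t : R, p <= t <= q -> is_derive t 1 g (g' t)) -> continuous g' ->
  \int[mu]_(t in `[p, q]) g' t = g q - g p.
Proof.
rewrite le_eqVlt => /predU1P[<- _ _|pq dg cg].
  by rewrite set_itv1 Rintegral_set1 subrr.
rewrite /Rintegral (@continuous_FTC2 _ g' g)//.
- exact: continuous_subspaceT.
- split.
  + move=> t; rewrite in_itv/= => /andP[pt tq].
    by have [] := dg t; rewrite ?ltW.
  + apply: cvg_at_right_filter.
    by apply: (@is_derive_cont _ (g' p)); apply: dg; rewrite lexx ltW.
  + apply: cvg_at_left_filter.
    by apply: (@is_derive_cont _ (g' q)); apply: dg; rewrite lexx ltW.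
- move=> t; rewrite in_itv/= => /andP[pt tq].
  by rewrite derive1E; have [] := dg t; rewrite ?ltW.
Qed.

Lemma primitive f (a t : R) : continuous f -> a < t ->
  is_derive t 1 (fun x => \int[mu]_(y in `[a, x]) f y) (f t).
Proof.
move=> cf lat; have [] := @continuous_FTC1_closed R f a t (t + 1) _ _ lat (cf t).
- by rewrite ltrDl.
- exact: cont_int.
- by rewrite derive1E => h1 h2; exact: DeriveDef h1 h2.
Qed.

Lemma int_itv_split f (p q r : R) : continuous f -> p <= q -> q <= r ->
  \int[mu]_(t in `[p, r]) f t = \int[mu]_(t in `[p, q]) f t + \int[mu]_(t in `[q, r]) f t.
Proof.
move=> cf pq qr.
(* Starting the integral at p - 1 puts all of [p, r] strictly to the right of its lower end, as
   [primitive] requires. *)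
have H (a : R) : p - 1 < a -> is_derive a 1 (fun x => \int[mu]_(y in `[p - 1, x]) f y) (f a).
  by move=> pa; exact: primitive.
pose F (x : R) : R := \int[mu]_(y in `[p - 1, x]) f y.
have E (s t : R) : p <= s -> s <= t -> \int[mu]_(y in `[s, t]) f y = F t - F s.
  move=> ps st; apply: FTC2 => // y /andP[sy _]; apply: H.
  by rewrite (lt_le_trans _ (le_trans ps sy))// ltrBlDr ltrDl.
rewrite (E p r)// ?(le_trans pq)// (E p q)// (E q r)//; ring.
Qed.

Lemma int_itv_mono f (p q p' q' : R) : continuous f -> (forall t, 0 <= f t) ->
  p <= p' -> p' <= q' -> q' <= q ->
  \int[mu]_(t in `[p', q']) f t <= \int[mu]_(t in `[p, q]) f t.
Proof.
move=> cf f0 h1 h2 h3.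
rewrite (@int_itv_split f p p' q)//; last exact: le_trans h2 h3.
rewrite (@int_itv_split f p' q' q)//.
have H (a b : R) : 0 <= \int[mu]_(t in `[a, b]) f t by apply: Rintegral_ge0.
by rewrite addrCA lerDl addr_ge0.
Qed.

Lemma int_itv_cst (c p q : R) : p <= q -> \int[mu]_(t in `[p, q]) c = c * (q - p).
Proof.
move=> pq; rewrite Rintegral_cst//= lebesgue_measure_itv/= lte_fin.
move: pq; rewrite le_eqVlt => /predU1P[->|->]; last by rewrite -EFinD.
by rewrite ltxx subrr.
Qed.

Lemma contM f g : continuous f -> continuous g -> continuous (fun t => f t * g t).
Proof. by move=> cf cg t; apply: cvgM; [exact: cf|exact: cg]. Qed.

Lemma contD f g : continuous f -> continuous g -> continuous (fun t => f t + g t).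
Proof. by move=> cf cg t; apply: cvgD; [exact: cf|exact: cg]. Qed.

Lemma contB f g : continuous f -> continuous g -> continuous (fun t => f t - g t).
Proof. by move=> cf cg t; apply: cvgB; [exact: cf|exact: cg]. Qed.

Lemma contZ c f : continuous f -> continuous (fun t => c * f t).
Proof. by move=> cf; apply: contM => // t; exact: cvg_cst. Qed.

Lemma contX f : continuous f -> continuous (fun t => f t ^+ 2).
Proof. by move=> cf; exact: contM. Qed.

Section OneFunction.
Variables (g g' : R -> R).
Hypothesis dg : forall t : R, is_derive t 1 g (g' t).
Hypothesis cg' : continuous g'.

Let cg : continuous g.
Proof. by move=> t; exact: is_derive_cont (dg t). Qed.

(** Integrate (g^2)' = 2 g g' between s and t and use 2 |g g'| <= tau g'^2 + g^2 / tau. The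
    parameter [tau] is free: it is later chosen to absorb a trace into the energy, or equal to
    sqrt(eps). *)
Lemma sq_line_le (p q s t tau : R) : 0 < tau -> p <= s <= q -> p <= t <= q ->
  g s ^+ 2 <= g t ^+ 2 + \int[mu]_(x in `[p, q]) (tau * g' x ^+ 2 + tau^-1 * g x ^+ 2).
Proof.
move=> tau0 /andP[ps sq] /andP[pt tq].
pose h x := 2 * (g x * g' x); pose k x := tau * g' x ^+ 2 + tau^-1 * g x ^+ 2.
have ch : continuous h by apply: contZ; exact: contM.
have ck : continuous k by apply: contD; apply: contZ; exact: contX.
have k0 (x : R) : 0 <= k x by rewrite addr_ge0// mulr_ge0 ?sqr_ge0// ?invr_ge0 ltW.
have ti : tau * tau^-1 = 1 by rewrite mulfV// gt_eqF.
have hk (x : R) : `|h x| <= k x.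
  rewrite ler_norml /h /k; have ti0 : 0 < tau^-1 by rewrite invr_gt0.
  have := mulr_ge0 (ltW ti0) (sqr_ge0 (tau * g' x + g x)).
  have := mulr_ge0 (ltW ti0) (sqr_ge0 (tau * g' x - g x)).
  have E1 : tau^-1 * (tau * g' x + g x) ^+ 2 = tau * g' x ^+ 2 + tau^-1 * g x ^+ 2 + 2 * (g x * g' x).
    by field; rewrite gt_eqF.
  have E2 : tau^-1 * (tau * g' x - g x) ^+ 2 = tau * g' x ^+ 2 + tau^-1 * g x ^+ 2 - 2 * (g x * g' x).
    by field; rewrite gt_eqF.
  rewrite E1 E2; lra.
have dh (x : R) : is_derive x 1 (fun x => g x ^+ 2) (h x).
  have := @is_deriveM _ _ g g x 1 _ _ (dg x) (dg x).
  rewrite (_ : _ + _ = h x) // /h /GRing.scale/=; ring.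
have key (a b : R) : p <= a -> a <= b -> b <= q ->
    `|g b ^+ 2 - g a ^+ 2| <= \int[mu]_(x in `[p, q]) k x.
  move=> pa ab bq; rewrite -(@FTC2 (fun x => g x ^+ 2) h)//.
  apply: le_trans (le_normr_Rintegral _ (cont_int _ _ ch)) _ => //.
  apply: le_trans (int_itv_mono ck k0 pa ab bq).
  apply: le_Rintegral => //; last exact: cont_int.
  have := cont_int a b ch; move=> /integrable_abse.
  by apply: eq_integrable.
have [st|ts] := leP s t.
  have := key s t ps st tq; rewrite distrC; have := ler_norm (g s ^+ 2 - g t ^+ 2); lra.
have := key t s pt (ltW ts) sq; have := ler_norm (g s ^+ 2 - g t ^+ 2); lra.
Qed.

(** The previous inequality averaged over t in [p, q]; the mean of g(t)^2 contributes the factor (q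
    - p)^-1. *)
Lemma sup_line_le (p q s tau : R) : 0 < tau -> p < q -> p <= s <= q ->
  g s ^+ 2 <= tau * (\int[mu]_(x in `[p, q]) g' x ^+ 2) +
    ((q - p)^-1 + tau^-1) * (\int[mu]_(x in `[p, q]) g x ^+ 2).
Proof.
move=> tau0 pq psq.
have i1 := cont_int p q (contX cg'); have i2 := cont_int p q (contX cg).
have qp0 : 0 < q - p by rewrite subr_gt0.
pose I := \int[mu]_(x in `[p, q]) (tau * g' x ^+ 2 + tau^-1 * g x ^+ 2).
have IE : I = tau * (\int[mu]_(x in `[p, q]) g' x ^+ 2) +
              tau^-1 * (\int[mu]_(x in `[p, q]) g x ^+ 2).
  rewrite /I RintegralD//; [by rewrite !RintegralZl|exact: intZ|exact: intZ].
have H : (g s ^+ 2 - I) * (q - p) <= \int[mu]_(x in `[p, q]) g x ^+ 2.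
  rewrite -int_itv_cst ?(ltW pq)//; apply: le_Rintegral => //.
    by apply: cont_int => x; exact: cvg_cst.
  by move=> x; rewrite /= in_itv/= => xpq; have := sq_line_le tau0 psq xpq; rewrite -/I; lra.
move: H; rewrite -ler_pdivlMr// IE; set J := \int[mu]_(x in `[p, q]) g x ^+ 2; lra.
Qed.

(** Cauchy-Schwarz, read off from the nonnegativity of the integral of (g' - c)^2 with c the mean
    slope. *)
Lemma incr_line_le (p q : R) : p <= q ->
  (g q - g p) ^+ 2 <= (q - p) * \int[mu]_(x in `[p, q]) g' x ^+ 2.
Proof.
rewrite le_eqVlt => /predU1P[<-|pq]; first by rewrite !subrr expr0n mul0r.
have qp0 : 0 < q - p by rewrite subr_gt0.
have i1 := cont_int p q (contX cg'); have i2 := cont_int p q cg'.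
have E := FTC2 (ltW pq) (fun t _ => dg t) cg'.
pose c := (g q - g p) / (q - p).
have : 0 <= \int[mu]_(x in `[p, q]) (g' x - c) ^+ 2.
  by apply: Rintegral_ge0 => x _; exact: sqr_ge0.
have -> : \int[mu]_(x in `[p, q]) (g' x - c) ^+ 2 =
    \int[mu]_(x in `[p, q]) (g' x ^+ 2 + ((- 2 * c) * g' x + c ^+ 2)).
  by apply: eq_Rintegral => x _; ring.
have ic : mu.-integrable `[p, q] (EFin \o (fun=> c ^+ 2)).
  by apply: cont_int => x; exact: cvg_cst.
rewrite RintegralD//; last first.
  by apply: intD => //; exact: intZ.
rewrite RintegralD//; last exact: intZ.
rewrite RintegralZl// E int_itv_cst ?(ltW pq)//.
set J := \int[mu]_(x in `[p, q]) g' x ^+ 2.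
have -> : J + (- 2 * c * (g q - g p) + c ^+ 2 * (q - p)) = J - (g q - g p) ^+ 2 / (q - p).
  by rewrite /c; field; rewrite gt_eqF.
by rewrite subr_ge0 ler_pdivrMr// mulrC.
Qed.

(** With G(t) the integral of g'^2 over [p, t], [incr_line_le] gives |g(S t) - g(t)|^2 <= h (G(S t)
    - G(t)). The integrals of G o S and of G over [p, d] nearly cancel after a change of variables,
    which yields the second factor h. *)
Lemma shift_line_le (d h p : R) : 0 <= h -> h < d -> 0 <= p <= d ->
  \int[mu]_(t in `[p, d]) (g (h + (1 - h / d) * t) - g t) ^+ 2 <=
  h ^+ 2 / (1 - h / d) * \int[mu]_(t in `[p, d]) g' t ^+ 2.
Proof.
move=> h0 hd /andP[p0 pd].
have d0 : 0 < d by exact: le_lt_trans h0 hd.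
pose ka : R := 1 - h / d.
have ka0 : 0 < ka by rewrite subr_gt0 ltr_pdivrMr// mul1r.
pose S (t : R) : R := h + ka * t.
have St (t : R) : S t - t = h * (1 - t / d) by rewrite /S /ka; field; rewrite gt_eqF.
have Sd : S d = d by rewrite /S /ka; field; rewrite gt_eqF.
have Sge (t : R) : t <= d -> t <= S t.
  by move=> td; rewrite -subr_ge0 St mulr_ge0// subr_ge0 ler_pdivrMr// mul1r.
have Sle (t : R) : t <= d -> S t <= d.
  by move=> td; rewrite -Sd /S lerD2l ler_pM2l.
have cS : continuous S.
  by apply: contD => [t|]; [exact: cvg_cst|apply: contZ => t; exact: cvg_id].
have dS (t : R) : is_derive t 1 S ka.
  have := @is_deriveD _ _ _ (fun=> h) (fun t => ka * t) t 1 0 ka _ _.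
  rewrite add0r; apply.
  have := @is_deriveZ _ _ _ (fun t : R => t) ka t 1 1 _.
  by rewrite /GRing.scale/= mulr1; apply.
pose f (t : R) : R := g' t ^+ 2; have cf : continuous f by exact: contX.
have f0 (t : R) : 0 <= f t by exact: sqr_ge0.
pose G0 (t : R) : R := \int[mu]_(y in `[p - 1, t]) f y.
have dG0 (t : R) : p - 1 < t -> is_derive t 1 G0 (f t) by exact: primitive.
have GE (s t : R) : p - 1 < s -> s <= t -> \int[mu]_(y in `[s, t]) f y = G0 t - G0 s.
  move=> ps st; apply: FTC2 => // x /andP[sx _]; apply: dG0; lra.
(* Truncation at [p] makes [G] continuous on the whole line, as [primitive] and [FTC2] require of
   their integrand. *)
pose G (t : R) : R := G0 (Num.max p t) - G0 p.
have GG (t : R) : p <= t -> G t = \int[mu]_(y in `[p, t]) f y.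
  by move=> pt; rewrite /G max_r// GE//; lra.
have cG : continuous G.
  apply: contB => [t|t]; last exact: cvg_cst.
  apply: (@continuous_comp _ _ _ (fun t => Num.max p t) G0).
    apply: continuous_max; [exact: cvg_cst|exact: cvg_id].
  by apply: is_derive_cont; apply: dG0; rewrite (lt_le_trans (_ : _ < p)) ?le_max ?lexx//; lra.
pose H (t : R) : R := \int[mu]_(y in `[p - 1, t]) G y.
have dH (t : R) : p - 1 < t -> is_derive t 1 H (G t) by exact: primitive.
have step (t : R) : p <= t <= d -> (g (S t) - g t) ^+ 2 <= h * (G (S t) - G t).
  move=> /andP[pt td]; apply: le_trans (incr_line_le (Sge _ td)) _.
  rewrite GG ?(le_trans pt) ?Sge// GG//.
  have -> : \int[mu]_(x in `[t, S t]) g' x ^+ 2 =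
     \int[mu]_(y in `[p, S t]) f y - \int[mu]_(y in `[p, t]) f y.
    by rewrite (@int_itv_split f p t (S t)) ?Sge//; rewrite /f; ring.
  have i0 : 0 <= \int[mu]_(x in `[t, S t]) f x by apply: Rintegral_ge0.
  move: i0; rewrite [X in 0 <= X](_ : _ = \int[mu]_(y in `[p, S t]) f y - \int[mu]_(y in `[p, t]) f y); last first.
    by rewrite (@int_itv_split f p t (S t)) ?Sge//; ring.
  move=> i0; apply: ler_wpM2r => //.
  rewrite St ler_piMr// gerBl divr_ge0//; lra.
have cgS : continuous (fun t => g (S t)).
  by move=> t; apply: continuous_comp; [exact: cS|exact: cg].
have cGS : continuous (fun t => G (S t)).
  by move=> t; apply: continuous_comp; [exact: cS|exact: cG].
apply: (@le_trans _ _ (\int[mu]_(t in `[p, d]) (h * (G (S t) - G t)))).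
  apply: le_Rintegral => //.
  - by apply: cont_int; apply: contX; exact: contB.
  - by apply: cont_int; apply: contZ; exact: contB.
rewrite RintegralZl//; last by apply: cont_int; exact: contB.
have I1 : \int[mu]_(t in `[p, d]) G (S t) = ka^-1 * (H d - H (S p)).
  have -> : ka^-1 * (H d - H (S p)) = ka^-1 * H (S d) - ka^-1 * H (S p) by rewrite Sd; ring.
  apply: (FTC2 (g := fun t => ka^-1 * H (S t)) pd _ cGS) => t /andP[pt td].
  have := @is_derive1_comp _ H S t _ _ (dH (S t) _) (dS t).
  have pS : p - 1 < S t by have := Sge t td; lra.
  move=> /(_ pS) dHS.
  have := @is_deriveZ _ _ _ (H \o S) ka^-1 t 1 _ dHS.
  move/isd_ext; apply => //; rewrite /GRing.scale/= mulrCA mulVf ?mulr1//.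
  by rewrite gt_eqF.
have I2 : \int[mu]_(t in `[p, d]) G t = H d - H p.
  by apply: FTC2 => // t /andP[pt _]; apply: dH; lra.
rewrite RintegralB//; try exact: cont_int.
rewrite I1 I2.
have G0p (t : R) : 0 <= G t.
  case: (leP p t) => pt; first by rewrite GG//; apply: Rintegral_ge0.
  by rewrite /G max_l ?(ltW pt)// subrr.
have Gd (t : R) : t <= d -> G t <= G d.
  move=> td; rewrite [G d]GG//.
  case: (leP p t) => pt; last first.
    rewrite /G max_l ?(ltW pt)// subrr; exact: Rintegral_ge0.
  by rewrite GG//; apply: int_itv_mono.
have Hp (s t : R) : p <= s -> s <= t -> t <= d -> 0 <= H t - H s <= G d * (t - s).
  move=> ps st td.
  have <- : \int[mu]_(x in `[s, t]) G x = H t - H s.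
    apply: FTC2 => // x /andP[sx _]; apply: dH.
    by rewrite (lt_le_trans _ (le_trans ps sx))// ltrBlDr ltrDl.
  apply/andP; split; first by apply: Rintegral_ge0.
  rewrite -(int_itv_cst (G d) st).
  apply: le_Rintegral => //; try exact: cont_int.
    by apply: cont_int => x; exact: cvg_cst.
  by move=> x; rewrite /= in_itv/= => /andP[_ xt]; apply: Gd; exact: le_trans xt td.
have := Hp p (S p) (lexx p) (Sge p pd) (Sle p pd).
have := Hp (S p) d (Sge p pd) (Sle p pd) (lexx d).
move=> /andP[_ h1] /andP[h2 _].
rewrite -[X in _ <= _ * X]GG//.
have E1 : d - S p = ka * (d - p) by rewrite -{1}Sd /S; ring.
have E2 : ka^-1 * (H d - H (S p)) - (H d - H p) =
   (ka^-1 - 1) * (H d - H (S p)) - (H (S p) - H p) by ring.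
have k1 : 0 <= ka^-1 - 1.
  rewrite subr_ge0 -invr1 lef_pV2 ?posrE// /ka gerBl divr_ge0//; exact: ltW.
have E3 : ka^-1 - 1 = h / d / ka.
  have -> : h / d = 1 - ka by rewrite /ka; ring.
  by field; rewrite gt_eqF.
rewrite E2.
have h3 := ler_wpM2l k1 h1.
apply: (@le_trans _ _ (h * ((ka^-1 - 1) * (G d * (d - S p))))).
  by apply: ler_wpM2l => //; apply: le_trans h3; rewrite gerBl.
rewrite E1 E3 -/ka.
have -> : h * (h / d / ka * (G d * (ka * (d - p)))) = h ^+ 2 * G d * ((d - p) / d).
  by field; rewrite !gt_eqF.
have -> : h ^+ 2 / ka * G d = h ^+ 2 * G d * ka^-1 by ring.
apply: ler_wpM2l; first by rewrite mulr_ge0 ?sqr_ge0.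
apply: (@le_trans _ _ 1); first by rewrite ler_pdivrMr// mul1r gerBl.
by rewrite -subr_ge0.
Qed.

End OneFunction.

End Calculus1D.

(** * Measure and topology of layers *)

Section Plane.
Context {R : realType}.
Local Notation mu := (@lebesgue_measure R).
Local Notation area := (@area R).
Implicit Types (U : set (R * R)) (f : R * R -> R) (gamma : R -> R).

Definition orect (q : R * R * (R * R)) : set (R * R) :=
  [set x | q.1.1 < x.1 < q.1.2 /\ q.2.1 < x.2 < q.2.2].

Definition crect (q : R * R * (R * R)) : set (R * R) :=
  [set x | q.1.1 <= x.1 <= q.1.2 /\ q.2.1 <= x.2 <= q.2.2].

(** Rational rectangles are a countable base of the plane: measurability and almost-everywhere
    statements on open sets reduce to them. *)
Definition ratq (q : rat * rat * (rat * rat)) : R * R * (R * R) :=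
  ((ratr q.1.1, ratr q.1.2), (ratr q.2.1, ratr q.2.2)).

Lemma orectE q : orect q = `]q.1.1, q.1.2[ `*` `]q.2.1, q.2.2[.
Proof. by apply/seteqP; split => x /=; rewrite !in_itv. Qed.

Lemma crectE q : crect q = `[q.1.1, q.1.2] `*` `[q.2.1, q.2.2].
Proof. by apply/seteqP; split => x /=; rewrite !in_itv. Qed.

Lemma measurable_orect q : measurable (orect q : set (measurableTypeR R * measurableTypeR R)).
Proof. by rewrite orectE; apply: measurableX; exact: measurable_itv. Qed.

Lemma measurable_crect q : measurable (crect q : set (measurableTypeR R * measurableTypeR R)).
Proof. by rewrite crectE; apply: measurableX; exact: measurable_itv. Qed.

Lemma compact_crect q : compact (crect q).
Proof. by rewrite crectE; apply: compact_setX; exact: segment_compact. Qed.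

Lemma open_ratrect U x : open U -> U x ->
  exists2 q, orect (ratq q) x & crect (ratq q) `<=` U.
Proof.
move=> oU Ux; have /= := open_nbhs_nbhs (conj oU Ux).
move=> /nbhs_ballP[e /= e0 eU].
have H (y : R) : exists q : rat * rat, y - e < ratr q.1 < y /\ y < ratr q.2 < y + e.
  have [r] : exists r, ratr r \in `]y - e, y[ by apply: rat_in_itvoo; lra.
  have [s] : exists s, ratr s \in `]y, y + e[ by apply: rat_in_itvoo; lra.
  by rewrite !in_itv/= => hs hr; exists (r, s).
have [q1 [/andP[a1 a2] /andP[a3 a4]]] := H x.1.
have [q2 [/andP[b1 b2] /andP[b3 b4]]] := H x.2.
exists (q1, q2); first by rewrite /orect/= a2 a3 b2 b3.
move=> y [/= /andP[c1 c2] /andP[c3 c4]]; apply: eU; split => /=.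
  by rewrite /ball/= ltr_distlC; apply/andP; split; lra.
by rewrite /ball/= ltr_distlC; apply/andP; split; lra.
Qed.

Lemma open_bigcup_ratrect U : open U ->
  U = \bigcup_(q in [set q | crect (ratq q) `<=` U]) orect (ratq q).
Proof.
move=> oU; apply/seteqP; split=> [x Ux|x [q qU xq]].
  by have [q xq qU] := open_ratrect oU Ux; exists q.
apply: qU; move: xq => [/andP[/ltW h1 /ltW h2] /andP[/ltW h3 /ltW h4]].
by split; apply/andP.
Qed.

Lemma open_measurable2 U : open U ->
  measurable (U : set (measurableTypeR R * measurableTypeR R)).
Proof.
move=> oU; rewrite (open_bigcup_ratrect oU) bigcup_mkcond.
apply: countable_bigcupT_measurable => //.
by move=> q; case: ifP => _ //; exact: measurable_orect.
Qed.

Lemma cont_measurable2 f : continuous f ->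
  measurable_fun (setT : set (measurableTypeR R * measurableTypeR R)) f.
Proof.
move=> cf; apply: (measurability _ (RGenOpens.measurableE R)) => _ [_ [a [b ->]] <-].
rewrite setTI; apply: open_measurable2.
by apply: open_comp => [x _|]; [exact: cf|exact: interval_open].
Qed.

Lemma layer_measurable gamma d : measurable_fun setT gamma ->
  measurable (layer gamma d : set (measurableTypeR R * measurableTypeR R)).
Proof.
move=> mg.
have m1 : measurable_fun (setT : set (measurableTypeR R * measurableTypeR R)) (fun x => gamma x.1).
  exact: measurableT_comp mg measurable_fst.
have m2 : measurable_fun (setT : set (measurableTypeR R * measurableTypeR R)) (fun x => x.2 : R).
  exact: measurable_snd.
rewrite (_ : layer gamma d = (setT `&` (fun x => x.2 - gamma x.1) @^-1` `]0, +oo[)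
   `&` (setT `&` (fun x => d - x.2) @^-1` `]0, +oo[)).
  apply: measurableI.
    exact: (measurable_funB m2 m1 measurableT (measurable_itv `]0, +oo[)).
  exact: (measurable_funB (measurable_cst d) m2 measurableT (measurable_itv `]0, +oo[)).
apply/seteqP; split=> x /=; rewrite !in_itv/= !andbT !subr_gt0 /layer/=.
  by move=> /andP[].
by move=> [[_ h1] [_ h2]]; apply/andP.
Qed.

Lemma layer_open gamma d : continuous gamma -> open (layer gamma d).
Proof.
move=> cg.
rewrite (_ : layer gamma d = [set x | 0 < x.2 - gamma x.1] `&` [set x | 0 < d - x.2]).
  apply: openI.
    apply: (@open_comp _ _ (fun x : R * R => x.2 - gamma x.1) [set y | 0 < y]); last exact: open_gt.
    move=> x _; apply: cvgB; first exact: cvg_snd.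
    by apply: (@continuous_comp _ _ _ fst gamma); [exact: cvg_fst|exact: cg].
  apply: (@open_comp _ _ (fun x : R * R => d - x.2) [set y | 0 < y]); last exact: open_gt.
  by move=> x _; apply: cvgB; [exact: cvg_cst|exact: cvg_snd].
apply/seteqP; split=> x /=; rewrite !subr_gt0 /layer/=; first by move=> /andP[].
by move=> [h1 h2]; apply/andP.
Qed.

Lemma layer_fubini gamma d f : measurable_fun setT gamma ->
  measurable_fun (layer gamma d : set (measurableTypeR R * measurableTypeR R)) f ->
  (forall x, layer gamma d x -> 0 <= f x) ->
  (\int[area]_(x in layer gamma d) (f x)%:E =
   \int[mu]_y \int[mu]_(t in `]gamma y, d[) (f (y, t))%:E)%E.
Proof.
move=> mg mf f0; have mL := layer_measurable d mg.
rewrite integral_mkcond /area fubini_tonelli1//; last 2 first.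
- by apply/(measurable_restrictT _ mL); exact/measurable_EFinP.
- by move=> x; rewrite patchE; case: ifP => // /set_mem Lx; rewrite lee_fin f0.
apply: eq_integral => y _; rewrite [RHS]integral_mkcond.
apply: eq_integral => t _; rewrite !patchE.
congr (if _ then _ else _); apply/idP/idP; rewrite !inE /layer/= in_itv//.
Qed.

End Plane.

(** * Test functions *)

Section Smooth1D.
Context {R : realType}.
Implicit Types (f g : R -> R) (P Q B : set (R -> R)).

Definition deriv_closed P : Prop :=
  forall g, P g -> exists2 g', P g' & forall t : R, is_derive t 1 g (g' t).

(** Infinite differentiability, witnessed by a class that contains [f] and is stable under
    derivation; no formula for iterated derivatives is ever needed. *)
Definition smooth1 f : Prop := exists2 P, P f & deriv_closed P.

(** Derivatives of products and of the functions [flat] are combinations of generators, so stability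
    has to be checked on generators only. *)
Inductive fspan B : (R -> R) -> Prop :=
| span_base f of B f : fspan B f
| span_add f g of fspan B f & fspan B g : fspan B (fun t => f t + g t)
| span_scale (c : R) f of fspan B f : fspan B (fun t => c * f t).

Lemma isdD f g (t df dg : R) : is_derive t 1 f df -> is_derive t 1 g dg ->
  is_derive t 1 (fun t => f t + g t) (df + dg).
Proof. by move=> h1 h2; exact: is_deriveD. Qed.

Lemma isdZ c f (t df : R) : is_derive t 1 f df ->
  is_derive t 1 (fun t => c * f t) (c * df).
Proof. by move=> h1; exact: is_deriveZ. Qed.

Lemma isdM f g (t df dg : R) : is_derive t 1 f df -> is_derive t 1 g dg ->
  is_derive t 1 (fun t => f t * g t) (df * g t + f t * dg).
Proof.
move=> h1 h2; have := is_deriveM h1 h2; move/isd_ext; apply => //.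
by rewrite /GRing.scale/= addrC mulrC.
Qed.

Lemma isd_aff (a b t : R) : is_derive t 1 (fun t : R => a + b * t) b.
Proof.
have h := isdD (is_derive_cst a t 1) (isdZ b (is_derive_id t 1)).
by apply: isd_ext h _ _ => //; rewrite add0r mulr1.
Qed.

Lemma isd_comp_aff f (a b t df : R) : is_derive (a + b * t) 1 f df ->
  is_derive t 1 (fun t => f (a + b * t)) (b * df).
Proof.
move=> h; have := @is_derive1_comp R f (fun t => a + b * t) t _ _ h (isd_aff a b t).
by move/isd_ext; apply => //; rewrite mulrC.
Qed.

Lemma span_closed B :
  (forall g, B g -> exists2 g', fspan B g' & forall t : R, is_derive t 1 g (g' t)) ->
  deriv_closed (fspan B).
Proof.
move=> HB g; elim=> [f /HB//|f h _ [f' sf df] _ [h' sh dh]|c f _ [f' sf df]].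
- exists (fun t => f' t + h' t); first exact: span_add.
  by move=> t; exact: isdD.
- exists (fun t => c * f' t); first exact: span_scale.
  by move=> t; exact: isdZ.
Qed.

Lemma smooth1M f g : smooth1 f -> smooth1 g -> smooth1 (fun t => f t * g t).
Proof.
move=> [P Pf cP] [Q Qg cQ].
pose B := [set h | exists p q, [/\ P p, Q q & h = fun t => p t * q t]].
exists (fspan B); first by apply: span_base; exists f, g.
apply: span_closed => _ [p [q [/[dup] Pp /cP[p' Pp' dp] /[dup] Qq /cQ[q' Qq' dq] ->]]].
exists (fun t => p' t * q t + p t * q' t).
  by apply: span_add; apply: span_base; [exists p', q|exists p, q'].
by move=> t; exact: isdM.
Qed.

Lemma smooth1_comp_aff f (a b : R) : smooth1 f -> smooth1 (fun t => f (a + b * t)).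
Proof.
move=> [P Pf cP].
pose B := [set h | exists2 p, P p & h = fun t => p (a + b * t)].
exists (fspan B); first by apply: span_base; exists f.
apply: span_closed => _ [p /[dup] Pp /cP[p' Pp' dp] ->].
exists (fun t => b * p' (a + b * t)).
  by apply: span_scale; apply: span_base; exists p'.
by move=> t; exact: isd_comp_aff.
Qed.

Section Flat.
Variable c : R.
Hypothesis c0 : 0 < c.

(** The functions t^-k exp(-c / t) span a class stable under derivation. The parameter [c] is later
    sent to 0, which turns bumps into indicator functions. *)
Definition flat (k : nat) (t : R) : R :=
  if 0 < t then t^-1 ^+ k * expR (- (c * t^-1)) else 0.

Lemma flat_ge0 k t : 0 <= flat k t.
Proof.
rewrite /flat; case: ifP => // t0.
by rewrite mulr_ge0 ?expR_ge0// exprn_ge0// invr_ge0 ltW.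
Qed.

(** One term of the exponential series bounds exp(c / t) from below. Taking the term of degree k + 2
    leaves a factor t^2, so the difference quotient at 0 tends to 0. *)
Lemma flat_le k t : flat k t <= (k.+2)`!%:R / c ^+ k.+2 * t ^+ 2.
Proof.
have F0 : 0 < (k.+2)`!%:R :> R by rewrite ltr0n fact_gt0.
rewrite /flat; case: ifP => t0; last first.
  by rewrite mulr_ge0 ?sqr_ge0// divr_ge0 ?exprn_ge0// ltW.
have y0 : 0 < t^-1 by rewrite invr_gt0.
have y1 : 0 <= c * t^-1 by apply: mulr_ge0; exact: ltW.
have H := expR_ge1Dxn k.+1 y1.
have H2 : (c * t^-1) ^+ k.+2 / (k.+2)`!%:R <= expR (c * t^-1) by rewrite (le_trans _ H)// lerDr.
have P0 : 0 < (c * t^-1) ^+ k.+2 / (k.+2)`!%:R by rewrite divr_gt0// exprn_gt0// mulr_gt0.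
rewrite expRN.
apply: (@le_trans _ _ (t^-1 ^+ k * ((c * t^-1) ^+ k.+2 / (k.+2)`!%:R)^-1)).
  apply: ler_wpM2l; first by rewrite exprn_ge0// ltW.
  by rewrite lef_pV2 ?posrE// expR_gt0.
rewrite le_eqVlt; apply/orP; left; apply/eqP.
rewrite exprMn !exprS; set A := t^-1 ^+ k; set C := c ^+ k.
have A0 : A != 0 by rewrite expf_neq0// gt_eqF.
have C0 : C != 0 by rewrite expf_neq0// gt_eqF.
by field; rewrite A0 C0 !gt_eqF.
Qed.

Lemma isd_flat k (t : R) : is_derive t 1 (flat k) (- k%:R * flat k.+1 t + c * flat k.+2 t).
Proof.
have [t0|t0|<-] := ltgtP 0 t.
- pose f (s : R) := s^-1 ^+ k * expR (- (c * s^-1)).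
  apply: (@near_eq_is_derive _ _ _ f).
    near=> s; rewrite /flat ifT//; near: s; exact: lt_nbhsr.
  have tn : t != 0 by rewrite gt_eqF.
  have d1 : is_derive t 1 (fun s : R => s^-1) (- t^-1 ^+ 2).
    have := @is_deriveV R id t 1 1 tn (is_derive_id t 1); move=> /isd_ext; apply => //.
    by rewrite /GRing.scale/= mulr1 exprVn.
  have d2 : is_derive t 1 (fun s : R => s^-1 ^+ k) (- k%:R * t^-1 ^+ k.+1).
    case: k {f} => [|k].
      apply: (isd_ext (is_derive_cst (1 : R) t 1)); first by move=> s; rewrite expr0.
      by rewrite oppr0 mul0r.
    have := @is_deriveX _ _ (fun s : R => s^-1) k.+1 t 1 _ d1; move=> /isd_ext; apply.
      by move=> s; rewrite exprfctE.
    by rewrite /GRing.scale/= !exprS; ring.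
  have d3 : is_derive t 1 (fun s : R => expR (- (c * s^-1))) (expR (- (c * t^-1)) * (c * t^-1 ^+ 2)).
    have d4 := isdZ (-c) d1.
    have := @is_derive1_comp _ expR _ t _ _ (is_derive_expR _) d4.
    move=> /isd_ext; apply; first by move=> s /=; rewrite mulNr.
    by rewrite mulrNN mulNr.
  apply: isd_ext (isdM d2 d3) _ _ => //.
  by rewrite /flat !ifT// !exprS; ring.
- have d0 := is_derive_cst (0 : R) t 1.
  rewrite /flat !ifF ?(lt_gtF t0)// !mulr0 addr0.
  apply: (near_eq_is_derive _ d0); near=> s; rewrite ifF//.
  by apply/negbTE; rewrite -leNgt ltW//; near: s; exact: lt_nbhsl.
- rewrite [in X in is_derive _ _ _ X]/flat ltxx !mulr0 addr0.
  pose C := (k.+2)`!%:R / c ^+ k.+2.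
  have C0 : 0 <= C by rewrite divr_ge0 ?exprn_ge0// ltW.
  suff H : (fun h : R => h^-1 *: (flat k (h *: 1 + 0) - flat k 0)) @ 0^' --> (0 : R).
    apply: DeriveDef; first by apply/cvg_ex; exists 0; exact: H.
    exact/cvg_lim.
  apply/cvgrPdist_le => e e0; near=> h.
  have h0 : h != 0 by near: h; exact: nbhs_dnbhs_neq.
  rewrite sub0r normrN /GRing.scale/= mulr1 addr0 {2}/flat ltxx subr0 normrM normfV.
  rewrite ger0_norm ?flat_ge0//.
  apply: (@le_trans _ _ (C * `|h|)).
    rewrite ler_pdivrMl ?normr_gt0// mulrCA -expr2 real_normK ?num_real//.
    exact: flat_le.
  have hd : `|h| <= e / (C + 1).
    near: h; apply: nbhs_dnbhs; apply: (@nbhs0_le _ R); rewrite divr_gt0//; lra.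
  apply: (@le_trans _ _ ((C + 1) * `|h|)); first by apply: ler_wpM2r => //; lra.
  by rewrite mulrC -ler_pdivlMr//; lra.
Unshelve. all: by end_near. Qed.

Lemma smooth1_flat : smooth1 (flat 0).
Proof.
pose B := [set h | exists k, h = flat k].
exists (fspan B); first by apply: span_base; exists 0%N.
apply: span_closed => _ [k ->].
exists (fun t => - k%:R * flat k.+1 t + c * flat k.+2 t).
  by apply: span_add; apply: span_scale; apply: span_base; eexists.
exact: isd_flat.
Qed.

Definition cbump (a b t : R) : R := flat 0 (t - a) * flat 0 (b - t).

Lemma smooth1_cbump a b : smooth1 (cbump a b).
Proof.
have -> : cbump a b = fun t => flat 0 (- a + 1 * t) * flat 0 (b + (-1) * t).
  by apply/funext => t; rewrite /cbump mul1r mulN1r addrC.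
by apply: smooth1M; apply: smooth1_comp_aff; exact: smooth1_flat.
Qed.

Lemma cbump_ge0 a b t : 0 <= cbump a b t.
Proof. by rewrite mulr_ge0 ?flat_ge0. Qed.

Lemma flat_le1 t : flat 0 t <= 1.
Proof.
rewrite /flat; case: ifP => // t0; rewrite expr0 mul1r -expR0 ler_expR.
by rewrite oppr_le0 mulr_ge0 ?invr_ge0// ltW.
Qed.

Lemma cbump_le1 a b t : cbump a b t <= 1.
Proof. by rewrite mulr_ile1 ?flat_ge0 ?flat_le1. Qed.

Lemma cbump_out a b t : ~~ (a < t < b) -> cbump a b t = 0.
Proof.
rewrite negb_and -!leNgt /cbump /flat !subr_gt0 => /orP[h|h].
  by rewrite (le_gtF h) mul0r.
by rewrite (le_gtF h) mulr0.
Qed.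

End Flat.

Lemma flat_cvg (t : R) : (fun n => flat n.+1%:R^-1 0 t) @ \oo --> (if 0 < t then 1 else 0 : R).
Proof.
rewrite /flat; case: ifP => t0; last exact: cvg_cst.
under eq_fun do rewrite expr0 mul1r.
have H : (fun n => - (n.+1%:R^-1 * t^-1)) @ \oo --> (0 : R).
  rewrite -[X in _ --> X]oppr0; apply: cvgN; rewrite -[X in _ --> X](mul0r t^-1).
  by apply: cvgMl; exact: cvg_harmonic.
have := cvg_comp _ _ H (@continuous_expR R 0).
by rewrite expR0.
Qed.

Lemma cbump_cvg (a b t : R) : (fun n => cbump n.+1%:R^-1 a b t) @ \oo --> (\1_(`]a, b[) t : R).
Proof.
have H : (fun n => flat n.+1%:R^-1 0 (t - a) * flat n.+1%:R^-1 0 (b - t)) @ \oo -->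
    (if 0 < t - a then 1 else 0 : R) * (if 0 < b - t then 1 else 0 : R).
  by apply: cvgM; exact: flat_cvg.
apply: cvg_eqr H; rewrite !subr_gt0 indicE mem_setE in_itv/=.
by case: (a < t); case: (t < b) => /=; rewrite ?mulr1 ?mulr0 ?mul0r.
Qed.

End Smooth1D.

(** * Partial derivatives and compactly supported functions in the plane *)

Section Smooth2D.
Context {R : realType}.
Local Notation mu := (@lebesgue_measure R).
Local Notation area := (@area R).
Implicit Types (phi psi : R * R -> R) (j : 'I_2).

Lemma cont_pair (U : topologicalType) (f g : U -> R) (x : U) :
  {for x, continuous f} -> {for x, continuous g} ->
  {for x, continuous (fun y => (f y, g y))}.
Proof. by move=> cf cg; exact: (cvg_pair cf cg). Qed.

Lemma evec0 : @evec R ord0 = (1, 0).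
Proof. by []. Qed.

Lemma evec1 : @evec R 1 = (0, 1).
Proof. by []. Qed.

Lemma ord2P j : j = 0 \/ j = 1.
Proof. by case: j => [[|[|//]] p]; [left|right]; apply: val_inj. Qed.

Lemma slice1 phi (x : R * R) (df : R) : is_derive x.1 1 (fun s => phi (s, x.2)) df <->
  is_derive x (evec 0) phi df.
Proof.
have E : (fun h : R => h^-1 *: (phi (h *: evec 0 + x) - phi x)) =
    (fun h : R => h^-1 *: (phi (h *: 1 + x.1, x.2) - phi (x.1, x.2))).
  apply/funext => h; congr (_ *: (phi _ - phi _)); last by case: x.
  by case: x => a b; rewrite evec0; congr pair; rewrite /= /GRing.scale/= mulr0 add0r.
split=> -[h1 h2].
  by apply: DeriveDef; rewrite /derivable /derive E.
by apply: DeriveDef; move: h1 h2; rewrite /derivable /derive E.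
Qed.

Lemma slice2 phi (x : R * R) (df : R) : is_derive x.2 1 (fun s => phi (x.1, s)) df <->
  is_derive x (evec 1) phi df.
Proof.
have E : (fun h : R => h^-1 *: (phi (h *: evec 1 + x) - phi x)) =
    (fun h : R => h^-1 *: (phi (x.1, h *: 1 + x.2) - phi (x.1, x.2))).
  apply/funext => h; congr (_ *: (phi _ - phi _)); last by case: x.
  by case: x => a b; rewrite evec1; congr pair; rewrite /= /GRing.scale/= mulr0 add0r.
split=> -[h1 h2].
  by apply: DeriveDef; rewrite /derivable /derive E.
by apply: DeriveDef; move: h1 h2; rewrite /derivable /derive E.
Qed.

Lemma isd_partial phi j x df : is_derive x (evec j) phi df -> partial j phi x = df.
Proof. by case. Qed.

Lemma smooth_closed (P : set (R * R -> R)) phi : P phi ->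
  (forall psi, P psi -> continuous psi) ->
  (forall psi j, P psi -> exists2 psi', P psi' &
     forall x, is_derive x (evec j) psi (psi' x)) -> smooth phi.
Proof.
move=> Pp cP dP.
have H s : P (foldr partial phi s).
  elim: s => [//|j s /(dP _ j)[psi' P' d]] /=.
  by rewrite (_ : partial j _ = psi')//; apply/funext => x; exact: isd_partial.
move=> s; split; first exact: cP.
by move=> j x; have [psi' _ d] := dP _ j (H s); have [] := d x.
Qed.

Lemma smooth_cont phi : smooth phi -> continuous phi.
Proof. by move=> /(_ [::])[]. Qed.

Lemma smooth_isd phi j x : smooth phi -> is_derive x (evec j) phi (partial j phi x).
Proof. by move=> /(_ [::])[_ d]; apply: DeriveDef => //; exact: d. Qed.

Lemma smooth_partial phi j : smooth phi -> smooth (partial j phi).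
Proof. by move=> sp s; have := sp (rcons s j); rewrite foldr_rcons. Qed.

Lemma smooth_lin a phi psi : smooth phi -> smooth psi ->
  smooth (fun x => a * phi x + psi x).
Proof.
move=> s1 s2.
apply: (@smooth_closed [set h | exists f g, [/\ smooth f, smooth g &
   h = fun x => a * f x + g x]]); first by exists phi, psi.
  move=> _ [f [g [/smooth_cont cf /smooth_cont cg ->]]] x.
  by apply: cvgD; [apply: cvgMr; exact: cf|exact: cg].
move=> _ j [f [g [sf sg ->]]].
exists (fun x => a * partial j f x + partial j g x).
  by exists (partial j f), (partial j g); split; [exact: smooth_partial|exact: smooth_partial|].
move=> x; have h1 := smooth_isd j x sf; have h2 := smooth_isd j x sg.
by have := is_deriveD (is_deriveZ a h1) h2.
Qed.

Definition shear (h k : R) (x : R * R) : R * R := (x.1, h + k * x.2).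

Lemma shear_cont h k : continuous (shear h k).
Proof.
move=> x; apply: cont_pair; first exact: cvg_fst.
by apply: cvgD; [exact: cvg_cst|apply: cvgMr; exact: cvg_snd].
Qed.

Lemma isd_shear h k phi df1 df2 x :
  is_derive (shear h k x) (evec 0) phi df1 ->
  is_derive (shear h k x) (evec 1) phi df2 ->
  is_derive x (evec 0) (phi \o shear h k) df1 /\
  is_derive x (evec 1) (phi \o shear h k) (k * df2).
Proof.
move=> /slice1 d1 /slice2 d2; split; first by apply/slice1.
apply/slice2; exact: (@isd_comp_aff R (fun s => phi (x.1, s)) h k).
Qed.

Lemma smooth_shear h k phi : smooth phi -> smooth (phi \o shear h k).
Proof.
move=> s.
apply: (@smooth_closed [set f | exists c psi, smooth psi /\
   f = fun x => c * psi (shear h k x)]).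
- by exists 1, phi; split => //; apply/funext => x /=; rewrite mul1r.
- move=> _ [c [psi [sp ->]]] x; apply: cvgMr.
  by apply: continuous_comp; [exact: shear_cont|exact: smooth_cont].
- move=> _ j [c [psi [sp ->]]].
  have D x : is_derive x (evec 0) (psi \o shear h k) (partial 0 psi (shear h k x)) /\
      is_derive x (evec 1) (psi \o shear h k) (k * partial 1 psi (shear h k x)).
    by apply: isd_shear; exact: smooth_isd.
  have [->|->] := ord2P j.
    exists (fun x => c * partial 0 psi (shear h k x)).
      by exists c, (partial 0 psi); split; [exact: smooth_partial|].
    by move=> x; apply: is_deriveZ; have [] := D x.
  exists (fun x => c * k * partial 1 psi (shear h k x)).
    by exists (c * k), (partial 1 psi); split; [exact: smooth_partial|].
  by move=> x; rewrite -mulrA; apply: is_deriveZ; have [] := D x.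
Qed.

Lemma partial_shear h k phi x : smooth phi ->
  (partial 0 (phi \o shear h k) x = partial 0 phi (shear h k x)) *
  (partial 1 (phi \o shear h k) x = k * partial 1 phi (shear h k x)).
Proof.
move=> s; have [d1 d2] := @isd_shear h k phi _ _ x (smooth_isd 0 (shear h k x) s) (smooth_isd 1 (shear h k x) s).
by split; exact: isd_partial.
Qed.

Lemma partial_lin a phi psi j x : smooth phi -> smooth psi ->
  partial j (fun x => a * phi x + psi x) x = a * partial j phi x + partial j psi x.
Proof.
move=> sf sg; apply: isd_partial.
by have := is_deriveD (is_deriveZ a (smooth_isd j x sf)) (smooth_isd j x sg).
Qed.

Lemma smooth_tensor (f g : R -> R) : smooth1 f -> smooth1 g ->
  smooth (fun x => f x.1 * g x.2).
Proof.
move=> [P Pf cP] [Q Qg cQ].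
apply: (@smooth_closed [set h | exists p q, [/\ P p, Q q & h = fun x => p x.1 * q x.2]]).
- by exists f, g.
- move=> _ [p [q [/cP[p' _ dp] /cQ[q' _ dq] ->]]] x; apply: cvgM.
    apply: (@continuous_comp _ _ _ fst p); [exact: cvg_fst|exact: is_derive_cont (dp _)].
  apply: (@continuous_comp _ _ _ snd q); [exact: cvg_snd|exact: is_derive_cont (dq _)].
- move=> _ j [p [q [/[dup] Pp /cP[p' Pp' dp] /[dup] Qq /cQ[q' Qq' dq] ->]]].
  have [->|->] := ord2P j.
    exists (fun x => p' x.1 * q x.2); first by exists p', q.
    move=> x; apply/slice1 => /=.
    apply: isd_ext (isdZ (q x.2) (dp x.1)) _ _; last by rewrite mulrC.
    by move=> t; rewrite mulrC.
  exists (fun x => p x.1 * q' x.2); first by exists p, q'.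
  by move=> x; apply/slice2 => /=; exact: isdZ.
Qed.

Definition box (M : R) : set (R * R) := [set x | `|x.1| <= M /\ `|x.2| <= M].

Lemma boxE M : box M = crect ((- M, M), (- M, M)).
Proof. by apply/seteqP; split => x; rewrite /box /crect/= !ler_norml. Qed.

(** A bounding box is easier to follow through sums and shears than the closure of a support. *)
Lemma testP phi : test_function setT phi <->
  smooth phi /\ exists2 M : R, 0 < M & forall x, ~ box M x -> phi x = 0.
Proof.
split=> [[sp cp _]|[sp [M M0 HM]]]; split => //.
  have [K [Kr HK]] := compact_bounded cp.
  exists (`|K| + 1); first by rewrite ltr_wpDl.
  move=> x nx; apply/eqP/negP => /negP px; apply: nx.
  have /HK : K < `|K| + 1 by rewrite (le_lt_trans (ler_norm _))// ltrDl.
  move=> /(_ x) H; have {H} : `|x| <= `|K| + 1 by apply: H; exact: subset_closure.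
  by rewrite prod_normE/= ge_max => /andP[].
have cB : closed (box M).
  by rewrite boxE; apply: compact_closed; [exact: norm_hausdorff|exact: compact_crect].
have cl : closure [set x | phi x != 0] `<=` crect ((- M, M), (- M, M)).
  rewrite -boxE [X in _ `<=` X](closure_id _).1//; apply: closureS => x /= px.
  by apply: contrapT => /HM /eqP; rewrite (negbTE px).
by apply: subclosed_compact cl; [exact: closed_closure|exact: compact_crect].
Qed.

(** The regularity that integration by parts uses. Products, also with x_2, stay in this class by a
    single product rule, with no iterated derivatives. *)
Definition C1c phi : Prop :=
  [/\ continuous phi, forall j, continuous (partial j phi),
      forall j x, is_derive x (evec j) phi (partial j phi x) &
      exists2 M : R, 0 < M & forall x, ~ box M x ->
        phi x = 0 /\ forall j, partial j phi x = 0].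

Lemma test_C1c phi : test_function setT phi -> C1c phi.
Proof.
move=> /testP[sp [M M0 HM]]; split.
- exact: smooth_cont.
- by move=> j; apply: smooth_cont; exact: smooth_partial.
- by move=> j x; exact: smooth_isd.
exists M => // x nx; split; first exact: HM.
move=> j; rewrite /partial.
rewrite (@near_eq_derive _ _ _ phi (fun=> 0)) ?derive_cst//.
have oB : open (~` box M).
  apply: closed_openC; rewrite boxE; apply: compact_closed; [exact: norm_hausdorff|exact: compact_crect].
have : nbhs x (~` box M) by apply: open_nbhs_nbhs.
by apply: filterS => y /HM.
Qed.

Lemma test_lin a phi psi : test_function setT phi -> test_function setT psi ->
  test_function setT (fun x => a * phi x + psi x).
Proof.
move=> /testP[s1 [M1 M10 H1]] /testP[s2 [M2 M20 H2]]; apply/testP; split.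
  exact: smooth_lin.
exists (M1 + M2); first by rewrite addr_gt0.
move=> x nx; rewrite H1 ?H2 ?mulr0 ?addr0//.
  move=> [h1 h2]; apply: nx; split; [apply: le_trans h1 _|apply: le_trans h2 _];
    by rewrite lerDr ltW.
move=> [h1 h2]; apply: nx; split; [apply: le_trans h1 _|apply: le_trans h2 _];
    by rewrite lerDl ltW.
Qed.

Lemma test0 : test_function setT (fun=> 0 : R).
Proof.
apply/testP; split; last by exists 1.
apply: (@smooth_closed [set h | h = fun=> 0]) => //.
- by move=> _ -> x; exact: cvg_cst.
- move=> _ j ->; exists (fun=> 0) => // x; exact: is_derive_cst.
Qed.

Lemma test_shear h k phi : 0 < k -> test_function setT phi ->
  test_function setT (phi \o shear h k).
Proof.
move=> k0 /testP[s1 [M1 M10 H1]]; apply/testP; split.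
  exact: smooth_shear.
exists (M1 + (M1 + `|h|) / k); first by rewrite addr_gt0// divr_gt0// ltr_wpDr.
move=> x nx /=; apply: H1 => -[/= h1 h2]; apply: nx; split.
  apply: le_trans h1 _; rewrite lerDl divr_ge0 ?addr_ge0// ltW//.
apply: (@le_trans _ _ ((M1 + `|h|) / k)); last by rewrite lerDr ltW.
rewrite ler_pdivlMr// -[k in X in X <= _]gtr0_norm// -normrM mulrC.
have -> : k * x.2 = (h + k * x.2) - h by ring.
by rewrite (le_trans (ler_normB _ _))// lerD2r.
Qed.

Lemma test_bump (Omega : set (R * R)) (c : R) q : 0 < c -> crect q `<=` Omega ->
  test_function Omega (fun x => cbump c q.1.1 q.1.2 x.1 * cbump c q.2.1 q.2.2 x.2).
Proof.
move=> c0 qO.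
have sub : [set x : R * R | cbump c q.1.1 q.1.2 x.1 * cbump c q.2.1 q.2.2 x.2 != 0] `<=` crect q.
  move=> x /=; rewrite mulf_eq0 negb_or => /andP[h1 h2]; split.
    apply: contrapT => /negP n; move: h1; rewrite cbump_out ?eqxx//.
    by apply: contra n => /andP[/ltW -> /ltW ->].
  apply: contrapT => /negP n; move: h2; rewrite cbump_out ?eqxx//.
  by apply: contra n => /andP[/ltW -> /ltW ->].
have cl : closure [set x : R * R | cbump c q.1.1 q.1.2 x.1 * cbump c q.2.1 q.2.2 x.2 != 0] `<=` crect q.
  have cB : closed (crect q).
    by apply: compact_closed; [exact: norm_hausdorff|exact: compact_crect].
  by rewrite [X in _ `<=` X](closure_id _).1//; exact: closureS.
split.
- by apply: smooth_tensor; exact: smooth1_cbump.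
- by apply: subclosed_compact cl; [exact: closed_closure|exact: compact_crect].
- exact: subset_trans cl qO.
Qed.

Lemma test_sub Omega phi : test_function Omega phi -> test_function setT phi.
Proof. by move=> [h1 h2 _]. Qed.

Lemma C1c_line1 phi (x2 t : R) : C1c phi ->
  is_derive t 1 (fun s => phi (s, x2)) (partial 0 phi (t, x2)).
Proof. by move=> [_ _ d _]; apply/(slice1 phi (t, x2)). Qed.

Lemma C1c_line2 phi (x1 t : R) : C1c phi ->
  is_derive t 1 (fun s => phi (x1, s)) (partial 1 phi (x1, t)).
Proof. by move=> [_ _ d _]; apply/(slice2 phi (x1, t)). Qed.

Lemma cont_line1 (f : R * R -> R) x2 : continuous f -> continuous (fun s => f (s, x2)).
Proof.
move=> cf t; apply: (@continuous_comp _ _ _ (fun s => (s, x2)) f); last exact: cf.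
by apply: cont_pair; [exact: cvg_id|exact: cvg_cst].
Qed.

Lemma cont_line2 (f : R * R -> R) x1 : continuous f -> continuous (fun s => f (x1, s)).
Proof.
move=> cf t; apply: (@continuous_comp _ _ _ (fun s => (x1, s)) f); last exact: cf.
by apply: cont_pair; [exact: cvg_cst|exact: cvg_id].
Qed.

Lemma cont_graph (f : R * R -> R) (gamma : R -> R) : continuous f -> continuous gamma ->
  continuous (fun s => f (s, gamma s)).
Proof.
move=> cf cg t; apply: (@continuous_comp _ _ _ (fun s => (s, gamma s)) f); last exact: cf.
by apply: cont_pair; [exact: cvg_id|exact: cg].
Qed.

End Smooth2D.

Section Restrict.
Context {R : realType}.

Lemma int_restrict {d} {T : measurableType d} (nu : {measure set T -> \bar R}) (D : set T)
    (f : T -> R) : measurable D ->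
  nu.-integrable D (EFin \o f) -> nu.-integrable setT (EFin \o (f \_ D)).
Proof. by move=> mD; rewrite -restrict_EFin => /(integrable_mkcond (EFin \o f) mD).1. Qed.

End Restrict.

(** * The fundamental lemma of the calculus of variations *)

Section AlmostEverywhereLine.
Context {R : realType}.
Local Notation mu := (@lebesgue_measure R).

Lemma ndec_derive_ge0 (F : R -> R) (a b x : R) : a < x < b ->
  (forall s t : R, a < s -> s <= t -> t < b -> F s <= F t) ->
  derivable F x 1 -> 0 <= derive1 F x.
Proof.
move=> /andP[ax xb] nd dF; rewrite derive1E.
have := dF; rewrite /derivable => cF.
apply: limr_ge => //.
near=> h.
have h0 : h != 0 by near: h; exact: nbhs_dnbhs_neq.
have hs : `|h| < Num.min (x - a) (b - x).
  near: h; apply: nbhs_dnbhs; apply: (@nbhs0_lt _ R).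
  by rewrite lt_min !subr_gt0 ax.
move: hs; rewrite lt_min !ltr_norml => /andP[/andP[h1 h2] /andP[h3 h4]].
rewrite /GRing.scale/= mulr1; have [hp|hn|/eqP] := ltgtP 0 h; last by rewrite eq_sym (negbTE h0).
  by rewrite mulr_ge0 ?invr_ge0 ?(ltW hp)// subr_ge0 nd//; lra.
rewrite mulr_le0 ?invr_le0 ?(ltW hn)// subr_le0 nd//; lra.
Unshelve. all: by end_near. Qed.

(** The primitive of w is nondecreasing between rational points, hence on all of ]a, b[ by
    continuity; its derivative is w almost everywhere by Lebesgue's differentiation theorem. *)
Lemma ae_ge0_itv (w : R -> R) (a b : R) : mu.-integrable `[a, b] (EFin \o w) ->
  (forall p q : rat, a < ratr p :> R -> ratr p < ratr q :> R -> ratr q < b :> R ->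
     0 <= \int[mu]_(x in `]ratr p : R, ratr q : R[) w x) ->
  {ae mu, forall x, a < x < b -> 0 <= w x}.
Proof.
move=> iw H.
have [ab|ba] := ltP a b; last first.
  by apply: aeW => x /andP[ax xb]; move: (lt_trans ax xb); rewrite ltNge ba.
pose v := w \_ `[a, b].
have iv : mu.-integrable setT (EFin \o v).
  by apply: int_restrict => //; exact: measurable_itv.
have ivS A : measurable A -> mu.-integrable A (EFin \o v).
  by move=> mA; exact: integrableS iv.
have lv : locally_integrable setT v by apply: open_integrable_locally => //; exact: openT.
pose F x := \int[mu]_(t in `[a, x]) v t.
have := @FTC1 R v (BLeft a) _ lv; rewrite -/F => /(_ _)/= FT.
have {}FT : {ae mu, forall x : R, (a%:E < x%:E)%E -> derivable F x 1 /\ derive1 F x = v x}.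
  by apply: FT => y; exact: ivS.
have vE x : a < x < b -> v x = w x.
  by move=> /andP[h1 h2]; rewrite /v patchE mem_set//= in_itv/= !ltW.
have incF (s t : R) : a <= s -> s <= t -> F t - F s = \int[mu]_(x in `]s, t]) v x.
  by move=> as_ st; rewrite /F Rintegral_itvB//; exact: ivS.
have cF : {within `[a, b], continuous F}.
  by apply: parameterized_integral_continuous; [exact: ltW|exact: ivS].
have cF' x : a < x < b -> {for x, continuous F}.
  by move=> xab; have [h _ _] := (continuous_within_itvP _ ab).1 cF; apply: h; rewrite in_itv.
have ndq (p q : rat) : a < ratr p -> ratr p < ratr q :> R -> ratr q < b -> F (ratr p) <= F (ratr q).
  move=> ap pq qb; rewrite -subr_ge0 incF ?(ltW ap) ?(ltW pq)//.
  rewrite -Rintegral_itv_bndo_bndc; last exact: ivS.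
  have := H p q ap pq qb; congr (0 <= _); apply: eq_Rintegral => x.
  rewrite inE/= in_itv/= => /andP[px xq]; rewrite vE//.
  by rewrite (lt_trans ap)//= (lt_trans xq).
have nd (s t : R) : a < s -> s <= t -> t < b -> F s <= F t.
  rewrite [s <= t]le_eqVlt => as_ /predU1P[->//|st] tb; rewrite leNgt; apply/negP => Fts.
  pose e := (F s - F t) / 2; have e0 : 0 < e by rewrite divr_gt0// subr_gt0.
  (* The midpoint separates the rationals that approximate s and t, so that p < q. *)
  pose m := (s + t) / 2.
  have sm : s < m by rewrite /m; lra. have mt : m < t by rewrite /m; lra.
  have /cvgrPdist_lt/(_ e e0)/nbhs_ballP[d1 /= d10 hd1] := cF' s (introT andP (conj as_ (lt_trans st tb))).
  have /cvgrPdist_lt/(_ e e0)/nbhs_ballP[d2 /= d20 hd2] := cF' t (introT andP (conj (lt_trans as_ st) tb)).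
  have [p] : exists p, ratr p \in `]s, (Num.min m (s + d1))[.
    by apply: rat_in_itvoo; rewrite lt_min sm ltrDl.
  have [q] : exists q, ratr q \in `](Num.max m (t - d2)), t[.
    by apply: rat_in_itvoo; rewrite gt_max mt gtrBl.
  rewrite !in_itv/= gt_max lt_min => /andP[/andP[q1 q2] q3] /andP[p1 /andP[p2 p3]].
  have := hd1 (ratr p); have := hd2 (ratr q).
  rewrite /ball/= => /(_ _)/wrap[]; first by rewrite ltr_distlC; apply/andP; split; lra.
  move=> h2 /(_ _)/wrap[]; first by rewrite ltr_distlC; apply/andP; split; lra.
  move=> h1.
  have h3 : F (ratr p) <= F (ratr q).
    apply: ndq; [exact: lt_trans as_ p1|exact: lt_trans p2 q1|exact: lt_trans q3 tb].
  move: h1 h2; rewrite !ltr_norml => /andP[_ h1] /andP[h2 _].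
  have : F s - F t = 2 * e by rewrite /e; lra.
  lra.
apply: aeS FT => x FT /[dup] xab /andP[ax xb].
have [dx Ex] := FT ax.
by rewrite -vE// -Ex; exact: ndec_derive_ge0 xab nd dx.
Qed.

End AlmostEverywhereLine.

(** * From intervals to rectangles and to test functions *)

Section AlmostEverywherePlane.
Context {R : realType}.
Local Notation mu := (@lebesgue_measure R).
Local Notation area := (@area R).

Lemma fubini_R (w : R * R -> R) : area.-integrable setT (EFin \o w) ->
  mu.-integrable setT (EFin \o (fun y => \int[mu]_t w (y, t))) /\
  \int[area]_x w x = \int[mu]_y \int[mu]_t w (y, t).
Proof.
move=> iw.
have iF := integrable_fubini_F iw.
have E := integral12_prod_meas1 iw.
have mF := measurable_int _ iF.
have mf : measurable_fun setT (fun y => \int[mu]_t w (y, t)).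
  by apply: (@measurableT_comp _ _ _ _ _ _ (@fine R)) => //.
(* On a null set of y the inner integral may fail to be finite, and there its real version differs
   from it. *)
have ae : {ae mu, forall y, setT y -> (\int[mu]_t w (y, t))%:E = fubini_F mu (EFin \o w) y}.
  apply: aeS (integrable_ae measurableT iF) => y h /h.
  by rewrite /Rintegral => h'; rewrite fineK.
have mF' : measurable_fun setT (EFin \o (fun y => \int[mu]_t w (y, t))).
  exact/measurable_EFinP.
have E2 : (\int[mu]_y (\int[mu]_t w (y, t))%:E = \int[mu]_y fubini_F mu (EFin \o w) y)%E.
  exact: ae_eq_integral.
split.
  apply/integrableP; split => //.
  move/integrableP : (iF) => [_]; congr (_ < _)%E; apply: ae_eq_integral => //.
  - exact: measurableT_comp.
  - exact: measurableT_comp.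
  - by apply: aeS ae => y h _; congr (abse _); exact/esym/h.
by rewrite /Rintegral -E -E2.
Qed.

Lemma fubini_orect (w : R * R -> R) q : area.-integrable setT (EFin \o w) ->
  [/\ mu.-integrable setT (EFin \o (fun y => \int[mu]_(t in `]q.2.1, q.2.2[) w (y, t))) &
  \int[area]_(x in orect q) w x =
  \int[mu]_(y in `]q.1.1, q.1.2[) \int[mu]_(t in `]q.2.1, q.2.2[) w (y, t)].
Proof.
move=> iw.
have mS : measurable (setT `*` `]q.2.1, q.2.2[ : set (measurableTypeR R * measurableTypeR R)).
  by apply: measurableX => //; exact: measurable_itv.
pose v := w \_ (setT `*` `]q.2.1, q.2.2[).
have iv : area.-integrable setT (EFin \o v).
  by apply: int_restrict => //; exact: integrableS iw.
have [i1 _] := fubini_R iv.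
have vE y : \int[mu]_t v (y, t) = \int[mu]_(t in `]q.2.1, q.2.2[) w (y, t).
  rewrite [RHS]Rintegral_mkcond; apply: eq_Rintegral => t _.
  by rewrite /v !patchE in_setX/= in_setT.
split; first by apply: eq_integrable i1 => // y _ /=; rewrite vE.
have [|_ E] := @fubini_R (w \_ (orect q)).
  apply: int_restrict; first exact: measurable_orect.
  by apply: integrableS iw => //; exact: measurable_orect.
rewrite Rintegral_mkcond E [RHS]Rintegral_mkcond; apply: eq_Rintegral => y _.
rewrite patchE; case: ifPn => [|/negP] yq.
  rewrite [RHS]Rintegral_mkcond; apply: eq_Rintegral => t _; rewrite !patchE.
  by congr (if _ then _ else _); rewrite orectE in_setX /= yq.
rewrite (@eq_Rintegral _ _ _ mu setT (fun=> 0)); first by rewrite Rintegral_cst// mul0r.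
move=> t _; rewrite patchE ifF// orectE in_setX/=.
by apply/negbTE; rewrite negb_and; apply/orP; left; apply/negP.
Qed.

Lemma integrable_setT_sub {d} {T : measurableType d} (nu : {measure set T -> \bar R})
  (D : set T) (f : T -> R) : measurable D -> nu.-integrable setT (EFin \o f) ->
  nu.-integrable D (EFin \o f).
Proof. by move=> mD; exact: integrableS. Qed.

(** [ae_ge0_itv] is used twice: in the first variable for each rational vertical interval, then,
    outside one common null set of y, in the second variable. *)
Lemma ae_ge0_orect (w : R * R -> R) q : area.-integrable setT (EFin \o w) ->
  (forall q', q.1.1 < q'.1.1 -> q'.1.1 < q'.1.2 -> q'.1.2 < q.1.2 ->
     q.2.1 < q'.2.1 -> q'.2.1 < q'.2.2 -> q'.2.2 < q.2.2 ->
     0 <= \int[area]_(x in orect q') w x) ->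
  {ae area, forall x, orect q x -> 0 <= w x}.
Proof.
move=> iw H.
have HJ (p : rat * rat) : {ae mu, forall y, q.1.1 < y < q.1.2 ->
    q.2.1 < ratr p.1 -> ratr p.1 < ratr p.2 :> R -> ratr p.2 < q.2.2 ->
    0 <= \int[mu]_(t in `]ratr p.1 : R, ratr p.2 : R[) w (y, t)}.
  have [hp|hp] := pselect (q.2.1 < ratr p.1 /\ ratr p.1 < ratr p.2 :> R /\ ratr p.2 < q.2.2); last first.
    by apply: aeW => y _ h1 h2 h3; exfalso; apply: hp.
  have [p1 [p2 p3]] := hp.
  pose W y := \int[mu]_(t in `]ratr p.1 : R, ratr p.2 : R[) w (y, t).
  have [iW _] := fubini_orect ((0, 0), (ratr p.1, ratr p.2)) iw.
  have iW' : mu.-integrable `[q.1.1, q.1.2] (EFin \o W).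
    by apply: integrable_setT_sub iW; exact: measurable_itv.
  apply: aeS (ae_ge0_itv iW' _); first by move=> y h yq _ _ _; exact: h.
  move=> s t qs st tq.
  have [_ E] := fubini_orect ((ratr s, ratr t), (ratr p.1, ratr p.2)) iw.
  by rewrite /W -E; apply: H.
have ae1 := ae_integrable1 iw.
have ae2 : {ae mu, forall y, q.1.1 < y < q.1.2 ->
    mu [set t | q.2.1 < t < q.2.2 /\ w (y, t) < 0] = 0%E}.
  apply: aeS2 (ae_countable HJ) ae1 => y hJ iy yq.
  have iy' : mu.-integrable `[q.2.1, q.2.2] (EFin \o (fun t => w (y, t))).
    by apply: integrable_setT_sub; [exact: measurable_itv|exact: iy].
  have := ae_ge0_itv iy' _ => /(_ _)/wrap[].
    by move=> s t h1 h2 h3; exact: (hJ (s, t)).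
  move=> [N [mN N0 sN]]; apply: (@subset_measure0 _ _ _ _ _ N) => //.
  - have mt := measurable_int _ iy.
    have mw : measurable_fun setT (fun t => w (y, t)) by apply/measurable_EFinP.
    rewrite (_ : [set t | _] = `]q.2.1, q.2.2[ `&` (setT `&` (fun t => w (y, t)) @^-1` `]-oo, 0[)).
      by apply: measurableI; [exact: measurable_itv|apply: mw => //; exact: measurable_itv].
    apply/seteqP; split=> t /=; rewrite !in_itv/=; first by move=> [-> ->].
    by move=> [-> [_ ->]].
  - move=> t [tq wt]; apply: sN => /= h; move: (h tq); rewrite leNgt wt //.
pose N := [set x | orect q x /\ w x < 0].
have mw : measurable_fun setT w by apply/measurable_EFinP; exact: measurable_int iw.
have mN : measurable (N : set (measurableTypeR R * measurableTypeR R)).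
  rewrite (_ : N = orect q `&` (setT `&` w @^-1` `]-oo, 0[)).
    by apply: measurableI; [exact: measurable_orect|apply: mw => //; exact: measurable_itv].
  apply/seteqP; split=> t /=; rewrite !in_itv/=; first by move=> [h ->].
  by move=> [h [_ wt]]; split.
exists N; split => //; last first.
  by move=> x /= /not_implyP[qx /negP]; rewrite -ltNge.
(* The set where w is negative has null vertical sections for almost every y, hence zero area. *)
rewrite /area/= /product_measure1/=.
rewrite -(@integral0 _ _ _ mu setT); apply: ae_eq_integral => //.
- exact: measurable_fun_xsection.
- apply: aeS ae2 => y h _ /=.
  have [yq|yq] := boolP (q.1.1 < y < q.1.2).
    rewrite -(h yq); congr (mu _); apply/seteqP; split => t; rewrite /xsection/= inE /N /orect/=.
      by move=> [[]].
    by move=> [].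
  have -> : xsection N y = set0; last by rewrite measure0.
  apply/seteqP; split => t //.
  by rewrite /xsection/= inE /N /orect/= => -[[h' _]]; rewrite h' in yq.
Qed.

Definition bump2 (c : R) (q : R * R * (R * R)) (x : R * R) : R :=
  cbump c q.1.1 q.1.2 x.1 * cbump c q.2.1 q.2.2 x.2.

Lemma bump2_ge0 c q x : 0 <= bump2 c q x.
Proof. by rewrite mulr_ge0// cbump_ge0. Qed.

Lemma bump2_le1 c q x : 0 < c -> bump2 c q x <= 1.
Proof. by move=> c0; rewrite mulr_ile1 ?cbump_ge0 ?cbump_le1. Qed.

Lemma bump2_out c q x : ~ orect q x -> bump2 c q x = 0.
Proof.
move=> h; rewrite /bump2.
have [h1|h1] := boolP (q.1.1 < x.1 < q.1.2); last by rewrite (cbump_out _ h1) mul0r.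
have [h2|h2] := boolP (q.2.1 < x.2 < q.2.2); last by rewrite (cbump_out _ h2) mulr0.
by exfalso; apply: h.
Qed.

Lemma bump2_cvg q x : (fun n => bump2 n.+1%:R^-1 q x) @ \oo --> (\1_(orect q) x : R).
Proof.
have H : (fun n => cbump n.+1%:R^-1 q.1.1 q.1.2 x.1 * cbump n.+1%:R^-1 q.2.1 q.2.2 x.2) @ \oo -->
    (\1_(`]q.1.1, q.1.2[) x.1 : R) * (\1_(`]q.2.1, q.2.2[) x.2 : R).
  by apply: cvgM; exact: cbump_cvg.
apply: cvg_eqr H; rewrite !indicE orectE in_setX.
by case: (_ \in _); case: (_ \in _); rewrite /= ?mulr1 ?mulr0.
Qed.

Definition lint (Omega : set (R * R)) (u : R * R -> R) : Prop :=
  forall K : set (R * R), compact K -> K `<=` Omega -> area.-integrable K (EFin \o u).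

Lemma lint_lin Omega a u v : lint Omega u -> lint Omega v ->
  (forall K, compact K -> K `<=` Omega -> measurable (K : set (measurableTypeR R * measurableTypeR R))) ->
  lint Omega (fun x => a * u x + v x).
Proof.
by move=> lu lv mK K cK KO; apply: intD; [exact: mK|apply: intZ; [exact: mK|exact: lu]|exact: lv].
Qed.

Lemma measurable_compact2 (K : set (R * R)) : compact K ->
  measurable (K : set (measurableTypeR R * measurableTypeR R)).
Proof.
move=> cK; rewrite -(setCK K); apply: measurableC; apply: open_measurable2.
by apply: closed_openC; apply: compact_closed => //; exact: norm_hausdorff.
Qed.

(** Local integrability speaks of compact sets only; a countable cover by rational rectangles
    recovers measurability on the whole open set. *)
Lemma lint_meas Omega u : open Omega -> lint Omega u ->
  measurable_fun (Omega : set (measurableTypeR R * measurableTypeR R)) u.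
Proof.
move=> oO lu _ Y mY; rewrite (open_bigcup_ratrect oO) bigcup_mkcond setI_bigcupl.
apply: countable_bigcupT_measurable => // q; case: ifPn => [|_]; last by rewrite set0I.
rewrite inE/= => qO; have mc := measurable_crect (@ratq R q).
have iq := lu _ (@compact_crect R (ratq q)) qO.
have mu_ : measurable_fun (crect (@ratq R q) : set (measurableTypeR R * measurableTypeR R)) u.
  by apply/measurable_EFinP; exact: measurable_int iq.
have := mu_ mc Y mY => m1.
rewrite (_ : _ `&` _ = orect (ratq q) `&` (crect (ratq q) `&` u @^-1` Y)).
  by apply: measurableI => //; exact: measurable_orect.
apply/seteqP; split => x; last by move=> [h1 [_ h2]]; split.
move=> [h1 h2]; split => //; split => //.
by move: h1 => [/andP[/ltW h3 /ltW h4] /andP[/ltW h5 /ltW h6]]; split; apply/andP.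
Qed.

Lemma int_bump_cvg Omega h q : open Omega -> lint Omega h -> crect q `<=` Omega ->
  (fun n => \int[area]_(x in Omega) (h x * bump2 n.+1%:R^-1 q x)) @ \oo -->
  \int[area]_(x in orect q) h x.
Proof.
move=> oO lh qO.
have mq := measurable_orect q.
have oq : orect q `<=` crect q.
  by move=> x [/andP[/ltW h1 /ltW h2] /andP[/ltW h3 /ltW h4]]; split; apply/andP.
have ih : area.-integrable (orect q) (EFin \o h).
  apply: (@integrableS _ _ _ area (crect q) (orect q)) => //; first exact: measurable_crect.
  by apply: lh => //; exact: compact_crect.
have E n : \int[area]_(x in Omega) (h x * bump2 n.+1%:R^-1 q x) =
    \int[area]_(x in orect q) (h x * bump2 n.+1%:R^-1 q x).
  rewrite Rintegral_mkcond [RHS]Rintegral_mkcond; apply: eq_Rintegral => x _; rewrite !patchE.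
  have [xq|xq] := pselect (orect q x).
    by rewrite !mem_set//; apply: qO; exact: oq.
  by rewrite bump2_out// mulr0; case: ifP; case: ifP.
under eq_fun do rewrite E.
have mb n : measurable_fun (orect q : set (measurableTypeR R * measurableTypeR R)) (bump2 n.+1%:R^-1 q).
  apply: measurable_funTS; apply: cont_measurable2; apply: smooth_cont.
  by have [] := @test_bump R setT n.+1%:R^-1 q _ (@subsetT _ _); rewrite ?invr_gt0.
have mh : measurable_fun (orect q : set (measurableTypeR R * measurableTypeR R)) h.
  by apply/measurable_EFinP; exact: measurable_int ih.
have := @dominated_convergence _ _ _ area (orect q) mq
   (fun n x => (h x * bump2 n.+1%:R^-1 q x)%:E) (EFin \o h) (EFin \o (fun x => `|h x|)).
case.
- by move=> n; apply/measurable_EFinP; exact: measurable_funM.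
- exact/measurable_EFinP.
- apply: aeW => x xq; apply: cvgn_EFin.
  apply: (@cvg_eqr _ (h x * 1)); first by rewrite mulr1.
  have b1 := @bump2_cvg q x; rewrite indicE mem_set// in b1.
  by apply: cvgMr; exact: b1.
- exact: int_abs.
- apply: aeW => x n xq /=; rewrite lee_fin normrM ler_piMr//.
  by rewrite ger0_norm ?bump2_ge0// bump2_le1.
move=> _ _; set I := (X in _ --> X); move=> H.
have If : I = (\int[area]_(x in orect q) h x)%:E.
  by rewrite /Rintegral fineK//; exact: integrable_fin_num.
by rewrite If in H; exact: fine_cvg H.
Qed.

(** As [c] tends to 0 the bumps tend to the indicator of their rectangle, so the integral of h over
    every rectangle inside Omega is nonnegative. Countably many rational rectangles then cover
    Omega. *)
Lemma ae_ge0_test Omega h : open Omega -> lint Omega h ->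
  (forall c q, 0 < c -> crect q `<=` Omega ->
     0 <= \int[area]_(x in Omega) (h x * bump2 c q x)) ->
  {ae area, forall x, Omega x -> 0 <= h x}.
Proof.
move=> oO lh H.
have K (q : rat * rat * (rat * rat)) : {ae area, forall x, crect (ratq q) `<=` Omega ->
    orect (ratq q) x -> 0 <= h x}.
  have [qO|qO] := pselect (crect (@ratq R q) `<=` Omega); last by apply: aeW => x /qO.
  have mq := @measurable_crect R (ratq q).
  pose w := h \_ (crect (ratq q)).
  have iw : area.-integrable setT (EFin \o w).
    by apply: int_restrict => //; apply: lh => //; exact: compact_crect.
  have oq : orect (@ratq R q) `<=` crect (ratq q).
    by move=> x [/andP[/ltW h1 /ltW h2] /andP[/ltW h3 /ltW h4]]; split; apply/andP.
  apply: aeS (@ae_ge0_orect w (ratq q) iw _).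
    move=> x hx _ qx; have := hx qx; rewrite /w patchE mem_set//; exact: oq.
  move=> q' h1 h2 h3 h4 h5 h6.
  have sq : crect q' `<=` crect (ratq q).
    move=> x [/andP[a1 a2] /andP[a3 a4]]; split; apply/andP; split; apply: ltW.
    + exact: lt_le_trans a1. + exact: le_lt_trans h3.
    + exact: lt_le_trans a3. + exact: le_lt_trans h6.
  have -> : \int[area]_(x in orect q') w x = \int[area]_(x in orect q') h x.
    apply: eq_Rintegral => x; rewrite inE => xq; rewrite /w patchE mem_set//; apply: sq.
    by move: xq => [/andP[/ltW b1 /ltW b2] /andP[/ltW b3 /ltW b4]]; split; apply/andP.
  have sO : crect q' `<=` Omega by exact: subset_trans sq qO.
  apply: (cvgr_to_ge (int_bump_cvg oO lh sO)); apply: nearW => n; apply: H => //.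
apply: aeS (ae_countable K) => x Kx Ox.
by have [q xq qO] := open_ratrect oO Ox; exact: (Kx q).
Qed.

End AlmostEverywherePlane.

(** * Weak derivatives *)

Section TestIntegrals.
Context {R : realType}.
Local Notation mu := (@lebesgue_measure R).
Local Notation area := (@area R).
Local Notation T2 := (measurableTypeR R * measurableTypeR R)%type.
Implicit Types (phi psi : R * R -> R) (j : 'I_2) (Omega : set (R * R)).

Definition cc (f : R * R -> R) : Prop :=
  continuous f /\ exists2 M : R, 0 < M & forall x, ~ box M x -> f x = 0.

Lemma C1c_cc phi : C1c phi -> cc phi.
Proof. by move=> [h1 _ _ [M M0 H]]; split => //; exists M => // x /H[]. Qed.

Lemma C1c_ccp phi j : C1c phi -> cc (partial j phi).
Proof. by move=> [_ h1 _ [M M0 H]]; split => //; exists M => // x /H[]. Qed.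

Lemma cc_bounded f : cc f -> exists2 B : R, 0 <= B & forall x, `|f x| <= B.
Proof.
move=> [cf [M M0 HM]].
have cK : compact (f @` box M).
  apply: continuous_compact; first exact: continuous_subspaceT.
  by rewrite boxE; exact: compact_crect.
have [N [Nr HN]] := compact_bounded cK.
exists (`|N| + 1); first by rewrite addr_ge0.
move=> x; have [bx|nx] := pselect (box M x); last by rewrite HM// normr0 addr_ge0.
by apply: HN; [rewrite (le_lt_trans (ler_norm _))// ltrDl|exists x].
Qed.

Lemma ccM f g : cc f -> cc g -> cc (fun x => f x * g x).
Proof.
move=> [cf [M M0 HM]] [cg _]; split; last by exists M => // x /HM ->; rewrite mul0r.
by move=> x; apply: cvgM; [exact: cf|exact: cg].
Qed.

Lemma area_crect q : (area (crect q) < +oo)%E.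
Proof.
have H (a b : R) : (mu `[a, b]%classic < +oo)%E.
  by rewrite lebesgue_measure_itv/=; case: ifP => // _; rewrite -EFinB ltry.
rewrite crectE.
have -> : area (`[q.1.1, q.1.2] `*` `[q.2.1, q.2.2]) = (mu `[q.1.1, q.1.2]%classic * mu `[q.2.1, q.2.2]%classic)%E.
  by apply: product_measure1E; exact: measurable_itv.
by apply: lte_mul_pinfty => //; rewrite ge0_fin_numE.
Qed.

Lemma cc_int (D : set (R * R)) f : measurable (D : set T2) -> cc f -> area.-integrable D (EFin \o f).
Proof.
move=> mD [cf [M M0 HM]]; have [B B0 HB] := cc_bounded (conj cf (ex_intro2 _ _ M M0 HM)).
have mb := @measurable_crect R ((- M, M), (- M, M)).
have ib : area.-integrable (D `&` crect ((- M, M), (- M, M))) (EFin \o f).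
  apply: measurable_bounded_integrable.
  - exact: measurableI.
  - apply: le_lt_trans (@area_crect ((- M, M), (- M, M))).
    by apply: le_measure; rewrite ?inE//; exact: measurableI.
  - by apply: measurable_funTS; exact: cont_measurable2.
  - by exists B; split; [exact: num_real|move=> b Bb x _; exact: le_trans (HB x) (ltW Bb)].
have := int_restrict (measurableI _ _ mD mb) ib.
move=> /(integrable_setT_sub mD); apply: eq_integrable => // x /set_mem Dx /=.
rewrite patchE; case: ifPn => // /negP nx.
rewrite HM//; rewrite boxE => bx; apply: nx; rewrite inE; split => //.
Qed.

Lemma cc_sqi (D : set (R * R)) f : measurable (D : set T2) -> cc f -> sqi area D f.
Proof.
move=> mD cf; apply: int_sqi => //.
  by apply: measurable_funTS; apply: cont_measurable2; case: cf.
by apply: cc_int => //; exact: ccM.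
Qed.

Lemma graph_sqi f (gamma : R -> R) : continuous gamma -> cc f ->
  sqi mu setT (fun y => f (y, gamma y)).
Proof.
move=> cg cf; have [B B0 HB] := cc_bounded cf; have [ff [M M0 HM]] := cf.
have cF : continuous (fun y => f (y, gamma y)) by exact: cont_graph.
apply: int_sqi => //; first exact: continuous_measurable_fun.
have mM : measurable (`[- M, M]%classic : set (measurableTypeR R)) by exact: measurable_itv.
have iM := cont_int (- M) M (contM cF cF).
have := int_restrict mM iM; apply: eq_integrable => // y _ /=.
rewrite patchE; case: ifPn => // /negP ny.
by rewrite HM ?mul0r// => -[/= h _]; apply: ny; rewrite inE/= in_itv/= -ler_norml.
Qed.

Lemma area_compact (K : set (R * R)) : compact K -> (area K < +oo)%E.
Proof.
move=> cK; have mK := measurable_compact2 cK.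
have [N [Nr HN]] := compact_bounded cK.
have N1 : N < `|N| + 1 by rewrite (le_lt_trans (ler_norm _))// ltrDl.
apply: le_lt_trans (@area_crect ((- (`|N| + 1), `|N| + 1), (- (`|N| + 1), `|N| + 1))).
apply: le_measure; rewrite ?inE//; first exact: measurable_crect.
rewrite -boxE => x Kx; have /= := HN _ N1 x Kx.
by rewrite prod_normE/= ge_max => /andP[].
Qed.

Lemma sqi_lint Omega u : sqi area Omega u -> measurable (Omega : set T2) -> lint Omega u.
Proof.
move=> su mO K cK KO; have mK := measurable_compact2 cK.
have fK := area_compact cK.
have i1 : area.-integrable K (EFin \o (fun=> 1 : R)).
  apply: measurable_bounded_integrable => //.
  by exists 1; split; [exact: num_real|move=> b b1 x _ /=; rewrite normr1 ltW].
have i2 : area.-integrable K (EFin \o (fun x => u x * u x)).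
  by apply: (@integrableS _ _ _ area Omega K) => //; exact: sqi_int.
apply: (int_le mK _ _ (intD mK i1 i2)).
  by apply: measurable_funS (sqi_meas su).
by move=> x _; have h1 := sqr_ge0 (u x - 1); have h2 := sqr_ge0 (u x + 1); apply/ler_normlP; split; nra.
Qed.

Lemma int_test Omega u f : open Omega -> lint Omega u -> cc f ->
  (exists K, [/\ compact K, K `<=` Omega & forall x, ~ K x -> f x = 0]) ->
  area.-integrable Omega (EFin \o (fun x => u x * f x)).
Proof.
move=> oO lu cf [K [cK KO HK]]; have mK := measurable_compact2 cK.
have [B B0 HB] := cc_bounded cf; have iu := lu K cK KO.
have muK : measurable_fun (K : set T2) u by apply/measurable_EFinP; exact: measurable_int iu.
have i1 : area.-integrable K (EFin \o (fun x => u x * f x)).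
  apply: (int_le mK _ _ (intZ mK B (int_abs mK iu))).
    by apply: measurable_funM => //; apply: measurable_funTS; apply: cont_measurable2; case: cf.
  by move=> x _; rewrite normrM mulrC; apply: ler_wpM2r.
have := int_restrict mK i1.
move=> /(integrable_setT_sub (open_measurable2 oO)); apply: eq_integrable.
  exact: open_measurable2.
move=> x _ /=; rewrite patchE; case: ifPn => // /negP nx.
by rewrite HK ?mulr0// => Kx; apply: nx; rewrite inE.
Qed.

Lemma test_supp Omega phi : test_function Omega phi ->
  exists K, [/\ compact K, K `<=` Omega & forall x, ~ K x -> phi x = 0 /\ forall j, partial j phi x = 0].
Proof.
move=> [sp cK KO]; exists (closure [set x | phi x != 0]); split => // x nx.
have h y : ~ closure [set x | phi x != 0] y -> phi y = 0.
  by move=> ny; apply/eqP/negP => /negP py; apply: ny; exact: subset_closure.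
split; first exact: h.
move=> j; rewrite /partial (@near_eq_derive _ _ _ phi (fun=> 0)) ?derive_cst//.
have oB : open (~` closure [set x | phi x != 0]) by apply: closed_openC; exact: closed_closure.
have : nbhs x (~` closure [set x | phi x != 0]) by apply: open_nbhs_nbhs.
by apply: filterS => y /h.
Qed.

Lemma test_int Omega phi j u : open Omega -> test_function Omega phi -> lint Omega u ->
  area.-integrable Omega (EFin \o (fun x => u x * phi x)) /\
  area.-integrable Omega (EFin \o (fun x => u x * partial j phi x)).
Proof.
move=> oO tp lu; have [K [cK KO HK]] := test_supp tp.
have C := test_C1c (test_sub tp).
split; apply: int_test => //; [exact: C1c_cc| |exact: C1c_ccp|];
  by exists K; split => // x /HK[].
Qed.

Definition rweak Omega j (u g : R * R -> R) : Prop :=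
  [/\ lint Omega u, lint Omega g &
   forall phi, test_function Omega phi ->
     \int[area]_(x in Omega) (u x * partial j phi x) =
     - \int[area]_(x in Omega) (g x * phi x)].

Lemma rweak_lin Omega j a u g v h : open Omega -> rweak Omega j u g -> rweak Omega j v h ->
  rweak Omega j (fun x => a * u x + v x) (fun x => a * g x + h x).
Proof.
move=> oO [lu lg H1] [lv lh H2]; split.
- by apply: lint_lin => // K cK _; exact: measurable_compact2.
- by apply: lint_lin => // K cK _; exact: measurable_compact2.
move=> phi tp; have mO := open_measurable2 oO.
have [u1 u2] := test_int j oO tp lu; have [v1 v2] := test_int j oO tp lv.
have [g1 g2] := test_int j oO tp lg; have [h1 h2] := test_int j oO tp lh.
have E (f k r : R * R -> R) : area.-integrable Omega (EFin \o (fun x => f x * r x)) ->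
    area.-integrable Omega (EFin \o (fun x => k x * r x)) ->
   \int[area]_(x in Omega) ((a * f x + k x) * r x) =
   a * \int[area]_(x in Omega) (f x * r x) + \int[area]_(x in Omega) (k x * r x).
  move=> i1 i2; rewrite -RintegralZl// -RintegralD//; last exact: intZ.
  by apply: eq_Rintegral => x _; rewrite mulrDl mulrA.
by rewrite !E// H1// H2// mulrN opprD.
Qed.

Lemma rweak_unique Omega j u g h : open Omega -> rweak Omega j u g -> rweak Omega j u h ->
  {ae area, forall x, Omega x -> g x = h x}.
Proof.
move=> oO [lu lg Hg] [_ lh Hh]; have mO := open_measurable2 oO.
have main (g' h' : R * R -> R) : lint Omega g' -> lint Omega h' ->
    (forall phi, test_function Omega phi -> \int[area]_(x in Omega) (g' x * phi x) = \int[area]_(x in Omega) (h' x * phi x)) ->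
    {ae area, forall x, Omega x -> 0 <= (-1) * g' x + h' x}.
  move=> lg' lh' E; apply: ae_ge0_test => //.
    by apply: lint_lin => // K cK _; exact: measurable_compact2.
  move=> c q c0 qO; have tp := test_bump c0 qO.
  have [i1 _] := test_int j oO tp lg'; have [i2 _] := test_int j oO tp lh'.
  rewrite le_eqVlt; apply/orP; left; apply/eqP.
  have -> : \int[area]_(x in Omega) ((-1 * g' x + h' x) * bump2 c q x) =
      \int[area]_(x in Omega) (h' x * bump2 c q x - g' x * bump2 c q x).
    by apply: eq_Rintegral => x _; ring.
  by rewrite RintegralB// E// subrr.
have E phi : test_function Omega phi -> \int[area]_(x in Omega) (g x * phi x) = \int[area]_(x in Omega) (h x * phi x).
  by move=> tp; apply: oppr_inj; rewrite -Hg// -Hh.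
apply: aeS2 (main g h lg lh E) (main h g lh lg (fun phi tp => esym (E phi tp))) => x h1 h2 Ox.
by have := h1 Ox; have := h2 Ox; lra.
Qed.

(** Both sides of the defining identity are L2 pairings with a fixed function, hence continuous
    along the two sequences. *)
Lemma rweak_lim Omega j un gn u g : open Omega ->
  (forall n, rweak Omega j (un n) (gn n)) ->
  cvgL2 area Omega un u -> cvgL2 area Omega gn g -> rweak Omega j u g.
Proof.
move=> oO H cu cg; have mO := open_measurable2 oO; split.
- by apply: sqi_lint => //; exact: cvgL2_lim cu.
- by apply: sqi_lint => //; exact: cvgL2_lim cg.
move=> phi tp; have C := test_C1c (test_sub tp).
have s1 := cc_sqi mO (C1c_cc C); have s2 := cc_sqi mO (C1c_ccp j C).
have c1 := cvgL2_ip mO cu (cvgL2_cst mO s2); have c2 := cvgL2_ip mO cg (cvgL2_cst mO s1).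
have : (fun n => - ip area Omega (gn n) phi) @ \oo --> - ip area Omega g phi by exact: cvgN.
rewrite (_ : (fun n => _) = (fun n => ip area Omega (un n) (partial j phi))).
  by move=> c3; exact: (cvg_unique _ c1 c3).
by apply/funext => n; have [_ _ h] := H n; exact/esym/h.
Qed.

Lemma partialM phi psi j x : C1c phi -> C1c psi ->
  is_derive x (evec j) (fun x => phi x * psi x) (partial j phi x * psi x + phi x * partial j psi x).
Proof.
case: x => x1 x2 [_ _ d1 _] [_ _ d2 _]; have [->|->] := ord2P j.
  apply/slice1; have e1 := (slice1 phi (x1, x2) _).2 (d1 0 (x1, x2)).
  by have e2 := (slice1 psi (x1, x2) _).2 (d2 0 (x1, x2)); exact: (isdM e1 e2).
apply/slice2; have e1 := (slice2 phi (x1, x2) _).2 (d1 1 (x1, x2)).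
by have e2 := (slice2 psi (x1, x2) _).2 (d2 1 (x1, x2)); exact: (isdM e1 e2).
Qed.

Lemma C1cM phi psi : C1c phi -> C1c psi -> C1c (fun x => phi x * psi x).
Proof.
move=> C1 C2; have [c1 p1 d1 [M M0 H1]] := C1; have [c2 p2 d2 _] := C2.
have E j : partial j (fun x => phi x * psi x) = fun x => partial j phi x * psi x + phi x * partial j psi x.
  by apply/funext => x; apply: isd_partial; exact: partialM.
split.
- by move=> x; apply: cvgM; [exact: c1|exact: c2].
- move=> j; rewrite E => x; apply: cvgD; apply: cvgM; [exact: p1|exact: c2|exact: c1|exact: p2].
- by move=> j x; rewrite E; exact: partialM.
- exists M => // x /H1[h1 h2]; split; first by rewrite h1 mul0r.
  by move=> j; rewrite E h1 h2 !mul0r addr0.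
Qed.

Lemma FTC_supp (f f' : R -> R) (M : R) : (forall t : R, is_derive t 1 f (f' t)) -> continuous f' ->
  0 < M -> (forall t, M < `|t| -> f t = 0 /\ f' t = 0) -> \int[mu]_t f' t = 0.
Proof.
move=> df cf M0 HM.
have -> : \int[mu]_t f' t = \int[mu]_(t in `[- (M + 1), M + 1]) f' t.
  rewrite [RHS]Rintegral_mkcond; apply: eq_Rintegral => t _; rewrite patchE.
  case: ifPn => // /negP nt; have [|_ ->] := HM t; last by [].
  rewrite ltNge; apply/negP => h; apply: nt; rewrite inE/= in_itv/= -ler_norml.
  by rewrite (le_trans h)// lerDl.
have ML : -(M + 1) <= M + 1 by rewrite (@le_trans _ _ 0)// ?oppr_le0 ltW// addr_gt0.
rewrite (FTC2 ML (fun t _ => df t) cf).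
have n1 : M < `|M + 1| by rewrite gtr0_norm ?addr_gt0// ltrDl.
have n2 : M < `|- (M + 1)| by rewrite normrN.
by rewrite (HM _ n1).1 (HM _ n2).1 subrr.
Qed.

Lemma C1c_int0 phi j : C1c phi -> \int[area]_x partial j phi x = 0.
Proof.
move=> C; have mM (M : R) : measurable (`[- M, M]%classic : set (measurableTypeR R)) by exact: measurable_itv.
have i1 := cc_int measurableT (C1c_ccp j C); have [c0 cp d [M M0 HM]] := C.
have [ej|ej] := ord2P j; rewrite ej in i1 *.
  rewrite /Rintegral -(integral21_prod_meas1 i1) /fubini_G.
  rewrite (_ : (\int[_]_x _)%E = 0%E)//; apply: integral0_eq => t _.
  have i2 : mu.-integrable setT (EFin \o (fun x => partial 0 phi (x, t))).
    have iM : mu.-integrable `[- M, M] (EFin \o (fun x => partial 0 phi (x, t))).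
      by apply: cont_int; apply: cont_line1; exact: cp.
    have := int_restrict (mM M) iM.
    apply: eq_integrable => // y _ /=; rewrite patchE; case: ifPn => // /negP ny.
    have [|_ ->//] := HM (y, t).
    by move=> [/= h _]; apply: ny; rewrite inE/= in_itv/= -ler_norml.
  have E : \int[mu]_s partial 0 phi (s, t) = 0.
    apply: (@FTC_supp (fun s => phi (s, t)) (fun s => partial 0 phi (s, t)) M) => //.
    - by move=> s; exact: C1c_line1.
    - exact: cont_line1.
    - move=> s Ms; have [|h1 h2] := HM (s, t); first by move=> [/= h _]; move: Ms; rewrite ltNge h.
      by split.
  by rewrite -[LHS]fineK ?[fine _]E//; exact: integrable_fin_num.
rewrite /Rintegral -(integral12_prod_meas1 i1) /fubini_F.
rewrite (_ : (\int[_]_x _)%E = 0%E)//; apply: integral0_eq => t _.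
have i2 : mu.-integrable setT (EFin \o (fun x => partial 1 phi (t, x))).
  have iM : mu.-integrable `[- M, M] (EFin \o (fun x => partial 1 phi (t, x))).
    by apply: cont_int; apply: cont_line2; exact: cp.
  have := int_restrict (mM M) iM.
  apply: eq_integrable => // y _ /=; rewrite patchE; case: ifPn => // /negP ny.
  have [|_ ->//] := HM (t, y).
  by move=> [/= _ h]; apply: ny; rewrite inE/= in_itv/= -ler_norml.
have E : \int[mu]_s partial 1 phi (t, s) = 0.
  apply: (@FTC_supp (fun s => phi (t, s)) (fun s => partial 1 phi (t, s)) M) => //.
  - by move=> s; exact: C1c_line2.
  - exact: cont_line2.
  - move=> s Ms; have [|h1 h2] := HM (t, s); first by move=> [/= _ h]; move: Ms; rewrite ltNge h.
    by split.
by rewrite -[LHS]fineK ?[fine _]E//; exact: integrable_fin_num.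
Qed.

Lemma rweak_C1c Omega j phi : open Omega -> C1c phi -> rweak Omega j phi (partial j phi).
Proof.
move=> oO C; have mO := open_measurable2 oO; split.
- by apply: sqi_lint => //; apply: cc_sqi => //; exact: C1c_cc.
- by apply: sqi_lint => //; apply: cc_sqi => //; exact: C1c_ccp.
move=> psi tp; have Cp := test_C1c (test_sub tp).
have [K [cK KO HK]] := test_supp tp.
have CC := C1cM C Cp.
have h1 := ccM (C1c_cc C) (C1c_ccp j Cp); have h2 := ccM (C1c_ccp j C) (C1c_cc Cp).
apply/eqP; rewrite -addr_eq0 addrC -RintegralD//; try exact: cc_int.
apply/eqP; rewrite -[RHS](C1c_int0 j CC) Rintegral_mkcond; apply: eq_Rintegral => x _.
rewrite (isd_partial (partialM j x C Cp)) patchE; case: ifPn => // /negP nx.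
have [|e1 e2] := HK x; first by move=> Kx; apply: nx; rewrite inE; exact: KO.
by rewrite e1 e2 !mulr0 addr0.
Qed.

End TestIntegrals.

(** * Shears and estimates for smooth functions *)

Section ShearMeasure.
Context {R : realType}.
Local Notation mu := (@lebesgue_measure R).
Local Notation area := (@area R).
Local Notation T1 := (measurableTypeR R).
Local Notation T2 := (measurableTypeR R * measurableTypeR R)%type.
Variables (h k : R).
Hypothesis k0 : 0 < k.

Definition aff (t : R) : R := h + k * t.

Lemma aff_meas : measurable_fun (setT : set T1) (aff : T1 -> T1).
Proof.
apply: continuous_measurable_fun => t.
by apply: cvgD; [exact: cvg_cst|apply: cvgMr; exact: cvg_id].
Qed.

Lemma shear_meas : measurable_fun (setT : set T2) (shear h k : T2 -> T2).
Proof.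
apply/measurable_fun_pairP; split; first exact: measurable_fst.
exact: measurableT_comp aff_meas measurable_snd.
Qed.

(** The measure of preimages, scaled by [k], agrees with Lebesgue measure on half-open intervals,
    hence everywhere by uniqueness. *)
Lemma aff_measure (A : set R) : measurable (A : set T1) ->
  mu (aff @^-1` A) = ((k^-1)%:E * mu A)%E.
Proof.
move=> mA.
pose kk : {nonneg R} := NngNum (ltW k0).
have -> : mu A = (k%:E * mu (aff @^-1` A))%E.
  have [m mE] : exists m : {measure set T1 -> \bar R}, forall B, m B = mu (aff @^-1` B).
    by exists (measure_function_pushforward__canonical__measure_function_Measure mu aff_meas).
  rewrite -mE; apply: (@lebesgue_measure_unique R (mscale kk m)) => // X [[a b] _ <-] /=.
  rewrite /mscale/= mE.
  have -> : aff @^-1` `]a, b] = `](a - h) / k, (b - h) / k]%classic.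
    apply/seteqP; split => t /=; rewrite !in_itv/= /aff ltr_pdivrMr// ler_pdivlMr// !(mulrC t).
      by rewrite ltrBlDl lerBrDl.
    by rewrite ltrBlDl lerBrDl.
  rewrite !lebesgue_measure_itv/= !lte_fin ltr_pM2r ?invr_gt0// ltrD2r.
  case: ifP => _; last by rewrite mule0.
  by rewrite -!EFinD -EFinM; congr (_%:E); field; rewrite gt_eqF.
by rewrite muleA -EFinM mulVf ?mul1e// gt_eqF.
Qed.

Lemma shear_measure (A : set T2) : measurable A ->
  area (shear h k @^-1` A) = ((k^-1)%:E * area A)%E.
Proof.
move=> mA.
have ki : 0 <= k^-1 by rewrite invr_ge0 ltW.
pose kk : {nonneg R} := NngNum (ltW k0).
have -> : area A = (k%:E * area (shear h k @^-1` A))%E.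
  have [m mE] : exists m : {measure set T2 -> \bar R}, forall B, m B = area (shear h k @^-1` B).
    by exists (measure_function_pushforward__canonical__measure_function_Measure area shear_meas).
  rewrite -mE; apply: (@product_measure_unique _ _ _ _ R mu mu (mscale kk m)) => // {mA}A B mA mB.
  transitivity (kk%:num%:E * m (A `*` B))%E => //; rewrite mE /=.
  have mB' : measurable (aff @^-1` B : set T1).
    by rewrite -(setTI (_ @^-1` _)); exact: aff_meas.
  have -> : shear h k @^-1` (A `*` B) = A `*` (aff @^-1` B) by [].
  transitivity (k%:E * (mu A * mu (aff @^-1` B)))%E; first by rewrite /area product_measure1E.
  rewrite (aff_measure mB) muleCA; congr (_ * _)%E.
  by rewrite muleA -EFinM mulfV ?mul1e// gt_eqF.
by rewrite muleA -EFinM mulVf ?mul1e// gt_eqF.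
Qed.

Lemma shear_measurable (D : set T2) : measurable D -> measurable (shear h k @^-1` D : set T2).
Proof. by move=> mD; rewrite -(setTI (_ @^-1` _)); exact: shear_meas. Qed.

Lemma shear_ge0_int (D : set T2) (f : R * R -> \bar R) : measurable D ->
  measurable_fun D f -> (forall x, D x -> (0 <= f x)%E) ->
  (\int[area]_(x in shear h k @^-1` D) f (shear h k x) = (k^-1)%:E * \int[area]_(x in D) f x)%E.
Proof.
move=> mD mf f0.
have ki : 0 <= k^-1 by rewrite invr_ge0 ltW.
pose kk : {nonneg R} := NngNum ki.
rewrite -(@ge0_integral_mscale _ _ _ area D mD kk f)//.
have := @ge0_integral_pushforward _ _ T2 T2 R _ shear_meas area D f mD mf.
move=> /(_ _)/wrap[]; first by move=> y /set_mem; exact: f0.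
move=> <-; apply: eq_measure_integral ; first exact: shear_meas.
move=> ? A mA _; transitivity (area (shear h k @^-1` A)) => //; exact: shear_measure.
Qed.

Lemma shear_integral (D : set T2) (f : R * R -> R) : measurable D ->
  area.-integrable D (EFin \o f) ->
  area.-integrable (shear h k @^-1` D) (EFin \o (f \o shear h k)) /\
  \int[area]_(x in shear h k @^-1` D) f (shear h k x) = k^-1 * \int[area]_(x in D) f x.
Proof.
move=> mD /[dup] iff /integrableP[mf lf].
have mS : measurable (shear h k @^-1` D : set T2).
  by rewrite -(setTI (_ @^-1` _)); exact: shear_meas.
have G (g : R * R -> R) : area.-integrable D (EFin \o g) -> (forall x, 0 <= g x) ->
    area.-integrable (shear h k @^-1` D) (EFin \o (g \o shear h k)) /\
    \int[area]_(x in shear h k @^-1` D) g (shear h k x) = k^-1 * \int[area]_(x in D) g x.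
  move=> /[dup] ig /integrableP[mg lg] g0.
  have E : (\int[area]_(x in shear h k @^-1` D) (g (shear h k x))%:E =
     (k^-1)%:E * \int[area]_(x in D) (g x)%:E)%E.
    by apply: (@shear_ge0_int D (EFin \o g)) => // x _; rewrite lee_fin.
  have fg := integrable_fin_num mD ig.
  split; last by rewrite /Rintegral E fineM.
  apply/integrableP; split.
    apply: (measurable_comp mD _ mg) => [_ [x hx <-]//|].
    by apply: measurable_funS shear_meas.
  rewrite (_ : (\int[area]_(x in _) _)%E = \int[area]_(x in shear h k @^-1` D) (g (shear h k x))%:E)%E.
    by rewrite E -(fineK fg) -EFinM ltry.
  by apply: eq_integral => x _; rewrite /= ger0_norm.
(* The nonnegative case is applied to |f| + f and to |f|, whose difference is f. *)
have [i1 E1] := G _ (intD mD (int_abs mD iff) iff) (fun x => ltac:(by rewrite -lerBlDr sub0r -normrN ler_norm)).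
have [i2 E2] := G _ (int_abs mD iff) (fun x => normr_ge0 _).
have := intB mS i1 i2; rewrite (_ : (fun x => _) = f \o shear h k); last first.
  by apply/funext => x; rewrite /= addrC addKr.
move=> i3; split => //.
transitivity (\int[area]_(x in shear h k @^-1` D) ((`|f (shear h k x)| + f (shear h k x)) - `|f (shear h k x)|)).
  by apply: eq_Rintegral => x _; rewrite addrC addKr.
rewrite RintegralB// E1 E2 -mulrBr; congr (_ * _).
rewrite -RintegralB//; [|exact: (intD mD (int_abs mD iff) iff)|exact: int_abs].
by apply: eq_Rintegral => x _; rewrite addrC addKr.
Qed.

Lemma shear_sqi (D : set T2) (f : R * R -> R) : measurable D -> sqi area D f ->
  sqi area (shear h k @^-1` D) (f \o shear h k) /\
  nn area (shear h k @^-1` D) (f \o shear h k) = k^-1 * nn area D f.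
Proof.
move=> mD sf; have [i1 E] := shear_integral mD (sqi_int sf).
have mS : measurable (shear h k @^-1` D : set T2).
  by rewrite -(setTI (_ @^-1` _)); exact: shear_meas.
split; last by rewrite -E.
apply: int_sqi => //; apply: (measurable_comp mD _ (sqi_meas sf)) => [_ [x hx <-]//|].
by apply: measurable_funS shear_meas.
Qed.

End ShearMeasure.

(** * Lifting inequalities from vertical lines to layers *)

Section PlaneLines.
Context {R : realType}.
Local Notation mu := (@lebesgue_measure R).
Local Notation area := (@area R).
Local Notation T2 := (measurableTypeR R * measurableTypeR R)%type.
Implicit Types (gamma : R -> R) (phi f g : R * R -> R).

Lemma itv_oo_cc (f : R -> R) (p q : R) : continuous f ->
  (\int[mu]_(t in `]p, q[) (f t)%:E = (\int[mu]_(t in `[p, q]) f t)%:E)%E.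
Proof.
move=> cf; rewrite /Rintegral fineK; last by apply: integrable_fin_num => //; exact: cont_int.
apply/esym/integral_itv_bndoo; apply/measurable_EFinP.
by apply: measurable_funTS; exact: continuous_measurable_fun.
Qed.

Lemma layer_lines gamma d f : continuous gamma -> continuous f -> (forall x, 0 <= f x) ->
  (\int[area]_(x in layer gamma d) (f x)%:E =
   \int[mu]_y (\int[mu]_(t in `[gamma y, d]) f (y, t))%:E)%E.
Proof.
move=> cg cf f0; rewrite layer_fubini//.
- by apply: eq_integral => y _; apply: itv_oo_cc; exact: cont_line2.
- exact: continuous_measurable_fun.
- by apply: measurable_funTS; exact: cont_measurable2.
Qed.

Lemma lines_meas gamma d f : continuous gamma -> continuous f -> (forall x, 0 <= f x) ->
  measurable_fun setT (fun y => \int[mu]_(t in `[gamma y, d]) f (y, t)).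
Proof.
move=> cg cf f0; have mg := continuous_measurable_fun cg.
have mL := layer_measurable d mg.
have := @measurable_fun_fubini_tonelli_F _ _ _ _ R mu (EFin \o (f \_ (layer gamma d))).
move=> /(_ _)/wrap[].
  apply/measurable_EFinP; apply/(measurable_restrictT _ mL).
  by apply: measurable_funTS; exact: cont_measurable2.
move=> /(_ _)/wrap[]; first by move=> x; rewrite /= patchE; case: ifP => // _; rewrite lee_fin.
move=> m; apply/measurable_EFinP; congr (measurable_fun _ _): m; apply/funext => y.
rewrite /fubini_F /= -itv_oo_cc; last exact: cont_line2.
rewrite [RHS]integral_mkcond; apply: eq_integral => t _; rewrite !patchE.
have -> : ((y, t) \in layer gamma d) = (t \in `]gamma y, d[%classic).
  by apply/idP/idP => /set_mem h; apply/mem_set; move: h; rewrite /layer/= in_itv.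
by case: ifP.
Qed.

(** Tonelli on the layer. The compact support of [f] makes the right side finite, so [l] needs no
    integrability of its own. *)
Lemma lift_lines gamma d (l : R -> R) f : continuous gamma -> cc f -> (forall x, 0 <= f x) ->
  measurable_fun setT l -> (forall y, 0 <= l y) ->
  (forall y, l y <= \int[mu]_(t in `[gamma y, d]) f (y, t)) ->
  \int[mu]_y l y <= \int[area]_(x in layer gamma d) f x.
Proof.
move=> cg cf f0 ml l0 H; have [ff _] := cf.
have mL := layer_measurable d (continuous_measurable_fun cg).
have i1 := cc_int mL cf.
apply: fine_le.
- rewrite ge0_fin_numE; last by apply: integral_ge0 => y _; rewrite lee_fin.
  apply: (@le_lt_trans _ _ (\int[area]_(x in layer gamma d) (f x)%:E)%E).
    rewrite layer_lines//; apply: ge0_le_integral => //.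
    + by move=> y _; rewrite lee_fin.
    + exact/measurable_EFinP.
    + by apply/measurable_EFinP; exact: lines_meas.
    + by move=> y _; rewrite lee_fin.
  by have := integrable_fin_num mL i1; rewrite ge0_fin_numE// integral_ge0// => x _; rewrite lee_fin.
- exact: integrable_fin_num.
rewrite layer_lines//; apply: ge0_le_integral => //.
+ by move=> y _; rewrite lee_fin.
+ exact/measurable_EFinP.
+ by apply/measurable_EFinP; exact: lines_meas.
+ by move=> y _; rewrite lee_fin.
Qed.

Lemma lift_lines2 gamma d gamma1 d1 f g : continuous gamma -> continuous gamma1 ->
  cc f -> cc g -> (forall x, 0 <= f x) -> (forall x, 0 <= g x) ->
  (forall y, \int[mu]_(t in `[gamma1 y, d1]) g (y, t) <= \int[mu]_(t in `[gamma y, d]) f (y, t)) ->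
  \int[area]_(x in layer gamma1 d1) g x <= \int[area]_(x in layer gamma d) f x.
Proof.
move=> cg cg1 cf cgg f0 g0 H; have [cf' _] := cf; have [cg' _] := cgg.
have -> : \int[area]_(x in layer gamma1 d1) g x = \int[mu]_y \int[mu]_(t in `[gamma1 y, d1]) g (y, t).
  by rewrite /Rintegral layer_lines.
apply: lift_lines => //; first exact: lines_meas.
by move=> y; apply: Rintegral_ge0.
Qed.

Lemma lines_lin gamma d (a b : R) f g y : continuous f -> continuous g ->
  \int[mu]_(t in `[gamma y, d]) (a * f (y, t) + b * g (y, t)) =
  a * \int[mu]_(t in `[gamma y, d]) f (y, t) + b * \int[mu]_(t in `[gamma y, d]) g (y, t).
Proof.
move=> cf cg; have i1 := cont_int (gamma y) d (@cont_line2 R f y cf).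
have i2 := cont_int (gamma y) d (@cont_line2 R g y cg).
by rewrite RintegralD ?RintegralZl//; exact: intZ.
Qed.

Lemma cc_lin (a b : R) f g : cc f -> cc g -> cc (fun x => a * f x + b * g x).
Proof.
move=> [cf [M M0 HM]] [cg [N N0 HN]]; split.
  by move=> x; apply: cvgD; apply: cvgMr; [exact: cf|exact: cg].
exists (M + N); first by rewrite addr_gt0.
move=> x nx; rewrite HM ?HN ?mulr0 ?addr0//.
  move=> [h1 h2]; apply: nx; split; [apply: le_trans h1 _|apply: le_trans h2 _];
    by rewrite lerDr ltW.
move=> [h1 h2]; apply: nx; split; [apply: le_trans h1 _|apply: le_trans h2 _];
    by rewrite lerDl ltW.
Qed.

(** The lower bound [m] on the thickness keeps the constant independent of the shape of [gamma];
    this uniformity allows one constant for all small eps. *)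
Lemma trace_le gamma p d tau m phi : continuous gamma -> continuous p -> C1c phi ->
  0 < tau -> 0 < m -> (forall y, gamma y + m <= d) -> (forall y, gamma y <= p y <= d) ->
  nn mu setT (fun y => phi (y, p y)) <=
  tau * nn area (layer gamma d) (partial 1 phi) + (m^-1 + tau^-1) * nn area (layer gamma d) phi.
Proof.
move=> cg cp C tau0 m0 gm gp.
have c1 := C1c_cc C; have c2 := C1c_ccp 1 C.
have c11 := ccM c1 c1; have c22 := ccM c2 c2.
have mL := layer_measurable d (continuous_measurable_fun cg).
have -> : tau * nn area (layer gamma d) (partial 1 phi) + (m^-1 + tau^-1) * nn area (layer gamma d) phi =
   \int[area]_(x in layer gamma d) (tau * (partial 1 phi x * partial 1 phi x) + (m^-1 + tau^-1) * (phi x * phi x)).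
  have i1 := cc_int mL c11; have i2 := cc_int mL c22.
  by rewrite RintegralD ?RintegralZl//; exact: intZ.
have M0 : 0 <= m^-1 + tau^-1 by rewrite addr_ge0// invr_ge0 ltW.
apply: lift_lines => //.
- exact: cc_lin.
- by move=> x; rewrite addr_ge0// mulr_ge0// -?expr2 ?sqr_ge0// ltW.
- apply: measurable_funM; apply: continuous_measurable_fun; apply: cont_graph => //; by case: c1.
- by move=> y; rewrite -expr2 sqr_ge0.
move=> y; rewrite (@lines_lin gamma d tau _ (fun x => partial 1 phi x * partial 1 phi x) (fun x => phi x * phi x)); [|by case: c22|by case: c11].
have pq : gamma y < d by rewrite (lt_le_trans _ (gm y))// ltrDl.
have := @sup_line_le R (fun t => phi (y, t)) (fun t => partial 1 phi (y, t)) _ _ (gamma y) d (p y) tau tau0 pq (gp y).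
move=> /(_ (fun t => C1c_line2 y t C))/(_ _)/wrap[]; first by apply: cont_line2; case: c2.
rewrite expr2 => h; apply: le_trans h _.
have E (f : R * R -> R) : \int[mu]_(x in `[gamma y, d]) f (y, x) ^+ 2 = \int[mu]_(x in `[gamma y, d]) (f (y, x) * f (y, x)).
  by apply: eq_Rintegral => x _; rewrite expr2.
rewrite !E lerD2l; apply: ler_wpM2r; first by apply: Rintegral_ge0 => x _; rewrite -expr2 sqr_ge0.
rewrite lerD2r lef_pV2 ?posrE ?subr_gt0//; have := gm y; lra.
Qed.

End PlaneLines.

Section SmoothEstimates.
Context {R : realType}.
Local Notation mu := (@lebesgue_measure R).
Local Notation area := (@area R).
Local Notation T2 := (measurableTypeR R * measurableTypeR R)%type.
Implicit Types (gamma : R -> R) (phi f g : R * R -> R).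

Lemma layer_cont_meas gamma d : continuous gamma -> measurable (layer gamma d : set T2).
Proof. by move=> cg; exact: layer_measurable (continuous_measurable_fun cg). Qed.

Lemma contM2 f g : continuous f -> continuous g -> continuous (fun x => f x * g x).
Proof. by move=> cf cg x; apply: cvgM; [exact: cf|exact: cg]. Qed.

Lemma ccZ (a : R) f : cc f -> cc (fun x => a * f x).
Proof.
move=> [cf [M M0 HM]]; split; last by exists M => // x nx; rewrite HM ?mulr0.
by move=> x; apply: cvgMr; exact: cf.
Qed.

Lemma ccMfst (E : R -> R) f : continuous E -> cc f -> cc (fun x => E x.1 * f x).
Proof.
move=> cE [cf [M M0 HM]]; split; last by exists M => // x nx; rewrite HM ?mulr0.
move=> x; apply: cvgM; last exact: cf.
by apply: (@continuous_comp _ _ _ fst E); [exact: cvg_fst|exact: cE].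
Qed.

Lemma cc_shear (h k : R) f : 0 < k -> cc f -> cc (f \o shear h k).
Proof.
move=> k0 [cf [M M0 HM]]; split.
  by move=> x; apply: continuous_comp; [exact: shear_cont|exact: cf].
have Q0 : 0 <= (M + `|h|) / k.
  by apply: divr_ge0; [apply: addr_ge0 => //; exact: ltW|exact: ltW].
have MM : 0 < M + (M + `|h|) / k by rewrite ltr_pwDl.
exists (M + (M + `|h|) / k) => // x nx; rewrite /= HM// => -[/= h1 h2]; apply: nx; split => /=.
  by apply: le_trans h1 _; rewrite lerDl.
apply: (@le_trans _ _ ((M + `|h|) / k)); last by rewrite lerDr ltW.
rewrite ler_pdivlMr// mulrC -{1}(gtr0_norm k0) -normrM.
have -> : k * x.2 = (h + k * x.2) - h by rewrite addrC addKr.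
by apply: le_trans (ler_normB _ _) _; rewrite lerD2r.
Qed.

Lemma lines_R (h d : R) f : cc f ->
  mu.-integrable setT (EFin \o (fun y => \int[mu]_(t in `[h, d]) f (y, t))) /\
  \int[area]_(x in layer (fun=> h) d) f x = \int[mu]_y \int[mu]_(t in `[h, d]) f (y, t).
Proof.
move=> cf; have [cf' _] := cf.
have mL : measurable (layer (fun=> h) d : set T2) by apply: layer_cont_meas => ?; exact: cvg_cst.
have := fubini_R (int_restrict mL (cc_int mL cf)).
rewrite -Rintegral_mkcond.
have E : (fun y => \int[mu]_t (f \_ (layer (fun=> h) d)) (y, t)) = (fun y => \int[mu]_(t in `[h, d]) f (y, t)).
  apply/funext => y; rewrite -[RHS]/(fine (\int[mu]_(t in `[h, d]) f (y, t))%:E) -itv_oo_cc; last exact: cont_line2.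
  rewrite -/(Rintegral mu _ _) [RHS]Rintegral_mkcond; apply: eq_Rintegral => t _; rewrite !patchE.
  have -> : ((y, t) \in layer (fun=> h) d) = (t \in `]h, d[%classic).
    by apply/idP/idP => /set_mem ht; apply/mem_set; move: ht; rewrite /layer/= in_itv.
  by case: ifP.
by move=> [i1 ->]; move: i1; rewrite E.
Qed.

Lemma nn_layer_mono (h d e : R) f : cc f -> e <= d ->
  nn area (layer (fun=> h) e) f <= nn area (layer (fun=> h) d) f.
Proof.
move=> cf ed; have [cf' _] := cf; have ch : continuous (fun _ : R => h) by move=> ?; exact: cvg_cst.
apply: (@lift_lines2 _ (fun=> h) d (fun=> h) e) => //; try exact: ccM.
- by move=> x; rewrite -expr2 sqr_ge0.
- by move=> x; rewrite -expr2 sqr_ge0.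
move=> y; have [he|eh] := leP h e.
  apply: int_itv_mono => //; first by apply: contM; exact: cont_line2.
  by move=> t; rewrite -expr2 sqr_ge0.
rewrite set_itv_ge; last by rewrite bnd_simp -ltNge.
by rewrite Rintegral_set0; apply: Rintegral_ge0 => x _; rewrite -expr2 sqr_ge0.
Qed.

Lemma nn_lin gamma d (a b : R) f g : continuous gamma -> cc f -> cc g ->
  a * nn area (layer gamma d) f + b * nn area (layer gamma d) g =
  \int[area]_(x in layer gamma d) (a * (f x * f x) + b * (g x * g x)).
Proof.
move=> cg cf cgg; have mL := layer_cont_meas d cg.
have i1 := cc_int mL (ccM cf cf); have i2 := cc_int mL (ccM cgg cgg).
by rewrite RintegralD ?RintegralZl//; exact: intZ.
Qed.

Lemma lines_sq gamma d f y : \int[mu]_(x in `[gamma y, d]) f (y, x) ^+ 2 =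
  \int[mu]_(x in `[gamma y, d]) (f (y, x) * f (y, x)).
Proof. by apply: eq_Rintegral => x _; rewrite expr2. Qed.

(** The pointwise bound of [sup_line_le] is integrated over vertical segments of length at most
    [H]. *)
Lemma strip_smooth gamma (d s tau m H : R) phi : continuous gamma -> C1c phi ->
  0 < tau -> 0 < m -> 0 <= H -> (forall y, gamma y + m <= d) -> s <= d ->
  (forall y, s - gamma y <= H) ->
  nn area (layer gamma s) phi <= H * (tau * nn area (layer gamma d) (partial 1 phi) +
     (m^-1 + tau^-1) * nn area (layer gamma d) phi).
Proof.
move=> cg C tau0 m0 H0 gm sd sH.
have c1 := C1c_cc C; have c2 := C1c_ccp 1 C.
have [c1' _] := c1; have [c2' _] := c2.
have M0 : 0 <= m^-1 + tau^-1 by rewrite addr_ge0// invr_ge0 ltW.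
have -> : H * (tau * nn area (layer gamma d) (partial 1 phi) +
     (m^-1 + tau^-1) * nn area (layer gamma d) phi) =
   H * tau * nn area (layer gamma d) (partial 1 phi) + H * (m^-1 + tau^-1) * nn area (layer gamma d) phi.
  by rewrite mulrDr !mulrA.
rewrite nn_lin//; apply: (@lift_lines2 _ gamma d gamma s) => //.
- by apply: cc_lin; exact: ccM.
- exact: ccM.
- by move=> x; rewrite addr_ge0// mulr_ge0// -?expr2 ?sqr_ge0// mulr_ge0// ltW.
- by move=> x; rewrite -expr2 sqr_ge0.
move=> y.
have [sg|gs] := ltP s (gamma y).
  rewrite set_itv_ge; last by rewrite bnd_simp -ltNge.
  rewrite Rintegral_set0; apply: Rintegral_ge0 => x _.
  by rewrite addr_ge0// mulr_ge0// -?expr2 ?sqr_ge0// mulr_ge0// ltW.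
rewrite (@lines_lin R gamma d _ _ (fun x => partial 1 phi x * partial 1 phi x) (fun x => phi x * phi x));
  [|by apply: contM2; case: c2|by apply: contM2; case: c1].
have pq : gamma y < d by rewrite (lt_le_trans _ (gm y))// ltrDl.
set X := (X in _ <= _ * X + _); set Y := (X in _ <= _ + _ * X).
have X0 : 0 <= X by apply: Rintegral_ge0 => x _; rewrite -expr2 sqr_ge0.
have Y0 : 0 <= Y by apply: Rintegral_ge0 => x _; rewrite -expr2 sqr_ge0.
pose K := tau * X + (m^-1 + tau^-1) * Y.
have K0 : 0 <= K by rewrite addr_ge0// mulr_ge0// ltW.
apply: (@le_trans _ _ (\int[mu]_(t in `[gamma y, s]) K)); last first.
  rewrite int_itv_cst// -/K; apply: (@le_trans _ _ (K * H)); first by apply: ler_wpM2l.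
  by rewrite /K; rewrite -subr_ge0 (_ : _ - _ = 0)//; ring.
apply: le_Rintegral => //.
- by apply: cont_int; apply: (@cont_line2 R (fun x => phi x * phi x)); apply: contM2.
- by apply: cont_int => t; exact: cvg_cst.
move=> t; rewrite /= in_itv/= => /andP[t1 t2].
have := @sup_line_le R (fun t => phi (y, t)) (fun t => partial 1 phi (y, t)) _ _ (gamma y) d t tau tau0 pq.
move=> /(_ (fun t => C1c_line2 y t C))/(_ _)/wrap[]; first exact: cont_line2.
move=> /(_ _)/wrap[]; first by rewrite t1 (le_trans t2).
rewrite -expr2 !lines_sq => h; apply: le_trans h _; rewrite lerD2l; apply: ler_wpM2r => //.
rewrite lerD2r lef_pV2 ?posrE ?subr_gt0//; have := gm y; lra.
Qed.

Lemma graph_incr gamma (p : R -> R) (s H : R) phi : continuous gamma -> continuous p -> C1c phi ->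
  0 <= H -> (forall y, gamma y <= p y) -> (forall y, p y <= s) -> (forall y, p y - gamma y <= H) ->
  nn mu setT (fun y => phi (y, p y) - phi (y, gamma y)) <=
  H * nn area (layer gamma s) (partial 1 phi).
Proof.
move=> cg cp C H0 gp ps pH.
have c2 := C1c_ccp 1 C; have [c2' _] := c2; have [c1' _] := C1c_cc C.
have -> : H * nn area (layer gamma s) (partial 1 phi) =
   \int[area]_(x in layer gamma s) (H * (partial 1 phi x * partial 1 phi x)).
  have i1 := cc_int (layer_cont_meas s cg) (ccM c2 c2).
  by rewrite RintegralZl//; exact: layer_cont_meas.
apply: lift_lines => //.
- by apply: ccZ; exact: ccM.
- by move=> x; rewrite mulr_ge0// -expr2 sqr_ge0.
- apply: continuous_measurable_fun; apply: contM; apply: contB; exact: cont_graph.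
- by move=> y; rewrite -expr2 sqr_ge0.
move=> y; have cl : continuous (fun t => partial 1 phi (y, t)) by exact: cont_line2.
have := @incr_line_le R (fun t => phi (y, t)) (fun t => partial 1 phi (y, t)) (fun t => C1c_line2 y t C) cl (gamma y) (p y) (gp y).
rewrite -expr2 => h; apply: le_trans h _.
rewrite RintegralZl//; last first.
  by apply: cont_int; apply: contM.
have -> : \int[mu]_(x in `[gamma y, s]) (partial 1 phi (y, x) * partial 1 phi (y, x)) =
  \int[mu]_(x in `[gamma y, s]) (partial 1 phi (y, x)) ^+ 2 by apply: eq_Rintegral => x _; rewrite expr2.
apply: ler_pM => //; first by rewrite subr_ge0.
  by apply: Rintegral_ge0 => x _; rewrite sqr_ge0.
apply: int_itv_mono => //; first by apply: contX.
by move=> t; rewrite sqr_ge0.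
Qed.

Lemma shift_smooth gamma (d s : R) phi : continuous gamma -> C1c phi -> 0 <= s -> s < d ->
  (forall y, 0 <= gamma y <= d) ->
  nn area (layer gamma d) (fun x => phi (shear s (1 - s / d) x) - phi x) <=
  s ^+ 2 / (1 - s / d) * nn area (layer gamma d) (partial 1 phi).
Proof.
move=> cg C s0 sd gd.
have d0 : 0 < d by apply: le_lt_trans sd.
have k0 : 0 < 1 - s / d by rewrite subr_gt0 ltr_pdivrMr// mul1r.
have c2 := C1c_ccp 1 C; have [c2' _] := c2; have c1 := C1c_cc C; have [c1' _] := c1.
have K0 : 0 <= s ^+ 2 / (1 - s / d) by rewrite divr_ge0 ?sqr_ge0 ?ltW.
set k := 1 - s / d in k0 K0 *.
have -> : s ^+ 2 / k * nn area (layer gamma d) (partial 1 phi) =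
   \int[area]_(x in layer gamma d) (s ^+ 2 / k * (partial 1 phi x * partial 1 phi x)).
  have i1 := cc_int (layer_cont_meas d cg) (ccM c2 c2).
  by rewrite RintegralZl//; exact: layer_cont_meas.
have cS : cc (fun x => phi (shear s k x) - phi x).
  have -> : (fun x => phi (shear s k x) - phi x) = (fun x => 1 * phi (shear s k x) + (-1) * phi x).
    by apply/funext => x; rewrite mul1r mulN1r.
  by apply: cc_lin => //; exact: cc_shear.
have [cS' _] := cS.
apply: lift_lines2 => //.
- by apply: ccZ; exact: ccM.
- by apply: ccM.
- by move=> x; rewrite mulr_ge0// -expr2 sqr_ge0.
- by move=> x; rewrite -expr2 sqr_ge0.
move=> y; have cl : continuous (fun t => partial 1 phi (y, t)) by exact: cont_line2.
have := @shift_line_le R (fun t => phi (y, t)) (fun t => partial 1 phi (y, t)) (fun t => C1c_line2 y t C) cl d s (gamma y) s0 sd (gd y).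
rewrite -/k => h.
rewrite RintegralZl//; last by apply: cont_int; apply: contM.
Qed.

Lemma strip_int0 (h d : R) (F f : R * R -> R) : cc F -> cc f ->
  (forall s t : R, is_derive s 1 (fun s => F (s, t)) (f (s, t))) ->
  \int[area]_(x in layer (fun=> h) d) f x = 0.
Proof.
move=> [cF [M M0 HM]] cf df; have [cf' [N N0 HN]] := cf.
have mL : measurable (layer (fun=> h) d : set T2) by apply: layer_cont_meas => ?; exact: cvg_cst.
have i1 := int_restrict mL (cc_int mL cf).
rewrite Rintegral_mkcond.
rewrite /Rintegral -(integral21_prod_meas1 i1) /fubini_G.
rewrite (_ : (\int[_]_x _)%E = 0%E)//; apply: integral0_eq => t _.
have [th|th] := boolP (h < t < d); last first.
  apply: integral0_eq => s _ /=; rewrite patchE ifN//; apply/negP => /set_mem.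
  by rewrite /layer/=; apply/negP.
have E : \int[mu]_s f (s, t) = 0.
  have MN : 0 < Num.max M N by rewrite lt_max M0.
  apply: (@FTC_supp R (fun s => F (s, t)) (fun s => f (s, t)) (Num.max M N)) => //.
  - exact: cont_line1.
  - move=> s; rewrite gt_max => /andP[h1 h2]; split.
      by apply: HM => -[/= h3 _]; move: h1; rewrite ltNge h3.
    by apply: HN => -[/= h3 _]; move: h2; rewrite ltNge h3.
have i2 : mu.-integrable setT (EFin \o (fun x => f (x, t))).
  have mM : measurable (`[- N, N]%classic : set (measurableTypeR R)) by exact: measurable_itv.
  have iM : mu.-integrable `[- N, N] (EFin \o (fun x => f (x, t))).
    by apply: cont_int; exact: cont_line1.
  have := int_restrict mM iM.
  apply: eq_integrable => // y _ /=; rewrite patchE; case: ifPn => // /negP ny.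
  rewrite HN//.
  by move=> [/= h' _]; apply: ny; rewrite inE/= in_itv/= -ler_norml.
transitivity (\int[mu]_x (f (x, t))%:E)%E.
  by apply: eq_integral => s _ /=; rewrite patchE ifT//; apply/mem_set.
by rewrite -[LHS]fineK ?[fine _]E//; exact: integrable_fin_num.
Qed.

Lemma abs_diff_le (a b j : R) : a <= b + j -> b <= a + j -> `|a - b| <= j.
Proof. by move=> h1 h2; rewrite ler_norml; apply/andP; split; lra. Qed.

(** On the flat boundary the tangential derivative of a trace is not controlled by the W_2^1 norm.
    The boundary integral is therefore replaced by its mean over 0 < x_2 < eps, where E' can be
    integrated by parts. *)
Lemma osc_smooth (d eps K : R) (E E' : R -> R) phi : C1c phi -> 0 < eps -> eps <= d -> eps <= 1 -> 0 <= K ->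
  (forall t : R, is_derive t 1 E (E' t)) -> continuous E' ->
  (forall t, `|E t| <= eps * K) -> (forall t, `|E' t| <= K) ->
  forall C1, nn area (layer (fun=> 0) eps) phi <= eps * C1 ->
  nn area (layer (fun=> 0) d) (partial 0 phi) <= C1 ->
  nn area (layer (fun=> 0) d) (partial 1 phi) <= C1 ->
  `|\int[mu]_y (E' y * (phi (y, 0) * phi (y, 0)))| <= Num.sqrt eps * (4 * K * C1).
Proof.
move=> C e0 ed e1 K0 dE cE' EK E'K C1 C1a C1b C1c'.
have c0 := C1c_cc C; have c1 := C1c_ccp 0 C; have c2 := C1c_ccp 1 C.
have [c0' _] := c0; have [c1' _] := c1; have [c2' _] := c2.
have cE : continuous E by move=> t; exact: is_derive_cont (dE t).
have ch : continuous (fun _ : R => 0 : R) by move=> ?; exact: cvg_cst.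
(* The Young parameter sqrt(eps) balances the two terms: since [nn] of phi over the strip is at most
   eps C1, both eps e |grad phi|^2 and eps e^-1 phi^2 are of order eps^(3/2). *)
set e := Num.sqrt eps.
have ee : e ^+ 2 = eps by rewrite sqr_sqrtr// ltW.
have e_gt0 : 0 < e by rewrite sqrtr_gt0.
have eV : e^-1 * eps = e by rewrite -ee expr2 mulKf// gt_eqF.
have Ke0 : 0 <= eps * K * e^-1 by rewrite !mulr_ge0// ?invr_ge0 ltW.
have Ke1 : 0 <= eps * K * e by rewrite !mulr_ge0// ltW.
have E2 : eps * K * e^-1 * (eps * C1) = eps * K * e * C1 by rewrite -[in RHS]eV; ring.
have mS : measurable (layer (fun=> 0) eps : set T2) by exact: layer_cont_meas.
have C1b' := le_trans (nn_layer_mono 0 c1 ed) C1b.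
have C1d' := le_trans (nn_layer_mono 0 c2 ed) C1c'.
pose G x := E' x.1 * (phi x * phi x).
have cG : cc G by apply: ccMfst => //; exact: ccM.
have [cG' _] := cG.
have [iB EB] := lines_R 0 eps cG.
pose A y := eps * (E' y * (phi (y, 0) * phi (y, 0))).
pose B y := \int[mu]_(t in `[0, eps]) G (y, t).
have iA0 : mu.-integrable setT (EFin \o (fun y => E' y * (phi (y, 0) * phi (y, 0)))).
  have := ip_int measurableT (graph_sqi ch (ccMfst cE' c0)) (graph_sqi ch c0).
  by congr (_.-integrable _ (EFin \o _)); apply/funext => y /=; rewrite mulrA.
have iA : mu.-integrable setT (EFin \o A) by exact: intZ.
have HA : \int[mu]_y A y = eps * \int[mu]_y (E' y * (phi (y, 0) * phi (y, 0))) by rewrite RintegralZl.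
(* Replacing the boundary value by the strip mean costs vertical increments only, whatever the
   oscillation of E'. *)
have b1 : `|\int[mu]_y (A y - B y)| <= eps * (2 * K * e * C1).
  have iAB : mu.-integrable setT (EFin \o (fun y => A y - B y)) by exact: intB.
  apply: le_trans (le_normr_Rintegral _ _) _ => //.
  apply: (@le_trans _ _ (eps * K * e * nn area (layer (fun=> 0) eps) (partial 1 phi) +
       eps * K * e^-1 * nn area (layer (fun=> 0) eps) phi)); last first.
    have h1 : eps * K * e * nn area (layer (fun=> 0) eps) (partial 1 phi) <= eps * K * e * C1.
      exact: (ler_wpM2l Ke1 C1d').
    have h2 : eps * K * e^-1 * nn area (layer (fun=> 0) eps) phi <= eps * K * e * C1.
      by rewrite -E2; exact: (ler_wpM2l Ke0 C1a).
    by apply: le_trans (lerD h1 h2) _; rewrite -subr_ge0 (_ : _ - _ = 0)//; ring.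
  rewrite nn_lin//; apply: lift_lines => //.
  - by apply: cc_lin; exact: ccM.
  - by move=> x; rewrite addr_ge0// mulr_ge0// -?expr2 ?sqr_ge0// !mulr_ge0 ?invr_ge0// ltW.
  - by apply: measurableT_comp => //; apply/measurable_EFinP; exact: measurable_int iAB.
  move=> y.
  have cl1 : continuous (fun t => phi (y, t)) by exact: cont_line2.
  have cl2 : continuous (fun t => partial 1 phi (y, t)) by exact: cont_line2.
  pose J := \int[mu]_(x in `[0, eps]) (e * partial 1 phi (y, x) ^+ 2 + e^-1 * phi (y, x) ^+ 2).
  have -> : \int[mu]_(t in `[0, eps]) (eps * K * e * (partial 1 phi (y, t) * partial 1 phi (y, t)) +
       eps * K * e^-1 * (phi (y, t) * phi (y, t))) = eps * K * J.
    rewrite -RintegralZl//; last first.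
      by apply: cont_int; apply: contD; apply: contZ; exact: contX.
    by apply: eq_Rintegral => t _; rewrite !expr2; ring.
  have HJ (s t : R) : 0 <= s <= eps -> 0 <= t <= eps -> phi (y, s) ^+ 2 <= phi (y, t) ^+ 2 + J.
    move=> hs ht.
    exact: (@sq_line_le R (fun t => phi (y, t)) (fun t => partial 1 phi (y, t)) (fun t => C1c_line2 y t C) cl2 0 eps s t e).
  have -> : A y - B y = \int[mu]_(t in `[0, eps]) (E' y * (phi (y, 0) ^+ 2 - phi (y, t) ^+ 2)).
    rewrite /B /A; have <- : \int[mu]_(t in `[0, eps]) (E' y * (phi (y, 0) * phi (y, 0))) =
       eps * (E' y * (phi (y, 0) * phi (y, 0))) by rewrite int_itv_cst ?subr0 1?mulrC// ltW.
    rewrite -RintegralB//; [|by apply: cont_int => ?; exact: cvg_cst|by apply: cont_int; exact: (@cont_line2 R G)].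
    by apply: eq_Rintegral => t _; rewrite /G/= !expr2; ring.
  apply: le_trans (le_normr_Rintegral _ _) _ => //.
    by apply: cont_int; apply: contZ; apply: contB; [move=> ?; exact: cvg_cst|exact: contX].
  apply: (@le_trans _ _ (\int[mu]_(t in `[0, eps]) (K * J))); last first.
    by rewrite int_itv_cst ?(ltW e0)// subr0 -subr_ge0 (_ : _ - _ = 0)//; ring.
  apply: le_Rintegral => //.
  - apply: (@int_abs _ _ _ mu) => //.
    by apply: cont_int; apply: contZ; apply: contB; [move=> ?; exact: cvg_cst|exact: contX].
  - by apply: cont_int => ?; exact: cvg_cst.
  move=> t; rewrite /= in_itv/= => ht; rewrite normrM; apply: ler_pM => //.
  have z : 0 <= (0 : R) <= eps by rewrite lexx ltW.
  have := HJ _ _ ht z; have := HJ _ _ z ht.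
  exact: abs_diff_le.
(* Inside the strip E' phi^2 is the horizontal derivative of E phi^2 minus 2 E phi d_1 phi, and |E|
   <= eps K. *)
have b2 : `|\int[mu]_y B y| <= eps * (2 * K * e * C1).
  rewrite -EB.
  pose G2 x := 2 * (E x.1 * (phi x * partial 0 phi x)).
  have cG2 : cc G2 by apply: ccZ; apply: ccMfst => //; exact: ccM.
  have i1 := cc_int mS cG; have i2 := cc_int mS cG2.
  have : \int[area]_(x in layer (fun=> 0) eps) (1 * G x + 1 * G2 x) = 0.
    apply: (@strip_int0 0 eps (fun x => E x.1 * (phi x * phi x))).
    - by apply: ccMfst => //; exact: ccM.
    - exact: cc_lin.
    - move=> s t; apply: (isd_ext (isdM (dE s) (isdM (C1c_line1 t s C) (C1c_line1 t s C)))) => //.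
      by rewrite /G /G2/=; ring.
  have -> : \int[area]_(x in layer (fun=> 0) eps) (1 * G x + 1 * G2 x) =
     \int[area]_(x in layer (fun=> 0) eps) G x + \int[area]_(x in layer (fun=> 0) eps) G2 x.
    by rewrite -RintegralD//; apply: eq_Rintegral => x _; rewrite !mul1r.
  move/eqP; rewrite addr_eq0 => /eqP ->; rewrite normrN.
  apply: le_trans (le_normr_Rintegral _ _) _ => //.
  apply: (@le_trans _ _ (eps * K * e * nn area (layer (fun=> 0) eps) (partial 0 phi) +
       eps * K * e^-1 * nn area (layer (fun=> 0) eps) phi)); last first.
    have h1 : eps * K * e * nn area (layer (fun=> 0) eps) (partial 0 phi) <= eps * K * e * C1.
      exact: (ler_wpM2l Ke1 C1b').
    have h2 : eps * K * e^-1 * nn area (layer (fun=> 0) eps) phi <= eps * K * e * C1.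
      by rewrite -E2; exact: (ler_wpM2l Ke0 C1a).
    by apply: le_trans (lerD h1 h2) _; rewrite -subr_ge0 (_ : _ - _ = 0)//; ring.
  rewrite nn_lin//; apply: le_Rintegral => //.
  - exact: int_abs.
  - by apply: cc_int => //; apply: cc_lin; exact: ccM.
  move=> x _; rewrite /G2 !normrM (ger0_norm (ler0n R 2)).
  apply: (@le_trans _ _ (2 * (eps * K * (`|phi x| * `|partial 0 phi x|)))).
    by apply: ler_wpM2l => //; apply: ler_wpM2r.
  rewrite -!expr2 -(real_normK (num_real (partial 0 phi x))) -(real_normK (num_real (phi x))).
  set p := `|phi x|; set q := `|partial 0 phi x|.
  rewrite -subr_ge0 (_ : _ - _ = eps * K * e^-1 * (e * q - p) ^+ 2).
    by rewrite mulr_ge0// sqr_ge0.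
  by field; rewrite gt_eqF.
rewrite -(ler_pM2l e0) -{1}(gtr0_norm e0) -normrM -HA.
have -> : \int[mu]_y A y = \int[mu]_y (A y - B y) + \int[mu]_y B y.
  rewrite -RintegralD//; [|exact: intB].
  by apply: eq_Rintegral => y _; rewrite subrK.
apply: le_trans (ler_normD _ _) _; apply: le_trans (lerD b1 b2) _.
by rewrite -subr_ge0 (_ : _ - _ = 0)//; ring.
Qed.

End SmoothEstimates.

Section RestrictConvergence.
Context {R : realType}.

Lemma sqi_sub {disp} {T : measurableType disp} (nu : {measure set T -> \bar R}) (D E : set T) (f : T -> R) :
  measurable D -> measurable E -> E `<=` D -> sqi nu D f -> sqi nu E f.
Proof.
move=> mD mE ED sf; apply: int_sqi; first exact: measurable_funS (sqi_meas sf).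
exact: (@integrableS _ _ _ nu D E _ mD mE ED (sqi_int sf)).
Qed.

Lemma nn_sub {disp} {T : measurableType disp} (nu : {measure set T -> \bar R}) (D E : set T) (f : T -> R) :
  measurable D -> measurable E -> E `<=` D -> sqi nu D f -> nn nu E f <= nn nu D f.
Proof.
move=> mD mE ED sf; rewrite -lee_fin (nnE mE (sqi_sub mD mE ED sf)) (nnE mD sf).
apply: ge0_subset_integral => //; last by move=> x _; rewrite lee_fin sqr_ge0.
by have /measurable_int := sqi_int sf; congr measurable_fun; apply/funext => x; rewrite /= expr2.
Qed.

Lemma cvgL2_sub {disp} {T : measurableType disp} (nu : {measure set T -> \bar R}) (D E : set T)
  (fn : nat -> T -> R) (f : T -> R) :
  measurable D -> measurable E -> E `<=` D -> cvgL2 nu D fn f -> cvgL2 nu E fn f.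
Proof.
move=> mD mE ED [s1 s2 c]; split; [by move=> n; exact: sqi_sub (s1 n)|exact: sqi_sub s2|].
apply: squeeze0 c => n; rewrite nn_ge0/=; apply: nn_sub => //; exact: sqiB.
Qed.

Lemma cvgL2_shear (h k : R) (k0 : 0 < k)
  (D : set (measurableTypeR R * measurableTypeR R)) (fn : nat -> R * R -> R) (f : R * R -> R) :
  measurable D -> cvgL2 area D fn f ->
  cvgL2 area (shear h k @^-1` D) (fun n => fn n \o shear h k) (f \o shear h k).
Proof.
move=> mD [s1 s2 c]; split.
- by move=> n; have [] := shear_sqi h k0 mD (s1 n).
- by have [] := shear_sqi h k0 mD s2.
rewrite (_ : (fun n => _) = (fun n => k^-1 * nn area D (fun x => fn n x - f x))).
  by rewrite -[X in _ --> X](mulr0 k^-1); exact: cvgMr.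
by apply/funext => n; have [_ <-] := shear_sqi h k0 mD (sqiB mD (s1 n) s2).
Qed.

End RestrictConvergence.

(** * Sobolev functions on a layer *)

Section H1data.
Context {R : realType}.
Local Notation mu := (@lebesgue_measure R).
Local Notation area := (@area R).
Local Notation T2 := (measurableTypeR R * measurableTypeR R)%type.
Implicit Types (gamma : R -> R) (phi f : R * R -> R) (t : R -> R).

(* [None] indexes the function itself and [Some j] its [j]-th derivative. *)
Definition idx : finType := option 'I_2.
Implicit Types (k : idx) (g : idx -> R * R -> R).

Definition jet phi k : R * R -> R := if k is Some j then partial j phi else phi.

Lemma jet_lin (a : R) phi psi k x : smooth phi -> smooth psi ->
  jet (fun x => a * phi x + psi x) k x = a * jet phi k x + jet psi k x.
Proof. by case: k => [j|] // s1 s2; exact: partial_lin. Qed.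

Lemma jet_cc phi k : C1c phi -> cc (jet phi k).
Proof. by case: k => [j|] C; [exact: C1c_ccp|exact: C1c_cc]. Qed.

Lemma lim_le (u v : nat -> R) (l l' : R) : (forall n, u n <= v n) ->
  u @ \oo --> l -> v @ \oo --> l' -> l <= l'.
Proof. by move=> uv ul vl; apply: (ler_cvg_to ul vl); apply: nearW. Qed.

Lemma harmonic0 : (fun n => n.+1%:R^-1 : R) @ \oo --> 0.
Proof. exact: cvg_harmonic. Qed.

(* Sobolev data: a function with its first derivatives and its trace on the
   lower boundary, with vanishing trace on [x_2 = d]. *)
Definition H1 gamma (d : R) g t : Prop :=
  exists phi : nat -> R * R -> R,
    [/\ forall n, test_function setT (phi n),
        forall k, cvgL2 area (layer gamma d) (fun n => jet (phi n) k) (g k),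
        cvgL2 mu setT (fun n y => phi n (y, gamma y)) t &
        cvgL2 mu setT (fun n y => phi n (y, d)) (fun=> 0)].

Section Layer.
Variables (gamma : R -> R) (d : R).
Hypothesis cg : continuous gamma.
Let mL : measurable (layer gamma d : set T2) := layer_cont_meas d cg.
Let mT : measurable (setT : set (measurableTypeR R)) := measurableT.
Let cd : continuous (fun _ : R => d).
Proof. by move=> ?; exact: cvg_cst. Qed.

Lemma H1_sqi g t k : H1 gamma d g t -> sqi area (layer gamma d) (g k).
Proof. by move=> [phi [_ h _ _]]; exact: cvgL2_lim (h k). Qed.

Lemma H1_tsqi g t : H1 gamma d g t -> sqi mu setT t.
Proof. by move=> [phi [_ _ h _]]; exact: cvgL2_lim h. Qed.

Lemma H1_lin (a : R) g t h s : H1 gamma d g t -> H1 gamma d h s ->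
  H1 gamma d (fun k x => a * g k x + h k x) (fun y => a * t y + s y).
Proof.
move=> [phi [tp pg pt pd]] [psi [ts sg st sd]].
exists (fun n x => a * phi n x + psi n x); split.
- by move=> n; exact: test_lin.
- move=> k; have := cvgL2D mL (cvgL2Z mL a (pg k)) (sg k).
  congr cvgL2; apply/funext => n; apply/funext => x; rewrite jet_lin//.
    by have [] := tp n.
  by have [] := ts n.
- exact: (cvgL2D mT (cvgL2Z mT a pt) st).
- have := cvgL2D mT (cvgL2Z mT a pd) sd; congr cvgL2.
  by apply/funext => y; rewrite mulr0 addr0.
Qed.

Lemma nn_split (D : set T2) (u v w : R * R -> R) : measurable D ->
  sqi area D u -> sqi area D v -> sqi area D w ->
  nn area D (fun x => u x - w x) <=
  2 * nn area D (fun x => u x - v x) + 2 * nn area D (fun x => v x - w x).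
Proof.
move=> mD su sv sw; have sa := sqiB mD su sv; have sb := sqiB mD sv sw.
have -> : (fun x => u x - w x) = (fun x => (u x - v x) + (v x - w x)).
  by apply/funext => x; rewrite addrA subrK.
rewrite (nnD mD sa sb); have := ip_AMGM mD sa sb; have := ler_norm (ip area D (fun x => u x - v x) (fun x => v x - w x)).
by lra.
Qed.

Lemma nn_split1 (u v w : R -> R) : sqi mu setT u -> sqi mu setT v -> sqi mu setT w ->
  nn mu setT (fun x => u x - w x) <=
  2 * nn mu setT (fun x => u x - v x) + 2 * nn mu setT (fun x => v x - w x).
Proof.
move=> su sv sw; have sa := sqiB mT su sv; have sb := sqiB mT sv sw.
have -> : (fun x => u x - w x) = (fun x => (u x - v x) + (v x - w x)).
  by apply/funext => x; rewrite addrA subrK.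
rewrite (nnD mT sa sb); have := ip_AMGM mT sa sb; have := ler_norm (ip mu setT (fun x => u x - v x) (fun x => v x - w x)).
by lra.
Qed.

Lemma nn_sym {disp} {T : measurableType disp} (nu : {measure set T -> \bar R}) (D : set T) (u v : T -> R) :
  nn nu D (fun x => u x - v x) = nn nu D (fun x => v x - u x).
Proof. by apply: eq_Rintegral => x _; ring. Qed.

Lemma diag_cvg (u : nat -> nat -> R) : (forall n, (fun m => u n m) @ \oo --> 0) ->
  forall n, exists N, forall m, (N <= m)%N -> u n m <= n.+1%:R^-1.
Proof.
move=> H n; have e0 : (0 : R) < n.+1%:R^-1 by rewrite invr_gt0.
have /cvgrPdist_le/(_ _ e0)[N _ HN] := H n; exists N => m Nm.
by have := HN m Nm; rewrite sub0r normrN; apply: le_trans; exact: ler_norm.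
Qed.

(** A diagonal argument: for each n one index serves all jet entries and both traces, because they
    are finitely many. *)
Lemma H1_closed (gn : nat -> idx -> R * R -> R) (tn : nat -> R -> R) g t :
  (forall n, H1 gamma d (gn n) (tn n)) ->
  (forall k, cvgL2 area (layer gamma d) (gn ^~ k) (g k)) ->
  cvgL2 mu setT tn t -> H1 gamma d g t.
Proof.
move=> H cgn ctn.
have P n : exists phi : R * R -> R, [/\ test_function setT phi,
    forall k, nn area (layer gamma d) (fun x => jet phi k x - gn n k x) <= n.+1%:R^-1,
    nn mu setT (fun y => phi (y, gamma y) - tn n y) <= n.+1%:R^-1 &
    nn mu setT (fun y => phi (y, d) - 0) <= n.+1%:R^-1].
  have [phi [tp pg [_ _ pt] [_ _ pd]]] := H n.
  have pg' k : (fun m => nn area (layer gamma d) (fun x => jet (phi m) k x - gn n k x)) @ \oo --> 0.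
    by have [] := pg k.
  have /choice[N HN] k := diag_cvg (fun _ => pg' k) n.
  have [N1 HN1] := diag_cvg (fun _ => pt) n.
  have [N2 HN2] := diag_cvg (fun _ => pd) n.
  pose M := maxn (\max_k N k) (maxn N1 N2).
  exists (phi M); split => //.
  - by move=> k; apply: HN; rewrite leq_max (leq_bigmax k).
  - by apply: HN1; rewrite !leq_max leqnn orbT.
  - by apply: HN2; rewrite !leq_max leqnn !orbT.
have {P}[phi P] := choice P.
have C n : C1c (phi n) by apply: test_C1c; have [] := P n.
have z2 : (fun n => 2 * n.+1%:R^-1 : R) @ \oo --> 0.
  by rewrite -[X in _ --> X](mulr0 2); apply: cvgMr; exact: harmonic0.
have sp n k : sqi area (layer gamma d) (jet (phi n) k) by apply: cc_sqi => //; exact: jet_cc.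
have st n : sqi mu setT (fun y => phi n (y, gamma y)) by apply: graph_sqi => //; exact: C1c_cc.
exists phi; split.
- by move=> n; have [] := P n.
- move=> k; have [s1 s2 c] := cgn k; split => //.
  apply: (@squeeze0 _ _ (fun n => 2 * n.+1%:R^-1 + 2 * nn area (layer gamma d) (fun x => gn n k x - g k x))).
    move=> n; rewrite nn_ge0/=; apply: le_trans (nn_split mL (sp n k) (s1 n) s2) _.
    by rewrite lerD2r ler_pM2l//; have [] := P n.
  by rewrite -[X in _ --> X](addr0 0); apply: cvgD => //; rewrite -[X in _ --> X](mulr0 2); exact: cvgMr.
- have [s1 s2 c] := ctn; split => //.
  apply: (@squeeze0 _ _ (fun n => 2 * n.+1%:R^-1 + 2 * nn mu setT (fun x => tn n x - t x))).
    move=> n; rewrite nn_ge0/=; apply: le_trans (nn_split1 (st n) (s1 n) s2) _.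
    by rewrite lerD2r ler_pM2l//; have [] := P n.
  by rewrite -[X in _ --> X](addr0 0); apply: cvgD => //; rewrite -[X in _ --> X](mulr0 2); exact: cvgMr.
- split; [by move=> n; apply: graph_sqi => //; exact: C1c_cc|exact: sqi0|].
  by apply: (@squeeze0 _ _ _ _ harmonic0) => n; rewrite nn_ge0/=; have [] := P n.
Qed.

Lemma H1_trace_le g t (tau m : R) : 0 < tau -> 0 < m -> (forall y, gamma y + m <= d) ->
  H1 gamma d g t ->
  nn mu setT t <= tau * nn area (layer gamma d) (g (Some 1)) +
    (m^-1 + tau^-1) * nn area (layer gamma d) (g None).
Proof.
move=> tau0 m0 gm [phi [tp pg pt _]].
apply: (lim_le _ (cvgL2_nn mT pt)); last first.
  apply: cvgD; apply: cvgMr; [exact: (cvgL2_nn mL (pg (Some 1)))|exact: (cvgL2_nn mL (pg None))].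
move=> n; apply: trace_le => //; first exact: test_C1c.
by move=> y; rewrite lexx (le_trans _ (gm y))// lerDl ltW.
Qed.

(* Traces on intermediate curves exist along the same approximating sequence. *)
Lemma H1_restrict g t (p : R -> R) (m s H : R) : continuous p -> 0 < m -> 0 <= H ->
  (forall y, gamma y + m <= d) -> (forall y, gamma y <= p y) -> (forall y, p y <= s) -> s <= d ->
  (forall y, p y - gamma y <= H) -> H1 gamma d g t ->
  exists2 t', H1 p d g t' &
    nn mu setT (fun y => t' y - t y) <= H * nn area (layer gamma s) (g (Some 1)).
Proof.
move=> cp m0 H0 gm gp ps sd pH [phi [tp pg pt pd]].
have C n : C1c (phi n) by exact: test_C1c.
have mS : measurable (layer gamma s : set T2) by exact: layer_cont_meas.
have mp : measurable (layer p d : set T2) by exact: layer_cont_meas.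
have Ls : layer gamma s `<=` layer gamma d.
  by move=> x /andP[h1 h2]; apply/andP; split => //; exact: lt_le_trans sd.
have Lp : layer p d `<=` layer gamma d.
  by move=> x /andP[h1 h2]; apply/andP; split => //; exact: le_lt_trans (gp _) h1.
have sq n : sqi mu setT (fun y => phi n (y, p y)) by apply: graph_sqi => //; exact: C1c_cc.
have smL n k : sqi area (layer gamma d) (jet (phi n) k) by apply: cc_sqi => //; exact: jet_cc.
have [t' ct'] : exists t', cvgL2 mu setT (fun n y => phi n (y, p y)) t'.
  apply: (L2_complete mT sq) => e e0.
  have K0 : 0 < 1 + (m^-1 + 1^-1) by rewrite ltr_wpDr// invr1 addr_ge0// invr_ge0 ltW.
  (* Passing through the limit [g] puts each jet entry of the difference within 4 e', and [trace_le]
     with tau = 1 then multiplies by 1 + (m^-1 + 1). *)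
  pose e' := e / (4 * (1 + (m^-1 + 1^-1))).
  have e'0 : 0 < e' by rewrite divr_gt0// mulr_gt0.
  have Z k : exists N, forall n, (N <= n)%N -> nn area (layer gamma d) (fun x => jet (phi n) k x - g k x) <= e'.
    have [_ _ /cvgrPdist_le/(_ _ e'0)[N _ HN]] := pg k; exists N => n Nn.
    by have := HN n Nn; rewrite sub0r normrN; apply: le_trans; exact: ler_norm.
  have [N1 HN1] := Z (Some 1); have [N2 HN2] := Z None.
  exists (maxn N1 N2) => n n'; rewrite !geq_max => /andP[n1 n2] /andP[n1' n2'].
  have tB : test_function setT (fun x => (-1) * phi n' x + phi n x) by exact: test_lin.
  have := @trace_le R gamma p d 1 m _ cg cp (test_C1c tB) ltr01 m0 gm.
  move=> /(_ _)/wrap[]; first by move=> y; rewrite gp (le_trans (ps y)).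
  have -> : (fun y => -1 * phi n' (y, p y) + phi n (y, p y)) = (fun y => phi n (y, p y) - phi n' (y, p y)).
    by apply/funext => y; ring.
  move=> h; apply: le_trans h _.
  have B k : (forall n0 : nat, (n0 = n) \/ (n0 = n') ->
      nn area (layer gamma d) (fun x => jet (phi n0) k x - g k x) <= e') -> nn area (layer gamma d) (jet (fun x => -1 * phi n' x + phi n x) k) <= 4 * e'.
    move=> hB.
    have -> : jet (fun x => -1 * phi n' x + phi n x) k = (fun x => jet (phi n) k x - jet (phi n') k x).
      by apply/funext => x; rewrite jet_lin; [ring|have [] := tp n'|have [] := tp n].
    have h := nn_split mL (smL n k) (cvgL2_lim (pg k)) (smL n' k).
    apply: le_trans h _.
    have -> : nn area (layer gamma d) (fun x => g k x - jet (phi n') k x) =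
      nn area (layer gamma d) (fun x => jet (phi n') k x - g k x) by exact: nn_sym.
    have a1 := hB n (or_introl erefl); have a2 := hB n' (or_intror erefl).
    by move: a1 a2; set A := nn _ _ _; set B := nn _ _ _; lra.
  have b1 : nn area (layer gamma d) (jet (fun x => -1 * phi n' x + phi n x) (Some 1)) <= 4 * e'.
    by apply: B => ? [->|->]; exact: HN1.
  have b2 : nn area (layer gamma d) (jet (fun x => -1 * phi n' x + phi n x) None) <= 4 * e'.
    by apply: B => ? [->|->]; exact: HN2.
  rewrite mul1r; apply: (@le_trans _ _ (4 * e' + (m^-1 + 1^-1) * (4 * e'))).
    by apply: lerD => //; apply: ler_wpM2l => //; rewrite invr1 addr_ge0// invr_ge0 ltW.
  rewrite /e'; move: (m^-1 + 1^-1) K0 => q K0.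
  by rewrite (_ : _ + _ = e)//; field; rewrite gt_eqF.
have cvs (D : set T2) (mD : measurable D) : D `<=` layer gamma d -> forall k,
    cvgL2 area D (fun n => jet (phi n) k) (g k).
  move=> DL k; apply: (@cvgL2_sub _ _ _ area (layer gamma d)) => //; exact: pg.
exists t'; first by exists phi; split => //; exact: cvs.
have ctt := cvgL2B mT ct' pt.
apply: (lim_le _ (cvgL2_nn mT ctt)); last first.
  by apply: cvgMr; exact: (cvgL2_nn mS (cvs _ mS Ls (Some 1))).
by move=> n; apply: graph_incr.
Qed.

Lemma H1_strip g t (s tau m H : R) : 0 < tau -> 0 < m -> 0 <= H ->
  (forall y, gamma y + m <= d) -> s <= d -> (forall y, s - gamma y <= H) -> H1 gamma d g t ->
  nn area (layer gamma s) (g None) <= H * (tau * nn area (layer gamma d) (g (Some 1)) +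
     (m^-1 + tau^-1) * nn area (layer gamma d) (g None)).
Proof.
move=> tau0 m0 H0 gm sd sH [phi [tp pg pt _]].
have mS : measurable (layer gamma s : set T2) by exact: layer_cont_meas.
have Ls : layer gamma s `<=` layer gamma d.
  by move=> x /andP[h1 h2]; apply/andP; split => //; exact: lt_le_trans sd.
have cS := cvgL2_sub mL mS Ls (pg None).
apply: (lim_le _ (cvgL2_nn mS cS)); last first.
  apply: cvgMr; apply: cvgD; apply: cvgMr; [exact: (cvgL2_nn mL (pg (Some 1)))|exact: (cvgL2_nn mL (pg None))].
move=> n; exact: (strip_smooth cg (test_C1c (tp n)) tau0 m0 H0 gm sd sH).
Qed.

Lemma shear_layer_sub (s : R) : 0 <= s -> s < d -> (forall y, 0 <= gamma y <= d) ->
  layer gamma d `<=` shear s (1 - s / d) @^-1` layer gamma d.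
Proof.
move=> s0 sd gd x /andP[h1 h2]; have d0 : 0 < d by apply: le_lt_trans sd.
have E : s + (1 - s / d) * x.2 = x.2 + s * (d - x.2) / d by field; rewrite gt_eqF.
have E' : d - (s + (1 - s / d) * x.2) = (d - s) * (d - x.2) / d by field; rewrite gt_eqF.
apply/andP; split => /=.
  by rewrite E (lt_le_trans h1)// lerDl !mulr_ge0 ?invr_ge0 ?(ltW d0)// subr_ge0 ltW.
by rewrite -subr_gt0 E' !mulr_gt0 ?invr_gt0 ?subr_gt0.
Qed.

Lemma H1_shift_le g t (s : R) : 0 <= s -> s < d -> (forall y, 0 <= gamma y <= d) -> H1 gamma d g t ->
  sqi area (layer gamma d) (g None \o shear s (1 - s / d)) /\
  nn area (layer gamma d) (fun x => g None (shear s (1 - s / d) x) - g None x) <=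
  s ^+ 2 / (1 - s / d) * nn area (layer gamma d) (g (Some 1)).
Proof.
move=> s0 sd gd [phi [tp pg pt _]].
have k0 : 0 < 1 - s / d by rewrite subr_gt0 ltr_pdivrMr ?mul1r// (le_lt_trans s0).
have sub := shear_layer_sub s0 sd gd.
have cS : cvgL2 area (layer gamma d) (fun n => phi n \o shear s (1 - s / d)) (g None \o shear s (1 - s / d)).
  apply: (cvgL2_sub (shear_measurable s (1 - s / d) mL) mL sub).
  by apply: cvgL2_shear => //; exact: (pg None).
split; first exact: cvgL2_lim cS.
have cB := cvgL2B mL cS (pg None).
apply: (lim_le _ (cvgL2_nn mL cB)); last first.
  by apply: cvgMr; exact: (cvgL2_nn mL (pg (Some 1))).
move=> n; exact: (shift_smooth cg (test_C1c (tp n)) s0 sd gd).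
Qed.

End Layer.

(* Chain-rule factors of the composition with [shear s kappa]. *)
Definition vwt (kappa : R) k : R := if k == Some 1 then kappa else 1.

Definition shift_data (s kappa : R) g : idx -> R * R -> R :=
  fun k x => vwt kappa k * g k (shear s kappa x).

Lemma shear_layer0 (s d : R) : 0 <= s -> s < d ->
  shear s (1 - s / d) @^-1` layer (fun=> s) d = layer (fun=> 0) d.
Proof.
move=> s0 sd; have d0 : 0 < d by apply: le_lt_trans sd.
have k0 : 0 < 1 - s / d by rewrite subr_gt0 ltr_pdivrMr// mul1r.
have E' x : d - (s + (1 - s / d) * x) = (1 - s / d) * (d - x) by field; rewrite gt_eqF.
apply/seteqP; split => x /andP[/= h1 h2]; apply/andP; split => /=.
- by move: h1; rewrite ltrDl pmulr_rgt0.
- by move: h2; rewrite -subr_gt0 E' pmulr_rgt0// subr_gt0.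
- by rewrite ltrDl pmulr_rgt0.
- by rewrite -subr_gt0 E' pmulr_rgt0// subr_gt0.
Qed.

(** [S] sends x_2 = 0 to x_2 = s and fixes x_2 = d, so the lower trace is carried over unchanged and
    the upper trace stays zero. *)
Lemma H1_shear g t (s d : R) : 0 <= s -> s < d ->
  H1 (fun=> s) d g t -> H1 (fun=> 0) d (shift_data s (1 - s / d) g) t.
Proof.
move=> s0 sd [phi [tp pg pt pd]]; have d0 : 0 < d by apply: le_lt_trans sd.
have k0 : 0 < 1 - s / d by rewrite subr_gt0 ltr_pdivrMr// mul1r.
have cs : continuous (fun _ : R => s) by move=> ?; exact: cvg_cst.
have c0 : continuous (fun _ : R => 0 : R) by move=> ?; exact: cvg_cst.
have mL := layer_cont_meas d cs; have mL0 := layer_cont_meas d c0.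
exists (fun n => phi n \o shear s (1 - s / d)); split.
- by move=> n; exact: test_shear.
- move=> k; have := cvgL2_shear s k0 mL (pg k); rewrite (shear_layer0 s0 sd).
  move=> /(cvgL2Z mL0 (vwt (1 - s / d) k)).
  congr cvgL2; apply/funext => n; apply/funext => x; rewrite /vwt.
  have [sm _ _] := tp n.
  case: k => [j|] /=; last by rewrite mul1r.
  have [->|->] := ord2P j; first by rewrite (partial_shear s (1 - s/d) x sm).1 mul1r.
  by rewrite (partial_shear s (1 - s/d) x sm).2 eqxx.
- by have := pt; congr cvgL2; apply/funext => n; apply/funext => y; rewrite /shear/= mulr0 addr0.
- have := pd; congr cvgL2; apply/funext => n; apply/funext => y; rewrite /shear/=.
  by congr (phi n (y, _)); field; rewrite gt_eqF.
Qed.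

End H1data.

(** * Vertical increments of coefficients and oscillating factors *)

Section Line.
Context {R : realType}.
Local Notation mu := (@lebesgue_measure R).
Implicit Types (f F : R -> R).

Lemma global_primitive f : continuous f ->
  exists F : R -> R, forall t : R, is_derive t 1 F (f t).
Proof.
(* An integral over a reversed interval is 0, so at most one of the two terms is active on each side
   of the origin. *)
move=> cf; pose F (t : R) := \int[mu]_(y in `[0, t]) f y - \int[mu]_(y in `[t, 0]) f y.
exists F => t; pose a := Num.min t 0 - 1.
have at_ : a < t by rewrite ltrBlDr ltr_pwDr// ge_min lexx.
have a0 : a < 0 by rewrite ltrBlDr ltr_pwDr// ge_min lexx orbT.
have E (x : R) : a < x -> F x = \int[mu]_(y in `[a, x]) f y + (- \int[mu]_(y in `[a, 0]) f y).
  move=> ax; rewrite /F; have [x0|x0] := leP x 0.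
    rewrite (int_itv_split cf (ltW ax) x0).
    have -> : \int[mu]_(y in `[0, x]) f y = 0.
      move: x0; rewrite le_eqVlt => /predU1P[->|x0]; first by rewrite set_itv1 Rintegral_set1.
      by rewrite set_itv_ge ?Rintegral_set0// bnd_simp -ltNge.
    by ring.
  rewrite (int_itv_split cf (ltW a0) (ltW x0)) [X in _ - X](_ : _ = 0); first by ring.
  by rewrite set_itv_ge ?Rintegral_set0// bnd_simp -ltNge.
apply: (@near_eq_is_derive _ _ _ (fun x => \int[mu]_(y in `[a, x]) f y + (- \int[mu]_(y in `[a, 0]) f y))).
  by near=> x; rewrite E//; near: x; exact: lt_nbhsr.
have h := primitive cf at_.
apply: (isd_ext (isdD h (is_derive_cst _ _ _))) => //.
by rewrite addr0.
Unshelve. all: by end_near. Qed.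

Lemma FTC_prim f F (p q : R) : continuous f -> (forall t : R, is_derive t 1 F (f t)) -> p <= q ->
  \int[mu]_(t in `[p, q]) f t = F q - F p.
Proof. by move=> cf dF pq; apply: FTC2 => // t _; exact: dF. Qed.

Lemma isd_shift F f (c : R) (t : R) : (forall t : R, is_derive t 1 F (f t)) ->
  is_derive t 1 (fun t => F (t + c)) (f (t + c)).
Proof.
move=> dF; have := @isd_comp_aff R F c 1 t (f (c + 1 * t)) (dF _).
by move/isd_ext; apply => [x|]; rewrite !mul1r addrC.
Qed.

Lemma periodic_int f (z : int) (y : R) : (forall y, f (y + 1) = f y) -> f (y + z%:~R) = f y.
Proof.
move=> pf; have N (n : nat) x : f (x + n%:R) = f x.
  by elim: n x => [|n IH] x; rewrite ?addr0// -natr1 addrA pf IH.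
case: z => n; first by rewrite -pmulrn N.
by rewrite NegzE mulrNz -pmulrn -(N n.+1 (y - _)) subrK.
Qed.

Lemma periodic_bounded f : continuous f -> (forall y, f (y + 1) = f y) ->
  exists2 M : R, 0 <= M & forall t, `|f t| <= M.
Proof.
move=> cf pf.
have cf' : {within `[0, 1]%classic, continuous (fun t => `|f t|)}.
  apply: continuous_subspaceT => t.
  by apply: (@continuous_comp _ _ _ f Num.norm); [exact: cf|exact: norm_continuous].
have [c _ Hc] := EVT_max (@ler01 R) cf'; exists `|f c| => // t.
have -> : f t = f (t + (- Num.floor t)%:~R) by rewrite periodic_int.
apply: Hc; rewrite in_itv/= intrN subr_ge0 floor_le_tmp lerBlDl.
by rewrite -[1]/(1%:~R) -intrD ltW// floorD1_gt.
Qed.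

Lemma lipschitz_cont f (L : R) : (forall x y : R, `|f x - f y| <= L * `|x - y|) -> continuous f.
Proof.
move=> H x; apply/cvgrPdist_le => e e0.
have M0 : 0 < `|L| + 1 by rewrite ltr_wpDl.
near=> y.
have h : `|x - y| <= e / (`|L| + 1).
  by near: y; apply/nbhs_ballP; exists (e / (`|L| + 1)) => /=; [exact: divr_gt0|move=> z; rewrite /ball/=; exact: ltW].
apply: le_trans (H _ _) _; apply: (@le_trans _ _ ((`|L| + 1) * `|x - y|)).
  by apply: ler_wpM2r => //; rewrite (le_trans (ler_norm _))// lerDl.
by rewrite mulrC -ler_pdivlMr.
Unshelve. all: by end_near. Qed.

End Line.

(** * Functions with bounded weak vertical derivative under the shear *)

Section ShearMono.
Context {R : realType}.
Local Notation mu := (@lebesgue_measure R).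
Local Notation area := (@area R).
Local Notation T2 := (measurableTypeR R * measurableTypeR R)%type.
Local Notation cst0 := (fun _ : R => 0 : R).

Lemma cst_cont (c : R) : continuous (fun _ : R => c).
Proof. by move=> ?; exact: cvg_cst. Qed.

Lemma Rint_supp (D E : set (R * R)) (g : R * R -> R) : E `<=` D ->
  (forall x, D x -> ~ E x -> g x = 0) ->
  \int[area]_(x in D) g x = \int[area]_(x in E) g x.
Proof.
move=> ED H; rewrite Rintegral_mkcond [RHS]Rintegral_mkcond; apply: eq_Rintegral => x _.
rewrite !patchE; have [/set_mem xE|/negP xE] := boolP (x \in E).
  by rewrite ifT//; apply/mem_set; exact: ED.
case: ifPn => // /set_mem xD; rewrite H// => xE'; apply: xE; exact/mem_set.
Qed.

Lemma test_box_tensor (Omega : set (R * R)) (f g : R -> R) q : smooth1 f -> smooth1 g ->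
  (forall t, ~~ (q.1.1 <= t <= q.1.2) -> f t = 0) ->
  (forall t, ~~ (q.2.1 <= t <= q.2.2) -> g t = 0) -> crect q `<=` Omega ->
  test_function Omega (fun x => f x.1 * g x.2).
Proof.
move=> sf sg f0 g0 qO.
have sub : [set x : R * R | f x.1 * g x.2 != 0] `<=` crect q.
  move=> x /=; rewrite mulf_eq0 negb_or => /andP[h1 h2]; split.
    by apply: contrapT => /negP n; move: h1; rewrite f0 ?eqxx.
  by apply: contrapT => /negP n; move: h2; rewrite g0 ?eqxx.
have cB : closed (crect q).
  by apply: compact_closed; [exact: norm_hausdorff|exact: compact_crect].
have cl : closure [set x : R * R | f x.1 * g x.2 != 0] `<=` crect q.
  by rewrite [X in _ `<=` X](closure_id _).1//; exact: closureS.
split; first exact: smooth_tensor.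
- by apply: subclosed_compact cl; [exact: closed_closure|exact: compact_crect].
- exact: subset_trans cl qO.
Qed.

Lemma smooth1_primitive (f F : R -> R) : smooth1 f -> (forall t : R, is_derive t 1 F (f t)) -> smooth1 F.
Proof.
move=> [P Pf cP] dF; exists [set h | P h \/ h = F]; first by right.
move=> h [/cP[h' Ph' dh]|->]; first by exists h' => //; left.
by exists f => //; left.
Qed.

Lemma smooth1D (f g : R -> R) : smooth1 f -> smooth1 g -> smooth1 (fun t => f t + g t).
Proof.
move=> [P Pf cP] [Q Qg cQ].
exists (fspan [set h | P h \/ Q h]); first by apply: span_add; apply: span_base; [left|right].
apply: span_closed => h [/cP|/cQ] [h' Ph' dh].
  by exists h' => //; apply: span_base; left.
by exists h' => //; apply: span_base; right.
Qed.

Lemma smooth1Z (c : R) (f : R -> R) : smooth1 f -> smooth1 (fun t => c * f t).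
Proof.
move=> [P Pf cP]; exists (fspan P); first by apply: span_scale; exact: span_base.
apply: span_closed => h /cP [h' Ph' dh].
by exists h' => //; apply: span_base.
Qed.

Section VerticalLipschitz.
Variables (d s : R).
Hypotheses (s0 : 0 <= s) (sd : s < d).
Let d0 : 0 < d. Proof. exact: le_lt_trans sd. Qed.
Let k : R := 1 - s / d.
Let k0 : 0 < k. Proof. by rewrite subr_gt0 ltr_pdivrMr// mul1r. Qed.
Let Om : set (R * R) := layer cst0 d.
Let oOm : open Om := @layer_open R _ d (@cst_cont 0).
Let mOm : measurable (Om : set T2) := layer_cont_meas d (@cst_cont 0).
Let T (x : R * R) : R * R := shear (- (s / k)) k^-1 x.

Lemma shearK x : T (shear s k x) = x.
Proof. by case: x => x y; rewrite /T /shear/=; congr pair; field; rewrite gt_eqF. Qed.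

Lemma Om_shear : Om `<=` shear s k @^-1` Om.
Proof.
by apply: shear_layer_sub => // y; rewrite lexx ltW.
Qed.

Lemma lint_shear h : lint Om h -> lint Om (h \o shear s k).
Proof.
move=> lh K cK KO; have mK := measurable_compact2 cK.
have cS : compact (shear s k @` K).
  apply: continuous_compact => //; apply: continuous_subspaceT; exact: shear_cont.
have SO : shear s k @` K `<=` Om by move=> _ [x /KO/Om_shear h' <-].
have := lh _ cS SO => ih.
have [i1 _] := shear_integral s k0 (measurable_compact2 cS) ih.
apply: (@integrableS _ _ _ area _ K _ _ mK _ i1).
  by apply: shear_measurable; exact: measurable_compact2.
by move=> x Kx; exists x.
Qed.

(* [psi o S^-1 / k - psi] is the vertical derivative of a nonpositive test
   function, since [S] moves points upwards. *)
Lemma shear_antideriv c q : 0 < c -> crect q `<=` Om ->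
  exists2 Psi, test_function Om Psi &
    forall x, Psi x <= 0 /\ partial 1 Psi x = k^-1 * bump2 c q (T x) - bump2 c q x.
Proof.
move=> c_gt0 qO.
have [ne|e] := pselect (q.1.1 < q.1.2 /\ q.2.1 < q.2.2); last first.
  have z x : bump2 c q x = 0.
    apply: bump2_out => -[/andP[h1 h2] /andP[h3 h4]]; apply: e.
    by split; [exact: lt_trans h2|exact: lt_trans h4].
  exists (fun=> 0) => [|x]; first by have [h1 h2 _] := @test0 R; split => // x; rewrite (_ : [set _ | _] = set0) ?closure0// -subset0 => y /=; rewrite eqxx.
  rewrite lexx !z mulr0 subrr; split => //.
  by apply: isd_partial; exact: is_derive_cst.
have [ne1 ne2] := ne.
set chi := cbump c q.2.1 q.2.2.
have schi : smooth1 chi by exact: smooth1_cbump.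
have cchi : continuous chi by have [P Pf /(_ _ Pf)[g' _ dg] t] := schi; exact: is_derive_cont (dg t).
have [X dX] := global_primitive cchi.
have sX := smooth1_primitive schi dX.
have Xle (p r : R) : p <= r -> X p <= X r.
  move=> pr; rewrite -subr_ge0 -(FTC_prim cchi dX pr).
  by apply: Rintegral_ge0 => x _; exact: cbump_ge0.
have Xcst (p r : R) : p <= r -> r <= q.2.1 \/ q.2.2 <= p -> X p = X r.
  move=> pr h; apply/eqP; rewrite eq_sym -subr_eq0 -(FTC_prim cchi dX pr); apply/eqP.
  have -> : \int[mu]_(t in `[p, r]) chi t = \int[mu]_(t in `[p, r]) 0.
    apply: eq_Rintegral => t /set_mem; rewrite /= in_itv/= => /andP[t1 t2].
    rewrite /chi cbump_out//; rewrite negb_and -!leNgt.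
    by case: h => h; apply/orP; [left; exact: le_trans h|right; exact: le_trans h _].
  by rewrite int_itv_cst// mul0r.
(* Subtracting two copies of one primitive cancels the constant reached above the bump, which makes
   the support compact. *)
pose Y t := X (- (s / k) + k^-1 * t) + (-1) * X t.
have sY : smooth1 Y.
  have s1 : smooth1 (fun t => X (- (s / k) + k^-1 * t)) by exact: smooth1_comp_aff.
  by apply: smooth1D => //; rewrite (_ : (fun t => -1 * X t) = (fun t => -1 * X (0 + 1 * t))); [apply: smooth1Z; exact: smooth1_comp_aff|apply/funext => t; rewrite add0r mul1r].
have [l1 l2] : 0 < q.2.1 /\ q.2.2 < d.
  have h1 : crect q (q.1.1, q.2.1) by split => /=; rewrite lexx ltW.
  have h2 : crect q (q.1.1, q.2.2) by split => /=; rewrite lexx ltW.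
  by move: (qO _ h1) (qO _ h2) => /andP[/= ? _] /andP[_ /= ?].
have Tle t : t < d -> - (s / k) + k^-1 * t <= t.
  move=> td; rewrite -(ler_pM2l k0); have -> : k * (- (s / k) + k^-1 * t) = t - s by field; rewrite gt_eqF.
  have -> : k * t = t - s + s * (d - t) / d by rewrite /k; field; rewrite gt_eqF.
  by rewrite lerDl divr_ge0 ?(ltW d0)// mulr_ge0// subr_ge0 ltW.
(* The difference of the two primitives lives between the bottom of the rectangle and the image of
   its top under S, still below [d]. *)
pose q' := (q.1, (q.2.1, s + k * q.2.2)).
have q'O : crect q' `<=` Om.
  move=> x [_ /= /andP[h1 h2]]; apply/andP; split => /=; first exact: lt_le_trans h1.
  apply: le_lt_trans h2 _.
  have -> : d = s + k * d by rewrite /k; field; rewrite gt_eqF.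
  by rewrite ltrD2l ltr_pM2l.
have S22 : q.2.2 <= s + k * q.2.2.
  have -> : s + k * q.2.2 = q.2.2 + s * (d - q.2.2) / d by rewrite /k; field; rewrite gt_eqF.
  by rewrite lerDl divr_ge0 ?(ltW d0)// mulr_ge0// subr_ge0 ltW.
have TS t : s + k * q.2.2 <= t -> q.2.2 <= - (s / k) + k^-1 * t.
  move=> h; have -> : q.2.2 = - (s / k) + k^-1 * (s + k * q.2.2) by field; rewrite gt_eqF.
  by rewrite lerD2l ler_pM2l ?invr_gt0.
have Yout t : ~~ (q'.2.1 <= t <= q'.2.2) -> Y t = 0.
  rewrite negb_and -!ltNge /= => /orP[h|h]; rewrite /Y mulN1r; apply/eqP; rewrite subr_eq0; apply/eqP.
    apply: Xcst; last by left; exact: ltW.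
    by apply: Tle; rewrite (lt_trans h)// (lt_trans ne2).
  have h2 := TS _ (ltW h); have h3 := le_trans S22 (ltW h).
  have [tt|tt] := leP (- (s / k) + k^-1 * t) t; [apply: Xcst tt _|apply/esym; apply: Xcst (ltW tt) _]; by right.
have tP : test_function Om (fun x => cbump c q.1.1 q.1.2 x.1 * Y x.2).
  apply: (@test_box_tensor _ _ _ q') => //; first exact: smooth1_cbump.
  move=> t nt; apply: cbump_out; apply: contra nt => /andP[/ltW -> /ltW ->] //.
exists (fun x => cbump c q.1.1 q.1.2 x.1 * Y x.2) => // x; split.
  have [xd|dx] := ltP x.2 d.
    by rewrite mulr_ge0_le0 ?cbump_ge0// /Y mulN1r subr_le0; apply: Xle; exact: Tle.
  rewrite Yout ?mulr0// negb_and -!ltNge /= orbC (lt_le_trans _ dx)//.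
  have -> : d = s + k * d by rewrite /k; field; rewrite gt_eqF.
  by rewrite ltrD2l ltr_pM2l.
apply: isd_partial; apply/slice2 => /=.
have h1 := isdZ (-1) (dX x.2).
have h2 := @isd_comp_aff R X (- (s / k)) k^-1 x.2 _ (dX _).
have := isdZ (cbump c q.1.1 q.1.2 x.1) (isdD h2 h1).
by move/isd_ext; apply => //; rewrite /bump2 /T /shear/= -/chi; ring.
Qed.

(** A change of variables moves the shear onto the bump. The result is the vertical derivative of
    the nonpositive function of [shear_antideriv], and the weak derivative identity leaves the
    integral of -h2 Psi. *)
Lemma shear_mono h h2 : rweak Om 1 h h2 -> {ae area, forall x, Om x -> 0 <= h2 x} ->
  {ae area, forall x, Om x -> 0 <= h (shear s k x) - h x}.
Proof.
move=> [lh lh2 wh] h20.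
have lS := lint_shear lh.
apply: (@ae_ge0_test R Om (fun x => h (shear s k x) - h x)) => //.
  have := @lint_lin R Om (-1) h _ lh lS (fun K cK _ => measurable_compact2 cK).
  by rewrite (_ : (fun x => _) = (fun x => h (shear s k x) - h x))//; apply/funext => x /=; ring.
move=> c q c_gt0 qO.
have tb := test_bump c_gt0 qO.
have [Psi tPsi HPsi] := shear_antideriv c_gt0 qO.
have [i1 i1'] := test_int 0 oOm tb lS.
have [i2 i2'] := test_int 0 oOm tb lh.
have [i3 i3'] := test_int 1 oOm tPsi lh.
have [i4 i4'] := test_int 1 oOm tPsi lh2.
have cT : cc (bump2 c q \o T).
  apply: cc_shear; first by rewrite invr_gt0.
  by apply: C1c_cc; apply: test_C1c; exact: test_sub tb.
have mL : measurable (layer (fun=> s) d : set T2) := layer_cont_meas d (@cst_cont s).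
have Ls : layer (fun=> s) d `<=` Om.
  by move=> x /andP[/= a1 a2]; apply/andP; split => //=; exact: le_lt_trans a1.
have Tout x : Om x -> ~ layer (fun=> s) d x -> bump2 c q (T x) = 0.
  move=> Ox nx; apply: bump2_out => -[/= h1 /andP[h3 h4]]; apply: nx.
  have : Om (T x) by apply: qO; split => /=; [case/andP: h1 => /ltW -> /ltW ->|rewrite !ltW].
  rewrite /Om -(shear_layer0 s0 sd) => /andP[/= a1 a2].
  have E : s + (1 - s / d) * (- (s / k) + k^-1 * x.2) = x.2 by rewrite -/k; field; rewrite gt_eqF.
  by move: a1 a2; rewrite /= E => a1 a2; apply/andP.
have i5 : area.-integrable Om (EFin \o (fun x => h x * bump2 c q (T x))).
  have E x : h x * bump2 c q (T x) = k * (h x * partial 1 Psi x) + k * (h x * bump2 c q x).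
    by have [_ ->] := HPsi x; field; rewrite gt_eqF.
  have := intD mOm (intZ mOm k i3') (intZ mOm k i2).
  by congr (_.-integrable _ (EFin \o _)); apply/funext => x; rewrite -E.
have i6 : area.-integrable (layer (fun=> s) d) (EFin \o (fun x => h x * bump2 c q (T x))).
  exact: (@integrableS _ _ _ area Om _ _ mOm mL Ls i5).
have [_] := shear_integral s k0 mL i6.
rewrite (shear_layer0 s0 sd) -/Om -(Rint_supp Ls); last by move=> x Ox nx; rewrite Tout ?mulr0.
move=> ES.
have ES' : \int[area]_(x in Om) (h (shear s k x) * bump2 c q x) =
    k^-1 * \int[area]_(x in Om) (h x * bump2 c q (T x)).
  by apply: etrans ES; apply: eq_Rintegral => x _; rewrite (shearK x).
have -> : \int[area]_(x in Om) ((h (shear s k x) - h x) * bump2 c q x) =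
   \int[area]_(x in Om) (h x * partial 1 Psi x).
  transitivity (\int[area]_(x in Om) (h (shear s k x) * bump2 c q x) - \int[area]_(x in Om) (h x * bump2 c q x)).
    by rewrite -RintegralB//; apply: eq_Rintegral => x _; rewrite mulrBl.
  transitivity (k^-1 * \int[area]_(x in Om) (h x * bump2 c q (T x)) - \int[area]_(x in Om) (h x * bump2 c q x)).
    exact: (congr1 (fun z => z - \int[area]_(x in Om) (h x * bump2 c q x)) ES').
  rewrite -RintegralZl// -RintegralB//; last exact: intZ.
  by apply: eq_Rintegral => x _; have [_ ->] := HPsi x; ring.
rewrite wh// oppr_ge0.
rewrite (_ : \int[area]_(x in Om) (h2 x * Psi x) = - \int[area]_(x in Om) (h2 x * - Psi x)); last first.
  by rewrite -mulN1r -RintegralZl//; [apply: eq_Rintegral => x _; ring|rewrite (_ : (fun x => _) = (fun x => -1 * (h2 x * Psi x))); [exact: intZ|apply/funext => x; ring]].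
rewrite oppr_le0.
have m4 : measurable_fun (Om : set T2) (fun x => h2 x * - Psi x).
  have /measurable_int/measurable_EFinP := intZ mOm (-1) i4.
  by congr measurable_fun; apply/funext => x; ring.
rewrite (@ae_Rintegral _ _ _ area Om mOm _ (fun x => `|h2 x * - Psi x|) m4 (measurableT_comp _ m4)).
- by apply: Rintegral_ge0.
- exact: normr_measurable.
apply: aeS h20 => x hx Ox; rewrite ger0_norm// mulr_ge0 ?hx// oppr_ge0.
by have [] := HPsi x.
Qed.

Lemma rweak_snd : rweak Om 1 (fun x => x.2) (fun=> 1).
Proof.
have lc (u : R * R -> R) : continuous u -> lint Om u.
  move=> cu K cK _; have mK := measurable_compact2 cK.
  apply: measurable_bounded_integrable => //.
  - exact: area_compact.
  - by apply: measurable_funTS; exact: cont_measurable2.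
  have : bounded_set (u @` K).
    by apply: compact_bounded; apply: continuous_compact => //; exact: continuous_subspaceT.
  by move=> [M [Mr HM]]; exists M; split => // y My x Kx; apply: (HM y My); exists x.
split.
- by apply: lc => x; exact: cvg_snd.
- by apply: lc => x; exact: cvg_cst.
move=> psi tp; have C := test_C1c (test_sub tp).
have [cpsi cp dpsi [M M0 HM]] := C.
pose D j x := (j == 1)%:R * psi x + x.2 * partial j psi x.
have dD j x : is_derive x (@evec R j) (fun x => x.2 * psi x) (D j x).
  have [->|->] := ord2P j.
    apply/slice1 => /=; apply: (isd_ext (isdZ x.2 (C1c_line1 x.2 x.1 C))) => //.
    by rewrite /D/= mul0r add0r -surjective_pairing.
  apply/slice2 => /=; apply: (isd_ext (isdM (is_derive_id _ _) (C1c_line2 x.1 x.2 C))) => //.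
  by rewrite /D/= -surjective_pairing.
have pD j : partial j (fun x => x.2 * psi x) = D j.
  by apply/funext => x; exact: isd_partial (dD j x).
have CC : C1c (fun x => x.2 * psi x).
  split.
  - by apply: contM2 => // x; exact: cvg_snd.
  - move=> j; rewrite pD => x; apply: cvgD.
      by apply: cvgMr; exact: cpsi.
    by apply: cvgM; [exact: cvg_snd|exact: cp].
  - by move=> j x; rewrite pD; exact: dD.
  - exists M => // x /HM[e1 e2]; rewrite e1 mulr0; split => // j.
    by rewrite pD /D e1 e2 !mulr0 addr0.
have [K [cK KO HK]] := test_supp tp.
have c1 := C1c_cc C; have c2 := C1c_ccp 1 CC.
have i1 := cc_int mOm c1; have i2 := cc_int mOm c2.
have E : \int[area]_(x in Om) partial 1 (fun x => x.2 * psi x) x = 0.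
  rewrite -(C1c_int0 1 CC); apply/esym; apply: Rint_supp => // x _ nx.
  by rewrite pD /D; have [|-> ->] := HK x; [move=> /KO|rewrite !mulr0 addr0].
transitivity (\int[area]_(x in Om) (partial 1 (fun x => x.2 * psi x) x - psi x)).
  by apply: eq_Rintegral => x _; rewrite pD /D/= mul1r addrC addKr.
by rewrite RintegralB// E sub0r; congr (- _); apply: eq_Rintegral => x _; rewrite mul1r.
Qed.

(** W_infty^1 only bounds a weak derivative, and no Lipschitz representative is constructed: L x_2 +
    m and L x_2 - m have nonnegative weak vertical derivatives, so [shear_mono] applies to both, and
    S raises a point by at most s. *)
Lemma shear_lip m m2 (L : R) : 0 <= L -> rweak Om 1 m m2 -> {ae area, forall x, Om x -> `|m2 x| <= L} ->
  {ae area, forall x, Om x -> `|m (shear s k x) - m x| <= L * s}.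
Proof.
move=> L0 wm mL.
have X := rweak_snd.
have mono (e : R) : `|e| = 1 -> {ae area, forall x, Om x -> 0 <= L * s + e * (m (shear s k x) - m x)}.
  move=> e1.
  have w0 : rweak Om 1 (fun=> 0) (fun=> 0).
    have := rweak_lin (-1) oOm X X.
    by rewrite (_ : (fun x => _) = (fun=> 0)) 1?(_ : (fun x => -1 * 1 + 1) = (fun=> 0))//; apply/funext => x; ring.
  have w := rweak_lin L oOm X (rweak_lin e oOm wm w0).
  have h := shear_mono w _.
  apply: aeS (h _) => [x hx Ox|].
    apply: le_trans (hx Ox) _.
    have E : s + k * x.2 = x.2 + s - s * x.2 / d by rewrite /k; field; rewrite gt_eqF.
    rewrite -subr_ge0 /shear/= E.
    rewrite (_ : _ - _ = L * (s * x.2 / d)); last by ring.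
    by case/andP: Ox => /= x0 _; rewrite !mulr_ge0// ?invr_ge0 ltW.
  apply: aeS mL => x hx Ox; rewrite mulr1 addr0.
  have := hx Ox; rewrite -[`|m2 x|]mul1r -e1 -normrM ler_norml => /andP[h1 _].
  by rewrite -lerBlDl sub0r.
have h1 := mono 1 (normr1 _); have h2 := mono (-1) (normrN1 _).
apply: aeS2 h1 h2 => x h1 h2 Ox; have := h1 Ox; have := h2 Ox.
rewrite mulN1r mul1r ler_norml subr_ge0 => h3 h4; apply/andP; split => //.
by rewrite -subr_ge0 opprK addrC.
Qed.
End VerticalLipschitz.
End ShearMono.

(** * Primitives of rapidly oscillating factors *)

Section Oscillation.
Context {R : realType}.
Local Notation mu := (@lebesgue_measure R).
Local Notation area := (@area R).
Local Notation cst0 := (fun _ : R => 0 : R).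

(* [E] with [E' = a g(./eps) + O(eps)] and [E = O(eps)] is [eps P(./eps)] times
   the mean value of [a] over [(y, y + eps)], where [P' = g]. *)
Lemma osc_primitive (a g : R -> R) (La M : R) :
  (forall y z : R, `|a y - a z| <= La * `|y - z|) -> 0 <= La -> (forall y, `|a y| <= M) ->
  continuous g -> (forall y, g (y + 1) = g y) -> \int[mu]_(t in `[0, 1]) g t = 0 ->
  exists2 K : R, 0 <= K & forall eps : R, 0 < eps -> eps <= 1 -> exists E E' : R -> R,
    [/\ forall t : R, is_derive t 1 E (E' t), continuous E', forall t, `|E t| <= eps * K,
        forall t, `|E' t| <= K & forall t, `|E' t - a t * g (t * eps^-1)| <= eps * K].
Proof.
move=> aL La0 aM cg pg g0.
have ca : continuous a by exact: lipschitz_cont aL.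
have M0 : 0 <= M by apply: le_trans (aM 0).
have [P dP] := global_primitive cg; have [F dF] := global_primitive ca.
have cP : continuous P by move=> t; exact: is_derive_cont (dP t).
have cF : continuous F by move=> t; exact: is_derive_cont (dF t).
(* The zero mean of [g] enters here: it is the increment of P over one period. *)
have pP y : P (y + 1) = P y.
  have E : (fun t => P (t + 1) + (-1) * P t) y = (fun t => P (t + 1) + (-1) * P t) 0.
    apply: (@is_derive_0_is_cst R (fun t => P (t + 1) + (-1) * P t) y 0) => t.
    apply: (isd_ext (isdD (isd_shift 1 t dP) (isdZ (-1) (dP t)))) => //.
    by rewrite pg; ring.
  move: E; rewrite /= add0r !mulN1r -(FTC_prim cg dP ler01) g0 => /eqP.
  by rewrite subr_eq0 => /eqP.
have [G G0 HG] := periodic_bounded cg pg.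
have [B B0 HB] := periodic_bounded cP pP.
pose K := B * M + B * La + G * M + G * La.
have K0 : 0 <= K by rewrite !addr_ge0// mulr_ge0.
exists K => // eps e0 e1.
(* A merely Lipschitz [a] cannot be differentiated in eps a P(./eps); its moving mean can, with
   derivative bounded by [La]. *)
pose ae t := eps^-1 * (F (t + eps) + (-1) * F t).
pose ae' t := eps^-1 * (a (t + eps) + (-1) * a t).
have dae (t : R) : is_derive t 1 ae (ae' t).
  exact: (isdZ eps^-1 (isdD (isd_shift eps t dF) (isdZ (-1) (dF t)))).
have shc (h : R -> R) : continuous h -> continuous (fun t : R => h (t + eps)).
  move=> ch t; apply: (@continuous_comp _ _ _ (fun t : R => t + eps) h); last exact: ch.
  by apply: cvgD; [exact: cvg_id|exact: cvg_cst].
have scc (h : R -> R) : continuous h -> continuous (fun t : R => h (t * eps^-1)).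
  move=> ch t; apply: (@continuous_comp _ _ _ (fun t : R => t * eps^-1) h); last exact: ch.
  by apply: cvgMl; exact: cvg_id.
have cae' : continuous ae' by apply: contZ; apply: contD; [exact: shc|exact: contZ].
have cae : continuous ae by move=> t; exact: is_derive_cont (dae t).
have aeE t : ae t - a t = eps^-1 * \int[mu]_(y in `[t, t + eps]) (a y - a t).
  have te : t <= t + eps by rewrite lerDl ltW.
  rewrite RintegralB//; [|exact: cont_int|by apply: cont_int => ?; exact: cvg_cst].
  rewrite (FTC_prim ca dF te) int_itv_cst// /ae.
  by field; rewrite gt_eqF.
have int_bnd t (h : R -> R) (c : R) : continuous h -> (forall y, t <= y <= t + eps -> `|h y| <= c) ->
    `|eps^-1 * \int[mu]_(y in `[t, t + eps]) h y| <= c.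
  move=> ch hc; have te : t <= t + eps by rewrite lerDl ltW.
  rewrite normrM gtr0_norm ?invr_gt0// mulrC ler_pdivrMr//.
  apply: le_trans (le_normr_Rintegral _ _) _ => //; first exact: cont_int.
  apply: (@le_trans _ _ (\int[mu]_(y in `[t, t + eps]) c)); last first.
    by rewrite int_itv_cst// addrAC subrr add0r.
  apply: le_Rintegral => //.
  - by apply: int_abs => //; exact: cont_int.
  - by apply: cont_int => ?; exact: cvg_cst.
have ae_a t : `|ae t - a t| <= eps * La.
  rewrite aeE; apply: int_bnd => [|y /andP[h1 h2]].
    by apply: contB => // ?; exact: cvg_cst.
  apply: le_trans (aL _ _) _; rewrite mulrC; apply: ler_wpM2r => //.
  by rewrite ger0_norm ?subr_ge0// lerBlDl.
have ae_M t : `|ae t| <= M.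
  have te : t <= t + eps by rewrite lerDl ltW.
  have -> : ae t = eps^-1 * \int[mu]_(y in `[t, t + eps]) a y.
    by rewrite (FTC_prim ca dF te) /ae mulN1r.
  by apply: int_bnd.
have ae'_L t : `|ae' t| <= La.
  rewrite /ae' normrM gtr0_norm ?invr_gt0// mulrC ler_pdivrMr// mulN1r.
  by apply: le_trans (aL _ _) _; rewrite addrAC subrr add0r gtr0_norm.
pose E t := eps * (P (t * eps^-1) * ae t).
pose E' t := g (t * eps^-1) * ae t + eps * (P (t * eps^-1) * ae' t).
have b1 t : `|P (t * eps^-1) * ae' t| <= B * La by rewrite normrM; apply: ler_pM.
have b2 t : `|P (t * eps^-1) * ae t| <= B * M by rewrite normrM; apply: ler_pM.
have b3 t : `|g (t * eps^-1) * ae t| <= G * M by rewrite normrM; apply: ler_pM.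
have z1 : 0 <= B * La by rewrite mulr_ge0.
have z2 : 0 <= B * M by rewrite mulr_ge0.
have z3 : 0 <= G * M by rewrite mulr_ge0.
have z4 : 0 <= G * La by rewrite mulr_ge0.
exists E, E'; split.
- move=> t.
  have dPe : is_derive t 1 (fun t : R => P (t * eps^-1)) (eps^-1 * g (t * eps^-1)).
    have := @isd_comp_aff R P 0 eps^-1 t (g (0 + eps^-1 * t)) (dP _).
    by move/isd_ext; apply => [x|]; [rewrite add0r mulrC|rewrite add0r [in LHS](mulrC eps^-1 t)].
  apply: (isd_ext (isdZ eps (isdM dPe (dae t)))) => //.
  by rewrite /E'; field; rewrite gt_eqF.
- apply: contD; first by apply: contM => //; exact: scc.
  by apply: contZ; apply: contM => //; exact: scc.
- move=> t; rewrite /E normrM gtr0_norm// ler_pM2l//.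
  by apply: le_trans (b2 t) _; rewrite /K; lra.
- move=> t; apply: le_trans (ler_normD _ _) _; rewrite [X in _ + X]normrM gtr0_norm//.
  have h : eps * `|P (t * eps^-1) * ae' t| <= B * La.
    by apply: le_trans (b1 t); rewrite ler_piMl.
  by apply: le_trans (lerD (b3 t) h) _; rewrite /K; lra.
- move=> t.
  have -> : E' t - a t * g (t * eps^-1) = g (t * eps^-1) * (ae t - a t) + eps * (P (t * eps^-1) * ae' t).
    by rewrite /E'; ring.
  apply: le_trans (ler_normD _ _) _; rewrite [X in _ + X]normrM (gtr0_norm e0).
  have h1 : eps * `|P (t * eps^-1) * ae' t| <= eps * (B * La) by rewrite ler_pM2l.
  have h2 : `|g (t * eps^-1) * (ae t - a t)| <= G * (eps * La) by rewrite normrM; apply: ler_pM.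
  apply: le_trans (lerD h2 h1) _; rewrite -subr_ge0.
  rewrite (_ : _ - _ = eps * (B * M + G * M)); last by rewrite /K; ring.
  by rewrite mulr_ge0 ?addr_ge0// ltW.
Qed.

End Oscillation.

(* [(c, k)] with [c = false] for real and [c = true] for imaginary parts. *)
Definition cidx : finType := (bool * idx)%type.

(** * The real system of real and imaginary parts *)

Section BulkForms.
Context {R : realType}.
Local Notation mu := (@lebesgue_measure R).
Local Notation area := (@area R).
Local Notation T2 := (measurableTypeR R * measurableTypeR R)%type.
Implicit Types (p q : cidx) (U V W : cidx -> R * R -> R) (m : cidx -> cidx -> R * R -> R).

Definition sqK (D : set T2) U := forall p, sqi area D (U p).
(** The squared W_2^1 norm of the real system; [ZZ] and [GG] are its zero-order and gradient
    parts. *)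
Definition NN (D : set T2) U : R := \sum_p nn area D (U p).
Definition ZZ (D : set T2) U : R := \sum_(p | p.2 == None) nn area D (U p).
Definition GG (D : set T2) U : R := \sum_(p | p.2 != None) nn area D (U p).
Definition bf (D : set T2) m U V : R := \sum_p \sum_q ip area D (fun x => m p q x * U p x) (V q).

Definition mbnd (D : set T2) (M : R) (f : R * R -> R) : Prop :=
  measurable_fun D f /\ {ae area, forall x, D x -> `|f x| <= M}.

Lemma mbnd_sub (D E : set T2) (M : R) f : measurable D -> E `<=` D -> mbnd D M f -> mbnd E M f.
Proof.
move=> mD ED [mf bf']; split; first exact: measurable_funS mf.
by apply: aeS bf' => x h /ED /h.
Qed.

Lemma NNE (D : set T2) U : NN D U = GG D U + ZZ D U.
Proof. by rewrite /NN (bigID (fun p => p.2 == None)) /= addrC. Qed.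

Lemma GG_ge0 (D : set T2) U : 0 <= GG D U.
Proof. by apply: sumr_ge0 => p _; exact: nn_ge0. Qed.

Lemma ZZ_ge0 (D : set T2) U : 0 <= ZZ D U.
Proof. by apply: sumr_ge0 => p _; exact: nn_ge0. Qed.

Lemma NN_ge0 (D : set T2) U : 0 <= NN D U.
Proof. by apply: sumr_ge0 => p _; exact: nn_ge0. Qed.

Lemma nn_leNN (D : set T2) U p : nn area D (U p) <= NN D U.
Proof. by rewrite /NN (bigD1 p)//= lerDl sumr_ge0// => q _; exact: nn_ge0. Qed.

Lemma nn_leGG (D : set T2) U p : p.2 != None -> nn area D (U p) <= GG D U.
Proof. by move=> np; rewrite /GG (bigD1 p)//= lerDl sumr_ge0// => q _; exact: nn_ge0. Qed.

Lemma nn_leZZ (D : set T2) U p : p.2 == None -> nn area D (U p) <= ZZ D U.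
Proof. by move=> np; rewrite /ZZ (bigD1 p)//= lerDl sumr_ge0// => q _; exact: nn_ge0. Qed.

Lemma ZZ_leNN (D : set T2) U : ZZ D U <= NN D U.
Proof. by rewrite NNE lerDr GG_ge0. Qed.

Section D.
Variable D : set T2.
Hypothesis mD : measurable D.

Lemma ip_mb f (M : R) u v : 0 <= M -> mbnd D M f -> sqi area D u -> sqi area D v ->
  `|ip area D (fun x => f x * u x) v| <= M * (Num.sqrt (nn area D u) * Num.sqrt (nn area D v)).
Proof.
move=> M0 [mf bf'] su sv.
have sfu := sqi_mulM mD mf bf' su.
apply: le_trans (ip_CS mD sfu sv) _; rewrite mulrA; apply: ler_wpM2r; first exact: sqrtr_ge0.
rewrite -[X in X * _](ger0_norm M0) -sqrtr_sqr -sqrtrM ?sqr_ge0// ler_sqrt ?mulr_ge0 ?sqr_ge0 ?nn_ge0//.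
exact: nn_mulM.
Qed.

Lemma ip_linl (a : R) f g h : sqi area D f -> sqi area D g -> sqi area D h ->
  ip area D (fun x => a * f x + g x) h = a * ip area D f h + ip area D g h.
Proof.
by move=> sf sg sh; rewrite -(ipZl mD a sf sh) -(ipDl mD (sqiZ mD a sf) sg sh).
Qed.

Lemma ip_linr (a : R) f g h : sqi area D f -> sqi area D g -> sqi area D h ->
  ip area D h (fun x => a * f x + g x) = a * ip area D h f + ip area D h g.
Proof.
move=> sf sg sh; have E := ip_linl a sf sg sh.
by rewrite ipC; apply: (etrans E); congr (_ * _ + _); exact: ipC.
Qed.

Lemma sqK_lin (a : R) U V : sqK D U -> sqK D V -> sqK D (fun p x => a * U p x + V p x).
Proof. by move=> sU sV p; apply: (sqiD mD) => //; exact: (sqiZ mD). Qed.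

Variables (m : cidx -> cidx -> R * R -> R) (M : R).
Hypothesis M0 : 0 <= M.
Hypothesis mm : forall p q, mbnd D M (m p q).

Lemma sq_m p q u : sqi area D u -> sqi area D (fun x => m p q x * u x).
Proof. by move=> su; have [h1 h2] := mm p q; exact: sqi_mulM h1 h2 su. Qed.

Lemma bf_linl (a : R) U V W : sqK D U -> sqK D V -> sqK D W ->
  bf D m (fun p x => a * U p x + V p x) W = a * bf D m U W + bf D m V W.
Proof.
move=> sU sV sW; rewrite /bf mulr_sumr -big_split; apply: eq_bigr => p _ /=.
rewrite mulr_sumr -big_split; apply: eq_bigr => q _ /=.
have s1 := sq_m p q (sU p); have s2 := sq_m p q (sV p).
rewrite -(ipZl mD a s1 (sW q)) -(ipDl mD (sqiZ mD a s1) s2 (sW q)).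
by apply: eq_Rintegral => x _; ring.
Qed.

Lemma bf_linr (a : R) U V W : sqK D U -> sqK D V -> sqK D W ->
  bf D m W (fun p x => a * U p x + V p x) = a * bf D m W U + bf D m W V.
Proof.
move=> sU sV sW; rewrite /bf mulr_sumr -big_split; apply: eq_bigr => p _ /=.
rewrite mulr_sumr -big_split; apply: eq_bigr => q _ /=.
have s1 := sq_m p q (sW p).
exact: ip_linr.
Qed.

Lemma bf_sym U V : (forall p q x, D x -> m p q x = m q p x) -> bf D m U V = bf D m V U.
Proof.
move=> sm; rewrite /bf exchange_big; apply: eq_bigr => p _; apply: eq_bigr => q _.
by apply: eq_Rintegral => x /set_mem Dx; rewrite (sm p q)//; ring.
Qed.

Lemma bf_bound U V : sqK D U -> sqK D V ->
  `|bf D m U V| <= 36 * M * (Num.sqrt (NN D U) * Num.sqrt (NN D V)).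
Proof.
move=> sU sV.
(* Six indices: real and imaginary parts of the function and of its two derivatives; hence 36
   pairs. *)
have card : \sum_(p : cidx) \sum_(q : cidx) (M * (Num.sqrt (NN D U) * Num.sqrt (NN D V))) =
    36 * M * (Num.sqrt (NN D U) * Num.sqrt (NN D V)).
  have c6 : #|cidx| = 6%N by rewrite card_prod card_bool card_option card_ord.
  rewrite !sumr_const !c6 -mulrnA -[LHS]mulr_natl /=; ring.
rewrite -card /bf; apply: le_trans (ler_norm_sum _ _ _) _; apply: ler_sum => p _.
apply: le_trans (ler_norm_sum _ _ _) _; apply: ler_sum => q _.
apply: le_trans (ip_mb M0 (mm p q) (sU p) (sV q)) _; apply: ler_wpM2l => //.
by apply: ler_pM; rewrite ?sqrtr_ge0// ler_sqrt ?NN_ge0// nn_leNN.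
Qed.

Lemma Rint_sum (I : finType) (P : pred I) (f : I -> R * R -> R) :
  (forall i, area.-integrable D (EFin \o f i)) ->
  area.-integrable D (EFin \o (fun x => \sum_(i | P i) f i x)) /\
  \int[area]_(x in D) \sum_(i | P i) f i x = \sum_(i | P i) \int[area]_(x in D) f i x.
Proof.
move=> If; elim: (index_enum I) => [|i s [i1 E]].
  split; first by rewrite (_ : _ \o _ = cst 0%E); [exact: integrable0|apply/funext => x; rewrite /= big_nil].
  by rewrite big_nil /Rintegral (eq_integral (cst 0%E)) ?integral0// => x _; rewrite big_nil.
have [Pi|nPi] := boolP (P i).
  have E1 : (fun x => \sum_(j <- i :: s | P j) f j x) = (fun x => f i x + \sum_(j <- s | P j) f j x).
    by apply/funext => x; rewrite big_cons Pi.
  by rewrite E1 RintegralD// E [RHS]big_cons Pi; split => //; exact: intD.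
have E1 : (fun x => \sum_(j <- i :: s | P j) f j x) = (fun x => \sum_(j <- s | P j) f j x).
  by apply/funext => x; rewrite big_cons (negbTE nPi).
by rewrite E1 E [RHS]big_cons (negbTE nPi).
Qed.

Lemma bf_coer (c1 C1 : R) U : sqK D U ->
  {ae area, forall x, D x -> forall xi : cidx -> R,
    c1 * (\sum_(p | p.2 != None) xi p ^+ 2) - C1 * (\sum_(p | p.2 == None) xi p ^+ 2) <=
    \sum_p \sum_q m p q x * xi p * xi q} ->
  c1 * GG D U - C1 * ZZ D U <= bf D m U U.
Proof.
move=> sU ell.
have i1 p : area.-integrable D (EFin \o (fun x => U p x * U p x)) by exact: (sqi_int (sU p)).
have i2 p q : area.-integrable D (EFin \o (fun x => m p q x * U p x * U q x)).
  exact: (ip_int mD (sq_m p q (sU p)) (sU q)).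
have [j1 E1] := Rint_sum (fun p => p.2 != None) i1.
have [j2 E2] := Rint_sum (fun p => p.2 == None) i1.
have j3 p : area.-integrable D (EFin \o (fun x => \sum_q m p q x * U p x * U q x)).
  by have [] := Rint_sum predT (i2 p).
have [j4 E4] := Rint_sum predT j3.
have -> : bf D m U U = \int[area]_(x in D) \sum_p \sum_q m p q x * U p x * U q x.
  rewrite E4; apply: eq_bigr => p _; by have [_ ->] := Rint_sum predT (i2 p).
rewrite /GG /ZZ -E1 -E2 -subr_ge0 -!RintegralZl// -!RintegralB//; try exact: intZ; last first.
  exact: (intB mD (intZ mD c1 j1) (intZ mD C1 j2)).
set h := (X in 0 <= \int[_]_(x in _) X x).
have ih : area.-integrable D (EFin \o h).
  exact: (intB mD j4 (intB mD (intZ mD c1 j1) (intZ mD C1 j2))).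
have mh : measurable_fun D h by apply/measurable_EFinP; exact: measurable_int ih.
(* The integrand is nonnegative only almost everywhere, so it is exchanged for its absolute
   value. *)
rewrite (@ae_Rintegral _ _ _ area D mD h (fun x => `|h x|) mh (measurableT_comp _ mh)).
- by apply: Rintegral_ge0.
- exact: normr_measurable.
apply: aeS ell => x hx Dx; rewrite ger0_norm// /h subr_ge0.
have := hx Dx (fun p => U p x); congr (_ * _ - _ * _ <= _);
  by apply: eq_bigr => p _; rewrite expr2.
Qed.

End D.
End BulkForms.

Lemma big_cidx (R : realType) (P : pred cidx) (F : cidx -> R) : \sum_(p | P p) F p =
  \sum_(c : bool) ((if P (c, None) then F (c, None) else 0) +
    (if P (c, Some 0) then F (c, Some 0) else 0) + (if P (c, Some 1) then F (c, Some 1) else 0)).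
Proof.
pose G c (k : idx) := if P (c, k) then F (c, k) else 0.
rewrite big_mkcond (eq_bigr (fun p => G p.1 p.2)); last by move=> [].
rewrite -(pair_bigA _ G) /= /G.
apply: eq_bigr => c _; rewrite (bigD1 None)//= (bigD1 (Some 0))//= (bigD1 (Some 1))//=.
rewrite big_pred0 ?addr0 ?addrA// => -[j|//].
by have [->|->] := ord2P j; rewrite ?eqxx ?andbF.
Qed.

Section Forms.
Context {R : realType}.
Local Notation mu := (@lebesgue_measure R).
Local Notation area := (@area R).
Local Notation T2 := (measurableTypeR R * measurableTypeR R)%type.

Definition sdata : Type := ((cidx -> R * R -> R) * (bool -> R -> R))%type.
Implicit Types (U V W : sdata) (p q : cidx) (c : bool) (gamma kb : R -> R).

Definition HH gamma (d : R) : set sdata :=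
  [set U | forall c, H1 gamma d (fun k => U.1 (c, k)) (U.2 c)].

Definition TT U : R := \sum_c nn mu setT (U.2 c).

Definition tf kb U V : R := \sum_c ip mu setT (fun y => kb y * U.2 c y) (V.2 c).

(* The real part of [- (i u, v)]. *)
Definition cross (D : set T2) (U V : cidx -> R * R -> R) : R :=
  ip area D (U (true, None)) (V (false, None)) - ip area D (U (false, None)) (V (true, None)).

(* Multiplication by the imaginary unit. *)
Definition JJ U : sdata :=
  (fun p x => if p.1 then U.1 (false, p.2) x else - U.1 (true, p.2) x,
   fun c y => if c then U.2 false y else - U.2 true y).

Definition slin (a : R) U V : sdata :=
  (fun p x => a * U.1 p x + V.1 p x, fun c y => a * U.2 c y + V.2 c y).

Lemma ZZE (D : set T2) (U : cidx -> R * R -> R) :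
  ZZ D U = nn area D (U (true, None)) + nn area D (U (false, None)).
Proof. by rewrite /ZZ big_cidx big_bool /= !addr0. Qed.

Lemma GGE (D : set T2) (U : cidx -> R * R -> R) :
  GG D U = nn area D (U (true, Some 0)) + nn area D (U (true, Some 1)) +
    (nn area D (U (false, Some 0)) + nn area D (U (false, Some 1))).
Proof. by rewrite /GG big_cidx big_bool /= !add0r. Qed.

Lemma TTE U : TT U = nn mu setT (U.2 true) + nn mu setT (U.2 false).
Proof. by rewrite /TT big_bool. Qed.

Lemma TT_ge0 U : 0 <= TT U.
Proof. by apply: sumr_ge0 => c _; exact: nn_ge0. Qed.

Lemma H1_scale gamma (d a : R) g t : continuous gamma -> H1 gamma d g t ->
  H1 gamma d (fun k x => a * g k x) (fun y => a * t y).
Proof.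
move=> cg h; have := H1_lin cg (a - 1) h h.
by congr H1; apply/funext => x; [apply/funext => y|]; ring.
Qed.

Section Layer.
Variables (d m0 : R) (gamma kb : R -> R) (Kb M c1 C1 : R) (m : cidx -> cidx -> R * R -> R).
Hypotheses (m0_gt0 : 0 < m0) (Kb0 : 0 <= Kb) (M0 : 0 <= M) (c1_gt0 : 0 < c1) (C10 : 0 <= C1).
Hypothesis cg : continuous gamma.
Hypothesis gm : forall y, gamma y + m0 <= d.
Hypothesis mk : measurable_fun setT kb.
Hypothesis kK : forall y, `|kb y| <= Kb.
Local Notation D := (layer gamma d).
Hypothesis mm : forall p q, mbnd D M (m p q).
Let mD : measurable (D : set T2) := layer_cont_meas d cg.
Let mT : measurable (setT : set (measurableTypeR R)) := measurableT.
Let aek : {ae mu, forall y, (setT : set R) y -> `|kb y| <= Kb}.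
Proof. by apply: aeW => y _; exact: kK. Qed.

(** Garding's inequality at the level of the coefficient matrix. *)
Definition bulk_ell : Prop :=
  {ae area, forall x, D x -> forall xi : cidx -> R,
    c1 * (\sum_(p | p.2 != None) xi p ^+ 2) - C1 * (\sum_(p | p.2 == None) xi p ^+ 2) <=
    \sum_p \sum_q m p q x * xi p * xi q}.

(** For a Hermitian form h the number h(u, u) is real, so h(u, i u) = -i h(u, u) has real part zero;
    this is the pointwise version for the real matrix. *)
Definition bulk_J : Prop :=
  forall x, D x -> forall xi : cidx -> R,
   \sum_p \sum_q m p q x * xi p * (if q.1 then xi (false, q.2) else - xi (true, q.2)) = 0.

Local Notation H := (HH gamma d).

Lemma HH_sq U : H U -> sqK D U.1.
Proof. by move=> HU [c j]; exact: (H1_sqi j (HU c)). Qed.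

Lemma HH_tsq U c : H U -> sqi mu setT (U.2 c).
Proof. by move=> HU; exact: H1_tsqi (HU c). Qed.

Lemma HH_lin (a : R) U V : H U -> H V -> H (slin a U V).
Proof. by move=> HU HV c; exact: (H1_lin cg a (HU c) (HV c)). Qed.

Lemma HH_J U : H U -> H (JJ U).
Proof.
move=> HU [|]; first exact: HU false.
have := H1_scale (-1) cg (HU true).
by congr H1; apply/funext => x; [apply/funext => y|]; rewrite mulN1r.
Qed.

Lemma HH0 : H (fun _ _ => 0, fun _ _ => 0).
Proof. 
move=> c; exists (fun _ _ => 0); split.
- by move=> _; exact: test0.
- move=> j; have -> : jet (fun=> 0) j = (fun=> 0 : R).
    case: j => [j|//]; apply/funext => x.
    by apply: isd_partial; exact: is_derive_cst.
  by apply: cvgL2_cst => //; exact: sqi0.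
- by apply: cvgL2_cst => //; exact: sqi0.
- by apply: cvgL2_cst => //; exact: sqi0.
Qed.

Lemma TT_le (tau : R) U : 0 < tau -> H U -> TT U <= tau * GG D U.1 + (m0^-1 + tau^-1) * ZZ D U.1.
Proof.
move=> tau0 HU; rewrite TTE GGE ZZE.
have h1 := H1_trace_le cg tau0 m0_gt0 gm (HU true).
have h2 := H1_trace_le cg tau0 m0_gt0 gm (HU false).
apply: le_trans (lerD h1 h2) _; rewrite -subr_ge0.
rewrite (_ : _ - _ = tau * (nn area D (U.1 (true, Some 0)) + nn area D (U.1 (false, Some 0)))).
  by rewrite mulr_ge0 ?(ltW tau0)// addr_ge0// nn_ge0.
by ring.
Qed.

Lemma TT_leN U : H U -> TT U <= (m0^-1 + 1) * NN D U.1.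
Proof.
move=> HU; apply: le_trans (TT_le ltr01 HU) _; rewrite mul1r invr1 NNE mulrDr.
apply: lerD => //; rewrite ler_peMl ?GG_ge0// lerDr invr_ge0 ltW//.
Qed.

Lemma ip_kb u v : sqi mu setT u -> sqi mu setT v ->
  `|ip mu setT (fun y => kb y * u y) v| <= Kb * (Num.sqrt (nn mu setT u) * Num.sqrt (nn mu setT v)).
Proof.
move=> su sv; have sfu := sqi_mulM mT mk aek su.
apply: le_trans (ip_CS mT sfu sv) _; rewrite mulrA; apply: ler_wpM2r; first exact: sqrtr_ge0.
rewrite -[X in X * _](ger0_norm Kb0) -sqrtr_sqr -sqrtrM ?sqr_ge0// ler_sqrt ?mulr_ge0 ?sqr_ge0 ?nn_ge0//.
exact: (nn_mulM mT Kb0 mk aek su).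
Qed.

Lemma nn_leTT U c : nn mu setT (U.2 c) <= TT U.
Proof. by rewrite TTE; case: c; rewrite ?lerDl ?lerDr nn_ge0. Qed.

Lemma tf_bound U V : H U -> H V -> `|tf kb U V| <= 2 * Kb * (Num.sqrt (TT U) * Num.sqrt (TT V)).
Proof.
move=> HU HV; rewrite /tf big_bool /=.
have h c : `|ip mu setT (fun y => kb y * U.2 c y) (V.2 c)| <= Kb * (Num.sqrt (TT U) * Num.sqrt (TT V)).
  apply: le_trans (ip_kb (HH_tsq c HU) (HH_tsq c HV)) _; apply: ler_wpM2l => //.
  by apply: ler_pM; rewrite ?sqrtr_ge0// ler_sqrt ?TT_ge0// nn_leTT.
by apply: le_trans (ler_normD _ _) _; apply: le_trans (lerD (h true) (h false)) _; lra.
Qed.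

Lemma tf_self U : H U -> - (Kb * TT U) <= tf kb U U.
Proof.
move=> HU; rewrite /tf big_bool TTE /=.
have h c : - (Kb * nn mu setT (U.2 c)) <= ip mu setT (fun y => kb y * U.2 c y) (U.2 c).
  have := ip_kb (HH_tsq c HU) (HH_tsq c HU).
  by rewrite -expr2 sqr_sqrtr ?nn_ge0// ler_norml => /andP[].
by have h1 := h true; have h2 := h false; lra.
Qed.

Lemma ip1_linl (a : R) f g h : sqi mu setT f -> sqi mu setT g -> sqi mu setT h ->
  ip mu setT (fun x => a * f x + g x) h = a * ip mu setT f h + ip mu setT g h.
Proof.
by move=> sf sg sh; rewrite -(ipZl mT a sf sh) -(ipDl mT (sqiZ mT a sf) sg sh).
Qed.

Lemma ip1_linr (a : R) f g h : sqi mu setT f -> sqi mu setT g -> sqi mu setT h ->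
  ip mu setT h (fun x => a * f x + g x) = a * ip mu setT h f + ip mu setT h g.
Proof.
move=> sf sg sh; have E := ip1_linl a sf sg sh.
by rewrite ipC; apply: (etrans E); congr (_ * _ + _); exact: ipC.
Qed.

Lemma tf_linl (a : R) U V W : H U -> H V -> H W -> tf kb (slin a U V) W = a * tf kb U W + tf kb V W.
Proof.
move=> HU HV HW; rewrite /tf !big_bool /=.
have E c : ip mu setT (fun y => kb y * (slin a U V).2 c y) (W.2 c) =
    a * ip mu setT (fun y => kb y * U.2 c y) (W.2 c) + ip mu setT (fun y => kb y * V.2 c y) (W.2 c).
  have s1 := sqi_mulM mT mk aek (HH_tsq c HU); have s2 := sqi_mulM mT mk aek (HH_tsq c HV).
  rewrite -(ip1_linl a s1 s2 (HH_tsq c HW)); apply: eq_Rintegral => y _.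
  by rewrite /slin/=; ring.
by rewrite !E; ring.
Qed.

Lemma tf_linr (a : R) U V W : H U -> H V -> H W -> tf kb W (slin a U V) = a * tf kb W U + tf kb W V.
Proof.
move=> HU HV HW; rewrite /tf !big_bool /=.
have E c : ip mu setT (fun y => kb y * W.2 c y) ((slin a U V).2 c) =
    a * ip mu setT (fun y => kb y * W.2 c y) (U.2 c) + ip mu setT (fun y => kb y * W.2 c y) (V.2 c).
  have s1 := sqi_mulM mT mk aek (HH_tsq c HW).
  exact: (ip1_linr a (HH_tsq c HU) (HH_tsq c HV) s1).
by rewrite !E; ring.
Qed.

Lemma tf_sym U V : tf kb U V = tf kb V U.
Proof. by apply: eq_bigr => c _; apply: eq_Rintegral => y _; ring. Qed.

Lemma cross_linl (a : R) U V W : H U -> H V -> H W ->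
  cross D (slin a U V).1 W.1 = a * cross D U.1 W.1 + cross D V.1 W.1.
Proof.
move=> HU HV HW; rewrite /cross.
have e1 := ip_linl mD a (HH_sq HU (true, None)) (HH_sq HV (true, None)) (HH_sq HW (false, None)).
have e2 := ip_linl mD a (HH_sq HU (false, None)) (HH_sq HV (false, None)) (HH_sq HW (true, None)).
by rewrite [X in X - _ = _]e1 [X in _ - X = _]e2; ring.
Qed.

Lemma cross_linr (a : R) U V W : H U -> H V -> H W ->
  cross D W.1 (slin a U V).1 = a * cross D W.1 U.1 + cross D W.1 V.1.
Proof.
move=> HU HV HW; rewrite /cross.
have e1 := ip_linr mD a (HH_sq HU (false, None)) (HH_sq HV (false, None)) (HH_sq HW (true, None)).
have e2 := ip_linr mD a (HH_sq HU (true, None)) (HH_sq HV (true, None)) (HH_sq HW (false, None)).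
by rewrite [X in X - _ = _]e1 [X in _ - X = _]e2; ring.
Qed.

Lemma cross_bound (U V : cidx -> R * R -> R) : sqK D U -> sqK D V ->
  `|cross D U V| <= 2 * (Num.sqrt (ZZ D U) * Num.sqrt (ZZ D V)).
Proof.
move=> sU sV; rewrite /cross.
have h c c' : `|ip area D (U (c, None)) (V (c', None))| <= Num.sqrt (ZZ D U) * Num.sqrt (ZZ D V).
  apply: le_trans (ip_CS mD (sU _) (sV _)) _.
  by apply: ler_pM; rewrite ?sqrtr_ge0// ler_sqrt ?ZZ_ge0// nn_leZZ.
apply: le_trans (ler_normB _ _) _; apply: le_trans (lerD (h true false) (h false true)) _; lra.
Qed.

(** [qf] is the real part of the form with its Robin term, symmetric when the matrix [m] is; [pf]
    adds the part that comes from -i u and is not symmetric. *)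
Definition qf U V : R := bf D m U.1 V.1 + tf kb U V.
Definition pf U V : R := qf U V + cross D U.1 V.1.

Lemma qf_linl (a : R) U V W : H U -> H V -> H W -> qf (slin a U V) W = a * qf U W + qf V W.
Proof.
move=> HU HV HW; rewrite /qf tf_linl//.
have -> : bf D m (slin a U V).1 W.1 = a * bf D m U.1 W.1 + bf D m V.1 W.1.
  exact: (bf_linl mD mm a (HH_sq HU) (HH_sq HV) (HH_sq HW)).
by ring.
Qed.

Lemma qf_linr (a : R) U V W : H U -> H V -> H W -> qf W (slin a U V) = a * qf W U + qf W V.
Proof.
move=> HU HV HW; rewrite /qf tf_linr//.
have -> : bf D m W.1 (slin a U V).1 = a * bf D m W.1 U.1 + bf D m W.1 V.1.
  exact: (bf_linr mD mm a (HH_sq HU) (HH_sq HV) (HH_sq HW)).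
by ring.
Qed.

Lemma pf_linl (a : R) U V W : H U -> H V -> H W -> pf (slin a U V) W = a * pf U W + pf V W.
Proof. by move=> HU HV HW; rewrite /pf qf_linl// cross_linl//; ring. Qed.

Lemma pf_linr (a : R) U V W : H U -> H V -> H W -> pf W (slin a U V) = a * pf W U + pf W V.
Proof. by move=> HU HV HW; rewrite /pf qf_linr// cross_linr//; ring. Qed.

Lemma NN_J U : NN D (JJ U).1 = NN D U.1.
Proof.
have E (u : R * R -> R) : nn area D (fun x => - u x) = nn area D u.
  by apply: eq_Rintegral => x _; rewrite mulrNN.
by rewrite /NN !big_cidx !big_bool /= !E; ring.
Qed.

(** Only the real part of -(i u, i u), minus the squared L2 norm, survives: bulk and boundary forms
    are real on the diagonal, so they vanish on the pair (u, i u). *)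
Lemma pf_J U : bulk_J -> H U -> pf U (JJ U) = - ZZ D U.1.
Proof.
move=> bJ HU; have sU := HH_sq HU; have HJ := HH_J HU; have sJ := HH_sq HJ.
rewrite /pf /qf.
have -> : bf D m U.1 (JJ U).1 = 0.
  have i2 p q : area.-integrable D (EFin \o (fun x => m p q x * U.1 p x * (JJ U).1 q x)).
    exact: (ip_int mD (sq_m mD mm p q (sU p)) (sJ q)).
  have j3 p : area.-integrable D (EFin \o (fun x => \sum_q m p q x * U.1 p x * (JJ U).1 q x)).
    by have [] := Rint_sum mD predT (i2 p).
  have [j4 E4] := Rint_sum mD predT j3.
  transitivity (\int[area]_(x in D) \sum_p \sum_q m p q x * U.1 p x * (JJ U).1 q x).
    by rewrite E4; apply: eq_bigr => p _; have [_ ->] := Rint_sum mD predT (i2 p).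
  rewrite /Rintegral (eq_integral (cst 0%E)) ?integral0// => x /set_mem Dx.
  by congr (_%:E); exact: (bJ x Dx (fun p => U.1 p x)).
have -> : tf kb U (JJ U) = 0.
  rewrite /tf big_bool /= /ip -[RHS](subrr (\int[mu]_(x in setT) (kb x * U.2 true x * U.2 false x))).
  congr (_ + _); rewrite -mulN1r -RintegralZl//; first by apply: eq_Rintegral => y _; ring.
  have s1 := sqi_mulM mT mk aek (HH_tsq true HU).
  exact: (ip_int mT s1 (HH_tsq false HU)).
rewrite /cross ZZE !add0r opprD /=; congr (_ - _).
rewrite /nn /ip -mulN1r -RintegralZl//; first by apply: eq_Rintegral => y _; ring.
exact: (sqi_int (sU _)).
Qed.

End Layer.
End Forms.

(** * Coercivity, stability and existence for the real system *)

Section WellPosed.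
Context {R : realType}.
Local Notation mu := (@lebesgue_measure R).
Local Notation area := (@area R).
Local Notation T2 := (measurableTypeR R * measurableTypeR R)%type.
Implicit Types (p q : cidx) (c : bool) (gamma kb : R -> R).

(** The multiple of the squared L2 norm that restores coercivity. The number c1 / (2 (Kb + 1)) is
    the Young parameter of the trace inequality for which the boundary term consumes at most half of
    the gradient energy; the + 1 covers Kb = 0. *)
Definition mu_coer (m0 Kb c1 C1 : R) : R :=
  C1 + c1 / 2 + Kb * (m0^-1 + (c1 / (2 * (Kb + 1)))^-1).

Section Layer.
Variables (d m0 : R) (gamma kb : R -> R) (Kb M c1 C1 : R) (m : cidx -> cidx -> R * R -> R).
Hypotheses (m0_gt0 : 0 < m0) (Kb0 : 0 <= Kb) (M0 : 0 <= M) (c1_gt0 : 0 < c1) (C10 : 0 <= C1).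
Hypothesis cg : continuous gamma.
Hypothesis gm : forall y, gamma y + m0 <= d.
Hypothesis mk : measurable_fun setT kb.
Hypothesis kK : forall y, `|kb y| <= Kb.
Local Notation D := (layer gamma d).
Hypothesis mm : forall p q, mbnd D M (m p q).
Hypothesis ell : bulk_ell d gamma c1 C1 m.
Hypothesis bJ : bulk_J d gamma m.
Let mD : measurable (D : set T2) := layer_cont_meas d cg.
Local Notation H := (HH gamma d).
Local Notation qf := (qf d gamma kb m).
Local Notation pf := (pf d gamma kb m).
Local Notation mu0 := (mu_coer m0 Kb c1 C1).

Lemma mu_coer_ge0 : 0 <= mu0.
Proof.
have h : 0 < c1 / (2 * (Kb + 1)) by rewrite divr_gt0// mulr_gt0// ltr_wpDl.
by rewrite /mu_coer !addr_ge0 ?mulr_ge0 ?addr_ge0 ?invr_ge0 ?(ltW m0_gt0) ?(ltW h) ?(ltW c1_gt0).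
Qed.

Lemma qf_coer U : H U -> c1 / 2 * NN D U.1 <= qf U U + mu0 * ZZ D U.1.
Proof.
move=> HU; have sU := HH_sq HU.
have h1 := bf_coer mD mm sU ell.
have h2 := tf_self Kb0 mk kK HU.
pose tau := c1 / (2 * (Kb + 1)).
have K1 : 0 < 2 * (Kb + 1) by rewrite mulr_gt0// ltr_wpDl.
have tau0 : 0 < tau by rewrite divr_gt0.
have h3 : Kb * TT U <= Kb * (tau * GG D U.1 + (m0^-1 + tau^-1) * ZZ D U.1).
  exact: (ler_wpM2l Kb0 (TT_le m0_gt0 cg gm tau0 HU)).
have h4 : Kb * tau <= c1 / 2.
  have -> : c1 / 2 = (Kb + 1) * tau by rewrite /tau; field; rewrite gt_eqF// ltr_wpDl.
  by rewrite ler_pM2r// lerDl.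
have h5 : Kb * tau * GG D U.1 <= c1 / 2 * GG D U.1 by apply: ler_wpM2r => //; exact: GG_ge0.
rewrite /qf NNE /mu_coer -/tau.
move: h1 h2 h3 h5; set b := bf _ _ _ _; set t := tf _ _ _; set G := GG _ _; set Z := ZZ _ _; set T := TT _.
move: (m0^-1 + tau^-1) => w h1 h2 h3 h5; rewrite -subr_ge0.
have e1 : Kb * (tau * G + w * Z) = Kb * tau * G + Kb * w * Z by ring.
have e2 : (C1 + c1 / 2 + Kb * w) * Z = C1 * Z + c1 / 2 * Z + Kb * w * Z by ring.
rewrite e2; rewrite e1 in h3; rewrite mulrDr.
have e3 : c1 * G = c1 / 2 * G + c1 / 2 * G by field.
rewrite e3 in h1; move: (c1 / 2 * G) (c1 / 2 * Z) (C1 * Z) (Kb * w * Z) (Kb * tau * G) (Kb * T) h1 h2 h3 h5 => a1 a2 a3 a4 a5 a6.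
by lra.
Qed.

Lemma pf_self U : pf U U = qf U U.
Proof. by rewrite /pf /cross [X in _ - X]ipC subrr addr0. Qed.

Lemma slinJ U : H U -> H (slin (- mu0) (JJ U) U).
Proof. by move=> HU; apply: HH_lin => //; exact: HH_J. Qed.

Lemma pf_coer U : H U -> c1 / 2 * NN D U.1 <= pf U (slin (- mu0) (JJ U) U).
Proof.
move=> HU; have HJ := HH_J cg HU.
rewrite (pf_linr cg mk kK mm (- mu0) HJ HU HU) (pf_J cg mk kK mm bJ HU) mulrNN pf_self addrC.
exact: qf_coer.
Qed.

Lemma NN_lin (a : R) (U V : cidx -> R * R -> R) : sqK D U -> sqK D V ->
  Num.sqrt (NN D (fun p x => a * U p x + V p x)) <= `|a| * Num.sqrt (NN D U) + Num.sqrt (NN D V).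
Proof.
move=> sU sV; pose b (U V : cidx -> R * R -> R) := \sum_p ip area D (U p) (V p).
have E : NN D (fun p x => a * U p x + V p x) = a ^+ 2 * NN D U + NN D V + 2 * (a * b U V).
  rewrite /NN /b !mulr_sumr -!big_split; apply: eq_bigr => p _ /=.
  rewrite (nnD mD (sqiZ mD a (sU p)) (sV p)) (nnZ mD a (sU p)) (ipZl mD a (sU p) (sV p)).
  by ring.
have CS : `|b U V| <= Num.sqrt (NN D U) * Num.sqrt (NN D V).
  have P (t : R) : 0 <= NN D V + t * (2 * b U V) + t ^+ 2 * NN D U.
    have -> : NN D V + t * (2 * b U V) + t ^+ 2 * NN D U = NN D (fun p x => t * U p x + V p x).
      rewrite /NN /b !mulr_sumr -!big_split; apply: eq_bigr => p _ /=.
      rewrite (nnD mD (sqiZ mD t (sU p)) (sV p)) (nnZ mD t (sU p)) (ipZl mD t (sU p) (sV p)).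
      by ring.
    exact: NN_ge0.
  have D0 : b U V ^+ 2 <= NN D U * NN D V.
    have := NN_ge0 D U; rewrite le_eqVlt => /predU1P[U0|U0].
      have h : b U V = 0.
        apply: (@quad_lin_eq0 R (b U V) (NN D V) (NN_ge0 _ _)) => t.
        have [->|t0] := eqVneq t 0; first by rewrite mul0r mulr0 expr0n/= mul0r addr0.
        have := mulr_ge0 (sqr_ge0 t) (P t^-1); rewrite -U0 mulr0 addr0.
        by congr (0 <= _); field.
      by rewrite h -U0 expr0n/= mul0r.
    have := P (- (b U V / NN D U)).
    have -> : NN D V + - (b U V / NN D U) * (2 * b U V) + (- (b U V / NN D U)) ^+ 2 * NN D U =
      (NN D U * NN D V - b U V ^+ 2) / NN D U by field; rewrite gt_eqF.
    by rewrite pmulr_lge0 ?invr_gt0// subr_ge0.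
  rewrite -sqrtrM ?NN_ge0// -sqrtr_sqr ler_sqrt// mulr_ge0 ?NN_ge0//.
rewrite -[leRHS]ger0_norm ?addr_ge0 ?mulr_ge0 ?sqrtr_ge0// -sqrtr_sqr ler_sqrt ?sqr_ge0// E sqrrD exprMn.
rewrite !sqr_sqrtr ?NN_ge0// real_normK ?num_real// addrAC lerD2r lerD2l.
rewrite -[X in _ <= X]mulr_natl -mulrA; apply: ler_wpM2l => //.
rewrite (le_trans (ler_norm _))// normrM; exact: ler_wpM2l.
Qed.

Definition stab_cst : R := (1 + mu0) / (c1 / 2).

(** The twisted test function turns a bound of the residual into a bound of [W]. The constant sees
    the layer only through [m0], hence is uniform in eps. *)
Lemma pf_stable (dlt : R) W : 0 <= dlt -> H W ->
  (forall V, H V -> `|pf W V| <= dlt * Num.sqrt (NN D V.1)) ->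
  Num.sqrt (NN D W.1) <= stab_cst * dlt.
Proof.
move=> dlt0 HW h; have HJ := HH_J cg HW.
have := pf_coer HW; have := h _ (slinJ HW); have := mu_coer_ge0.
have := NN_lin (- mu0) (HH_sq HJ) (HH_sq HW).
rewrite NN_J normrN => h1 mu_ge0 h2 h3.
have h4 : c1 / 2 * NN D W.1 <= dlt * ((mu0 + 1) * Num.sqrt (NN D W.1)).
  apply: le_trans h3 _; apply: le_trans (ler_norm _) _; apply: le_trans h2 _.
  apply: ler_wpM2l => //; apply: le_trans h1 _; rewrite ger0_norm//.
  by rewrite -subr_ge0 (_ : _ - _ = 0)//; ring.
have c12 : 0 < c1 / 2 by rewrite divr_gt0.
rewrite /stab_cst mulrAC ler_pdivlMr//.
have [s0|s0] := ltP 0 (Num.sqrt (NN D W.1)); last first.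
  apply: (@le_trans _ _ 0); first by rewrite pmulr_lle0.
  by rewrite mulr_ge0// addr_ge0.
rewrite -(ler_pM2r s0); move: h4; rewrite -[X in c1 / 2 * X](sqr_sqrtr (NN_ge0 D W.1)).
set r := Num.sqrt _ => h4; apply: le_trans (_ : c1 / 2 * r ^+ 2 <= _); first by rewrite -subr_ge0 (_ : _ - _ = 0)//; ring.
by apply: le_trans h4 _; rewrite -subr_ge0 (_ : _ - _ = 0)//; ring.
Qed.

(** The traces need no Cauchy hypothesis of their own, since [TT_leN] controls them by the norm. *)
Lemma HH_complete (Un : nat -> sdata) : (forall n, H (Un n)) ->
  (forall e : R, 0 < e -> exists N, forall i j, (N <= i)%N -> (N <= j)%N ->
     NN D (fun p x => (Un i).1 p x - (Un j).1 p x) <= e) ->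
  exists2 V, H V & (fun n => NN D (fun p x => (Un n).1 p x - V.1 p x)) @ \oo --> 0.
Proof.
move=> HU cau.
have G p : exists g, cvgL2 area D (fun n => (Un n).1 p) g.
  apply: (L2_complete mD) => [n|e e0]; first exact: (HH_sq (HU n)).
  have [N HN] := cau e e0; exists N => i j iN jN.
  by apply: le_trans (HN _ _ iN jN); exact: (nn_leNN D (fun p x => (Un i).1 p x - (Un j).1 p x)).
have {G}[g Hg] := choice G.
have G2 c : exists t, cvgL2 mu setT (fun n => (Un n).2 c) t.
  apply: (L2_complete measurableT) => [n|e e0]; first exact: (HH_tsq c (HU n)).
  have K0 : 0 < m0^-1 + 1 by rewrite ltr_wpDl// invr_ge0 ltW.
  have e'0 : 0 < e / (m0^-1 + 1) by rewrite divr_gt0.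
  have [N HN] := cau _ e'0; exists N => i j iN jN.
  have HB := HH_lin cg (-1) (HU j) (HU i).
  have E : (fun p x => (slin (-1) (Un j) (Un i)).1 p x) = (fun p x => (Un i).1 p x - (Un j).1 p x).
    by apply/funext => p; apply/funext => x; rewrite /=; ring.
  have E2 : (slin (-1) (Un j) (Un i)).2 c = (fun x => (Un i).2 c x - (Un j).2 c x).
    by apply/funext => x; rewrite /=; ring.
  rewrite -E2; apply: le_trans (nn_leTT _ c) _; apply: le_trans (TT_leN m0_gt0 cg gm HB) _.
  rewrite mulrC -ler_pdivlMr//; apply: le_trans (HN _ _ iN jN).
  by rewrite -E.
have {G2}[t Ht] := choice G2.
exists (g, t) => [c|].
  by apply: (H1_closed cg (fun n => HU n c)) => [k|]; [exact: (Hg (c, k))|exact: Ht].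
have z p : (fun n => nn area D (fun x => (Un n).1 p x - g p x)) @ \oo --> 0 by have [] := Hg p.
rewrite /NN; under eq_fun do rewrite big_cidx big_bool /=.
apply: (@cvg_eqr _ (0 + 0 + 0 + (0 + 0 + 0))); first by rewrite !addr0.
by apply: cvgD; apply: cvgD; [apply: cvgD|idtac|apply: cvgD|idtac]; exact: z.
Qed.

Definition pf_cst : R := 36 * M + 2 * Kb * (m0^-1 + 1) + 2.

Lemma pf_cst_ge0 : 0 <= pf_cst.
Proof. by rewrite /pf_cst !addr_ge0 ?mulr_ge0 ?addr_ge0 ?invr_ge0 ?(ltW m0_gt0). Qed.

Lemma pf_bound U V : H U -> H V -> `|pf U V| <= pf_cst * (Num.sqrt (NN D U.1) * Num.sqrt (NN D V.1)).
Proof.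
move=> HU HV; have sU := HH_sq HU; have sV := HH_sq HV.
have h1 := bf_bound mD M0 mm sU sV.
have h2 := tf_bound Kb0 mk kK HU HV.
have h3 := cross_bound cg sU sV.
set r := Num.sqrt (NN D U.1) * Num.sqrt (NN D V.1).
have r0 : 0 <= r by rewrite mulr_ge0 ?sqrtr_ge0.
have m1 : 0 <= m0^-1 + 1 by rewrite addr_ge0// invr_ge0 ltW.
have h4 : Num.sqrt (TT U) * Num.sqrt (TT V) <= (m0^-1 + 1) * r.
  rewrite -[X in X * r](ger0_norm m1) -sqrtr_sqr /r -!sqrtrM ?sqr_ge0 ?NN_ge0 ?TT_ge0//.
  rewrite ler_sqrt ?mulr_ge0 ?NN_ge0 ?sqr_ge0//.
  apply: le_trans (ler_pM (TT_ge0 _) (TT_ge0 _) (TT_leN m0_gt0 cg gm HU) (TT_leN m0_gt0 cg gm HV)) _.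
  by rewrite -subr_ge0 (_ : _ - _ = 0)//; ring.
have h5 : Num.sqrt (ZZ D U.1) * Num.sqrt (ZZ D V.1) <= r.
  by apply: ler_pM; rewrite ?sqrtr_ge0// ler_sqrt ?NN_ge0// ZZ_leNN.
have h2' : `|tf kb U V| <= 2 * Kb * ((m0^-1 + 1) * r).
  by apply: le_trans h2 _; apply: ler_wpM2l => //; rewrite mulr_ge0.
have h3' : `|cross D U.1 V.1| <= 2 * r by apply: le_trans h3 _; exact: ler_wpM2l.
rewrite /pf /qf; apply: le_trans (ler_normD _ _) _.
apply: le_trans (lerD (ler_normD _ _) (lexx _)) _.
apply: le_trans (lerD (lerD h1 h2') h3') _.
by rewrite /pf_cst -/r -subr_ge0 (_ : _ - _ = 0)//; ring.
Qed.

(* Testing with [V - mu0 J V] makes the form of [H - i] coercive, since [pf V (J V)]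
   is minus the squared L2 norm of [V]. *)
Definition twist U : sdata := slin (- mu0) (JJ U) U.

Lemma twist_lin (a : R) U V : twist (slin a U V) = slin a (twist U) (twist V).
Proof.
by congr pair; apply/funext => p; apply/funext => x; rewrite /=; case: ifP => _; ring.
Qed.

Lemma NN_twist U : H U -> Num.sqrt (NN D (twist U).1) <= (1 + mu0) * Num.sqrt (NN D U.1).
Proof.
move=> HU; have HJ := HH_J cg HU; have := NN_lin (- mu0) (HH_sq HJ) (HH_sq HU).
rewrite NN_J normrN ger0_norm ?mu_coer_ge0// => h; apply: le_trans h _.
by rewrite -subr_ge0 (_ : _ - _ = 0)//; ring.
Qed.

(** Since J^2 = -1, the inverse of 1 - mu0 J is (1 + mu0 J) / (1 + mu0^2). *)
Lemma twist_onto V : H V -> exists2 W, H W & V = twist W.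
Proof.
move=> HV; have HJ := HH_J cg HV.
have n0 : 1 + mu0 ^+ 2 != 0 by rewrite gt_eqF// ltr_pwDl// sqr_ge0.
exists (slin (mu0 / (1 + mu0 ^+ 2)) (JJ V) (slin ((1 + mu0 ^+ 2)^-1 - 1) V V)).
  by apply: HH_lin => //; exact: HH_lin.
rewrite [V in LHS]surjective_pairing; congr pair; apply/funext => -[].
- by case=> k; apply/funext => x; rewrite /=; field.
- by apply/funext => y; rewrite /=; field.
- by apply/funext => y; rewrite /=; field.
Qed.

Definition FL (f : bool -> R * R -> R) (V : cidx -> R * R -> R) : R :=
  \sum_c ip area D (f c) (V (c, None)).

Lemma FL_lin f (a : R) U V : (forall c, sqi area D (f c)) -> H U -> H V ->
  FL f (slin a U V).1 = a * FL f U.1 + FL f V.1.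
Proof.
move=> sf HU HV; rewrite /FL !big_bool /=.
have E c := ip_linr mD a (HH_sq HU (c, None)) (HH_sq HV (c, None)) (sf c).
by rewrite !E; ring.
Qed.

Lemma FL_bound f U : (forall c, sqi area D (f c)) -> H U ->
  `|FL f U.1| <= (Num.sqrt (nn area D (f true)) + Num.sqrt (nn area D (f false))) * Num.sqrt (ZZ D U.1).
Proof.
move=> sf HU; rewrite /FL big_bool /=; apply: le_trans (ler_normD _ _) _; rewrite mulrDl.
have h c : `|ip area D (f c) (U.1 (c, None))| <= Num.sqrt (nn area D (f c)) * Num.sqrt (ZZ D U.1).
  apply: le_trans (ip_CS mD (sf c) (HH_sq HU _)) _; apply: ler_wpM2l; first exact: sqrtr_ge0.
  by rewrite ler_sqrt ?ZZ_ge0// nn_leZZ.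
by apply: lerD.
Qed.

(** The same data with values in [R^o], which supplies the module structure that [lax_milgram] asks
    for. *)
Definition sdataL : lmodType R := ((cidx -> (R * R)%type -> R^o) * (bool -> R -> R^o))%type.

Lemma slinE (U V : sdataL) : U + V = slin 1 U V :> sdata.
Proof. by congr pair; apply/funext => p; apply/funext => x; rewrite mul1r. Qed.

Lemma slinZ a (U : sdataL) : a *: U = slin (a - 1) U U :> sdata.
Proof.
congr pair; apply/funext => p; apply/funext => x.
  by transitivity (a * U.1 p x) => //; ring.
by transitivity (a * U.2 p x) => //; ring.
Qed.

(** Lax-Milgram applies to pf(U, twist V), which is coercive; surjectivity of [twist] then frees the
    test function. *)
Lemma pf_exists f : (forall c, sqi area D (f c)) ->
  exists2 U, H U & forall V, H V -> pf U V = FL f V.1.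
Proof.
move=> sf.
pose b (U V : sdata) := \sum_p ip area D (U.1 p) (V.1 p).
have bN U : b U U = NN D U.1 by [].
have blin (a : R) U V W : H U -> H V -> H W -> b (slin a U V) W = a * b U W + b V W.
  move=> HU HV HW; rewrite /b mulr_sumr -big_split; apply: eq_bigr => p _.
  exact: (ip_linl mD a (HH_sq HU p) (HH_sq HV p) (HH_sq HW p)).
have bC U W : b U W = b W U by apply: eq_bigr => p _; exact: ipC.
have PD (u v : sdataL) : H u -> H v -> H (u + v).
  by move=> hu hv; rewrite slinE; exact: HH_lin.
have PZ a (u : sdataL) : H u -> H (a *: u).
  by move=> hu; rewrite slinZ; exact: HH_lin.
have bD (u v w : sdataL) : H u -> H v -> H w -> b (u + v) w = b u w + b v w.
  by move=> hu hv hw; rewrite slinE blin// mul1r.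
have bZ a (u w : sdataL) : H u -> H w -> b (a *: u) w = a * b u w.
  by move=> hu hw; rewrite slinZ blin//; ring.
have HT U : H U -> H (twist U) by exact: slinJ.
pose BB U V := pf U (twist V); pose FF V := FL f (twist V).1.
have Bl (a : R) U V W : H U -> H V -> H W -> BB (slin a U V) W = a * BB U W + BB V W.
  move=> HU HV HW; exact: (pf_linl cg mk kK mm a HU HV (HT _ HW)).
have Br (a : R) U V W : H U -> H V -> H W -> BB W (slin a U V) = a * BB W U + BB W V.
  move=> HU HV HW; rewrite /BB twist_lin; exact: (pf_linr cg mk kK mm a (HT _ HU) (HT _ HV) HW).
have Fl (a : R) U V : H U -> H V -> FF (slin a U V) = a * FF U + FF V.
  by move=> HU HV; rewrite /FF twist_lin; exact: (FL_lin a sf (HT _ HU) (HT _ HV)).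
have h1 (u v w : sdataL) : H u -> H v -> H w -> BB (u + v) w = BB u w + BB v w.
  by move=> hu hv hw; rewrite slinE Bl// mul1r.
have h2 a (u w : sdataL) : H u -> H w -> BB (a *: u) w = a * BB u w.
  by move=> hu hw; rewrite slinZ Bl//; ring.
have h3 (u v w : sdataL) : H u -> H v -> H w -> BB w (u + v) = BB w u + BB w v.
  by move=> hu hv hw; rewrite slinE Br// mul1r.
have h4 a (u w : sdataL) : H u -> H w -> BB w (a *: u) = a * BB w u.
  by move=> hu hw; rewrite slinZ Br//; ring.
have h5 (u v : sdataL) : H u -> H v -> `|BB u v| <= (pf_cst * (1 + mu0)) * (snorm b u * snorm b v).
  move=> hu hv; apply: le_trans (pf_bound hu (HT _ hv)) _; rewrite -mulrA; apply: ler_wpM2l; first exact: pf_cst_ge0.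
  apply: (@le_trans _ _ (Num.sqrt (NN D u.1) * ((1 + mu0) * Num.sqrt (NN D v.1)))).
    by apply: ler_wpM2l; [exact: sqrtr_ge0|exact: NN_twist].
  by rewrite /snorm !bN -subr_ge0 (_ : _ - _ = 0)//; ring.
have h6 (u : sdataL) : H u -> c1 / 2 * b u u <= BB u u by move=> hu; exact: pf_coer.
have h7 (u v : sdataL) : H u -> H v -> FF (u + v) = FF u + FF v.
  by move=> hu hv; rewrite slinE Fl// mul1r.
have h8 a (u : sdataL) : H u -> FF (a *: u) = a * FF u.
  by move=> hu; rewrite slinZ Fl//; ring.
pose Kf := Num.sqrt (nn area D (f true)) + Num.sqrt (nn area D (f false)).
have Kf0 : 0 <= Kf by rewrite addr_ge0 ?sqrtr_ge0.
have h9 (u : sdataL) : H u -> `|FF u| <= (Kf * (1 + mu0)) * snorm b u.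
  move=> hu; apply: le_trans (FL_bound sf (HT _ hu)) _; rewrite -mulrA; apply: ler_wpM2l => //.
  apply: le_trans (NN_twist hu); rewrite ler_sqrt ?NN_ge0//; exact: ZZ_leNN.
have bcpl (u : nat -> sdataL) : (forall n, H (u n)) ->
  (forall e : R, 0 < e -> exists N, forall m n : nat, (N <= m)%N -> (N <= n)%N ->
     b (u m - u n) (u m - u n) <= e) ->
  exists2 v : sdataL, H v & (fun n => b (u n - v) (u n - v)) @ \oo --> 0.
  exact: HH_complete.
have [U HU hU] := @lax_milgram R sdataL H b PD PZ bD bZ (fun u w _ _ => bC u w) (fun u _ => NN_ge0 D u.1) bcpl
  BB FF _ _ (c1 / 2) (ex_intro _ _ (@HH0 R d gamma cg)) (divr_gt0 c1_gt0 (ltr0Sn R 1)) h1 h2 h3 h4 h5 h6 h7 h8 h9.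
exists U => // V HV; have [W HW ->] := twist_onto HV; exact: hU.
Qed.

End Layer.
End WellPosed.

(** * Shift and strip estimates *)

Section ShiftTools.
Context {R : realType}.
Local Notation mu := (@lebesgue_measure R).
Local Notation area := (@area R).
Local Notation T2 := (measurableTypeR R * measurableTypeR R)%type.
Implicit Types (f g h u v : R * R -> R).

Definition nrm (D : set T2) f : R := Num.sqrt (nn area D f).

Lemma nrm_ge0 D f : 0 <= nrm D f. Proof. exact: sqrtr_ge0. Qed.

Lemma sqr_nrm D f : nrm D f ^+ 2 = nn area D f.
Proof. by rewrite sqr_sqrtr// nn_ge0. Qed.

Lemma nrm_le D f (x : R) : 0 <= x -> nn area D f <= x ^+ 2 -> nrm D f <= x.
Proof. by move=> x0 h; rewrite -[x]ger0_norm// -sqrtr_sqr ler_sqrt// sqr_ge0. Qed.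

Lemma nrm_sub (D E : set T2) f : measurable D -> measurable E -> E `<=` D -> sqi area D f ->
  nrm E f <= nrm D f.
Proof. by move=> mD mE ED sf; rewrite ler_sqrt ?nn_ge0// nn_sub. Qed.

Section D.
Variable D : set T2.
Hypothesis mD : measurable D.

Lemma nrmD f g : sqi area D f -> sqi area D g -> nrm D (fun x => f x + g x) <= nrm D f + nrm D g.
Proof. exact: nn_tri. Qed.

Lemma nrmZ (a : R) f : sqi area D f -> nrm D (fun x => a * f x) = `|a| * nrm D f.
Proof. by move=> sf; rewrite /nrm nnZ// sqrtrM ?sqr_ge0// sqrtr_sqr. Qed.

Lemma nrm_mb h (M : R) f : 0 <= M -> mbnd D M h -> sqi area D f ->
  nrm D (fun x => h x * f x) <= M * nrm D f.
Proof.
move=> M0 [mh bh] sf; apply: nrm_le; first by rewrite mulr_ge0// nrm_ge0.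
by rewrite exprMn sqr_nrm; exact: nn_mulM.
Qed.

Lemma sqi_mb h (M : R) f : mbnd D M h -> sqi area D f -> sqi area D (fun x => h x * f x).
Proof. by move=> [mh bh] sf; exact: sqi_mulM bh sf. Qed.

Lemma ip_nrm f g : sqi area D f -> sqi area D g -> `|ip area D f g| <= nrm D f * nrm D g.
Proof. exact: ip_CS. Qed.

End D.

Lemma area_line (s : R) : area [set x | x.2 = s] = 0%E.
Proof.
have -> : [set x : R * R | x.2 = s] = setT `*` [set s].
  by apply/seteqP; split => x /=; [move=> ->|case].
transitivity (mu (setT : set (measurableTypeR R)) * mu ([set s] : set (measurableTypeR R)))%E.
  by apply: product_measure1E => //; exact: measurable_set1.
by rewrite [X in (_ * X)%E]lebesgue_measure_set1 mule0.
Qed.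

Lemma layer_sub_r (gamma : R -> R) (s d : R) : s <= d -> layer gamma s `<=` layer gamma d.
Proof. by move=> sd x /andP[h1 h2]; apply/andP; split => //; exact: lt_le_trans sd. Qed.

Lemma layer_sub_l (gamma gamma' : R -> R) (d : R) : (forall y, gamma y <= gamma' y) ->
  layer gamma' d `<=` layer gamma d.
Proof. by move=> gg x /andP[h1 h2]; apply/andP; split => //; exact: le_lt_trans h1. Qed.

Lemma ip_split (gamma : R -> R) (s d : R) f g : continuous gamma -> s <= d -> (forall y, gamma y <= s) ->
  sqi area (layer gamma d) f -> sqi area (layer gamma d) g ->
  ip area (layer gamma d) f g = ip area (layer gamma s) f g + ip area (layer (fun=> s) d) f g.
Proof.
move=> cg sd gs sf sg.
have cs : continuous (fun _ : R => s) by move=> ?; exact: cvg_cst.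
have mA := layer_cont_meas d cg; have mB := layer_cont_meas s cg; have mC := layer_cont_meas d cs.
have BA := @layer_sub_r gamma s d sd; have CA := @layer_sub_l gamma (fun=> s) d gs.
have iA := ip_int mA sf sg.
have iB := @integrableS _ _ _ area (layer gamma d) _ _ mA mB BA iA.
have iC := @integrableS _ _ _ area (layer gamma d) _ _ mA mC CA iA.
have rA := int_restrict mA iA; have rB := int_restrict mB iB; have rC := int_restrict mC iC.
rewrite /ip Rintegral_mkcond [X in _ = X + _]Rintegral_mkcond [X in _ = _ + X]Rintegral_mkcond.
rewrite -RintegralD//; apply: ae_Rintegral => //.
- by apply/measurable_EFinP; exact: measurable_int rA.
- by apply/measurable_EFinP; exact: measurable_int (intD measurableT rB rC).
(* The two pieces together miss only the line x_2 = s, of area zero. *)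
exists [set x | x.2 = s]; split; [|exact: area_line|].
  have -> : [set x : R * R | x.2 = s] = setT `*` [set s].
    by apply/seteqP; split => x /=; [move=> ->|case].
  by apply: measurableX => //; exact: measurable_set1.
move=> x /= nx; apply: contrapT => xs; apply: nx => _; rewrite !patchE.
have [/set_mem/andP[h1 h2]|/negP nA] := boolP (x \in layer gamma d).
  have [h|h|//] := ltgtP x.2 s.
    rewrite ifT; last by apply/mem_set; rewrite /layer/= h1 h.
    rewrite ifF ?addr0//; apply/negbTE/negP => /set_mem/andP[/= h3 _].
    by move: (lt_trans h h3); rewrite ltxx.
  rewrite ifF; last by apply/negbTE/negP => /set_mem/andP[/= _ h3]; move: (lt_trans h h3); rewrite ltxx.
  by rewrite ifT ?add0r//; apply/mem_set; rewrite /layer/= h h2.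
rewrite !ifF ?addr0//; apply/negbTE/negP => /set_mem h; apply: nA; apply/mem_set;
  [exact: CA|exact: BA].
Qed.

Section Shift.
Variables (d s : R).
Hypotheses (d0 : 0 < d) (s0 : 0 <= s) (sd2 : s <= d / 2).
Let k : R := 1 - s / d.
Local Notation S := (shear s (1 - s / d)).
Local Notation Om := (layer (fun _ : R => 0) d).
Local Notation Ls := (layer (fun _ : R => s) d).

Lemma shift_sd : s < d. Proof. by apply: le_lt_trans sd2 _; rewrite ltr_pdivrMr// mulr_natr mulr2n ltrDl. Qed.

Lemma kappa_ge : 2^-1 <= k.
Proof.
rewrite /k lerBrDr -lerBrDl (_ : 1 - 2^-1 = 2^-1); last by field.
by rewrite ler_pdivrMr// mulrC.
Qed.

Lemma kappa_gt0 : 0 < k.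
Proof. by apply: lt_le_trans kappa_ge; rewrite invr_gt0. Qed.

Lemma kappa_le1 : k <= 1.
Proof. by rewrite /k gerBl divr_ge0// ltW. Qed.

Lemma kappaV_le2 : k^-1 <= 2.
Proof. by rewrite -[2]invrK lef_pV2 ?posrE ?kappa_gt0 ?invr_gt0// kappa_ge. Qed.

Let c0 : continuous (fun _ : R => 0 : R). Proof. by move=> ?; exact: cvg_cst. Qed.
Let cs : continuous (fun _ : R => s). Proof. by move=> ?; exact: cvg_cst. Qed.
Let mO : measurable (Om : set T2) := layer_cont_meas d c0.
Let mL : measurable (Ls : set T2) := layer_cont_meas d cs.

Lemma Ls_sub : Ls `<=` Om.
Proof. by apply: layer_sub_l => y. Qed.

Lemma shear_sq f : sqi area Ls f -> sqi area Om (f \o S).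
Proof. by move=> sf; have [h _] := shear_sqi s kappa_gt0 mL sf; move: h; rewrite (shear_layer0 s0 shift_sd). Qed.

Lemma shear_ip f g : sqi area Ls f -> sqi area Ls g ->
  ip area Om (f \o S) (g \o S) = k^-1 * ip area Ls f g.
Proof.
move=> sf sg; have [_] := shear_integral s kappa_gt0 mL (ip_int mL sf sg).
by rewrite (shear_layer0 s0 shift_sd).
Qed.

Lemma shear_nrm f : sqi area Ls f -> nrm Om (f \o S) <= 2 * nrm Ls f.
Proof.
move=> sf; apply: nrm_le; first by rewrite mulr_ge0// nrm_ge0.
rewrite /nn shear_ip// exprMn sqr_nrm; apply: ler_wpM2r; first exact: nn_ge0.
by apply: le_trans kappaV_le2 _; lra.
Qed.

Lemma mbnd_shear h (M : R) : mbnd Om M h -> measurable_fun (Om : set T2) (h \o S).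
Proof.
move=> [mh _]; apply: (measurable_comp mO _ mh).
  move=> _ [x Ox <-]; move: Ox; rewrite -{1}(shear_layer0 s0 shift_sd) => Lx.
  by apply: Ls_sub.
by apply: measurable_funTS; exact: shear_meas.
Qed.

Definition vlip (L : R) h : Prop := {ae area, forall x, Om x -> `|h (S x) - h x| <= L * s}.

Lemma vlip_mbnd (L M : R) h : mbnd Om M h -> vlip L h -> mbnd Om (L * s) (fun x => h (S x) - h x).
Proof.
move=> mh vh; split => //; apply: measurable_funB; first exact: mbnd_shear mh.
by have [] := mh.
Qed.

(** After the change of variables the sheared term is an integral over s < x_2 < d. Jacobian and
    chain-rule factors cost s / d, the displacement of the coefficient costs L s, and the strip 0 <
    x_2 < s is what remains. *)
Lemma entry_self h (M L : R) u v (a b : R) : 0 <= M -> 0 <= L -> mbnd Om M h -> vlip L h ->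
  sqi area Om u -> sqi area Om v -> a = 1 \/ a = k -> b = 1 \/ b = k ->
  `|ip area Om (fun x => h x * u x) v - ip area Om (fun x => h x * (a * u (S x))) (fun x => b * v (S x))
    - ip area (layer (fun=> 0) s) (fun x => h x * u x) v| <=
  (2 * M / d + 4 * L) * s * (nrm Om u * nrm Om v).
Proof.
move=> M0 L0 mh vh su sv a1 b1.
have suL := sqi_sub mO mL Ls_sub su; have svL := sqi_sub mO mL Ls_sub sv.
have shu := sqi_mb mO mh su.
have shuL := sqi_sub mO mL Ls_sub shu.
have SU := shear_sq suL; have SV := shear_sq svL; have SHU := shear_sq shuL.
have uL : nrm Ls u <= nrm Om u := nrm_sub mO mL Ls_sub su.
have SuL : nrm Om (u \o S) <= 2 * nrm Om u.
  by apply: le_trans (shear_nrm suL) _; rewrite ler_pM2l.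
have vL : nrm Ls v <= nrm Om v := nrm_sub mO mL Ls_sub sv.
have SvL : nrm Om (v \o S) <= 2 * nrm Om v.
  by apply: le_trans (shear_nrm svL) _; rewrite ler_pM2l.
have md := vlip_mbnd mh vh.
have sE := sqi_mb mO md SU.
have -> : ip area Om (fun x => h x * (a * u (S x))) (fun x => b * v (S x)) =
    a * b * (k^-1 * ip area Ls (fun x => h x * u x) v) - a * b * ip area Om (fun x => (h (S x) - h x) * (u \o S) x) (v \o S).
  rewrite -(shear_ip shuL svL) -mulrBr -RintegralB//; [|exact: (ip_int mO SHU SV)|exact: (ip_int mO sE SV)].
  rewrite -RintegralZl//; last exact: (intB mO (ip_int mO SHU SV) (ip_int mO sE SV)).
  by apply: eq_Rintegral => x _; rewrite /=; ring.
rewrite (ip_split c0 (ltW shift_sd) (fun _ => s0) shu sv).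
set X := ip _ _ _ _; set Y := ip _ _ _ _; set E := ip _ _ _ _.
have -> : X + Y - (a * b * (k^-1 * Y) - a * b * E) - X = (1 - a * b * k^-1) * Y + a * b * E by ring.
have r0 : 0 <= nrm Om u * nrm Om v by rewrite mulr_ge0 ?nrm_ge0.
have hY : `|Y| <= M * (nrm Om u * nrm Om v).
  apply: le_trans (ip_mb mL M0 (mbnd_sub mO Ls_sub mh) suL svL) _; apply: ler_wpM2l => //.
  by apply: ler_pM => //; exact: nrm_ge0.
have hE : `|E| <= L * s * (4 * (nrm Om u * nrm Om v)).
  apply: le_trans (ip_mb mO (mulr_ge0 L0 s0) md SU SV) _; apply: ler_wpM2l; first exact: mulr_ge0.
  have -> : 4 * (nrm Om u * nrm Om v) = (2 * nrm Om u) * (2 * nrm Om v) by ring.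
  by apply: ler_pM => //; exact: nrm_ge0.
have k_gt0 := kappa_gt0; have k1 := kappa_le1; have kV := kappaV_le2.
have ek : s / d = 1 - k by rewrite /k; ring.
have sd0 : 0 <= s / d by rewrite divr_ge0// ltW.
have hab : `|a * b| <= 1.
  have kk : k * k <= 1 by apply: mulr_ile1 => //; exact: ltW.
  by case: a1 => ->; case: b1 => ->; rewrite normrM ?normr1 ?mulr1 ?mul1r ?(gtr0_norm k_gt0).
(* The combinations of chain-rule factors give 1 - 1/k, 0 or 1 - k, each at most 2 s / d in absolute
   value because k >= 1/2. *)
have h1ab : `|1 - a * b * k^-1| <= 2 * (s / d).
  have e1 : 1 - k^-1 = - (s / d * k^-1) by rewrite ek; field; rewrite gt_eqF.
  have e2 : 1 - k * k * k^-1 = s / d by rewrite ek; field; rewrite gt_eqF.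
  have e3 : 1 - k * k^-1 = 0 by field; rewrite gt_eqF.
  case: a1 => ->; case: b1 => ->; rewrite ?mulr1 ?mul1r ?e1 ?e2 ?e3 ?normr0.
  - rewrite normrN normrM ger0_norm// gtr0_norm ?invr_gt0// mulrC.
    exact: ler_wpM2r.
  - by rewrite mulr_ge0.
  - by rewrite mulr_ge0.
  - by rewrite ger0_norm// ler_peMl//; lra.
apply: le_trans (ler_normD _ _) _.
apply: (@le_trans _ _ (2 * (s / d) * (M * (nrm Om u * nrm Om v)) + 1 * (L * s * (4 * (nrm Om u * nrm Om v))))).
  by rewrite (normrM (1 - _)) (normrM (a * b)); apply: lerD; apply: ler_pM.
by rewrite -subr_ge0 (_ : _ - _ = 0)//; field; rewrite gt_eqF.
Qed.

(** Only the test function is sheared here, from the perturbed layer to the flat one. Undoing the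
    change of variables produces u - u o S, which is where the shift estimate for the limit solution
    will enter. *)
Lemma entry_cross h (M L : R) (gamma : R -> R) u v (b : R) : continuous gamma ->
  (forall y, 0 <= gamma y <= s) -> 0 <= M -> 0 <= L -> mbnd Om M h -> vlip L h ->
  sqi area Om u -> sqi area (layer gamma d) v -> b = 1 \/ b = k ->
  `|ip area Om (fun x => h x * u x) (fun x => b * v (S x)) -
    ip area (layer gamma d) (fun x => h x * u x) v| <=
  (2 * (M / d + 2 * L) * s * nrm Om u + 2 * M * nrm Om (fun x => u x - u (S x)) +
   M * nrm (layer (fun=> 0) s) u) * nrm (layer gamma d) v.
Proof.
move=> cg gs M0 L0 mh vh su sv b1.
have mG := layer_cont_meas d cg; have mGs := layer_cont_meas s cg.
have gs' y : gamma y <= s by case/andP: (gs y).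
have GO : layer gamma d `<=` Om by apply: layer_sub_l => y; case/andP: (gs y).
have LG : Ls `<=` layer gamma d by exact: layer_sub_l.
have GsG : layer gamma s `<=` layer gamma d := @layer_sub_r gamma s d (ltW shift_sd).
have suL := sqi_sub mO mL Ls_sub su; have svL := sqi_sub mG mL LG sv.
have shu := sqi_mb mO mh su.
have shuL := sqi_sub mO mL Ls_sub shu.
have SU := shear_sq suL; have SV := shear_sq svL; have SHU := shear_sq shuL.
have uL : nrm Ls u <= nrm Om u := nrm_sub mO mL Ls_sub su.
have SuL : nrm Om (u \o S) <= 2 * nrm Om u.
  by apply: le_trans (shear_nrm suL) _; rewrite ler_pM2l.
have md := vlip_mbnd mh vh.
have sE := sqi_mb mO md SU.
have sB := sqiB mO su SU.
have shB := sqi_mb mO mh sB.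
have k_gt0 := kappa_gt0; have k1 := kappa_le1.
rewrite (ip_split cg (ltW shift_sd) gs' (sqi_sub mO mG GO shu) sv).
set X := ip area (layer gamma s) _ _; set Y := ip area Ls _ _.
have EY : Y = k * ip area Om ((fun x => h x * u x) \o S) (v \o S).
  by rewrite (shear_ip shuL svL) mulrA mulfV ?mul1r// gt_eqF.
have EI : ip area Om (fun x => h x * u x) (fun x => b * v (S x)) = b * ip area Om (fun x => h x * u x) (v \o S).
  by rewrite ipC (ipZl mO b SV shu) ipC.
have -> : ip area Om (fun x => h x * u x) (fun x => b * v (S x)) - (X + Y) =
   (b - k) * ip area Om (fun x => h x * u x) (v \o S) + k * ip area Om (fun x => h x * (u x - (u \o S) x)) (v \o S)
   - k * ip area Om (fun x => (h (S x) - h x) * (u \o S) x) (v \o S) - X.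
  have -> : ip area Om (fun x => h x * (u x - (u \o S) x)) (v \o S) = ip area Om (fun x => h x * u x) (v \o S) -
     ip area Om ((fun x => h x * u x) \o S) (v \o S) + ip area Om (fun x => (h (S x) - h x) * (u \o S) x) (v \o S).
    have i1 := ip_int mO shu SV; have i2 := ip_int mO SHU SV; have i3 := ip_int mO sE SV.
    rewrite -RintegralB// -RintegralD//; last exact: (intB mO i1 i2).
    by apply: eq_Rintegral => x _; rewrite /=; ring.
  by rewrite EI EY; ring.
have nv : nrm Om (v \o S) <= 2 * nrm (layer gamma d) v.
  by apply: le_trans (shear_nrm svL) _; rewrite ler_pM2l//; exact: nrm_sub mG mL LG sv.
have V0 := nrm_ge0 (layer gamma d) v.
have ek : s / d = 1 - k by rewrite /k; ring.
have sd0 : 0 <= s / d by rewrite divr_ge0// ltW.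
have hb : `|b - k| <= s / d.
  by case: b1 => ->; [rewrite -ek ger0_norm|rewrite subrr normr0].
have b_1 : `|(b - k) * ip area Om (fun x => h x * u x) (v \o S)| <= s / d * (M * (nrm Om u * (2 * nrm (layer gamma d) v))).
  rewrite normrM; apply: ler_pM => //; apply: le_trans (ip_mb mO M0 mh su SV) _; apply: ler_wpM2l => //.
  by apply: ler_wpM2l => //; exact: nrm_ge0.
have b_2 : `|k * ip area Om (fun x => h x * (u x - (u \o S) x)) (v \o S)| <=
    1 * (M * (nrm Om (fun x => u x - u (S x)) * (2 * nrm (layer gamma d) v))).
  rewrite normrM; apply: ler_pM => //; first by rewrite gtr0_norm.
  apply: le_trans (ip_mb mO M0 mh sB SV) _; apply: ler_wpM2l => //.
  by apply: ler_wpM2l => //; exact: nrm_ge0.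
have b_3 : `|k * ip area Om (fun x => (h (S x) - h x) * (u \o S) x) (v \o S)| <=
    1 * (L * s * (2 * nrm Om u * (2 * nrm (layer gamma d) v))).
  rewrite normrM; apply: ler_pM => //; first by rewrite gtr0_norm.
  apply: le_trans (ip_mb mO (mulr_ge0 L0 s0) md SU SV) _; apply: ler_wpM2l; first exact: mulr_ge0.
  by apply: ler_pM => //; exact: nrm_ge0.
have b_4 : `|X| <= M * (nrm (layer (fun=> 0) s) u * nrm (layer gamma d) v).
  have G0 : layer gamma s `<=` layer (fun=> 0) s by apply: layer_sub_l => y; case/andP: (gs y).
  have m0s := layer_cont_meas s c0.
  have s0s : layer (fun=> 0) s `<=` Om := @layer_sub_r (fun=> 0) s d (ltW shift_sd).
  have su0 := sqi_sub mO m0s s0s su.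
  apply: le_trans (ip_mb mGs M0 (mbnd_sub mO (subset_trans G0 s0s) mh) (sqi_sub m0s mGs G0 su0) (sqi_sub mG mGs GsG sv)) _.
  apply: ler_wpM2l => //; apply: ler_pM; rewrite ?nrm_ge0//; exact: nrm_sub.
apply: le_trans (ler_normB _ _) _; apply: le_trans (lerD (ler_normB _ _) (lexx _)) _.
apply: le_trans (lerD (lerD (ler_normD _ _) (lexx _)) (lexx _)) _.
apply: le_trans (lerD (lerD (lerD b_1 b_2) b_3) b_4) _.
by rewrite -subr_ge0 (_ : _ - _ = 0)//; field; rewrite gt_eqF.
Qed.

End Shift.
End ShiftTools.

(** The linear arithmetic of the energy comparison, with each integral replaced by a variable. *)
Lemma energy_diff (R : realType) (b1 b2 b3 t1 t2 e g zs zz t : R) :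
  - e <= b1 - b2 - b3 -> g - zs <= b3 -> zs <= zz -> t1 - t2 <= t ->
  b2 + t1 - (b1 + t2) <= e - (g - zz) + t.
Proof. by move=> *; lra. Qed.

Lemma energy_bound (R : realType) (q1 q2 q3 e g zz t mz mz' w x : R) :
  w <= 2 * q2 - q1 + q3 + mz -> q2 <= x -> q3 - q1 <= e - (g + g - zz) + (g + t) ->
  mz <= mz' -> w + g <= 2 * x + (e + zz + t) + mz'.
Proof. by move=> *; lra. Qed.

(** * The limit solution against its vertical shift *)

Section ShiftDifference.
Context {R : realType}.
Local Notation mu := (@lebesgue_measure R).
Local Notation area := (@area R).
Local Notation T2 := (measurableTypeR R * measurableTypeR R)%type.
Implicit Types (p q : cidx) (c : bool) (gamma : R -> R).

Variables (d s : R).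
Hypotheses (d0 : 0 < d) (s0 : 0 <= s) (sd2 : s <= d / 2).
Local Notation k := (1 - s / d).
Local Notation S := (shear s (1 - s / d)).
Local Notation Om := (layer (fun _ : R => 0) d).
Local Notation H0 := (HH (fun _ : R => 0) d).
Local Notation strip := (layer (fun _ : R => 0) s).
Let c0 : continuous (fun _ : R => 0 : R). Proof. by move=> ?; exact: cvg_cst. Qed.
Let cs : continuous (fun _ : R => s). Proof. by move=> ?; exact: cvg_cst. Qed.
Let mO : measurable (Om : set T2) := layer_cont_meas d c0.
Let mS : measurable (strip : set T2) := layer_cont_meas s c0.
Let sd : s < d := shift_sd d0 sd2.
Let dh : 0 < d / 2. Proof. by rewrite divr_gt0. Qed.
Let sO : strip `<=` Om := @layer_sub_r R (fun=> 0) s d (ltW sd).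

Definition shiftK (U : cidx -> R * R -> R) : cidx -> R * R -> R :=
  fun p x => vwt k p.2 * U p (S x).

Lemma half_margin (g : R -> R) : (forall y, 0 <= g y <= s) -> forall y, g y + d / 2 <= d.
Proof. by move=> gs y; case/andP: (gs y) => _ gy; move: (d) (s) sd2 gy => *; lra. Qed.

(** The data are restricted to x_2 > s and pulled back by [S]; the trace changes by at most s times
    the vertical energy between the two curves. With gamma = 0 this is u o S for the limit problem,
    with the oscillating curve it makes test functions admissible. *)
Lemma HH_shift gamma (U : sdata) : continuous gamma -> (forall y, 0 <= gamma y <= s) -> HH gamma d U ->
  exists V : sdata, [/\ H0 V, V.1 = shiftK U.1 &
    forall c, nn mu setT (fun y => V.2 c y - U.2 c y) <= s * nn area (layer gamma s) (U.1 (c, Some 1))].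
Proof.
move=> cg gs HU.
have P c : exists t, H1 (fun=> 0) d (shift_data s k (fun j => U.1 (c, j))) t /\
    nn mu setT (fun y => t y - U.2 c y) <= s * nn area (layer gamma s) (U.1 (c, Some 1)).
  have [t Ht nt] := @H1_restrict R gamma d cg (fun j => U.1 (c, j)) (U.2 c) (fun=> s) (d / 2) s s cs dh s0
    (half_margin gs) (fun y => proj2 (andP (gs y))) (fun y => lexx s) (ltW sd)
    (fun y => ltac:(by rewrite lerBlDr lerDl; case/andP: (gs y))) (HU c).
  by exists t; split => //; exact: H1_shear.
have {P}[t Ht] := choice P.
by exists (shiftK U.1, t); split => // c; have [] := Ht c.
Qed.

Lemma HH_restr gamma (U : sdata) : continuous gamma -> (forall y, 0 <= gamma y <= s) -> H0 U ->
  exists V : sdata, [/\ HH gamma d V, V.1 = U.1 &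
    forall c, nn mu setT (fun y => V.2 c y - U.2 c y) <= s * nn area strip (U.1 (c, Some 1))].
Proof.
move=> cg gs HU.
have P c : exists t, H1 gamma d (fun j => U.1 (c, j)) t /\
    nn mu setT (fun y => t y - U.2 c y) <= s * nn area strip (U.1 (c, Some 1)).
  have z2 (y : R) : 0 + d / 2 <= d by rewrite add0r ler_pdivrMr// mulr_natr mulr2n lerDl ltW.
  have [t h1 h2] := (@H1_restrict R (fun=> 0) d c0 (fun j => U.1 (c, j)) (U.2 c) gamma (d / 2) s s cg dh s0
    z2 (fun y => proj1 (andP (gs y))) (fun y => proj2 (andP (gs y))) (ltW sd)
    (fun y => ltac:(by rewrite subr0; case/andP: (gs y))) (HU c)).
  by exists t.
have {P}[t Ht] := choice P.
by exists (U.1, t); split => // c; have [] := Ht c.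
Qed.

Lemma kV2 : k^-1 <= 2. Proof. exact: kappaV_le2. Qed.
Lemma k_gt0 : 0 < k. Proof. exact: kappa_gt0. Qed.

(** Order s, not sqrt(s): one vertical derivative is available on the whole layer. *)
Lemma nrm_diff gamma (U : sdata) c : continuous gamma -> (forall y, 0 <= gamma y <= s) -> HH gamma d U ->
  sqi area (layer gamma d) (U.1 (c, None) \o S) /\
  nrm (layer gamma d) (fun x => U.1 (c, None) (S x) - U.1 (c, None) x) <= 2 * s * Num.sqrt (NN (layer gamma d) U.1).
Proof.
move=> cg gs HU.
have [sS h] := @H1_shift_le R gamma d cg _ _ s s0 sd (fun y => ltac:(by case/andP: (gs y) => -> h1; rewrite (le_trans h1) ?ltW)) (HU c).
split => //; apply: nrm_le; first by rewrite !mulr_ge0 ?sqrtr_ge0.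
apply: le_trans h _; rewrite exprMn sqr_sqrtr ?NN_ge0//; apply: ler_pM; rewrite ?nn_ge0 ?divr_ge0 ?sqr_ge0 ?(ltW k_gt0)//.
  rewrite exprMn [2 ^+ 2 * _]mulrC; apply: ler_wpM2l; first exact: sqr_ge0.
  by apply: le_trans kV2 _; lra.
exact: nn_leNN.
Qed.

(** The constant of the trace inequality with tau = 1 in a layer of thickness at least d / 2. *)
Definition Kd : R := (d / 2)^-1 + 1^-1.
Lemma Kd_ge1 : 1 <= Kd.
Proof. by rewrite /Kd invr1 lerDr invr_ge0 ltW. Qed.
Lemma Kd_ge0 : 0 <= Kd. Proof. exact: le_trans Kd_ge1. Qed.

Lemma nn_strip_le gamma (U : sdata) c : continuous gamma -> (forall y, 0 <= gamma y <= s) -> HH gamma d U ->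
  nn area (layer gamma s) (U.1 (c, None)) <= s * (Kd * NN (layer gamma d) U.1).
Proof.
move=> cg gs HU.
have h := @H1_strip R gamma d cg _ _ s 1 (d / 2) s ltr01 dh s0 (half_margin gs) (ltW sd)
  (fun y => ltac:(by rewrite lerBlDr lerDl; case/andP: (gs y))) (HU c).
apply: le_trans h _; apply: ler_wpM2l => //; rewrite mul1r.
have h1 := nn_leNN (layer gamma d) U.1 (c, Some 1); have h2 := nn_leNN (layer gamma d) U.1 (c, None).
have h3 := @nn_ge0 _ _ _ area (layer gamma d) (U.1 (c, Some 1)).
have h4 : nn area (layer gamma d) (U.1 (c, Some 1)) + nn area (layer gamma d) (U.1 (c, None)) <= NN (layer gamma d) U.1.
  rewrite NNE GGE ZZE.
  have n p := @nn_ge0 _ _ _ area (layer gamma d) (U.1 p).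
  have n1 := n (c, Some 0); have n2 := n (~~ c, Some 0); have n3 := n (~~ c, Some 1); have n4 := n (~~ c, None).
  by case: c n1 n2 n3 n4 h1 h2 h3 => /= *; lra.
rewrite -/Kd; apply: (@le_trans _ _ (Kd * nn area (layer gamma d) (U.1 (c, Some 1)) + Kd * nn area (layer gamma d) (U.1 (c, None)))).
  by rewrite lerD2r ler_peMl// Kd_ge1.
by rewrite -mulrDr; apply: ler_wpM2l => //; exact: Kd_ge0.
Qed.

Lemma vwt_or j : vwt k j = 1 \/ vwt k j = k.
Proof. by rewrite /vwt; case: ifP => _; [right|left]. Qed.

Lemma shiftK_sq U : sqK Om U -> sqK Om (shiftK U).
Proof.
move=> sU p; apply: (sqiZ mO); apply: (shear_sq d0 s0 sd2).
by apply: (sqi_sub mO (layer_cont_meas d cs) _ (sU p)); exact: Ls_sub.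
Qed.

Lemma nrm_shiftS U p : sqK Om U -> nrm Om (U p \o S) <= 2 * nrm Om (U p).
Proof.
move=> sU; have mL := layer_cont_meas d cs.
have LO : layer (fun=> s) d `<=` Om by exact: Ls_sub.
apply: le_trans (shear_nrm d0 s0 sd2 (sqi_sub mO mL LO (sU p))) _.
by rewrite ler_pM2l//; exact: nrm_sub mO mL LO (sU p).
Qed.

Lemma nrm_shiftK U p : sqK Om U -> nrm Om (shiftK U p) <= 2 * nrm Om (U p).
Proof.
move=> sU; have mL := layer_cont_meas d cs.
have LO : layer (fun=> s) d `<=` Om by exact: Ls_sub.
have sS : sqi area Om (U p \o S) := shear_sq d0 s0 sd2 (sqi_sub mO mL LO (sU p)).
rewrite /shiftK (nrmZ mO _ sS); apply: le_trans (nrm_shiftS p sU).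
rewrite ler_piMl ?nrm_ge0//; case: (vwt_or p.2) => ->; rewrite ?normr1// ger0_norm ?kappa_le1//.
exact: ltW k_gt0.
Qed.

Section Estimates.
Variables (kb : R -> R) (Kb M L c1 C1 : R) (m : cidx -> cidx -> R * R -> R).
Hypotheses (Kb0 : 0 <= Kb) (M0 : 0 <= M) (L0 : 0 <= L) (c1_gt0 : 0 < c1) (C10 : 0 <= C1).
Hypothesis mk : measurable_fun setT kb.
Hypothesis kK : forall y, `|kb y| <= Kb.
Hypothesis mm : forall p q, mbnd Om M (m p q).
Hypothesis ell : bulk_ell d (fun=> 0) c1 C1 m.
Hypothesis bJ : bulk_J d (fun=> 0) m.
Hypothesis msym : forall p q x, Om x -> m p q x = m q p x.
Hypothesis mlip : forall p q, ~~ ((p.2 == None) && (q.2 == None)) -> vlip d s L (m p q).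

(** The first two terms come from [entry_self]. The others come from pairs of undifferentiated
    functions: 6 M = 2 M + 4 M from the two shifted factors, M Kd from the strip. *)
Definition CB1 : R := 2 * M / d + 4 * L + 6 * M + M * Kd.

Lemma CB1_ge0 : 0 <= CB1.
Proof. by rewrite /CB1 !addr_ge0 ?mulr_ge0 ?invr_ge0 ?Kd_ge0 ?(ltW d0). Qed.

(** Entries containing a derivative follow [entry_self]. The entries of A_0 have no Lipschitz bound,
    but there u o S - u itself is of order s in L2, which replaces it. *)
Lemma bf_shift_self (U : sdata) : H0 U ->
  `|bf Om m U.1 U.1 - bf Om m (shiftK U.1) (shiftK U.1) - bf strip m U.1 U.1| <= 36 * CB1 * s * NN Om U.1.
Proof.
move=> HU; have sU := HH_sq HU.
set r := Num.sqrt (NN Om U.1).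
have r0 : 0 <= r by exact: sqrtr_ge0.
have r2 : r ^+ 2 = NN Om U.1 by rewrite sqr_sqrtr ?NN_ge0.
have ur p : nrm Om (U.1 p) <= r by rewrite ler_sqrt ?NN_ge0// nn_leNN.
have gs0 (y : R) : 0 <= (0 : R) <= s by rewrite lexx.
have E p q : `|ip area Om (fun x => m p q x * U.1 p x) (U.1 q) -
    ip area Om (fun x => m p q x * shiftK U.1 p x) (shiftK U.1 q) -
    ip area strip (fun x => m p q x * U.1 p x) (U.1 q)| <= CB1 * s * r ^+ 2.
  have [/andP[/eqP p0 /eqP q0]|npq] := boolP ((p.2 == None) && (q.2 == None)); last first.
    have := entry_self d0 s0 sd2 M0 L0 (mm p q) (mlip npq) (sU p) (sU q) (vwt_or p.2) (vwt_or q.2).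
    move=> h; apply: le_trans h _; apply: ler_pM.
    - by rewrite mulr_ge0// addr_ge0 ?mulr_ge0 ?invr_ge0 ?(ltW d0).
    - by rewrite mulr_ge0 ?nrm_ge0.
    - by apply: ler_wpM2r => //; rewrite /CB1 -addrA lerDl addr_ge0 ?mulr_ge0 ?Kd_ge0.
    - by rewrite expr2; apply: ler_pM; rewrite ?nrm_ge0.
  case: p p0 => c [//|] _; case: q q0 => c' [//|] _.
  have [su hu] := nrm_diff c c0 gs0 HU; have [sv hv] := nrm_diff c' c0 gs0 HU.
  rewrite -/r in hu hv.
  have z (e : bool) : shiftK U.1 (e, None) = U.1 (e, None) \o S by apply/funext => x; rewrite /shiftK /vwt/= mul1r.
  rewrite !z; set h := m _ _; set u := U.1 (c, None) in su hu *; set v := U.1 (c', None) in sv hv *.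
  have mh : mbnd Om M h := mm _ _.
  have sqv := sU (c', None); have squ := sU (c, None).
  have sdu := sqiB mO su squ; have sdv := sqiB mO sv sqv.
  have s1 := sqi_mb mO mh squ; have s2 := sqi_mb mO mh su; have s3 := sqi_mb mO mh sdu.
  have -> : ip area Om (fun x => h x * u x) v - ip area Om (fun x => h x * (u \o S) x) (v \o S) =
     - (ip area Om (fun x => h x * u x) (fun x => (v \o S) x - v x) + ip area Om (fun x => h x * ((u \o S) x - u x)) (v \o S)).
    have i1 := ip_int mO s1 sqv; have i2 := ip_int mO s2 sv; have i3 := ip_int mO s1 sdv; have i4 := ip_int mO s3 sv.
    rewrite -[LHS]opprB; congr (- _); rewrite -RintegralB// -RintegralD//.
    by apply: eq_Rintegral => x _; rewrite /=; ring.
  have b1 := ip_mb mO M0 mh squ sdv; have b2 := ip_mb mO M0 mh sdu sv.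
  have b3 := ip_mb mS M0 (mbnd_sub mO sO mh) (sqi_sub mO mS sO squ) (sqi_sub mO mS sO sqv).
  have st e : nrm strip (U.1 (e, None)) <= Num.sqrt (s * (Kd * r ^+ 2)).
    by rewrite r2 ler_sqrt ?mulr_ge0 ?NN_ge0 ?Kd_ge0//; exact: nn_strip_le.
  have b3' : M * (nrm strip u * nrm strip v) <= M * (s * (Kd * r ^+ 2)).
    apply: ler_wpM2l => //; rewrite -[X in _ <= X]sqr_sqrtr ?mulr_ge0 ?Kd_ge0 ?sqr_ge0// expr2.
    by apply: ler_pM; rewrite ?nrm_ge0// st.
  have b1' : M * (nrm Om u * nrm Om (fun x => (v \o S) x - v x)) <= M * (r * (2 * s * r)).
    by apply: ler_wpM2l => //; apply: ler_pM; rewrite ?nrm_ge0// ur.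
  have b2' : M * (nrm Om (fun x => (u \o S) x - u x) * nrm Om (v \o S)) <= M * (2 * s * r * (2 * r)).
    apply: ler_wpM2l => //; apply: ler_pM; rewrite ?nrm_ge0//.
    by apply: le_trans (nrm_shiftS (c', None) sU) _; rewrite ler_pM2l.
  apply: le_trans (ler_normB _ _) _; rewrite normrN.
  apply: le_trans (lerD (ler_normD _ _) (lexx _)) _.
  apply: le_trans (lerD (lerD (le_trans b1 b1') (le_trans b2 b2')) (le_trans b3 b3')) _.
  rewrite -subr_ge0 (_ : _ - _ = (2 * M / d + 4 * L) * s * r ^+ 2); last by rewrite /CB1; ring.
  by rewrite !mulr_ge0 ?sqr_ge0// addr_ge0 ?mulr_ge0 ?invr_ge0 ?(ltW d0).
have -> : bf Om m U.1 U.1 - bf Om m (shiftK U.1) (shiftK U.1) - bf strip m U.1 U.1 =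
  \sum_p \sum_q (ip area Om (fun x => m p q x * U.1 p x) (U.1 q) -
    ip area Om (fun x => m p q x * shiftK U.1 p x) (shiftK U.1 q) -
    ip area strip (fun x => m p q x * U.1 p x) (U.1 q)).
  rewrite /bf -!sumrB; apply: eq_bigr => p _; by rewrite -!sumrB.
apply: le_trans (ler_norm_sum _ _ _) _.
have card : \sum_(p : cidx) \sum_(q : cidx) (CB1 * s * r ^+ 2) = 36 * CB1 * s * NN Om U.1.
  have c6 : #|{: cidx}| = 6%N by rewrite card_prod card_bool card_option card_ord.
  by rewrite !sumr_const !c6 -mulrnA -[LHS]mulr_natl r2 /=; ring.
rewrite -card; apply: ler_sum => p _; apply: le_trans (ler_norm_sum _ _ _) _; exact: ler_sum.
Qed.

Local Notation mu0 := (mu_coer (d / 2) Kb c1 C1).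
Local Notation acst := (stab_cst (d / 2) Kb c1 C1).

(** The four terms pay for the L2 norm of U - U o S in the coercivity inequality, for the zero-order
    part of the strip energy, for the change of variables in the bulk, and for the boundary term
    after completing a square. *)
Definition CB2 : R := 4 * d * mu0 + 2 * C1 * Kd + 36 * CB1 + 18 * Kb ^+ 2 * Kd / c1.
Definition CB : R := 2 / c1 * (6 * (1 + 2 * acst) * acst + CB2 * acst ^+ 2).

Lemma CB2_ge0 : 0 <= CB2.
Proof.
have h1 := mu_coer_ge0 dh Kb0 c1_gt0 C10; have h2 := CB1_ge0; have h3 := Kd_ge0.
have h4 := ltW d0; have h5 := ltW c1_gt0.
by rewrite /CB2 !addr_ge0 ?mulr_ge0 ?sqr_ge0 ?invr_ge0.
Qed.

Lemma acst_ge0 : 0 <= acst.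
Proof.
have h1 := mu_coer_ge0 dh Kb0 c1_gt0 C10.
apply: divr_ge0; first exact: addr_ge0.
by apply: divr_ge0 => //; exact: ltW.
Qed.

Lemma CB_ge0 : 0 <= CB.
Proof.
have h1 := acst_ge0; have h2 := CB2_ge0; have h3 := ltW c1_gt0.
rewrite /CB mulr_ge0//; first by rewrite mulr_ge0// invr_ge0.
apply: addr_ge0; last by rewrite mulr_ge0// sqr_ge0.
by apply: mulr_ge0 => //; apply: mulr_ge0 => //; apply: addr_ge0 => //; apply: mulr_ge0.
Qed.

(* Testing the equation with [U - U o S] and comparing the energies of [U] and
   [U o S] gains a factor [s] without any second derivatives. *)
Lemma shift_difference_estimate (f : bool -> R * R -> R) (U : sdata) (phi : R) : (forall c, sqi area Om (f c)) -> H0 U ->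
  (forall V, H0 V -> pf d (fun=> 0) kb m U V = FL d (fun=> 0) f V.1) ->
  phi = nrm Om (f true) + nrm Om (f false) ->
  [/\ Num.sqrt (NN Om U.1) <= acst * phi, GG strip U.1 <= CB * s * phi ^+ 2 &
    NN Om (fun p x => -1 * shiftK U.1 p x + U.1 p x) <= CB * s * phi ^+ 2].
Proof.
move=> sf HU eqU ephi.
have phi0 : 0 <= phi by rewrite ephi addr_ge0 ?nrm_ge0.
have gs0 (y : R) : 0 <= (0 : R) <= s by rewrite lexx.
have gm0 (y : R) : 0 + d / 2 <= d := half_margin gs0 y.
have FLb V : H0 V -> `|FL d (fun=> 0) f V.1| <= phi * Num.sqrt (ZZ Om V.1).
  by move=> HV; rewrite ephi; exact: FL_bound.
set r := Num.sqrt (NN Om U.1).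
have r0 : 0 <= r by exact: sqrtr_ge0.
have r2 : r ^+ 2 = NN Om U.1 by rewrite sqr_sqrtr ?NN_ge0.
have ra : r <= acst * phi.
  apply: (pf_stable dh Kb0 c1_gt0 C10 c0 gm0 mk kK mm ell bJ phi0 HU) => V HV.
  rewrite eqU//; apply: le_trans (FLb _ HV) _; apply: ler_wpM2l => //.
  by rewrite ler_sqrt ?NN_ge0// ZZ_leNN.
have [SU [HS ES TS]] := HH_shift c0 gs0 HU.
set W := slin (-1) SU U.
have HW : H0 W by exact: HH_lin.
have sU := HH_sq HU.
set G := GG strip U.1.
have G0 : 0 <= G by exact: GG_ge0.
have Wc c : nn area Om (W.1 (c, None)) <= (2 * s * r) ^+ 2.
  have [su hu] := nrm_diff c c0 gs0 HU.
  have -> : nn area Om (W.1 (c, None)) = nn area Om (fun x => U.1 (c, None) (S x) - U.1 (c, None) x).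
    by apply: eq_Rintegral => x _; rewrite /W /= ES /shiftK /vwt/=; ring.
  by rewrite -sqr_nrm ler_sqr ?nnegrE ?nrm_ge0 ?mulr_ge0.
(* The equation tested with [W] sees only this norm, because the right-hand side and the term -i u
   are of order zero. *)
have ZW : Num.sqrt (ZZ Om W.1) <= 3 * s * r.
  rewrite -[X in _ <= X]ger0_norm ?mulr_ge0// -sqrtr_sqr ler_sqrt ?sqr_ge0// ZZE.
  apply: le_trans (lerD (Wc true) (Wc false)) _.
  rewrite -subr_ge0 (_ : _ - _ = (s * r) ^+ 2); last by ring.
  exact: sqr_ge0.
have ZW2 : ZZ Om W.1 <= 4 * d * s * r ^+ 2.
  rewrite ZZE; apply: le_trans (lerD (Wc true) (Wc false)) _.
  rewrite -subr_ge0 (_ : _ - _ = 8 * s * (d / 2 - s) * r ^+ 2); last by field.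
  by rewrite !mulr_ge0 ?sqr_ge0// subr_ge0.
(* The trace of [W] is an increment across the strip. Its smallness relative to the strip energy [G]
   lets the boundary terms be absorbed by [G]. *)
have TW : TT W <= s * G.
  rewrite TTE /G GGE.
  have e c : nn mu setT (W.2 c) = nn mu setT (fun y => SU.2 c y - U.2 c y).
    by apply: eq_Rintegral => y _; rewrite /W/=; ring.
  rewrite !e; apply: le_trans (lerD (TS true) (TS false)) _; rewrite -subr_ge0.
  rewrite (_ : _ - _ = s * (nn area strip (U.1 (true, Some 0)) + nn area strip (U.1 (false, Some 0)))); last by ring.
  by rewrite mulr_ge0// addr_ge0// nn_ge0.
have KdE : (d / 2)^-1 + 1 = Kd by rewrite /Kd invr1.
have TU : TT U <= Kd * r ^+ 2 by rewrite r2 -KdE; exact: TT_leN dh c0 gm0 _ HU.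
have TSU : TT SU <= Kd * (2 * r) ^+ 2.
  apply: le_trans (TT_leN dh c0 gm0 HS) _; rewrite KdE; apply: ler_wpM2l; first exact: Kd_ge0.
  rewrite exprMn r2 /NN mulr_sumr; apply: ler_sum => p _.
  rewrite -!sqr_nrm -exprMn ler_sqr ?nnegrE ?nrm_ge0 ?mulr_ge0 ?nrm_ge0// ES.
  exact: nrm_shiftK.
pose g := Num.sqrt G; pose sg := Num.sqrt s; pose kd := Num.sqrt Kd.
have g0 : 0 <= g by exact: sqrtr_ge0.
have sg0 : 0 <= sg by exact: sqrtr_ge0.
have kd0 : 0 <= kd by exact: sqrtr_ge0.
have gE : G = g ^+ 2 by rewrite sqr_sqrtr.
have sgE : s = sg ^+ 2 by rewrite sqr_sqrtr.
have kdE : Kd = kd ^+ 2 by rewrite sqr_sqrtr// Kd_ge0.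
have sqle (x y : R) : 0 <= y -> x <= y ^+ 2 -> Num.sqrt x <= y.
  by move=> y0 xy; rewrite -[y]ger0_norm// -sqrtr_sqr ler_sqrt ?sqr_ge0.
have tW : Num.sqrt (TT W) <= sg * g by apply: sqle; rewrite ?mulr_ge0// exprMn -sgE -gE.
have tU : Num.sqrt (TT U) <= kd * r by apply: sqle; rewrite ?mulr_ge0// exprMn -kdE.
have tS : Num.sqrt (TT SU) <= kd * (2 * r) by apply: sqle; rewrite ?mulr_ge0// exprMn -kdE.
have htf : tf kb SU SU - tf kb U U <= c1 / 2 * G + 18 * Kb ^+ 2 * Kd / c1 * s * r ^+ 2.
  have -> : tf kb SU SU - tf kb U U = - (tf kb W U + tf kb SU W).
    rewrite /W (tf_linl mk kK (-1) HS HU HU) (tf_linr mk kK (-1) HS HU HS).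
    by ring.
  have h1 := tf_bound Kb0 mk kK HW HU; have h2 := tf_bound Kb0 mk kK HS HW.
  have h3 : `|tf kb W U| <= 2 * Kb * (sg * g * (kd * r)).
    by apply: le_trans h1 _; apply: ler_wpM2l; [rewrite mulr_ge0|apply: ler_pM; rewrite ?sqrtr_ge0].
  have h4 : `|tf kb SU W| <= 2 * Kb * (kd * (2 * r) * (sg * g)).
    by apply: le_trans h2 _; apply: ler_wpM2l; [rewrite mulr_ge0|apply: ler_pM; rewrite ?sqrtr_ge0].
  apply: le_trans (ler_norm _) _; rewrite normrN; apply: le_trans (ler_normD _ _) _.
  apply: le_trans (lerD h3 h4) _; rewrite -subr_ge0.
  (* Young's inequality as a completed square: c1 / 2 of the strip energy pays for the product of
     traces. *)
  rewrite (_ : _ - _ = (2 * c1)^-1 * (c1 * g - 6 * Kb * kd * sg * r) ^+ 2).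
    by rewrite mulr_ge0 ?sqr_ge0// invr_ge0 mulr_ge0// ltW.
  by rewrite gE {1}sgE kdE; field; rewrite gt_eqF.
have hbf := bf_shift_self HU.
have hst : c1 * G - C1 * ZZ strip U.1 <= bf strip m U.1 U.1.
  apply: (bf_coer mS (fun p q => mbnd_sub mO sO (mm p q)) (fun p => sqi_sub mO mS sO (sU p))).
  by apply: aeS ell => x hx /sO; exact: hx.
have hzs : ZZ strip U.1 <= 2 * Kd * s * r ^+ 2.
  rewrite ZZE r2; apply: le_trans (lerD (nn_strip_le true c0 gs0 HU) (nn_strip_le false c0 gs0 HU)) _.
  by rewrite -subr_ge0 (_ : _ - _ = 0)//; ring.
have hco := qf_coer dh Kb0 c1_gt0 c0 gm0 mk kK mm ell HW.
have HUW : qf d (fun=> 0) kb m U W <= (phi + 2 * r) * (3 * s * r).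
  have -> : qf d (fun=> 0) kb m U W = FL d (fun=> 0) f W.1 - cross Om U.1 W.1.
    by rewrite -(eqU _ HW) /pf addrK.
  apply: le_trans (ler_norm _) _; apply: le_trans (ler_normB _ _) _.
  have h1 := FLb _ HW; have h2 := cross_bound c0 sU (HH_sq HW).
  apply: le_trans (lerD h1 h2) _; rewrite [X in _ <= X]mulrDl; apply: lerD; first by apply: ler_wpM2l.
  rewrite -(mulrA 2 r) ler_pM2l//; apply: ler_pM; rewrite ?sqrtr_ge0//.
  by rewrite ler_sqrt ?NN_ge0// ZZ_leNN.
(* Symmetry eliminates the mixed energy of U and SU: the energy of W is twice the tested equation
   plus an energy difference. *)
have EQ : qf d (fun=> 0) kb m W W = 2 * qf d (fun=> 0) kb m U W - qf d (fun=> 0) kb m U U + qf d (fun=> 0) kb m SU SU.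
  have qsym A B : qf d (fun=> 0) kb m A B = qf d (fun=> 0) kb m B A.
    by rewrite /qf (bf_sym _ _ msym) tf_sym.
  rewrite /W (qf_linl c0 mk kK mm (-1) HS HU HW) !(qf_linr c0 mk kK mm (-1) HS HU) //.
  by rewrite (qsym U SU); ring.
have hE : qf d (fun=> 0) kb m SU SU - qf d (fun=> 0) kb m U U <=
    36 * CB1 * s * r ^+ 2 - (c1 * G - C1 * (2 * Kd * s * r ^+ 2)) + (c1 / 2 * G + 18 * Kb ^+ 2 * Kd / c1 * s * r ^+ 2).
  have hz : C1 * ZZ strip U.1 <= C1 * (2 * Kd * s * r ^+ 2) by exact: ler_wpM2l.
  move: hbf; rewrite -r2 ler_norml => /andP[hbf _].
  by rewrite /qf ES; apply: energy_diff hbf hst hz htf.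
have mu_ge0 := mu_coer_ge0 dh Kb0 c1_gt0 C10.
(* One half of c1 G was spent on the boundary term; the other half stays on the left beside the norm
   of W, so one inequality bounds both. *)
have final : c1 / 2 * (NN Om W.1 + G) <= s * (6 * (phi + 2 * r) * r + CB2 * r ^+ 2).
  have hm : mu0 * ZZ Om W.1 <= mu0 * (4 * d * s * r ^+ 2) by exact: ler_wpM2l.
  have -> : s * (6 * (phi + 2 * r) * r + CB2 * r ^+ 2) =
    2 * ((phi + 2 * r) * (3 * s * r)) + (36 * CB1 * s * r ^+ 2 + C1 * (2 * Kd * s * r ^+ 2)
      + 18 * Kb ^+ 2 * Kd / c1 * s * r ^+ 2) + mu0 * (4 * d * s * r ^+ 2).
    by rewrite /CB2; ring.
  have cG : c1 * G = c1 / 2 * G + c1 / 2 * G by field.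
  rewrite mulrDr; rewrite EQ in hco; rewrite cG in hE.
  exact: energy_bound hco HUW hE hm.
have fin2 : NN Om W.1 + G <= CB * s * phi ^+ 2.
  have c12 : 0 < c1 / 2 by rewrite divr_gt0.
  rewrite -(ler_pM2l c12); apply: le_trans final _.
  have -> : c1 / 2 * (CB * s * phi ^+ 2) = s * (6 * (phi + 2 * (acst * phi)) * (acst * phi) + CB2 * (acst * phi) ^+ 2).
    by rewrite /CB; field; rewrite gt_eqF.
  have a0 := acst_ge0; have C0 := CB2_ge0.
  apply: ler_wpM2l => //; apply: lerD.
    apply: ler_pM => //; first by rewrite mulr_ge0// addr_ge0// mulr_ge0.
    by apply: ler_wpM2l => //; rewrite lerD2l ler_pM2l.
  apply: ler_wpM2l => //; rewrite ler_sqr ?nnegrE// mulr_ge0//.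
have WN : NN Om W.1 = NN Om (fun p x => -1 * shiftK U.1 p x + U.1 p x).
  by rewrite /W /slin/= ES.
split => //; first by apply: le_trans fin2; rewrite lerDr NN_ge0.
by rewrite -WN; apply: le_trans fin2; rewrite lerDl.
Qed.

End Estimates.
End ShiftDifference.

Ltac nonneg := repeat first
  [ assumption | exact: ler0n | exact: ler01 | exact: sqr_ge0 | exact: nrm_ge0 | exact: sqrtr_ge0
  | by apply: ltW | apply: addr_ge0 | apply: mulr_ge0 | rewrite invr_ge0 ].

(** * Comparison of the two solutions *)

Section StripPerturbation.
Context {R : realType}.
Local Notation mu := (@lebesgue_measure R).
Local Notation area := (@area R).
Local Notation T2 := (measurableTypeR R * measurableTypeR R)%type.
Implicit Types (p q : cidx) (c : bool).

Variables (d s : R) (gamma : R -> R).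
Hypotheses (d0 : 0 < d) (s0 : 0 <= s) (sd2 : s <= d / 2).
Hypothesis cg : continuous gamma.
Hypothesis gs : forall y, 0 <= gamma y <= s.
Local Notation k := (1 - s / d).
Local Notation S := (shear s (1 - s / d)).
Local Notation Om := (layer (fun _ : R => 0) d).
Local Notation Og := (layer gamma d).
Local Notation Ls := (layer (fun _ : R => s) d).
Local Notation H0 := (HH (fun _ : R => 0) d).
Local Notation Hg := (HH gamma d).
Local Notation strip := (layer (fun _ : R => 0) s).
Local Notation Kd := (Kd d).
Let c0 : continuous (fun _ : R => 0 : R). Proof. by move=> ?; exact: cvg_cst. Qed.
Let cs : continuous (fun _ : R => s). Proof. by move=> ?; exact: cvg_cst. Qed.
Let mO : measurable (Om : set T2) := layer_cont_meas d c0.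
Let mS : measurable (strip : set T2) := layer_cont_meas s c0.
Let mG : measurable (Og : set T2) := layer_cont_meas d cg.
Let mGs : measurable (layer gamma s : set T2) := layer_cont_meas s cg.
Let mL : measurable (Ls : set T2) := layer_cont_meas d cs.
Let sd : s < d := shift_sd d0 sd2.
Let dh : 0 < d / 2. Proof. by rewrite divr_gt0. Qed.
Let sO : strip `<=` Om := @layer_sub_r R (fun=> 0) s d (ltW sd).
Let gs1 y : gamma y <= s. Proof. by case/andP: (gs y). Qed.
Let GO : Og `<=` Om. Proof. by apply: layer_sub_l => y; case/andP: (gs y). Qed.
Let LG : Ls `<=` Og. Proof. exact: layer_sub_l. Qed.
Let LO : Ls `<=` Om. Proof. exact: subset_trans LG GO. Qed.
Let GsG : layer gamma s `<=` Og := @layer_sub_r R gamma s d (ltW sd).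
Let gs0 (y : R) : 0 <= (0 : R) <= s. Proof. by rewrite lexx. Qed.
Let rs : R := Num.sqrt s.
Let rd : R := Num.sqrt d.
Let kd : R := Num.sqrt Kd.
Let rs0 : 0 <= rs. Proof. exact: sqrtr_ge0. Qed.
Let rd0 : 0 <= rd. Proof. exact: sqrtr_ge0. Qed.
Let kd0 : 0 <= kd. Proof. exact: sqrtr_ge0. Qed.
Let rsE : rs ^+ 2 = s. Proof. by rewrite sqr_sqrtr. Qed.
Let rdE : rd ^+ 2 = d. Proof. by rewrite sqr_sqrtr// ltW. Qed.
Let kdE : kd ^+ 2 = Kd. Proof. by rewrite sqr_sqrtr// Kd_ge0. Qed.

Lemma s_le_rs : s <= rs * rd.
Proof.
rewrite -[X in X <= _]rsE expr2; apply: ler_wpM2l => //.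
by rewrite ler_sqrt ?(ltW d0)//; exact: ltW.
Qed.

Local Notation nrm1 u := (Num.sqrt (nn mu setT u)).

Lemma sqrt_le (x y : R) : 0 <= y -> x <= y ^+ 2 -> Num.sqrt x <= y.
Proof. by move=> y0 xy; rewrite -[y]ger0_norm// -sqrtr_sqr ler_sqrt ?sqr_ge0. Qed.

Lemma NN_shiftK_le (V : cidx -> R * R -> R) : sqK Og V -> NN Om (shiftK d s V) <= (2 * Num.sqrt (NN Og V)) ^+ 2.
Proof.
move=> sV; rewrite exprMn sqr_sqrtr ?NN_ge0// /NN mulr_sumr; apply: ler_sum => p _.
have sL := sqi_sub mG mL LG (sV p).
have sS : sqi area Om (V p \o S) := shear_sq d0 s0 sd2 sL.
rewrite -!sqr_nrm -exprMn ler_sqr ?nnegrE ?mulr_ge0 ?nrm_ge0// /shiftK nrmZ//.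
apply: (@le_trans _ _ (nrm Om (V p \o S))).
  rewrite ler_piMl ?nrm_ge0//; case: (vwt_or d s p.2) => ->; rewrite ?normr1// ger0_norm ?kappa_le1//.
  exact: ltW (k_gt0 d0 sd2).
by apply: le_trans (shear_nrm d0 s0 sd2 sL) _; rewrite ler_pM2l//; exact: nrm_sub mG mL LG (sV p).
Qed.

Definition Cz : R := 3 * kd + 2 * rd.
Lemma Cz_ge0 : 0 <= Cz. Proof. by rewrite addr_ge0// mulr_ge0. Qed.

(** [F] has no regularity, so the shear is compared on the test function: its mass in the strips
    costs sqrt(s), and v o S - v costs s. *)
Lemma zero_order (F : R * R -> R) (V : sdata) c : sqi area Om F -> Hg V ->
  `|ip area Om F (V.1 (c, None) \o S) - ip area Og F (V.1 (c, None))| <=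
  Cz * rs * (nrm Om F * Num.sqrt (NN Og V.1)).
Proof.
move=> sF HV; have sV := HH_sq HV.
have [SV [HS ES _]] := HH_shift d0 s0 sd2 cg gs HV.
set r := Num.sqrt (NN Og V.1); have r0 : 0 <= r by exact: sqrtr_ge0.
have E : SV.1 (c, None) = V.1 (c, None) \o S by rewrite ES; apply/funext => x; rewrite /shiftK /vwt/= mul1r.
have h1 : nrm strip (V.1 (c, None) \o S) <= 2 * kd * rs * r.
  apply: sqrt_le; first by nonneg.
  rewrite -E; apply: le_trans (nn_strip_le d0 s0 sd2 c c0 gs0 HS) _; rewrite ES.
  have -> : (2 * kd * rs * r) ^+ 2 = s * (Kd * (2 * r) ^+ 2) by rewrite -rsE -kdE; ring.
  by do 2 (apply: ler_wpM2l; rewrite ?Kd_ge0//); exact: NN_shiftK_le.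
have [sS' h2'] := nrm_diff d0 s0 sd2 c cg gs HV; rewrite -/r in h2'.
have sSO : sqi area Om (V.1 (c, None) \o S) by rewrite -E; exact: HH_sq HS _.
have sD := sqiB mG sS' (sV (c, None)).
have h2 : nrm Ls (fun x => V.1 (c, None) (S x) - V.1 (c, None) x) <= 2 * rd * rs * r.
  apply: le_trans (nrm_sub mG mL LG sD) _; apply: le_trans h2' _; apply: ler_wpM2r => //.
  by rewrite -mulrA ler_pM2l// mulrC; exact: s_le_rs.
have h3 : nrm (layer gamma s) (V.1 (c, None)) <= kd * rs * r.
  apply: sqrt_le; first by nonneg.
  apply: le_trans (nn_strip_le d0 s0 sd2 c cg gs HV) _.
  have -> : (kd * rs * r) ^+ 2 = s * (Kd * r ^+ 2) by rewrite -rsE -kdE; ring.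
  by rewrite sqr_sqrtr ?NN_ge0.
have sFG := sqi_sub mO mG GO sF; have sFL := sqi_sub mO mL LO sF.
rewrite (ip_split c0 (ltW sd) (fun _ => s0) sF sSO) (ip_split cg (ltW sd) gs1 sFG (sV (c, None))).
have sDL := sqi_sub mG mL LG sD.
have i1 := ip_int mL sFL (sqi_sub mO mL LO sSO); have i2 := ip_int mL sFL (sqi_sub mG mL LG (sV (c, None))).
have e : ip area Ls F (V.1 (c, None) \o S) - ip area Ls F (V.1 (c, None)) =
   ip area Ls F (fun x => V.1 (c, None) (S x) - V.1 (c, None) x).
  by rewrite -RintegralB//; apply: eq_Rintegral => x _; rewrite /=; ring.
set X := ip area strip _ _; set Y := ip area (layer gamma s) _ _.
rewrite (_ : _ - _ = X + (ip area Ls F (V.1 (c, None) \o S) - ip area Ls F (V.1 (c, None))) - Y); last by ring.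
rewrite e; apply: le_trans (ler_normB _ _) _; apply: le_trans (lerD (ler_normD _ _) (lexx _)) _.
have F0 := nrm_ge0 Om F.
have b1 : `|X| <= nrm Om F * (2 * kd * rs * r).
  apply: le_trans (ip_nrm mS (sqi_sub mO mS sO sF) (sqi_sub mO mS sO sSO)) _.
  by apply: ler_pM; rewrite ?nrm_ge0//; exact: nrm_sub mO mS sO sF.
have b2 : `|ip area Ls F (fun x => V.1 (c, None) (S x) - V.1 (c, None) x)| <= nrm Om F * (2 * rd * rs * r).
  apply: le_trans (ip_nrm mL sFL sDL) _.
  by apply: ler_pM; rewrite ?nrm_ge0//; exact: nrm_sub mO mL LO sF.
have b3 : `|Y| <= nrm Om F * (kd * rs * r).
  apply: le_trans (ip_nrm mGs (sqi_sub mG mGs GsG sFG) (sqi_sub mG mGs GsG (sV _))) _.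
  apply: ler_pM; rewrite ?nrm_ge0//; apply: le_trans (nrm_sub mG mGs GsG sFG) _.
  exact: nrm_sub mO mG GO sF.
apply: le_trans (lerD (lerD b1 b2) b3) _.
by rewrite -subr_ge0 (_ : _ - _ = 0)// /Cz; ring.
Qed.

Section Estimates.
Variables (kb0 kbg : R -> R) (Kb M L c1 C1 om : R) (m : cidx -> cidx -> R * R -> R).
Hypotheses (Kb0 : 0 <= Kb) (M0 : 0 <= M) (L0 : 0 <= L) (c1_gt0 : 0 < c1) (C10 : 0 <= C1) (om0 : 0 <= om).
Hypothesis mk0 : measurable_fun setT kb0.
Hypothesis kK0 : forall y, `|kb0 y| <= Kb.
Hypothesis mkg : measurable_fun setT kbg.
Hypothesis kKg : forall y, `|kbg y| <= Kb.
Hypothesis mm : forall p q, mbnd Om M (m p q).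
Hypothesis ell : bulk_ell d (fun=> 0) c1 C1 m.
Hypothesis bJ : bulk_J d (fun=> 0) m.
Hypothesis msym : forall p q x, Om x -> m p q x = m q p x.
Hypothesis mlip : forall p q, ~~ ((p.2 == None) && (q.2 == None)) -> vlip d s L (m p q).
Hypothesis osc : forall U V : sdata, H0 U -> H0 V ->
  `|tf (fun y => kb0 y - kbg y) U V| <= om * (Num.sqrt (NN Om U.1) * Num.sqrt (NN Om V.1)).

Local Notation acst := (stab_cst (d / 2) Kb c1 C1).
Local Notation CBc := (CB d Kb M L c1 C1).
Local Notation cb := (Num.sqrt CBc).

(** The first term serves the pairs without derivatives, the others bound the three terms of
    [entry_cross]. *)
Definition Ce : R := Cz * M * acst + 2 * (M / d + 2 * L) * rd * acst + 2 * M * (cb + 2 / d * rd * acst) +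
  M * (cb + kd * acst).

(* Neither [s] nor [om] enters the constant. *)
Definition CC : R := acst * (Cz + 36 * Ce + 2 * Cz * acst + 6 * Kb * kd * acst + 2 * acst).

(** The limit solution, restricted to the perturbed layer, almost solves the perturbed problem: the
    shear of a test function is admissible in the limit problem, and subtracting the two equations
    leaves a small residual, to which [pf_stable] applies. *)
Lemma strip_perturbation_estimate (f : bool -> R * R -> R) (U0 Ue : sdata) (phi : R) : (forall c, sqi area Om (f c)) ->
  H0 U0 -> Hg Ue ->
  (forall V, H0 V -> pf d (fun=> 0) kb0 m U0 V = FL d (fun=> 0) f V.1) ->
  (forall V, Hg V -> pf d gamma kbg m Ue V = FL d gamma f V.1) ->
  phi = nrm Om (f true) + nrm Om (f false) ->
  Num.sqrt (NN Og (fun p x => -1 * U0.1 p x + Ue.1 p x)) <= CC * (rs + om) * phi.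
Proof.
move=> sf HU0 HUe eq0 eqe ephi.
have phi0 : 0 <= phi by rewrite ephi addr_ge0 ?nrm_ge0.
have a0 : 0 <= acst by exact: acst_ge0.
have CB0 : 0 <= CBc by exact: CB_ge0.
have Cz0 := Cz_ge0.
have cb0 : 0 <= cb by exact: sqrtr_ge0.
have [ra hG hW] := shift_difference_estimate d0 s0 sd2 Kb0 M0 L0 c1_gt0 C10 mk0 kK0 mm ell bJ msym mlip sf HU0 eq0 ephi.
set r := Num.sqrt (NN Om U0.1) in ra.
have r0 : 0 <= r by exact: sqrtr_ge0.
have sU := HH_sq HU0.
have ur p : nrm Om (U0.1 p) <= r by rewrite ler_sqrt ?NN_ge0// nn_leNN.
have [RU [HR ER TR]] := HH_restr d0 s0 sd2 cg gs HU0.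
have HW : Hg (slin (-1) RU Ue) by exact: HH_lin.
have gm := half_margin sd2 gs.
have mmg p q : mbnd Og M (m p q) := mbnd_sub mO GO (mm p q).
have ellg : bulk_ell d gamma c1 C1 m by apply: aeS ell => x hx /GO; exact: hx.
have bJg : bulk_J d gamma m by move=> x /GO; exact: bJ.
pose dlt := (Cz + 36 * Ce + 2 * Cz * acst + 6 * Kb * kd * acst + 2 * acst) * (rs + om) * phi.
have Ce0 : 0 <= Ce.
  by rewrite /Ce; nonneg.
have dlt0 : 0 <= dlt by rewrite /dlt; nonneg.
suff key V : Hg V -> `|pf d gamma kbg m (slin (-1) RU Ue) V| <= dlt * Num.sqrt (NN Og V.1).
  have := pf_stable dh Kb0 c1_gt0 C10 cg gm mkg kKg mmg ellg bJg dlt0 HW key.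
  by rewrite /slin/= ER /CC /dlt !mulrA.
move=> HV; have sV := HH_sq HV.
set v := Num.sqrt (NN Og V.1); have v0 : 0 <= v by exact: sqrtr_ge0.
have vv p : nrm Og (V.1 p) <= v by rewrite ler_sqrt ?NN_ge0// nn_leNN.
have [SV [HS ES TS]] := HH_shift d0 s0 sd2 cg gs HV.
have ESN c : SV.1 (c, None) = V.1 (c, None) \o S by rewrite ES; apply/funext => x; rewrite /shiftK /vwt/= mul1r.
have rphi : rs * phi <= (rs + om) * phi by apply: ler_wpM2r => //; rewrite lerDl.
(* The shift estimate for the limit solution is spent here; its square root produces the rate
   sqrt(s). *)
have dif p : nrm Om (fun x => U0.1 p x - U0.1 p (S x)) <= (cb + 2 / d * rd * acst) * rs * phi.
  have sS : sqi area Om (U0.1 p \o S) := shear_sq d0 s0 sd2 (sqi_sub mO mL LO (sU p)).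
  have sW : sqi area Om (fun x => -1 * shiftK d s U0.1 p x + U0.1 p x).
    by apply: (sqiD mO) => //; apply: (sqiZ mO); exact: shiftK_sq.
  have -> : (fun x => U0.1 p x - U0.1 p (S x)) =
     (fun x => (-1 * shiftK d s U0.1 p x + U0.1 p x) + (vwt k p.2 - 1) * (U0.1 p \o S) x).
    by apply/funext => x; rewrite /shiftK/=; ring.
  apply: le_trans (nrmD mO sW (sqiZ mO _ sS)) _; rewrite nrmZ//.
  have h1 : nrm Om (fun x => -1 * shiftK d s U0.1 p x + U0.1 p x) <= cb * rs * phi.
    apply: sqrt_le; first by nonneg.
    apply: le_trans (nn_leNN Om (fun p x => -1 * shiftK d s U0.1 p x + U0.1 p x) p) _.
    by rewrite !exprMn rsE sqr_sqrtr.
  have h2 : `|vwt k p.2 - 1| <= s / d.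
    case: (vwt_or d s p.2) => ->; first by rewrite subrr normr0 divr_ge0// ltW.
    by rewrite addrAC subrr add0r normrN ger0_norm// divr_ge0// ltW.
  have h3 : `|vwt k p.2 - 1| * nrm Om (U0.1 p \o S) <= s / d * (2 * (acst * phi)).
    apply: ler_pM; rewrite ?nrm_ge0//; apply: le_trans (nrm_shiftS d0 s0 sd2 p sU) _.
    by rewrite ler_pM2l// (le_trans (ur p)).
  apply: le_trans (lerD h1 h3) _.
  have h4 : s / d * (2 * (acst * phi)) <= rs * rd / d * (2 * (acst * phi)).
    apply: ler_wpM2r; first by nonneg.
    by rewrite ler_pM2r ?invr_gt0//; exact: s_le_rs.
  apply: le_trans (lerD (lexx _) h4) _; rewrite -subr_ge0 (_ : _ - _ = 0)//; field; rewrite gt_eqF//.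
(* For derivatives this is the strip energy estimate; the function itself needs only the bound on
   vertical lines. *)
have stp p : nrm strip (U0.1 p) <= (cb + kd * acst) * rs * phi.
  case: p => c [j|].
    apply: (@le_trans _ _ (cb * rs * phi)); last first.
      rewrite -subr_ge0 (_ : _ - _ = kd * acst * rs * phi); last by ring.
      by nonneg.
    apply: sqrt_le; first by nonneg.
    apply: le_trans (nn_leGG strip (p := (c, Some j)) _ _) _ => //; apply: le_trans hG _.
    by rewrite !exprMn rsE sqr_sqrtr.
  apply: (@le_trans _ _ (kd * rs * r)).
    apply: sqrt_le; first by nonneg.
    apply: le_trans (nn_strip_le d0 s0 sd2 c c0 gs0 HU0) _.
    by rewrite !exprMn rsE kdE sqr_sqrtr ?NN_ge0// -subr_ge0 (_ : _ - _ = 0)//; ring.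
  apply: (@le_trans _ _ (kd * rs * (acst * phi))); first by apply: ler_wpM2l => //; rewrite mulr_ge0.
  rewrite -subr_ge0 (_ : _ - _ = cb * rs * phi); last by ring.
  by nonneg.
have Sz (F : R * R -> R) c : sqi area Om F ->
  `|ip area Om F (SV.1 (c, None)) - ip area Og F (V.1 (c, None))| <= Cz * rs * (nrm Om F * v).
  by move=> sF; rewrite ESN; exact: zero_order.
have b_bf : `|bf Om m U0.1 SV.1 - bf Og m U0.1 V.1| <= 36 * Ce * rs * phi * v.
  have E p q : `|ip area Om (fun x => m p q x * U0.1 p x) (SV.1 q) - ip area Og (fun x => m p q x * U0.1 p x) (V.1 q)| <=
      Ce * rs * phi * v.
    have rv : 0 <= rs * phi * v by rewrite !mulr_ge0.
    have [/andP[/eqP p0 /eqP q0]|npq] := boolP ((p.2 == None) && (q.2 == None)).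
      case: q q0 => c [//|] _.
      have h := Sz _ c (sqi_mb mO (mm p (c, None)) (sU p)); apply: le_trans h _.
      have h2 : nrm Om (fun x => m p (c, None) x * U0.1 p x) <= M * (acst * phi).
        apply: le_trans (nrm_mb mO M0 (mm p (c, None)) (sU p)) _; apply: ler_wpM2l => //.
        exact: le_trans (ur p) ra.
      apply: (@le_trans _ _ (Cz * rs * (M * (acst * phi) * v))).
        by apply: ler_wpM2l; [exact: mulr_ge0|apply: ler_wpM2r].
      have -> : Cz * rs * (M * (acst * phi) * v) = Cz * M * acst * (rs * phi * v) by ring.
      rewrite -subr_ge0 (_ : _ - _ = (2 * (M / d + 2 * L) * rd * acst + 2 * M * (cb + 2 / d * rd * acst) +
        M * (cb + kd * acst)) * (rs * phi * v)); last by rewrite /Ce; ring.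
      by nonneg.
    rewrite ES; have := entry_cross d0 s0 sd2 cg gs M0 L0 (mm p q) (mlip npq) (sU p) (sV q) (vwt_or d s q.2).
    move=> h; apply: le_trans h _.
    set A := (X in X * _ <= _).
    have A1 : A <= (2 * (M / d + 2 * L) * rd * acst + 2 * M * (cb + 2 / d * rd * acst) + M * (cb + kd * acst)) * (rs * phi).
      have t1 : 2 * (M / d + 2 * L) * s * nrm Om (U0.1 p) <= 2 * (M / d + 2 * L) * (rs * rd) * (acst * phi).
        apply: ler_pM; rewrite ?nrm_ge0//.
        - by nonneg.
        - apply: ler_wpM2l; last exact: s_le_rs.
          by nonneg.
        - exact: le_trans (ur p) ra.
      have t2 : 2 * M * nrm Om (fun x => U0.1 p x - U0.1 p (S x)) <= 2 * M * ((cb + 2 / d * rd * acst) * rs * phi).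
        by apply: ler_wpM2l => //; rewrite mulr_ge0.
      have t3 : M * nrm strip (U0.1 p) <= M * ((cb + kd * acst) * rs * phi) by exact: ler_wpM2l.
      rewrite /A; apply: le_trans (lerD (lerD t1 t2) t3) _.
      by rewrite -subr_ge0 (_ : _ - _ = 0)//; ring.
    apply: (@le_trans _ _ ((2 * (M / d + 2 * L) * rd * acst + 2 * M * (cb + 2 / d * rd * acst) + M * (cb + kd * acst)) * (rs * phi) * v)).
      apply: ler_pM; rewrite ?nrm_ge0//.
      by rewrite /A; nonneg.
    rewrite -subr_ge0 (_ : _ - _ = Cz * M * acst * (rs * phi * v)); last by rewrite /Ce; ring.
    by nonneg.
  have -> : bf Om m U0.1 SV.1 - bf Og m U0.1 V.1 =
    \sum_p \sum_q (ip area Om (fun x => m p q x * U0.1 p x) (SV.1 q) - ip area Og (fun x => m p q x * U0.1 p x) (V.1 q)).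
    rewrite /bf -!sumrB; apply: eq_bigr => p _; by rewrite -!sumrB.
  apply: le_trans (ler_norm_sum _ _ _) _.
  have card : \sum_(p : cidx) \sum_(q : cidx) (Ce * rs * phi * v) = 36 * Ce * rs * phi * v.
    have c6 : #|{: cidx}| = 6%N by rewrite card_prod card_bool card_option card_ord.
    by rewrite !sumr_const !c6 -mulrnA -[LHS]mulr_natl /=; ring.
  by rewrite -card; apply: ler_sum => p _; apply: le_trans (ler_norm_sum _ _ _) _; exact: ler_sum.
have b_cr : `|cross Om U0.1 SV.1 - cross Og U0.1 V.1| <= 2 * Cz * acst * rs * phi * v.
  have h c c' : `|ip area Om (U0.1 (c, None)) (SV.1 (c', None)) - ip area Og (U0.1 (c, None)) (V.1 (c', None))| <= Cz * rs * (acst * phi * v).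
    apply: le_trans (Sz _ c' (sU (c, None))) _; apply: ler_wpM2l; first exact: mulr_ge0.
    by apply: ler_wpM2r => //; exact: le_trans (ur _) ra.
  rewrite /cross (_ : _ - _ = (ip area Om (U0.1 (true, None)) (SV.1 (false, None)) - ip area Og (U0.1 (true, None)) (V.1 (false, None)))
    - (ip area Om (U0.1 (false, None)) (SV.1 (true, None)) - ip area Og (U0.1 (false, None)) (V.1 (true, None)))); last by ring.
  apply: le_trans (ler_normB _ _) _; apply: le_trans (lerD (h true false) (h false true)) _.
  by rewrite -subr_ge0 (_ : _ - _ = 0)//; ring.
have b_FL : `|FL d gamma f V.1 - FL d (fun=> 0) f SV.1| <= Cz * rs * phi * v.
  rewrite /FL !big_bool /= distrC.
  rewrite (_ : _ - _ = (ip area Om (f true) (SV.1 (true, None)) - ip area Og (f true) (V.1 (true, None)))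
    + (ip area Om (f false) (SV.1 (false, None)) - ip area Og (f false) (V.1 (false, None)))); last by ring.
  apply: le_trans (ler_normD _ _) _; apply: le_trans (lerD (Sz _ true (sf true)) (Sz _ false (sf false))) _.
  by rewrite ephi -subr_ge0 (_ : _ - _ = 0)//; ring.
have b_tf : `|tf kb0 U0 SV - tf kbg RU V| <= 2 * acst * om * phi * v + 6 * Kb * kd * acst * rs * phi * v.
  have mT : measurable (setT : set (measurableTypeR R)) by exact: measurableT.
  have aeg : {ae mu, forall y, (setT : set R) y -> `|kbg y| <= Kb} by apply: aeW => y _; exact: kKg.
  have ae0 : {ae mu, forall y, (setT : set R) y -> `|kb0 y| <= Kb} by apply: aeW => y _; exact: kK0.
  have tU c := HH_tsq c HU0; have tS c := HH_tsq c HS; have tV c := HH_tsq c HV; have tR c := HH_tsq c HR.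
  have SVle : Num.sqrt (NN Om SV.1) <= 2 * v.
    by apply: sqrt_le; [rewrite mulr_ge0|rewrite ES; exact: NN_shiftK_le].
  have KdE : (d / 2)^-1 + 1 = Kd by rewrite /Kd invr1.
  have nS c : nrm1 (SV.2 c) <= kd * (2 * v).
    apply: sqrt_le; first by nonneg.
    apply: le_trans (nn_leTT SV c) _; apply: le_trans (TT_leN dh c0 (half_margin sd2 gs0) HS) _.
    rewrite KdE exprMn kdE; apply: ler_wpM2l; first exact: Kd_ge0.
    by rewrite ES; exact: NN_shiftK_le.
  have nR c : nrm1 (RU.2 c) <= kd * r.
    apply: sqrt_le; first by nonneg.
    apply: le_trans (nn_leTT RU c) _; apply: le_trans (TT_leN dh cg gm HR) _.
    rewrite KdE exprMn kdE; apply: ler_wpM2l; first exact: Kd_ge0.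
    rewrite ER sqr_sqrtr ?NN_ge0//; apply: ler_sum => p _; exact: (nn_sub mO mG GO (sU p)).
  have nd1 c : nrm1 (fun y => RU.2 c y - U0.2 c y) <= rs * r.
    apply: sqrt_le; first by nonneg.
    apply: le_trans (TR c) _; rewrite exprMn rsE; apply: ler_wpM2l => //.
    rewrite sqr_sqrtr ?NN_ge0//; apply: le_trans (nn_sub mO mS sO (sU _)) _; exact: nn_leNN.
  have nd2 c : nrm1 (fun y => SV.2 c y - V.2 c y) <= rs * v.
    apply: sqrt_le; first by nonneg.
    apply: le_trans (TS c) _; rewrite exprMn rsE; apply: ler_wpM2l => //.
    rewrite sqr_sqrtr ?NN_ge0//; apply: le_trans (nn_sub mG mGs GsG (sV _)) _; exact: nn_leNN.
  have e c : `|ip mu setT (fun y => kbg y * U0.2 c y) (SV.2 c) - ip mu setT (fun y => kbg y * RU.2 c y) (V.2 c)| <=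
     3 * Kb * kd * rs * (r * v).
    have sd1 := sqiB mT (tR c) (tU c); have sd2' := sqiB mT (tS c) (tV c).
    have sk (u : R -> R) : sqi mu setT u -> sqi mu setT (fun y => kbg y * u y) by move=> su; exact: (sqi_mulM mT mkg aeg su).
    have i1 := ip_int mT (sk _ (tU c)) (tS c); have i2 := ip_int mT (sk _ (tR c)) (tV c).
    have i3 := ip_int mT (sk _ sd1) (tS c); have i4 := ip_int mT (sk _ (tR c)) sd2'.
    rewrite (_ : _ - _ = ip mu setT (fun y => kbg y * RU.2 c y) (fun y => SV.2 c y - V.2 c y) -
      ip mu setT (fun y => kbg y * (RU.2 c y - U0.2 c y)) (SV.2 c)); last first.
      by rewrite -!RintegralB//; apply: eq_Rintegral => y _; ring.
    have h1 := ip_kb Kb0 mkg kKg (tR c) sd2'; have h2 := ip_kb Kb0 mkg kKg sd1 (tS c).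
    have h1' : Kb * (nrm1 (RU.2 c) * nrm1 (fun y => SV.2 c y - V.2 c y)) <= Kb * (kd * r * (rs * v)).
      by apply: ler_wpM2l => //; apply: ler_pM; rewrite ?sqrtr_ge0.
    have h2' : Kb * (nrm1 (fun y => RU.2 c y - U0.2 c y) * nrm1 (SV.2 c)) <= Kb * (rs * r * (kd * (2 * v))).
      by apply: ler_wpM2l => //; apply: ler_pM; rewrite ?sqrtr_ge0.
    apply: le_trans (ler_normB _ _) _; apply: le_trans (lerD (le_trans h1 h1') (le_trans h2 h2')) _.
    by rewrite -subr_ge0 (_ : _ - _ = 0)//; ring.
  (* The change of coefficient is measured on the flat boundary, where the oscillation hypothesis
     lives; the change of curve is measured with the coefficient [kbg] fixed. *)
  have E : tf kb0 U0 SV - tf kbg RU V = tf (fun y => kb0 y - kbg y) U0 SV + (tf kbg U0 SV - tf kbg RU V).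
    have -> : tf (fun y => kb0 y - kbg y) U0 SV = tf kb0 U0 SV - tf kbg U0 SV.
      rewrite /tf -sumrB; apply: eq_bigr => c _.
      have i1 := ip_int mT (sqi_mulM mT mk0 ae0 (tU c)) (tS c).
      have i2 := ip_int mT (sqi_mulM mT mkg aeg (tU c)) (tS c).
      by rewrite -RintegralB//; apply: eq_Rintegral => y _; ring.
    by ring.
  rewrite E; apply: le_trans (ler_normD _ _) _; apply: lerD.
    apply: le_trans (osc HU0 HS) _.
    apply: (@le_trans _ _ (om * (acst * phi * (2 * v)))).
      by apply: ler_wpM2l => //; apply: ler_pM; rewrite ?sqrtr_ge0.
    by rewrite -subr_ge0 (_ : _ - _ = 0)//; ring.
  rewrite /tf !big_bool /= (_ : _ - _ = (ip mu setT (fun y => kbg y * U0.2 true y) (SV.2 true) - ip mu setT (fun y => kbg y * RU.2 true y) (V.2 true))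
    + (ip mu setT (fun y => kbg y * U0.2 false y) (SV.2 false) - ip mu setT (fun y => kbg y * RU.2 false y) (V.2 false))); last by ring.
  apply: le_trans (ler_normD _ _) _; apply: le_trans (lerD (e true) (e false)) _.
  apply: (@le_trans _ _ (6 * Kb * kd * rs * (acst * phi * v))).
    rewrite -mulrDl (_ : _ + _ = 6 * Kb * kd * rs); last by ring.
    by apply: ler_wpM2l; [nonneg|apply: ler_wpM2r].
  by rewrite -subr_ge0 (_ : _ - _ = 0)//; ring.
have -> : pf d gamma kbg m (slin (-1) RU Ue) V = (FL d gamma f V.1 - FL d (fun=> 0) f SV.1) +
   (bf Om m U0.1 SV.1 - bf Og m U0.1 V.1) + (cross Om U0.1 SV.1 - cross Og U0.1 V.1) + (tf kb0 U0 SV - tf kbg RU V).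
  rewrite (pf_linl cg mkg kKg mmg (-1) HR HUe HV) (eqe _ HV) -(eq0 _ HS) /pf /qf ER.
  by ring.
apply: le_trans (ler_normD _ _) _; apply: le_trans (lerD (ler_normD _ _) (lexx _)) _.
apply: le_trans (lerD (lerD (ler_normD _ _) (lexx _)) (lexx _)) _.
apply: le_trans (lerD (lerD (lerD b_FL b_bf) b_cr) b_tf) _.
rewrite -subr_ge0 (_ : _ - _ = (Cz + 36 * Ce + 2 * Cz * acst + 6 * Kb * kd * acst) * om * phi * v + 2 * acst * rs * phi * v); last first.
  by rewrite /dlt; ring.
by nonneg.
Qed.

End Estimates.
End StripPerturbation.

(** * The oscillating boundary form *)

Section OscillatingTrace.
Context {R : realType}.
Local Notation mu := (@lebesgue_measure R).
Local Notation area := (@area R).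
Local Notation T2 := (measurableTypeR R * measurableTypeR R)%type.

(** The discriminant of t^2 p - 2 t b + q; for p = 0 a suitable large [t] forces b = 0. *)
Lemma disc_le (p q b : R) : 0 <= p -> 0 <= q -> (forall t : R, 2 * (t * b) <= t ^+ 2 * p + q) ->
  `|b| <= Num.sqrt p * Num.sqrt q.
Proof.
move=> p0 q0 H.
have h : b ^+ 2 <= p * q.
  move: p0; rewrite le_eqVlt => /predU1P[p0|p0].
    have -> : b = 0.
      apply: contrapT => /eqP b0.
      have := H ((q + 1) / (2 * b)); rewrite -p0 mulr0 add0r.
      have -> : 2 * ((q + 1) / (2 * b) * b) = q + 1 by field.
      by rewrite gerDl ler10.
    by rewrite expr0n/= -p0 mul0r.
  have := H (b / p); rewrite -subr_ge0.
  have -> : (b / p) ^+ 2 * p + q - 2 * (b / p * b) = (p * q - b ^+ 2) / p by field; rewrite gt_eqF.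
  by rewrite pmulr_lge0 ?invr_gt0// subr_ge0.
by rewrite -sqrtrM// -sqrtr_sqr ler_sqrt// mulr_ge0.
Qed.

Lemma weighted_le (x y z w : R) : 1 <= x -> 0 <= z -> 0 <= w -> w + x * y <= x * (y + z + w).
Proof.
move=> x1 z0 w0; have x0 : 0 <= x by exact: le_trans x1.
rewrite !mulrDr [X in _ <= X]addrC; apply: lerD; first by rewrite ler_peMl.
by rewrite lerDl mulr_ge0.
Qed.

Lemma mid_le (x y z : R) : 0 <= x -> 0 <= z -> y <= x + y + z.
Proof. by move=> *; lra. Qed.

Lemma last_le (x y z : R) : 0 <= x -> 0 <= y -> z <= x + y + z.
Proof. by move=> *; lra. Qed.

Variable d : R.
Hypothesis d0 : 0 < d.
Local Notation Om := (layer (fun _ : R => 0) d).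
Local Notation H0 := (HH (fun _ : R => 0) d).
Let c0 : continuous (fun _ : R => 0 : R). Proof. by move=> ?; exact: cvg_cst. Qed.
Let mO : measurable (Om : set T2) := layer_cont_meas d c0.
Let mT : measurable (setT : set (measurableTypeR R)) := measurableT.
Let dh : 0 < d / 2. Proof. by rewrite divr_gt0. Qed.
Let gm0 (y : R) : 0 + d / 2 <= d.
Proof. by rewrite add0r ler_pdivrMr// mulr_natr mulr2n lerDl ltW. Qed.

Definition N3 (g : idx -> R * R -> R) : R :=
  nn area Om (g None) + nn area Om (g (Some 0)) + nn area Om (g (Some 1)).

Lemma N3_ge0 g : 0 <= N3 g.
Proof. by rewrite !addr_ge0// nn_ge0. Qed.

Lemma osc_data (eps K : R) (E E' : R -> R) g t : 0 < eps -> eps <= d / 2 -> eps <= 1 -> 0 <= K ->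
  (forall t : R, is_derive t 1 E (E' t)) -> continuous E' ->
  (forall t, `|E t| <= eps * K) -> (forall t, `|E' t| <= K) ->
  H1 (fun=> 0) d g t ->
  `|ip mu setT (fun y => E' y * t y) t| <= Num.sqrt eps * (4 * K * (Kd d * N3 g)).
Proof.
move=> e0 ed e1 K0 dE cE' EK E'K [phi [tp pg pt _]].
have ed' : eps <= d by apply: le_trans ed _; rewrite ler_pdivrMr// mulr_natr mulr2n lerDl ltW.
have mE' : measurable_fun setT E' by exact: continuous_measurable_fun.
have aE : {ae mu, forall y, (setT : set R) y -> `|E' y| <= K} by apply: aeW => y _; exact: E'K.
have cE := cvgL2_mulM mT K0 mE' aE pt.
have lim1 : (fun n => `|ip mu setT (fun y => E' y * phi n (y, 0)) (fun y => phi n (y, 0))|) @ \oo -->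
    `|ip mu setT (fun y => E' y * t y) t| by apply: cvg_norm; exact: (cvgL2_ip mT cE pt).
have kd1 := Kd_ge1 d0; have kd0 := Kd_ge0 d0.
have lim2 : (fun n => Num.sqrt eps * (4 * K * (Kd d * N3 (jet (phi n))))) @ \oo -->
   Num.sqrt eps * (4 * K * (Kd d * N3 g)).
  apply: cvgMr; apply: cvgMr; apply: cvgMr; apply: cvgD; [apply: cvgD|];
    exact: (cvgL2_nn mO (pg _)).
apply: (lim_le _ lim1 lim2) => n.
have C := test_C1c (tp n).
have n1 := @nn_ge0 _ _ _ area Om (phi n).
have n2 := @nn_ge0 _ _ _ area Om (partial 0 (phi n)).
have n3 := @nn_ge0 _ _ _ area Om (partial 1 (phi n)).
have le1 x : x <= N3 (jet (phi n)) -> x <= Kd d * N3 (jet (phi n)).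
  by move=> h; apply: le_trans h _; rewrite ler_peMl// N3_ge0.
have h0 : nn area (layer (fun=> 0) eps) (phi n) <= eps * (Kd d * N3 (jet (phi n))).
  have := @strip_smooth R (fun=> 0) d eps 1 (d / 2) eps (phi n) c0 C ltr01 dh (ltW e0) gm0 ed'.
  move=> /(_ (fun y => ltac:(by rewrite subr0)))h; apply: le_trans h _.
  apply: ler_wpM2l; first exact: ltW.
  rewrite /N3 mul1r -/(Kd d) [jet _ None]/jet [jet _ (Some 0)]/jet [jet _ (Some 1)]/jet.
  exact: (weighted_le _ kd1 n2 n3).
have h1 : nn area Om (partial 0 (phi n)) <= Kd d * N3 (jet (phi n)).
  by apply: le1; exact: (mid_le _ n1 n3).
have h2 : nn area Om (partial 1 (phi n)) <= Kd d * N3 (jet (phi n)).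
  by apply: le1; exact: (last_le _ n1 n2).
have := osc_smooth C e0 ed' e1 K0 dE cE' EK E'K h0 h1 h2.
congr (`|_| <= _); apply: eq_Rintegral => y _; ring.
Qed.

(** The bound is first proved on the diagonal, where [osc_data] applies, and then polarized with a
    free real parameter; [disc_le] recovers the product of the two norms. *)
Lemma osc_tf (a g : R -> R) (La Ma : R) :
  (forall y z : R, `|a y - a z| <= La * `|y - z|) -> 0 <= La -> (forall y, `|a y| <= Ma) ->
  continuous g -> (forall y, g (y + 1) = g y) -> \int[mu]_(t in `[0, 1]) g t = 0 ->
  exists2 C : R, 0 <= C & forall eps : R, 0 < eps -> eps <= 1 -> eps <= d / 2 ->
    forall U V, H0 U -> H0 V ->
    `|tf (fun y => a y * g (y * eps^-1)) U V| <=
      C * Num.sqrt eps * (Num.sqrt (NN Om U.1) * Num.sqrt (NN Om V.1)).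
Proof.
move=> aL La0 aM cg pg g0.
have [K K0 HK] := osc_primitive aL La0 aM cg pg g0.
have [G G0 HG] := periodic_bounded cg pg.
have Ma0 : 0 <= Ma by apply: le_trans (aM 0).
have kd0 := Kd_ge0 d0.
pose C := 4 * K * Kd d + K * Kd d.
have C0 : 0 <= C by rewrite addr_ge0 ?mulr_ge0.
exists C => // eps e0 e1 ed U V HU HV.
have [E [E' [dE cE' EK E'K E'a]]] := HK eps e0 e1.
pose w y := a y * g (y * eps^-1).
have ca : continuous a by exact: lipschitz_cont aL.
have mw : measurable_fun setT w.
  apply: continuous_measurable_fun; apply: contM => // t.
  apply: (@continuous_comp _ _ _ (fun t : R => t * eps^-1) g); last exact: cg.
  by apply: cvgMl; exact: cvg_id.
have wB y : `|w y| <= Ma * G by rewrite normrM; apply: ler_pM.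
have MG0 : 0 <= Ma * G by rewrite mulr_ge0.
have se0 : 0 <= Num.sqrt eps by exact: sqrtr_ge0.
have ese : eps <= Num.sqrt eps.
  rewrite -[X in X <= _]sqr_sqrtr ?(ltW e0)// expr2 ler_piMl//.
  by rewrite -[leRHS]sqrtr1 ler_sqrt.
have mE' : measurable_fun setT E' by exact: continuous_measurable_fun.
have quad X : H0 X -> `|tf w X X| <= C * Num.sqrt eps * NN Om X.1.
  move=> HX.
  have q1 c : `|ip mu setT (fun y => w y * X.2 c y) (X.2 c)| <= C * Num.sqrt eps * N3 (fun k => X.1 (c, k)).
    have st := HH_tsq c HX.
    have h1 := osc_data e0 ed e1 K0 dE cE' EK E'K (HX c).
    have aE : {ae mu, forall y, (setT : set R) y -> `|E' y| <= K} by apply: aeW => y _; exact: E'K.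
    have aw : {ae mu, forall y, (setT : set R) y -> `|w y| <= Ma * G} by apply: aeW => y _; exact: wB.
    have s1 := sqi_mulM mT mE' aE st; have s2 := sqi_mulM mT mw aw st.
    have md : measurable_fun setT (fun y => E' y - w y) by exact: measurable_funB.
    have h2 := ip_kb (mulr_ge0 (ltW e0) K0) md E'a st st.
    have i1 := ip_int mT s1 st; have i2 := ip_int mT s2 st.
    (* The weight is replaced by the exact derivative E'; the error, at most eps K, is paid by the
       trace inequality. *)
    have -> : ip mu setT (fun y => w y * X.2 c y) (X.2 c) =
      ip mu setT (fun y => E' y * X.2 c y) (X.2 c) - ip mu setT (fun y => (E' y - w y) * X.2 c y) (X.2 c).
      have ad : {ae mu, forall y, (setT : set R) y -> `|E' y - w y| <= eps * K} by apply: aeW => y _; exact: E'a.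
      have sd := sqi_mulM mT md ad st.
      by rewrite -RintegralB//; [apply: eq_Rintegral => y _; ring|exact: (ip_int mT sd st)].
    apply: le_trans (ler_normB _ _) _; apply: le_trans (lerD h1 h2) _.
    rewrite -expr2 sqr_sqrtr ?nn_ge0//.
    have h3 := H1_trace_le c0 ltr01 dh gm0 (HX c).
    have n1 := @nn_ge0 _ _ _ area Om (X.1 (c, None)).
    have n2 := @nn_ge0 _ _ _ area Om (X.1 (c, Some 0)).
    have n3 := @nn_ge0 _ _ _ area Om (X.1 (c, Some 1)).
    have h4 : nn mu setT (X.2 c) <= Kd d * N3 (fun k => X.1 (c, k)).
      apply: le_trans h3 _; rewrite /N3 mul1r -/(Kd d); exact: (weighted_le _ (Kd_ge1 d0) n2 n3).
    have h5 : eps * K * nn mu setT (X.2 c) <= Num.sqrt eps * K * (Kd d * N3 (fun k => X.1 (c, k))).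
      by apply: ler_pM; rewrite ?nn_ge0 ?mulr_ge0 ?(ltW e0)//; apply: ler_wpM2r.
    apply: le_trans (lerD (lexx _) h5) _.
    by rewrite -subr_ge0 (_ : _ - _ = 0)// /C; ring.
  rewrite /tf big_bool /=; apply: le_trans (ler_normD _ _) _.
  apply: le_trans (lerD (q1 true) (q1 false)) _; rewrite -mulrDr; apply: ler_wpM2l; first exact: mulr_ge0.
  by rewrite /NN big_cidx big_bool /N3 /=.
pose Ce := C * Num.sqrt eps.
have Ce0 : 0 <= Ce by exact: mulr_ge0.
have := @disc_le (Ce * NN Om U.1) (Ce * NN Om V.1) (tf w U V).
rewrite !mulr_ge0 ?NN_ge0// => /(_ isT isT)h.
have -> : C * Num.sqrt eps * (Num.sqrt (NN Om U.1) * Num.sqrt (NN Om V.1)) =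
    Num.sqrt (Ce * NN Om U.1) * Num.sqrt (Ce * NN Om V.1).
  by rewrite !(sqrtrM _ Ce0) [RHS]mulrACA -(expr2 (Num.sqrt Ce)) sqr_sqrtr.
apply: h => t.
have HX e : H0 (slin (e * t) U V) by exact: HH_lin.
have hx e : tf w (slin (e * t) U V) (slin (e * t) U V) =
    (e * t) ^+ 2 * tf w U U + 2 * (e * t) * tf w U V + tf w V V.
  rewrite (tf_linl mw wB _ HU HV (HX e)) !(tf_linr mw wB _ HU HV) // (tf_sym w V U); ring.
have sU := HH_sq HU; have sV := HH_sq HV.
have nx : NN Om (slin (1 * t) U V).1 + NN Om (slin (-1 * t) U V).1 = 2 * (t ^+ 2 * NN Om U.1 + NN Om V.1).
  rewrite /NN mulr_sumr -!big_split /= mulr_sumr; apply: eq_bigr => p _.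
  rewrite /slin /= !(nnD mO (sqiZ mO _ (sU p)) (sV p)) !(nnZ mO _ (sU p)) !(ipZl mO _ (sU p) (sV p)).
  by ring.
have q1 := quad _ (HX 1); have q2 := quad _ (HX (-1)); rewrite -/Ce in q1 q2.
have : 4 * (t * tf w U V) <= Ce * (2 * (t ^+ 2 * NN Om U.1 + NN Om V.1)).
  rewrite -nx mulrDr; apply: le_trans _ (lerD q1 q2); apply: le_trans (ler_normB _ _).
  by apply: le_trans (ler_norm _); rewrite !hx -subr_ge0 (_ : _ - _ = 0)//; ring.
move=> h4; rewrite -(ler_pM2l (ltr0Sn R 1)); apply: le_trans (_ : _ <= 4 * (t * tf w U V)) _.
  by rewrite -subr_ge0 (_ : _ - _ = 0)//; ring.
by apply: le_trans h4 _; rewrite -subr_ge0 (_ : _ - _ = 0)//; ring.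
Qed.

End OscillatingTrace.

(** * Reduction of the complex problem *)

Section ComplexParts.
Local Open Scope complex_scope.
Context {R : realType}.
Implicit Types (c : bool) (z : R[i]) (r : R).

Definition cpart c z : R := if c then complex.Im z else complex.Re z.

Lemma cpartD c z1 z2 : cpart c (z1 + z2) = cpart c z1 + cpart c z2.
Proof. by case: c z1 z2 => -[a b] [a' b']. Qed.

Lemma cpartB c z1 z2 : cpart c (z1 - z2) = cpart c z1 - cpart c z2.
Proof. by case: c z1 z2 => -[a b] [a' b']. Qed.

Lemma cpartMr c z r : cpart c (z * r%:C) = cpart c z * r.
Proof. by case: c z => -[a b] /=; ring. Qed.

Lemma cpart_inj z1 z2 : (forall c, cpart c z1 = cpart c z2) -> z1 = z2.
Proof. by move: z1 z2 => [a b] [a' b'] h; have /= -> := h false; have /= -> := h true. Qed.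

Section L2.
Context {disp : measure_display} {T : measurableType disp}.
Variables (nu : {measure set T -> \bar R}) (D : set T).
Hypothesis mD : measurable D.
Implicit Types f g : T -> R[i].

Lemma cmeasurableP f : cmeasurable D f <-> forall c, measurable_fun D (fun x => cpart c (f x)).
Proof. by split=> [[h1 h2] []//|h]; split; [exact: (h false)|exact: (h true)]. Qed.

Lemma L2normsqE f : (forall c, sqi nu D (fun x => cpart c (f x))) ->
  L2normsq nu D f = (\sum_c nn nu D (fun x => cpart c (f x)))%:E.
Proof.
move=> h; rewrite big_bool /= addrC EFinD (nnE mD (h false)) (nnE mD (h true)) -ge0_integralD//; last 4 first.
- by move=> x _; rewrite lee_fin sqr_ge0.
- by apply/measurable_EFinP; apply: measurable_funX; exact: (sqi_meas (h false)).
- by move=> x _; rewrite lee_fin sqr_ge0.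
- by apply/measurable_EFinP; apply: measurable_funX; exact: (sqi_meas (h true)).
Qed.

Lemma inL2P f : inL2 nu D f <-> forall c, sqi nu D (fun x => cpart c (f x)).
Proof.
split=> [[/cmeasurableP mf fi] c|h]; last first.
  split; first by apply/cmeasurableP => c; exact: sqi_meas (h c).
  by rewrite L2normsqE// ltry.
split; first exact: mf.
apply: le_lt_trans fi; apply: ge0_le_integral => //.
- by move=> x _; rewrite lee_fin sqr_ge0.
- by apply/measurable_EFinP; apply: measurable_funX; exact: mf.
- by apply/measurable_EFinP; apply: measurable_funD; apply: measurable_funX; [exact: (mf false)|exact: (mf true)].
- by move=> x _; rewrite lee_fin /sqmod; case: c => /=; rewrite ?lerDl ?lerDr sqr_ge0.
Qed.

End L2.
End ComplexParts.

(** * Weak derivatives and norms of complex functions *)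

Section SobolevData.
Local Open Scope complex_scope.
Context {R : realType}.
Local Notation mu := (@lebesgue_measure R).
Local Notation area := (@area R).
Local Notation T2 := (measurableTypeR R * measurableTypeR R)%type.
Implicit Types (c : bool) (j : 'I_2) (p q : cidx) (u v w : R * R -> R[i]).
Implicit Types (U V g : cidx -> R * R -> R).
Variable Om : set (R * R).
Hypotheses (oO : open Om) (mO : measurable (Om : set T2)).

(** Test functions are real, so the complex identity splits into two independent real ones. *)
Lemma weakP j u h : is_weak_deriv Om j u h <->
  forall c, rweak Om j (fun x => cpart c (u x)) (fun x => cpart c (h x)).
Proof.
have E (phi : R * R -> R) (w : R * R -> R[i]) : cintegral area Om (fun x => w x * (phi x)%:C) =
    (\int[area]_(x in Om) (complex.Re (w x) * phi x)) +i* (\int[area]_(x in Om) (complex.Im (w x) * phi x)).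
  by congr (_ +i* _); apply: eq_Rintegral => x _; [exact: (cpartMr false)|exact: (cpartMr true)].
split=> [[lu lh H] c|H].
- split; [by move=> K cK KO; have [? ?] := lu K cK KO; case: c|
         by move=> K cK KO; have [? ?] := lh K cK KO; case: c|].
  move=> phi tp; have := H phi tp; rewrite !E => -[h1 h2].
  by case: c.
- have [l1 g1 H1] := H false; have [l2 g2 H2] := H true.
  split; [by move=> K cK KO; split; [exact: l1|exact: l2]|
         by move=> K cK KO; split; [exact: g1|exact: g2]|].
  by move=> phi tp; rewrite !E; congr (_ +i* _); [exact: H1|exact: H2].
Qed.

Definition wjet U : Prop := sqK Om U /\ forall c j, rweak Om j (U (c, None)) (U (c, Some j)).

Lemma wjet_lin (a : R) U V : wjet U -> wjet V -> wjet (fun p x => a * U p x + V p x).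
Proof. by move=> [sU rU] [sV rV]; split; [exact: sqK_lin|move=> c j; exact: rweak_lin]. Qed.

Definition cdata u : cidx -> R * R -> R :=
  fun p x => cpart p.1 ((if p.2 is Some j then weak_deriv Om j u else u) x).

Definition mkc U : R * R -> R[i] := fun x => U (false, None) x +i* U (true, None) x.

Lemma cpart_mkc c U x : cpart c (mkc U x) = U (c, None) x. Proof. by case: c. Qed.

Lemma weak_deriv_ex j u h : is_weak_deriv Om j u h -> is_weak_deriv Om j u (weak_deriv Om j u).
Proof. by move=> ?; apply: (@xgetPex _ _ [set h | is_weak_deriv Om j u h]); exists h. Qed.

(** [weak_deriv] is a choice made up to null sets; any other system of weak derivatives agrees with
    it almost everywhere. *)
Lemma cdata_of u U : wjet U -> (forall c x, cpart c (u x) = U (c, None) x) ->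
  wjet (cdata u) /\ forall p, {ae area, forall x, Om x -> U p x = cdata u p x}.
Proof.
move=> [sU rU] uU.
have W j : is_weak_deriv Om j u (weak_deriv Om j u).
  apply: (@weak_deriv_ex j u (fun x => U (false, Some j) x +i* U (true, Some j) x)).
  apply/weakP => c; have -> : (fun x => cpart c (u x)) = U (c, None) by apply/funext => x; exact: uU.
  by have := rU c j; case: c.
have cN c : cdata u (c, None) = U (c, None) by apply/funext => x; exact: uU.
have rw c j : rweak Om j (cdata u (c, None)) (cdata u (c, Some j)) by have /weakP := W j; exact.
have ae p : {ae area, forall x, Om x -> U p x = cdata u p x}.
  case: p => c [j|]; last by rewrite cN; apply: aeW.
  by apply: (rweak_unique oO (rU c j)); rewrite -cN.
split=> //; split=> // -[c [j|]]; last by rewrite cN.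
have [_ l _] := rw c j; exact: (ae_sqi mO (lint_meas oO l) (ae _) (sU _)).
Qed.

Lemma W2P u : W2 Om 1 u <-> wjet (cdata u).
Proof.
split=> [[/(inL2P _ mO) iu W]|[sd rw]].
- have wj j : is_weak_deriv Om j u (weak_deriv Om j u) by have [h hw _] := W j; exact: weak_deriv_ex hw.
  have rw c j : rweak Om j (cdata u (c, None)) (cdata u (c, Some j)) by have /weakP := wj j; exact.
  split=> // -[c [j|]]; last exact: iu.
  have [h /weakP hw [/(inL2P _ mO) ih _]] := W j.
  have [_ l _] := rw c j; exact: (ae_sqi mO (lint_meas oO l) (rweak_unique oO (hw c) (rw c j)) (ih c)).
- split; first by apply/(inL2P _ mO) => c; exact: (sd (c, None)).
  move=> j; exists (weak_deriv Om j u); first by apply/weakP => c; exact: rw.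
  by split=> //; apply/(inL2P _ mO) => c; exact: (sd (c, Some j)).
Qed.

Lemma W12normE u : wjet (cdata u) -> W12norm Om u = (Num.sqrt (NN Om (cdata u)))%:E.
Proof.
move=> [sd _]; rewrite /W12norm.
rewrite (L2normsqE mO (fun c => sd (c, None))).
have -> : (\sum_(j < 2) L2normsq area Om (weak_deriv Om j u) =
    \sum_(j < 2) (\sum_c nn area Om (cdata u (c, Some j)))%:E)%E.
  by apply: eq_bigr => j _; exact: (L2normsqE mO (fun c => sd (c, Some j))).
rewrite sumEFin -EFinD poweR_EFin powR12_sqrt; last first.
  by rewrite addr_ge0// sumr_ge0// => *; rewrite ?sumr_ge0// => *; exact: nn_ge0.
have lo : lift ord0 ord0 = 1 :> 'I_2 by exact: val_inj.
have -> : NN Om (cdata u) = \sum_c nn area Om (cdata u (c, None)) +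
    \sum_(j < 2) \sum_c nn area Om (cdata u (c, Some j)).
  rewrite /NN big_cidx exchange_big -big_split /=; apply: eq_bigr => c _.
  by rewrite big_ord_recl big_ord1 lo addrA.
by [].
Qed.

(** Computes the norm of a difference from the difference of the data, without comparing the chosen
    weak derivatives. *)
Lemma W12norm_of u U : wjet U -> (forall c x, cpart c (u x) = U (c, None) x) ->
  W12norm Om u = (Num.sqrt (NN Om U))%:E.
Proof.
move=> wU uU; have [wu ae] := cdata_of wU uU; rewrite W12normE//.
congr ((Num.sqrt _)%:E); apply: eq_bigr => p _; apply/esym.
have [sU _] := wU; have [su _] := wu.
exact: (ae_nn mO (sqi_meas (sU p)) (sqi_meas (su p)) (ae p)).
Qed.

End SobolevData.

(** * Arc length against the parameter x_1 *)

Section ArcLength.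
Local Open Scope complex_scope.
Context {R : realType}.
Local Notation mu := (@lebesgue_measure R).
Implicit Types (gamma : R -> R) (t : R -> R[i]) (c : bool).

Lemma arc_ge1 gamma y : 1 <= arc_density gamma y.
Proof. by rewrite /arc_density -[leLHS]sqrtr1 ler_sqrt ?lerDl ?sqr_ge0// addr_ge0// sqr_ge0. Qed.

Lemma arc_cst (a y : R) : arc_density (fun=> a) y = 1.
Proof. by rewrite /arc_density derive1_cst expr0n addr0 sqrtr1. Qed.

Variables (gamma : R -> R) (Cr : R).
Hypothesis mr : measurable_fun setT (arc_density gamma).
Hypothesis rC : forall y, arc_density gamma y <= Cr.
Let mT : measurable (setT : set (measurableTypeR R)) := measurableT.

(** The density lies between 1 and [Cr], so neither square integrability nor convergence depends on
    it. *)
Lemma arc_normsq t : cmeasurable setT t ->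
  (L2normsq mu setT t <= arc_L2normsq gamma t <= Cr%:E * L2normsq mu setT t)%E.
Proof.
move=> [m1 m2].
have Cr0 : 0 <= Cr by apply: le_trans (rC 0); apply: le_trans (arc_ge1 _ _).
have ms : measurable_fun setT (fun y => sqmod (t y)).
  by apply: measurable_funD; apply: measurable_funX.
have s0 y : 0 <= sqmod (t y) by rewrite addr_ge0// sqr_ge0.
have r0 y : 0 <= arc_density gamma y by apply: le_trans (arc_ge1 _ _).
apply/andP; split.
- apply: ge0_le_integral => //; do ?[by move=> *; rewrite lee_fin ?mulr_ge0].
  + by apply/measurable_EFinP.
  + by apply/measurable_EFinP; exact: measurable_funM.
  + by move=> y _; rewrite lee_fin ler_peMr// arc_ge1.
- rewrite -ge0_integralZl//; last by move=> y _; rewrite lee_fin.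
    apply: ge0_le_integral => //; do ?[by move=> *; rewrite ?lee_fin ?mulr_ge0].
    + by apply/measurable_EFinP; exact: measurable_funM.
    + by apply/measurable_EFinP; apply: measurable_funM.
    + by move=> y _; rewrite -EFinM lee_fin mulrC ler_wpM2r.
  by apply/measurable_EFinP.
Qed.

Lemma arc_inL2P t : arc_inL2 gamma t <-> inL2 mu setT t.
Proof.
split=> -[mt fi]; split=> //; have /andP[h1 h2] := arc_normsq mt.
  exact: le_lt_trans h1 fi.
apply: le_lt_trans h2 _; apply: lte_mul_pinfty => //.
by apply: le_trans (rC 0); apply: le_trans (arc_ge1 _ _).
Qed.

Lemma sum_nn_cvg0 {disp} {T : measurableType disp} (nu : {measure set T -> \bar R}) (D : set T)
  (I : finType) (F : nat -> I -> T -> R) :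
  (fun n => \sum_i nn nu D (F n i)) @ \oo --> 0 <-> forall i, (fun n => nn nu D (F n i)) @ \oo --> 0.
Proof.
split=> [h i|h].
  apply: squeeze0 h => n; rewrite nn_ge0 (bigD1 i)//= lerDl.
  by apply: sumr_ge0 => *; exact: nn_ge0.
elim: (index_enum I) => [|i r IH]; first by under eq_fun => n do rewrite big_nil; exact: cvg_cst.
apply: (cvg_eqr (addr0 0)); under eq_fun => n do rewrite big_cons.
by apply: cvgD.
Qed.

Lemma arc_cvg (tn : nat -> R -> R[i]) : (forall n c, sqi mu setT (fun y => cpart c (tn n y))) ->
  (fun n => arc_L2normsq gamma (tn n)) @ \oo --> 0%E <->
  forall c, (fun n => nn mu setT (fun y => cpart c (tn n y))) @ \oo --> 0.
Proof.
move=> sn.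
have ms n : cmeasurable setT (tn n) by apply/cmeasurableP => c; exact: sqi_meas (sn n c).
have E n := L2normsqE mT (sn n).
split=> h.
  apply/(sum_nn_cvg0 mu setT (fun n c y => cpart c (tn n y))).
  have : (fun n => (\sum_c nn mu setT (fun y => cpart c (tn n y)))%:E) @ \oo --> 0%E.
    apply: (@squeeze_cvge _ _ _ _ (fun=> 0%E) _ (fun n => arc_L2normsq gamma (tn n))) => //; last exact: cvg_cst.
    apply: nearW => n; rewrite lee_fin sumr_ge0 => [/=|*]; last exact: nn_ge0.
    by have /andP[] := arc_normsq (ms n); rewrite E.
  by move=> /fine_cvg.
have /(sum_nn_cvg0 mu setT (fun n c y => cpart c (tn n y))) h2 := h.
apply: (@squeeze_cvge _ _ _ _ (fun=> 0%E) _ (fun n => (Cr * \sum_c nn mu setT (fun y => cpart c (tn n y)))%:E)).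
- apply: nearW => n; have /andP[h3] := arc_normsq (ms n); rewrite E EFinM => ->; rewrite andbT.
  by apply: le_trans h3; rewrite E lee_fin sumr_ge0// => *; exact: nn_ge0.
- exact: cvg_cst.
- by apply: cvgn_EFin; rewrite -[X in _ --> X](mulr0 Cr); apply: cvgMr.
Qed.

End ArcLength.

(** * Traces through real approximating sequences *)

Section Traces.
Local Open Scope complex_scope.
Context {R : realType}.
Local Notation mu := (@lebesgue_measure R).
Local Notation area := (@area R).
Local Notation T2 := (measurableTypeR R * measurableTypeR R)%type.
Implicit Types (c : bool) (k : idx) (u v : R * R -> R[i]) (gamma : R -> R).

Section TraceP.
Variables (Om : set (R * R)) (gamma : R -> R) (Cr : R).
Hypotheses (oO : open Om) (mO : measurable (Om : set T2)) (cg : continuous gamma).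
Hypothesis mr : measurable_fun setT (arc_density gamma).
Hypothesis rC : forall y, arc_density gamma y <= Cr.
Let mT : measurable (setT : set (measurableTypeR R)) := measurableT.

Lemma sqrt_EFin_cvg0 (F : nat -> R) : (forall n, 0 <= F n) ->
  (fun n => (Num.sqrt (F n))%:E) @ \oo --> 0%E <-> F @ \oo --> 0.
Proof.
move=> F0; split=> [/fine_cvg h|h]; last by apply: cvgn_EFin; exact: sqrt_cvg0.
have : (fun n => Num.sqrt (F n) * Num.sqrt (F n)) @ \oo --> (0 * 0 : R) by apply: cvgM.
by rewrite mulr0; under eq_fun => n do rewrite -expr2 sqr_sqrtr ?F0//.
Qed.

(** A complex approximating sequence is a pair of real ones, and convergence in [W12norm] is
    convergence of every entry of the jets. *)
Lemma traceP u t : wjet Om (cdata Om u) ->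
  is_trace Om gamma u t <->
  exists phi : bool -> nat -> R * R -> R, [/\ forall c n, test_function setT (phi c n),
    forall c k, cvgL2 area Om (fun n => jet (phi c n) k) (cdata Om u (c, k)) &
    forall c, cvgL2 mu setT (fun n y => phi c n (y, gamma y)) (fun y => cpart c (t y))].
Proof.
move=> wu; have [su ru] := wu.
pose D (phi : bool -> nat -> R * R -> R) n (p : cidx) (x : R * R) : R := -1 * cdata Om u p x + jet (phi p.1 n) p.2 x.
have wD (phi : bool -> nat -> R * R -> R) n : (forall c n, test_function setT (phi c n)) -> wjet Om (D phi n).
  move=> tp; apply: (wjet_lin oO mO) => //; split=> [p|c j].
    by apply: cc_sqi => //; apply: jet_cc; exact: test_C1c.
  exact: (rweak_C1c j oO (test_C1c (tp c n))).
have wN (phi : bool -> nat -> R * R -> R) (P : nat -> R * R -> R[i]) : (forall c n, test_function setT (phi c n)) ->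
    (forall n c x, cpart c (P n x) = phi c n x) ->
    (fun n => W12norm Om (fun x => P n x - u x)) @ \oo --> 0%E <->
    forall c k, (fun n => nn area Om (fun x => jet (phi c n) k x - cdata Om u (c, k) x)) @ \oo --> 0.
  move=> tp PE.
  have -> : (fun n => W12norm Om (fun x => P n x - u x)) = fun n => (Num.sqrt (NN Om (D phi n)))%:E.
    apply/funext => n; apply: (W12norm_of oO mO (wD phi n tp)) => c x.
    by rewrite cpartB PE /D /= mulN1r addrC.
  have DE n (p : cidx) : nn area Om (D phi n p) = nn area Om (fun x => jet (phi p.1 n) p.2 x - cdata Om u p x).
    by apply: eq_nn => x _; rewrite /D mulN1r addrC.
  have sq := @sqrt_EFin_cvg0 (fun n => NN Om (D phi n)) (fun n => NN_ge0 _ _).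
  split=> [/sq/(sum_nn_cvg0 area Om (D phi)) h c k|h].
    by have := h (c, k); under eq_fun => n do rewrite DE.
  apply/sq/(sum_nn_cvg0 area Om (D phi)) => -[c k].
  by under eq_fun => n do rewrite DE; exact: h.
have tr (phi : bool -> nat -> R * R -> R) c n : (forall c n, test_function setT (phi c n)) ->
   sqi mu setT (fun y => phi c n (y, gamma y)).
  by move=> tp; apply: graph_sqi => //; apply: C1c_cc; exact: test_C1c.
split.
- move=> [/(arc_inL2P mr rC)/(inL2P _ mT) st [P [tP P1 P2]]].
  pose phi c n x := cpart c (P n x).
  have tp c n : test_function setT (phi c n) by have [? ?] := tP n; case: c.
  have /(wN phi P tp) Q1 := P1.
  exists phi; split=> //.
    move=> c k; split; last exact: Q1; last by [].
    by move=> n; apply: cc_sqi => //; apply: jet_cc; exact: test_C1c.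
  have sd n c : sqi mu setT (fun y => cpart c (P n (y, gamma y) - t y)).
    rewrite [X in sqi _ _ X](_ : _ = fun y => phi c n (y, gamma y) - cpart c (t y)); last first.
      by apply/funext => y; rewrite cpartB.
    by apply: sqiB => //; exact: tr.
  have /(arc_cvg mr rC sd) Q2 := P2.
  move=> c; split; [by move=> n; exact: tr|exact: st|].
  by have := Q2 c; under eq_fun => n do under eq_nn => y _ do rewrite cpartB.
- move=> [phi [tp P1 P2]].
  have st c : sqi mu setT (fun y => cpart c (t y)) by exact: cvgL2_lim (P2 c).
  split; first by apply/(arc_inL2P mr rC)/(inL2P _ mT).
  exists (fun n x => phi false n x +i* phi true n x); split.
  + by move=> n; split; exact: tp.
  + apply/(wN phi) => //; first by move=> n [].
    by move=> c k; have [_ _] := P1 c k.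
  + have cE n c y : cpart c ((phi false n (y, gamma y) +i* phi true n (y, gamma y)) - t y) =
      phi c n (y, gamma y) - cpart c (t y) by rewrite cpartB; case: c.
    apply/(arc_cvg mr rC) => [n c|c].
      by under eq_fun => y do rewrite cE; apply: sqiB => //; exact: tr.
    have [_ _] := P2 c.
    by under [in X in _ -> X]eq_fun => n do under eq_fun => y do rewrite cE.
Qed.

End TraceP.
End Traces.

(** * The form domain as a closure of smooth functions *)

Section FormDomain.
Local Open Scope complex_scope.
Context {R : realType}.
Local Notation mu := (@lebesgue_measure R).
Local Notation area := (@area R).
Local Notation T2 := (measurableTypeR R * measurableTypeR R)%type.
Implicit Types (c : bool) (k : idx) (u v : R * R -> R[i]).
Variables (d m0 Cr : R) (gamma : R -> R).
Hypotheses (m0_gt0 : 0 < m0) (cg : continuous gamma) (gm : forall y, gamma y + m0 <= d).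
Hypothesis mr : measurable_fun setT (arc_density gamma).
Hypothesis rC : forall y, arc_density gamma y <= Cr.
Local Notation Om := (layer gamma d).
Let mT : measurable (setT : set (measurableTypeR R)) := measurableT.
Let cd : continuous (fun _ : R => d). Proof. exact: cst_cont. Qed.
Let mO : measurable (Om : set T2) := layer_cont_meas d cg.
Let oO : open Om := layer_open cg.

Lemma trace_diff (phi psi : R * R -> R) : test_function setT phi -> test_function setT psi ->
  nn mu setT (fun y => phi (y, gamma y) - psi (y, gamma y)) <=
  nn area Om (fun x => jet phi (Some 1) x - jet psi (Some 1) x) +
  (m0^-1 + 1) * nn area Om (fun x => jet phi None x - jet psi None x).
Proof.
move=> tp ts; have /testP[sp _] := tp; have /testP[ss _] := ts.
have C := test_C1c (test_lin (-1) ts tp).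
have g1 y : gamma y <= gamma y <= d.
  by rewrite lexx /=; apply: le_trans (gm y); rewrite lerDl ltW.
have := trace_le cg cg C ltr01 m0_gt0 gm g1; rewrite invr1 mul1r.
have -> : nn mu setT (fun y => -1 * psi (y, gamma y) + phi (y, gamma y)) =
   nn mu setT (fun y => phi (y, gamma y) - psi (y, gamma y)).
  by apply: eq_nn => y _; rewrite mulN1r addrC.
have -> : nn area Om (partial 1 (fun x => -1 * psi x + phi x)) =
   nn area Om (fun x => jet phi (Some 1) x - jet psi (Some 1) x).
  by apply: eq_nn => x _; rewrite partial_lin// mulN1r addrC.
have -> : nn area Om (fun x => -1 * psi x + phi x) = nn area Om (fun x => jet phi None x - jet psi None x).
  by apply: eq_nn => x _; rewrite mulN1r addrC.
by [].
Qed.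

(** The bound of [trace_diff] measured to a common limit [g]: the traces of two approximations are
    close as soon as both jets are close to [g], even if they belong to different sequences. *)
Definition jetdist g (phi : R * R -> R) : R :=
  2 * nn area Om (fun x => jet phi (Some 1) x - g (Some 1 : idx) x) +
  (m0^-1 + 1) * (2 * nn area Om (fun x => jet phi None x - g (None : idx) x)).

Let jet_sq phi k : test_function setT phi -> sqi area Om (jet phi k).
Proof. by move=> tp; apply: cc_sqi => //; apply: jet_cc; exact: test_C1c. Qed.

Lemma two_le (K a b p q r s : R) : 0 <= K -> a <= 2 * p + 2 * q -> b <= 2 * r + 2 * s ->
  a + K * b <= 2 * p + K * (2 * r) + (2 * q + K * (2 * s)).
Proof. by move=> K0 h1 h2; rewrite addrACA -(mulrDr K); apply: lerD => //; apply: ler_wpM2l. Qed.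

Lemma trace_diff2 (phi psi : R * R -> R) g : test_function setT phi -> test_function setT psi ->
  (forall k, sqi area Om (g k)) ->
  nn mu setT (fun y => phi (y, gamma y) - psi (y, gamma y)) <= jetdist g phi + jetdist g psi.
Proof.
move=> tp ts sg; apply: le_trans (trace_diff tp ts) _.
have h k := nn_split mO (jet_sq k tp) (sg k) (jet_sq k ts).
have K0 : 0 <= m0^-1 + 1 by rewrite addr_ge0// invr_ge0 ltW.
apply: (two_le K0 _ _).
  by rewrite (nn_sym area Om (jet psi (Some 1)) (g (Some 1))); exact: (h (Some 1)).
by rewrite (nn_sym area Om (jet psi None) (g None)); exact: (h None).
Qed.

Lemma jetdist_cvg0 (phi : nat -> R * R -> R) g :
  (forall k, cvgL2 area Om (fun n => jet (phi n) k) (g k)) -> (fun n => jetdist g (phi n)) @ \oo --> 0.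
Proof.
move=> pg; have [_ _ h1] := pg (Some 1); have [_ _ h2] := pg None.
apply: (@cvg_eqr R (2 * 0 + (m0^-1 + 1) * (2 * 0)) 0); first by rewrite !mulr0 addr0.
by apply: cvgD; [|apply: cvgMr]; apply: cvgMr.
Qed.

Let tr_sq phi : test_function setT phi -> sqi mu setT (fun y => phi (y, gamma y)).
Proof. by move=> tp; apply: graph_sqi => //; apply: C1c_cc; exact: test_C1c. Qed.

Lemma trace_ex (phi : nat -> R * R -> R) g : (forall n, test_function setT (phi n)) ->
  (forall k, cvgL2 area Om (fun n => jet (phi n) k) (g k)) ->
  exists t, cvgL2 mu setT (fun n y => phi n (y, gamma y)) t.
Proof.
move=> tp pg; apply: (L2_complete mT) => [n|e e0]; first exact: tr_sq.
have sg k : sqi area Om (g k) by exact: cvgL2_lim (pg k).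
have := jetdist_cvg0 pg => /cvgr0Pnorm_le /(_ (e / 2)); rewrite divr_gt0// => /(_ isT)[N _ HN].
exists N => i j Ni Nj; apply: le_trans (trace_diff2 (tp i) (tp j) sg) _.
rewrite [leRHS]splitr; apply: lerD.
  by apply: le_trans (ler_norm _) _; exact: HN.
by apply: le_trans (ler_norm _) _; exact: HN.
Qed.

(** The trace does not depend on the approximating sequence. This is needed because the sequences
    defining the lower trace and the vanishing upper trace are unrelated. *)
Lemma trace_cvg (phi psi : nat -> R * R -> R) g t : (forall n, test_function setT (phi n)) ->
  (forall n, test_function setT (psi n)) ->
  (forall k, cvgL2 area Om (fun n => jet (phi n) k) (g k)) ->
  (forall k, cvgL2 area Om (fun n => jet (psi n) k) (g k)) ->
  cvgL2 mu setT (fun n y => psi n (y, gamma y)) t -> cvgL2 mu setT (fun n y => phi n (y, gamma y)) t.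
Proof.
move=> tp ts pg sg pt; have [s1 st h] := pt.
have qg k : sqi area Om (g k) by exact: cvgL2_lim (pg k).
split=> [n||]; [exact: tr_sq|exact: st|].
apply: (@squeeze0 _ _ (fun n => 2 * (jetdist g (phi n) + jetdist g (psi n)) +
   2 * nn mu setT (fun y => psi n (y, gamma y) - t y))) => [n|].
  rewrite nn_ge0 /=.
  apply: le_trans (nn_split1 (tr_sq (tp n)) (tr_sq (ts n)) st) _.
  by rewrite lerD2r; apply: ler_wpM2l => //; exact: trace_diff2.
apply: (@cvg_eqr R (2 * (0 + 0) + 2 * 0) 0); first by rewrite addr0 !mulr0 addr0.
by apply: cvgD; apply: cvgMr => //; apply: cvgD; exact: jetdist_cvg0.
Qed.

Definition sdat u : sdata := (cdata Om u, fun c y => cpart c (trace Om gamma u y)).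

Let mr1 : measurable_fun setT (arc_density (fun _ : R => d)).
Proof. by rewrite (_ : arc_density _ = fun=> 1)//; apply/funext => y; exact: arc_cst. Qed.
Let rC1 y : arc_density (fun _ : R => d) y <= 1. Proof. by rewrite arc_cst. Qed.

(** The sequence whose upper trace vanishes also has a lower trace by [trace_ex]. Hence the chosen
    [trace] is not the default value, and it is the limit along that same sequence. *)
Lemma dom_HH u : W12_zero_trace Om (fun=> d) u -> HH gamma d (sdat u).
Proof.
move=> [/(W2P oO mO) wu /(traceP oO mO cd mr1 rC1 _ wu)[phi [tp P1 P2]]].
have tex c := trace_ex (tp c) (P1 c).
have [t0 T0] := tex false; have [t1 T1] := tex true.
have it : is_trace Om gamma u (fun y => t0 y +i* t1 y).
  apply/(traceP oO mO cg mr rC _ wu); exists phi; split=> //.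
  by move=> [].
have : is_trace Om gamma u (trace Om gamma u).
  by apply: (@xgetPex _ _ [set t | is_trace Om gamma u t]); exists (fun y => t0 y +i* t1 y).
move=> /(traceP oO mO cg mr rC _ wu)[psi [ts Q1 Q2]] c.
exists (phi c); split; [exact: tp|exact: P1| |].
- exact: (trace_cvg (tp c) (ts c) (P1 c) (Q1 c) (Q2 c)).
- by have := P2 c; case: c.
Qed.

Lemma HH_wjet (U : sdata) : HH gamma d U -> wjet Om U.1.
Proof.
move=> HU; split; first exact: HH_sq HU.
move=> c j; have [phi [tp P1 _ _]] := HU c.
by apply: (rweak_lim oO _ (P1 None) (P1 (Some j))) => n; exact: (rweak_C1c j oO (test_C1c (tp n))).
Qed.

(** The weak derivatives of [mkc U.1] are chosen anew and may differ from those in [U] on a null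
    set; the second claim records that this does not affect the norm. *)
Lemma HH_dom (U : sdata) : HH gamma d U -> W12_zero_trace Om (fun=> d) (mkc U.1) /\
  NN Om (fun p x => -1 * cdata Om (mkc U.1) p x + U.1 p x) = 0.
Proof.
move=> HU; have [wu ae] := cdata_of oO mO (HH_wjet HU) (fun c x => cpart_mkc c U.1 x).
have [su _] := wu; have sU : sqK Om U.1 by exact: HH_sq HU.
split; last first.
  apply: big1 => p _; have s1 := sqi_meas (su p); have s2 := sqi_meas (sU p).
  transitivity (nn area Om (fun=> 0)).
    apply: ae_nn => //; first by apply: measurable_funD => //; exact: measurable_funM.
    by apply: aeS (ae p) => x h Ox; rewrite h// mulN1r addNr.
  by rewrite /nn /ip /Rintegral integral0_eq// => x _; rewrite mulr0.
split; first exact/(W2P oO mO).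
apply/(traceP oO mO cd mr1 rC1 _ wu).
have [phi H] : exists phi : bool -> nat -> R * R -> R, forall c,
    [/\ forall n, test_function setT (phi c n),
        forall k, cvgL2 area Om (fun n => jet (phi c n) k) (U.1 (c, k)) &
        cvgL2 mu setT (fun n y => phi c n (y, d)) (fun=> 0)].
  have [phi1 [? ? ? ?]] := HU true; have [phi0 [? ? ? ?]] := HU false.
  by exists (fun c => if c then phi1 else phi0) => -[].
exists phi; split=> [c n|c k|c].
- by have [] := H c.
- have [tp /(_ k)[P1 P2 P3] _] := H c.
  have aeq n : nn area Om (fun x => jet (phi c n) k x - U.1 (c, k) x) =
     nn area Om (fun x => jet (phi c n) k x - cdata Om (mkc U.1) (c, k) x).
    apply: ae_nn => //; do ?[by apply: measurable_funB; [exact: sqi_meas (P1 n)|exact: sqi_meas]].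
    by apply: aeS (ae (c, k)) => x h Ox; rewrite h.
  by split=> //; under eq_fun => n do rewrite -aeq.
- by have [_ _] := H c; case: c.
Qed.

End FormDomain.

(** * The sesquilinear form in real and imaginary parts *)

Section ComplexForms.
Local Open Scope complex_scope.
Context {R : realType}.
Local Notation mu := (@lebesgue_measure R).
Local Notation area := (@area R).
Local Notation T2 := (measurableTypeR R * measurableTypeR R)%type.
Implicit Types (c e : bool) (j : 'I_2) (k l : idx) (p q : cidx).

Lemma addr_rot4 (V : nmodType) (a b c e : V) : a + b + c + e = e + b + (c + a).
Proof. by rewrite addrC -[RHS]addrA; congr (_ + _); rewrite -addrA addrC -addrA. Qed.

Lemma big_idx (V : nmodType) (F : idx -> V) : \sum_k F k = F None + \sum_(j < 2) F (Some j).
Proof.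
rewrite (bigD1 None)//=; congr (_ + _).
rewrite (bigD1 (Some 0))//= (bigD1 (Some 1))//= big_pred0 ?addr0; last first.
  by move=> [j|//]; have [->|->] := ord2P j; rewrite ?eqxx ?andbF.
by rewrite big_ord_recl big_ord1; congr (_ + F (Some _)); exact: val_inj.
Qed.

Lemma sum_cidx (F : cidx -> R) : \sum_p F p = \sum_c \sum_k F (c, k).
Proof.
by rewrite (eq_bigr (fun p => F (p.1, p.2))) => [|[]//]; rewrite -(pair_bigA _ (fun c k => F (c, k))).
Qed.

Lemma cpartMl c (r : R) (z : R[i]) : cpart c (r%:C * z) = r * cpart c z.
Proof. by rewrite mulrC cpartMr mulrC. Qed.

(* The real and imaginary parts of a Hermitian form are the associated real
   form evaluated at [v] and at [i v]. *)
Definition rotb {T : Type} e (G : bool -> T -> R) c : T -> R :=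
  fun x => if e then (if c then G false x else - G true x) else G c x.

Definition rotd e (V : @sdata R) : @sdata R := if e then JJ V else V.

Lemma rotd1 e (V : @sdata R) c k : (rotd e V).1 (c, k) = rotb e (fun c => V.1 (c, k)) c.
Proof. by case: e => //; apply/funext => x; rewrite /rotd/JJ/=; case: c. Qed.

Lemma rotd2 e (V : @sdata R) c : (rotd e V).2 c = rotb e V.2 c.
Proof. by case: e. Qed.

Section Inner.
Context {disp : measure_display} {T : measurableType disp}.
Variables (nu : {measure set T -> \bar R}) (D : set T).
Hypothesis mD : measurable D.
Implicit Types F G : T -> R[i].

Lemma inner_part e F G : (forall c, sqi nu D (fun x => cpart c (F x))) ->
  (forall c, sqi nu D (fun x => cpart c (G x))) ->
  cpart e (inner nu D F G) = \sum_c ip nu D (fun x => cpart c (F x)) (rotb e (fun c x => cpart c (G x)) c).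
Proof.
move=> sF sG; have i c c' := ip_int mD (sF c) (sG c').
rewrite big_bool /inner /cintegral /=; case: e; rewrite /= /ip -RintegralD//.
- by apply: eq_Rintegral => x _; rewrite /rotb /=; case: (F x) (G x) => [a b] [a' b'] /=; ring.
- exact: (i true false).
- rewrite (_ : (fun x => complex.Re (F x) * _) = fun x => -1 * (cpart false (F x) * cpart true (G x))).
    by apply: (intZ mD); exact: i.
  by apply/funext => x; rewrite /rotb /=; ring.
- by apply: eq_Rintegral => x _; rewrite /rotb /=; case: (F x) (G x) => [a b] [a' b'] /=; ring.
- exact: (i true true).
- exact: (i false false).
Qed.

End Inner.

Section System.
Variables (A : 'I_2 -> 'I_2 -> R * R -> R[i]) (A1 : 'I_2 -> R * R -> R[i]) (A0 : R * R -> R).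

(** The function and its two derivatives form one vector, so all terms of the form are entries of a
    3 by 3 matrix; the terms (u, A_j d_j v) contribute the conjugates of [A1]. *)
Definition cmat k l (x : R * R) : R[i] :=
  match k, l with
  | Some i, Some j => A i j x
  | None, Some j => A1 j x
  | Some i, None => conjc (A1 i x)
  | None, None => (A0 x)%:C
  end.

(* The matrix of multiplication by [cmat] on real and imaginary parts. *)
Definition rmat p q (x : R * R) : R :=
  let z := cmat q.2 p.2 x in
  if p.1 == q.1 then complex.Re z else if q.1 then complex.Im z else - complex.Im z.

Lemma cpart_cmat c k l (z : R[i]) x : cpart c (cmat k l x * z) = \sum_e rmat (e, l) (c, k) x * cpart e z.
Proof.
rewrite big_bool /rmat /=; case: (cmat k l x) z => [a b] [a' b'].
by case: c => /=; ring.
Qed.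

Section Layer.
Variables (d m0 Cr Kb M c1 C1 : R) (gamma kap : R -> R).
Hypotheses (m0_gt0 : 0 < m0) (cg : continuous gamma) (gm : forall y, gamma y + m0 <= d).
Hypothesis mr : measurable_fun setT (arc_density gamma).
Hypothesis rC : forall y, arc_density gamma y <= Cr.
Local Notation kb := (fun y => kap y * arc_density gamma y).
Hypotheses (Kb0 : 0 <= Kb) (M0 : 0 <= M) (c1_gt0 : 0 < c1) (C10 : 0 <= C1).
Hypothesis mk : measurable_fun setT kb.
Hypothesis kK : forall y, `|kb y| <= Kb.
Local Notation Om := (layer gamma d).
Hypothesis mm : forall p q, mbnd Om M (rmat p q).
Hypothesis ell : bulk_ell d gamma c1 C1 rmat.
Hypothesis bJ : bulk_J d gamma rmat.
Let mT : measurable (setT : set (measurableTypeR R)) := measurableT.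
Let mO : measurable (Om : set T2) := layer_cont_meas d cg.
Let oO : open Om := layer_open cg.
Local Notation H := (HH gamma d).
Local Notation dom := (W12_zero_trace Om (fun=> d)).

Definition cval (u : R * R -> R[i]) k : R * R -> R[i] := if k is Some j then weak_deriv Om j u else u.

Lemma cmat_sqi c k l u : sqK Om (cdata Om u) ->
  sqi area Om (fun x => cpart c (cmat k l x * cval u l x)).
Proof.
move=> su; under eq_fun => x do rewrite cpart_cmat big_bool.
by apply: sqiD => //; [exact: (sq_m mO mm _ _ (su (true, l)))|exact: (sq_m mO mm _ _ (su (false, l)))].
Qed.

Lemma cmat_ip c k l u Z : sqK Om (cdata Om u) -> sqi area Om Z ->
  ip area Om (fun x => cpart c (cmat k l x * cval u l x)) Z =
  \sum_e ip area Om (fun x => rmat (e, l) (c, k) x * cdata Om u (e, l) x) Z.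
Proof.
move=> su sZ; rewrite big_bool /=.
rewrite -(ipDl mO (sq_m mO mm _ _ (su (true, l))) (sq_m mO mm _ _ (su (false, l))) sZ).
by apply: eq_Rintegral => x _; rewrite cpart_cmat big_bool.
Qed.

Lemma bulk_formE u v : bulk_form A A1 A0 Om u v =
  \sum_k \sum_l inner area Om (fun x => cmat k l x * cval u l x) (cval v k).
Proof.
rewrite big_idx big_idx /= /bulk_form.
have -> : \sum_(i < 2) \sum_l inner area Om (fun x => cmat (Some i) l x * cval u l x) (cval v (Some i)) =
   \sum_(i < 2) inner area Om u (fun x => A1 i x * weak_deriv Om i v x) +
   \sum_(i < 2) \sum_(j < 2) inner area Om (fun x => A i j x * weak_deriv Om j u x) (weak_deriv Om i v).
  rewrite -big_split /=; apply: eq_bigr => i _; rewrite big_idx /=; congr (_ + _).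
  by rewrite /inner; congr (cintegral _ _ _); apply/funext => x; rewrite rmorphM mulrCA mulrA.
by exact: addr_rot4.
Qed.

Lemma bulk_part e u v (V : @sdata R) : sqK Om (cdata Om u) -> sqK Om (cdata Om v) -> V.1 = cdata Om v ->
  cpart e (bulk_form A A1 A0 Om u v) = bf Om rmat (cdata Om u) (rotd e V).1.
Proof.
move=> su sv VE.
have cs (I : finType) (F : I -> R[i]) : cpart e (\sum_i F i) = \sum_i cpart e (F i).
  by apply: (big_morph (cpart e)); [exact: cpartD|case: e].
have sV p : sqi area Om ((rotd e V).1 p).
  case: p => c k; rewrite rotd1 VE /rotb; case: (e) => /=; last exact: sv.
  by case: c; [exact: sv|apply: sqiN => //; exact: sv].
rewrite bulk_formE cs /bf exchange_big /= sum_cidx exchange_big /=; apply: eq_bigr => k _.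
rewrite cs; under [in RHS]eq_bigr => c _ do rewrite sum_cidx exchange_big /=.
rewrite exchange_big /=; apply: eq_bigr => l _.
rewrite (inner_part mO e (fun c => cmat_sqi c k l su)); last by move=> c; exact: (sv (c, k)).
apply: eq_bigr => c _; rewrite -(cmat_ip c k l su (sV (c, k))).
by rewrite rotd1 VE.
Qed.

Lemma trace_part e t s (U V : @sdata R) : (forall c y, U.2 c y = cpart c (t y)) ->
  (forall c y, V.2 c y = cpart c (s y)) -> H U -> H V ->
  cpart e (arc_inner gamma (fun y => (kap y)%:C * t y) s) = tf kb U (rotd e V).
Proof.
move=> tU sV HU HV.
have -> : arc_inner gamma (fun y => (kap y)%:C * t y) s =
    inner mu setT (fun y => (kap y * arc_density gamma y)%:C * t y) s.
  by rewrite /arc_inner /inner; congr (cintegral _ _ _); apply/funext => y; rewrite rmorphM; ring.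
have aek : {ae mu, forall y, (setT : set R) y -> `|kb y| <= Kb} by apply: aeW => y _; exact: kK.
have st c : sqi mu setT (fun y => cpart c (s y)).
  by under eq_fun => y do rewrite -sV; exact: HH_tsq HV.
rewrite (inner_part mT e _ st); last first.
  move=> c; under eq_fun => y do rewrite cpartMl -tU.
  by apply: (sqi_mulM mT mk aek); exact: HH_tsq HU.
apply: eq_bigr => c _; rewrite rotd2; apply: eq_Rintegral => y _.
rewrite cpartMl tU; congr (_ * _); rewrite /rotb.
by case: (e); case: (c); rewrite sV.
Qed.

Definition cparts (f : R * R -> R[i]) c : R * R -> R := fun x => cpart c (f x).

Lemma rhs_part e u v f (V : @sdata R) : sqK Om (cdata Om u) -> sqK Om (cdata Om v) ->
  (forall c, sqi area Om (cparts f c)) -> V.1 = cdata Om v ->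
  cpart e (inner area Om (fun x => f x + (0 +i* 1) * u x) v) =
  FL d gamma (cparts f) (rotd e V).1 - cross Om (cdata Om u) (rotd e V).1.
Proof.
move=> su sv sf VE.
have sV p : sqi area Om ((rotd e V).1 p).
  case: p => c k; rewrite rotd1 VE /rotb; case: (e) => /=; last exact: sv.
  by case: c; [exact: sv|apply: sqiN => //; exact: sv].
have pE c x : cpart c (f x + (0 +i* 1) * u x) =
   cpart c (f x) + (if c then cpart false (u x) else -1 * cpart true (u x)).
  by rewrite cpartD; congr (_ + _); case: c; case: (u x) => a b /=; ring.
have sN := sqiZ mO (-1) (su (true, None)).
have si c : sqi area Om (fun x => if c then cpart false (u x) else -1 * cpart true (u x)).
  by case: c => //; exact: (su (false, None)).
rewrite (inner_part mO e); last 2 first.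
- by move=> c; under eq_fun => x do rewrite pE; apply: sqiD => //; exact: sf.
- by move=> c; exact: (sv (c, None)).
rewrite /FL !big_bool /cross /=.
have E c : ip area Om (fun x => cpart c (f x + (0 +i* 1) * u x)) (rotb e (fun c x => cpart c (v x)) c) =
    ip area Om (cparts f c) ((rotd e V).1 (c, None)) +
    ip area Om (fun x => if c then cpart false (u x) else -1 * cpart true (u x)) ((rotd e V).1 (c, None)).
  rewrite -(ipDl mO (sf c) (si c) (sV (c, None))); apply: eq_Rintegral => x _.
  by rewrite pE rotd1 VE.
have EN : ip area Om (fun x => -1 * cpart true (u x)) ((rotd e V).1 (false, None)) =
    - ip area Om (cdata Om u (true, None)) ((rotd e V).1 (false, None)).
  by rewrite (ipZl mO _ (su (true, None)) (sV (false, None))) mulN1r.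
rewrite (E true) (E false) /= EN opprB.
set p := ip _ _ _ _; set q := ip _ _ _ _; set r := ip _ _ _ _; set z := ip _ _ _ _.
by ring.
Qed.

(** One complex equation is two real ones, and its imaginary part is the real equation tested with i
    v. The term i u passes from the right side into [pf]. *)
Lemma robin_iff u v f : dom u -> dom v -> (forall c, sqi area Om (cparts f c)) ->
  robin_form A A1 A0 Om gamma kap u v = inner area Om (fun x => f x + (0 +i* 1) * u x) v <->
  forall e, pf d gamma kb rmat (sdat d gamma u) (rotd e (sdat d gamma v)) =
    FL d gamma (cparts f) (rotd e (sdat d gamma v)).1.
Proof.
move=> du dv sf.
have HU := dom_HH m0_gt0 cg gm mr rC du; have HV := dom_HH m0_gt0 cg gm mr rC dv.
have su : sqK Om (cdata Om u) by exact: (HH_sq HU).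
have sv : sqK Om (cdata Om v) by exact: (HH_sq HV).
have L e : cpart e (robin_form A A1 A0 Om gamma kap u v) =
    qf d gamma kb rmat (sdat d gamma u) (rotd e (sdat d gamma v)).
  rewrite /robin_form cpartD /qf; congr (_ + _).
    exact: (bulk_part e su sv (erefl (cdata Om v) : (sdat d gamma v).1 = _)).
  by apply: trace_part.
have Rr e := rhs_part e su sv sf (erefl (cdata Om v) : (sdat d gamma v).1 = _).
split=> [E e|E].
  by rewrite /pf -L E Rr subrK.
by apply: cpart_inj => e; rewrite L Rr -E /pf addrK.
Qed.

(** The form is bounded by [NN], which also controls the traces, so data at distance zero are
    interchangeable in it. *)
Lemma pf_ae0 (U V W : @sdata R) : H U -> H V -> H W ->
  NN Om (fun p x => -1 * U.1 p x + V.1 p x) = 0 -> pf d gamma kb rmat U W = pf d gamma kb rmat V W.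
Proof.
move=> HU HV HW N0; have HL := HH_lin cg (-1) HU HV.
have := pf_bound m0_gt0 Kb0 M0 cg gm mk kK mm HL HW.
rewrite (pf_linl cg mk kK mm (-1) HU HV HW) N0 sqrtr0 mul0r mulr0 normr_le0 mulN1r addrC subr_eq0.
by move/eqP.
Qed.

Lemma pf_FL_ae0 f (U V W : @sdata R) : (forall c, sqi area Om (cparts f c)) -> H U -> H V -> H W ->
  NN Om (fun p x => -1 * U.1 p x + V.1 p x) = 0 ->
  pf d gamma kb rmat W U = FL d gamma (cparts f) U.1 ->
  pf d gamma kb rmat W V = FL d gamma (cparts f) V.1.
Proof.
move=> sf HU HV HW N0 E; have HL := HH_lin cg (-1) HU HV.
have b1 := pf_bound m0_gt0 Kb0 M0 cg gm mk kK mm HW HL.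
have b2 := FL_bound cg sf HL.
have Z0 : ZZ Om (slin (-1) U V).1 = 0.
  by apply/eqP; rewrite eq_le ZZ_ge0 andbT; apply: le_trans (ZZ_leNN _ _) _; rewrite N0.
move: b1 b2; rewrite (pf_linr cg mk kK mm (-1) HU HV HW) (FL_lin cg (-1) sf HU HV) Z0 N0 sqrtr0 !mulr0 !normr_le0.
by rewrite E !mulN1r !(addrC (- _)) !subr_eq0 => /eqP -> /eqP ->.
Qed.

Lemma rotd_HH e (V : @sdata R) : H V -> H (rotd e V).
Proof. by move=> HV; case: e => //; exact: HH_J. Qed.

(** [resolvent] is a choice with default value 0; [pf_exists] shows that a solution exists, so the
    choice is one. The equation then extends from complex test functions to all data in [HH]. *)
Lemma resolvent_data f : inL2 area Om f ->
  let u := resolvent (robin_operator A A1 A0 d gamma kap) (0 +i* 1) f in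
  [/\ dom u, H (sdat d gamma u) &
    forall V, H V -> pf d gamma kb rmat (sdat d gamma u) V = FL d gamma (cparts f) V.1].
Proof.
move=> /(inL2P _ mO) sf /=; set u := resolvent _ _ _.
have [U HU EU] := pf_exists m0_gt0 Kb0 M0 c1_gt0 C10 cg gm mk kK mm ell bJ sf.
have dH v : dom v -> H (sdat d gamma v) by move=> dv; exact: (dom_HH m0_gt0 cg gm mr rC dv).
have sfi v : dom v -> inL2 area Om (fun x => f x + (0 +i* 1) * v x).
  move=> /dH/HH_sq sv; apply/(inL2P _ mO) => c.
  have s2 : sqi area Om (fun x => cpart c ((0 +i* 1) * v x)).
    case: c.
      rewrite [X in sqi _ _ X](_ : _ = cdata Om v (false, None)); first exact: (sv (false, None)).
      by apply/funext => x; rewrite /cdata /=; case: (v x) => a b /=; ring.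
    rewrite [X in sqi _ _ X](_ : _ = fun x => -1 * cdata Om v (true, None) x); last first.
      by apply/funext => x; rewrite /cdata /=; case: (v x) => a b /=; ring.
    exact: (sqiZ mO (-1) (sv (true, None))).
  have := sqiD mO (sf c) s2; congr sqi; apply/funext => x.
  by rewrite cpartD.
have [dU NU] := HH_dom cg HU.
have : robin_operator A A1 A0 d gamma kap u (fun x => f x + (0 +i* 1) * u x).
  apply: (@xgetPex _ _ [set u | robin_operator A A1 A0 d gamma kap u (fun x => f x + (0 +i* 1) * u x)]).
  exists (mkc U.1); split; [exact: dU|exact: sfi|].
  move=> v dv; apply/(robin_iff dU dv sf) => e.
  rewrite (pf_ae0 (dH _ dU) HU (rotd_HH e (dH _ dv)) NU); exact: (EU _ (rotd_HH e (dH _ dv))).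
move=> [du _ Eu]; split=> //; first exact: dH.
move=> V HV; have [dV NV] := HH_dom cg HV.
apply: (pf_FL_ae0 sf (dH _ dV) HV (dH _ du) NV).
by have /(robin_iff du dV sf)/(_ false) := Eu _ dV.
Qed.

End Layer.
End System.
End ComplexForms.

(** * The coefficients *)

Section Coefficients.
Local Open Scope complex_scope.
Context {R : realType}.
Local Notation mu := (@lebesgue_measure R).
Local Notation area := (@area R).
Local Notation T2 := (measurableTypeR R * measurableTypeR R)%type.
Implicit Types (c e : bool) (j : 'I_2) (k l : idx) (p q : cidx).

Lemma cpart_le c (z : R[i]) : `|cpart c z| <= Num.sqrt (sqmod z).
Proof.
rewrite -sqrtr_sqr ler_sqrt; last by rewrite addr_ge0// sqr_ge0.
by case: c; rewrite /sqmod ?lerDl ?lerDr sqr_ge0.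
Qed.

Lemma inLinf_mbnd (Om : set T2) u : inLinf area Om u ->
  exists2 M, 0 <= M & forall c, mbnd Om M (fun x => cpart c (u x)).
Proof.
move=> [[m1 m2] [M HM]]; exists `|M| => // c; split; first by case: c.
by apply: aeS HM => x h Ox; apply: le_trans (cpart_le _ _) _; apply: le_trans (h Ox) (ler_norm _).
Qed.

Lemma mbnd_le (Om : set T2) (M M' : R) h : M <= M' -> mbnd Om M h -> mbnd Om M' h.
Proof. by move=> MM [mh bh]; split=> //; apply: aeS bh => x hx Ox; exact: le_trans (hx Ox) MM. Qed.

Lemma mbndN (Om : set T2) (M : R) h : mbnd Om M h -> mbnd Om M (fun x => - h x).
Proof.
move=> [mh bh]; split; first exact: measurableT_comp.
by apply: aeS bh => x hx Ox; rewrite normrN; exact: hx.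
Qed.

Lemma finite_bound (I : finType) (P : I -> R -> Prop) :
  (forall i (M M' : R), M <= M' -> P i M -> P i M') -> (forall i, exists2 M : R, 0 <= M & P i M) ->
  exists2 M : R, 0 <= M & forall i, P i M.
Proof.
move=> Pm Pe; have /boolp.choice[F HF] : forall i, exists M : R, 0 <= M /\ P i M.
  by move=> i; have [M ? ?] := Pe i; exists M.
exists (\sum_i F i) => [|i]; first by apply: sumr_ge0 => i _; have [] := HF i.
have [_ Pi] := HF i; apply: Pm Pi; rewrite (bigD1 i)//= lerDl.
by apply: sumr_ge0 => j _; have [] := HF j.
Qed.

Lemma young_coef (t M m x y : R) : 0 < t -> `|m| <= M ->
  - (t * x ^+ 2 + M ^+ 2 / t * y ^+ 2) <= 2 * (m * x * y).
Proof.
move=> t0 mM; rewrite lerNl -mulrN.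
have m2 : m ^+ 2 <= M ^+ 2 by rewrite -real_normK ?num_real// lerXn2r ?nnegrE//; apply: le_trans mM.
apply: (@le_trans _ _ (t * x ^+ 2 + m ^+ 2 / t * y ^+ 2)); last first.
  by rewrite lerD2l ler_wpM2r ?sqr_ge0// ler_wpM2r// invr_ge0 ltW.
rewrite -subr_ge0; have -> : t * x ^+ 2 + m ^+ 2 / t * y ^+ 2 - 2 * - (m * x * y) = (t * x + m * y) ^+ 2 / t.
  by field; rewrite gt_eqF.
by rewrite divr_ge0 ?sqr_ge0// ltW.
Qed.

Variables (d c0 : R) (A : 'I_2 -> 'I_2 -> R * R -> R[i]) (A1 : 'I_2 -> R * R -> R[i]) (A0 : R * R -> R).
Hypothesis d0 : 0 < d.
Local Notation Om := (layer (fun _ : R => 0) d).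
Hypothesis hA : forall i j, Winf Om 2 (A i j).
Hypothesis hA1 : forall j, Winf Om 1 (A1 j).
Hypothesis hA0 : inLinf area Om (fun x => (A0 x)%:C).
Hypothesis herm : forall i j x, Om x -> A i j x = conjc (A j i x).
Hypothesis hc0 : 0 < c0.
Hypothesis ellA : forall x (z : 'I_2 -> R[i]), Om x ->
  (c0 * (sqmod (z 0) + sqmod (z 1)))%:C <= \sum_(i < 2) \sum_(j < 2) A i j x * z i * conjc (z j).
Let oO : open Om. Proof. by apply: layer_open; exact: cst_cont. Qed.
Local Notation m := (rmat A A1 A0).

(** One constant for all shears, because [s] varies with eps. *)
Definition coef_lip (M : R) (h : R * R -> R) : Prop :=
  forall s : R, 0 <= s -> s < d -> vlip d s M h.

Lemma coef_lip_le (M M' : R) h : M <= M' -> coef_lip M h -> coef_lip M' h.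
Proof.
move=> MM hl s s0 sd; apply: aeS (hl s s0 sd) => x hx Ox; apply: le_trans (hx Ox) _.
exact: ler_wpM2r.
Qed.

Lemma coef_lipN (M : R) h : coef_lip M h -> coef_lip M (fun x => - h x).
Proof.
move=> hl s s0 sd; apply: aeS (hl s s0 sd) => x hx Ox.
by rewrite -opprD normrN; exact: hx.
Qed.

Lemma Winf_coef n u : Winf Om n.+1 u -> exists2 M, 0 <= M & forall c,
  mbnd Om M (fun x => cpart c (u x)) /\ coef_lip M (fun x => cpart c (u x)).
Proof.
move=> [/inLinf_mbnd[M M0 HM] /(_ 1)[g /weakP wg Lg]].
have [L L0 HL] : exists2 L, 0 <= L & forall c, mbnd Om L (fun x => cpart c (g x)).
  by apply: inLinf_mbnd; case: n Lg => [|n] [].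
exists (M + L) => [|c]; first exact: addr_ge0.
split; first by apply: mbnd_le (HM c); rewrite lerDl.
apply: (@coef_lip_le L); first by rewrite lerDr.
move=> s s0 sd; have [_ bL] := HL c; exact: (shear_lip s0 sd L0 (wg c) bL).
Qed.

(** A_0 alone has no weak derivative to bound; it fills the entries between undifferentiated
    functions, which the second claim leaves out. *)
Lemma coef_bounds : exists2 M, 0 <= M &
  (forall p q, mbnd Om M (m p q)) /\
  forall p q, ~~ ((p.2 == None) && (q.2 == None)) -> coef_lip M (m p q).
Proof.
pose P (kl : idx * idx) (M : R) := (forall c, mbnd Om M (fun x => cpart c (cmat A A1 A0 kl.1 kl.2 x))) /\
  (~~ ((kl.2 == None) && (kl.1 == None)) -> forall c, coef_lip M (fun x => cpart c (cmat A A1 A0 kl.1 kl.2 x))).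
have [|[[i|] [j|]]|M M0 HM] := @finite_bound _ P.
- move=> i M M' MM [h1 h2]; split=> [c|n c]; first exact: mbnd_le (h1 c).
  exact: coef_lip_le (h2 n c).
- have [M M0 HM] := Winf_coef (hA i j); exists M => //; split=> [c|_ c]; by have [] := HM c.
- have [M M0 HM] := Winf_coef (hA1 i); exists M => //; split=> [c|_ c]; have [h1 h2] := HM c.
    case: c h1 h2 => h1 h2; [have := mbndN h1|have := h1]; congr mbnd; apply/funext => x /=;
      by case: (A1 i x).
  case: c h1 h2 => h1 h2; [have := coef_lipN h2|have := h2]; congr coef_lip; apply/funext => x /=;
      by case: (A1 i x).
- have [M M0 HM] := Winf_coef (hA1 j); exists M => //; split=> [c|_ c]; by have [] := HM c.
- have [M M0 HM] := inLinf_mbnd hA0; exists M => //; split=> // c; exact: HM.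
have E p q : m p q = (fun x => cpart (p.1 != q.1) (cmat A A1 A0 q.2 p.2 x)) \/
    m p q = (fun x => - cpart (p.1 != q.1) (cmat A A1 A0 q.2 p.2 x)).
  move: p q => [c k] [c' l]; rewrite /rmat /=.
  by case: c; case: c'; [left|right|left|left]; apply/funext.
exists M => //; split=> p q.
  have [h _] := HM (q.2, p.2); have [->|->] := E p q; [exact: h|apply: mbndN; exact: h].
move=> pq; have [_ /(_ pq) h] := HM (q.2, p.2).
by have [->|->] := E p q; [exact: h|apply: coef_lipN; exact: h].
Qed.

Lemma rmat_sym p q x : Om x -> m p q x = m q p x.
Proof.
move=> Ox; rewrite /rmat.
have -> : cmat A A1 A0 p.2 q.2 x = conjc (cmat A A1 A0 q.2 p.2 x).
  case: p q => [? [i|]] [? [j|]] //=; first exact: herm.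
  - by rewrite conjcK.
  - by rewrite oppr0.
case: (cmat _ _ _ _ _ _) => a b; case: p q => [[] k] [[] l] //=; by rewrite opprK.
Qed.

Lemma sum_I2 (V : nmodType) (F : 'I_2 -> V) : \sum_(i < 2) F i = F 0 + F 1.
Proof. by rewrite big_ord_recl big_ord1; congr (_ + F _); exact: val_inj. Qed.

Let expand (F : cidx -> R) : \sum_p F p = F (true, None) + F (true, Some 0) + F (true, Some 1) +
  (F (false, None) + F (false, Some 0) + F (false, Some 1)).
Proof. by rewrite big_cidx big_bool. Qed.

Lemma rmat_J : bulk_J d (fun=> 0) m.
Proof.
move=> x Ox xi; rewrite !expand /=.
have s := fun p q => rmat_sym p q Ox.
rewrite (s (true, Some 0) (true, None)) (s (true, Some 1) (true, None)) (s (true, Some 1) (true, Some 0)).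
rewrite (s (false, Some 0) (false, None)) (s (false, Some 1) (false, None)) (s (false, Some 1) (false, Some 0)).
have t k l : m (false, k) (false, l) x = m (true, k) (true, l) x by [].
have h k l : m (false, k) (true, l) x = - m (true, k) (false, l) x by rewrite /rmat /= opprK.
have z k : m (false, k) (true, k) x = 0.
  have := s (false, k) (true, k); rewrite h => /eqP; rewrite eqNr => /eqP ->.
  by rewrite oppr0.
have z' k : m (true, k) (false, k) x = 0 by rewrite -(z k) s.
rewrite !z !z' !t.
rewrite (s (true, None) (false, Some 0)) (s (true, None) (false, Some 1)) (s (true, Some 0) (false, Some 1)).
rewrite (s (true, Some 0) (false, None)) (s (true, Some 1) (false, None)) (s (true, Some 1) (false, Some 0)).
have g k l : m (false, k) (true, l) x = - m (false, l) (true, k) x by rewrite h s.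
rewrite (g (Some 0) None) (g (Some 1) None) (g (Some 1) (Some 0)).
by ring.
Qed.

(** Mixed terms are split by Young's inequality with weight c0 / 4. A gradient entry meets two
    zero-order entries, which costs c0 / 2; a zero-order entry meets four gradient entries, which
    costs 16 M^2 / c0, and A_0 adds M. *)
Lemma rmat_ell M : (forall p q, mbnd Om M (m p q)) -> 0 <= M ->
  bulk_ell d (fun=> 0) (c0 / 2) (16 * M ^+ 2 / c0 + M) m.
Proof.
move=> mm M0; rewrite /bulk_ell.
have h p : {ae area, forall x, forall q : cidx, Om x -> `|m p q x| <= M}.
  by apply: (@ae_countable _ _ _ area cidx (fun q x => Om x -> `|m p q x| <= M)) => q; have [] := mm p q.
have := @ae_countable _ _ _ area cidx (fun p x => forall q : cidx, Om x -> `|m p q x| <= M) h; move: h => _.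
apply: aeS => x bm Ox xi.
have b p q : `|m p q x| <= M by exact: bm.
(* The conjugate matches the order of indices: the hypothesis pairs A_ij with z_i and the conjugate
   of z_j, the form pairs it with d_j u and the conjugate of d_i v. *)
pose z j : R[i] := conjc (xi (false, Some j) +i* xi (true, Some j)).
have := ellA z Ox; rewrite lecE => /andP[_]; rewrite !sum_I2.
have -> : complex.Re (A 0 0 x * z 0 * conjc (z 0) + A 0 1 x * z 0 * conjc (z 1) +
    (A 1 0 x * z 1 * conjc (z 0) + A 1 1 x * z 1 * conjc (z 1))) =
  \sum_(p | p.2 != None) \sum_(q | q.2 != None) m p q x * xi p * xi q.
  rewrite !big_cidx !big_bool /= !big_cidx !big_bool /= /rmat /= /z.
  case: (A 0 0 x) (A 0 1 x) (A 1 0 x) (A 1 1 x) => [? ?] [? ?] [? ?] [? ?] /=.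
  by ring.
have -> : complex.Re (c0 * (sqmod (z 0) + sqmod (z 1)))%:C = c0 * \sum_(p | p.2 != None) xi p ^+ 2.
  by rewrite big_cidx big_bool /= /sqmod /z /=; ring.
move=> h.
have -> : \sum_p \sum_q m p q x * xi p * xi q = \sum_(p | p.2 != None) \sum_(q | q.2 != None) m p q x * xi p * xi q +
  (\sum_c \sum_e (2 * (m (c, Some 0) (e, None) x * xi (c, Some 0) * xi (e, None)) +
                  2 * (m (c, Some 1) (e, None) x * xi (c, Some 1) * xi (e, None))) +
   A0 x * \sum_(p | p.2 == None) xi p ^+ 2).
  have s := fun p q => rmat_sym p q Ox.
  rewrite !expand !big_cidx !big_bool /= !big_cidx !big_bool /=.
  rewrite (s (true, None) (true, Some 0)) (s (true, None) (true, Some 1)) (s (true, None) (false, Some 0))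
    (s (true, None) (false, Some 1)) (s (false, None) (true, Some 0)) (s (false, None) (true, Some 1))
    (s (false, None) (false, Some 0)) (s (false, None) (false, Some 1)).
  have -> : m (true, None) (true, None) x = A0 x by [].
  have -> : m (false, None) (false, None) x = A0 x by [].
  have -> : m (true, None) (false, None) x = 0 by rewrite /rmat /= oppr0.
  have -> : m (false, None) (true, None) x = 0 by [].
  by ring.
have c4 : 0 < c0 / 4 by rewrite divr_gt0.
have yg c j e := young_coef (xi (c, Some j)) (xi (e, None)) c4 (b (c, Some j) (e, None)).
have a0 : `|A0 x| <= M by exact: (b (true, None) (true, None)).
have a0' : - (M * \sum_(p | p.2 == None) xi p ^+ 2) <= A0 x * \sum_(p | p.2 == None) xi p ^+ 2.
  have S0 : 0 <= \sum_(p | p.2 == None) xi p ^+ 2 by apply: sumr_ge0 => p _; exact: sqr_ge0.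
  by rewrite -mulNr ler_wpM2r// lerNl; apply: le_trans (ler_norm _) _; rewrite normrN.
apply: le_trans (lerD h (lerD (_ : \sum_c \sum_e (- (c0 / 4 * xi (c, Some 0) ^+ 2 + M ^+ 2 / (c0 / 4) * xi (e, None) ^+ 2) -
   (c0 / 4 * xi (c, Some 1) ^+ 2 + M ^+ 2 / (c0 / 4) * xi (e, None) ^+ 2)) <= _) a0')); last first.
  by apply: ler_sum => c _; apply: ler_sum => e _; apply: lerD; exact: yg.
have -> : M ^+ 2 / (c0 / 4) = 4 * M ^+ 2 / c0 by field; rewrite gt_eqF.
rewrite le_eqVlt; apply/orP; left; apply/eqP.
rewrite !big_cidx !big_bool /=; field; by rewrite gt_eqF.
Qed.

End Coefficients.

(** * A pointwise bound for the Robin coefficient *)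

Section RobinCoefficient.
Context {R : realType}.
Local Notation mu := (@lebesgue_measure R).
Local Notation area := (@area R).
Local Open Scope complex_scope.

(** The rectangle of width 1 to the right of [x] has positive area, so it contains a point that
    obeys the essential bound; the Lipschitz condition covers the distance to it, at most 1 +
    delta. *)
Lemma Winf_bounded (a : R * R -> R) (delta : R) n : 0 < delta ->
  Winf (layer (fun=> 0) delta) n (fun x => (a x)%:C) ->
  (exists L : R, forall x y : R * R, 0 <= x.2 <= delta -> 0 <= y.2 <= delta -> `|a x - a y| <= L * `|x - y|) ->
  exists2 M : R, 0 <= M & forall x, 0 <= x.2 <= delta -> `|a x| <= M.
Proof.
move=> dl0 wa [L aL].
have [M M0 /(_ false)[_ bM]] : exists2 M, 0 <= M & forall c, mbnd (layer (fun=> 0) delta) M (fun x => cpart c (a x)%:C).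
  by apply: inLinf_mbnd; case: n wa => [|n] [].
exists (M + `|L| * (1 + delta)) => [|x x2]; first by rewrite addr_ge0// mulr_ge0// addr_ge0// ltW.
pose B1 : set R := `]x.1, x.1 + 1[%classic; pose B2 : set R := `]0, delta[%classic.
pose B : set (R * R) := B1 `*` B2.
have [y By ay] : exists2 y, B y & `|a y| <= M.
  apply: contrapT => nB.
  have N0 : area.-negligible B.
    apply: negligibleS bM => y By /= h; apply: nB; exists y => //; apply: h.
    by move: By => []; rewrite /B1 /B2 /= !in_itv /= => _.
  have mB : measurable (B : set (measurableTypeR R * measurableTypeR R)) by apply: measurableX; exact: measurable_itv.
  have E : area B = (mu B1 * mu B2)%E.
    exact: (@product_measure1E _ _ _ _ R mu mu _ _ (measurable_itv _) (measurable_itv _)).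
  have : (mu B1 * mu B2)%E = 0%E by rewrite -E; exact: (measure_negligible mB N0).
  rewrite /B1 /B2.
  rewrite !lebesgue_measure_itv /= !lte_fin ltrDl ltr01 dl0 -!EFinD -EFinM => -[].
  by apply/eqP; rewrite subr0 (addrC x.1) addrK mul1r gt_eqF.
move: By => []; rewrite /B1 /B2 /= !in_itv /= => /andP[y1 y1'] /andP[y2 y2'].
have -> : a x = a y + (a x - a y) by ring.
apply: le_trans (ler_normD _ _) _; apply: lerD => //.
apply: le_trans (aL _ _ x2 _) _; first by rewrite !ltW.
apply: (@le_trans _ _ (`|L| * `|x - y|)); first by rewrite ler_wpM2r// ler_norm.
rewrite ler_wpM2l// prod_normE /= ge_max.
move: x2 => /andP[x20 x2d].
by rewrite !ler_norml; apply/andP; split; apply/andP; split; lra.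
Qed.

End RobinCoefficient.

(** * Homogenization of the boundary coefficient *)

Section Homogenization.
Context {R : realType}.
Local Notation mu := (@lebesgue_measure R).
Local Notation area := (@area R).
Implicit Types (b gamma kb : R -> R) (t y z : R).

(** Difference of two squares, with both square roots at least 1. *)
Lemma sqrt1_lip (x y : R) : 0 <= x -> 0 <= y -> `|Num.sqrt (1 + x) - Num.sqrt (1 + y)| <= `|x - y|.
Proof.
move=> x0 y0; set p := Num.sqrt (1 + x); set q := Num.sqrt (1 + y).
have p1 : 1 <= p by rewrite -[leLHS]sqrtr1 ler_sqrt ?lerDl// addr_ge0.
have q1 : 1 <= q by rewrite -[leLHS]sqrtr1 ler_sqrt ?lerDl// addr_ge0.
have -> : x - y = (p - q) * (p + q).
  have e1 : p ^+ 2 = 1 + x by rewrite sqr_sqrtr// addr_ge0.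
  have e2 : q ^+ 2 = 1 + y by rewrite sqr_sqrtr// addr_ge0.
  by rewrite -subr_sqr e1 e2; ring.
rewrite normrM ler_peMr// ger0_norm; last by rewrite addr_ge0// ?(le_trans ler01).
by apply: le_trans p1 _; rewrite lerDl (le_trans ler01).
Qed.

(** The arc length density in terms of t, the squared ratio eta / eps, and of the fast variable. Its
    Lipschitz dependence on t is the source of |eta^2 / eps^2 - alpha^2| in the rate. *)
Definition slope_density b t z : R := Num.sqrt (1 + t * derive1 b z ^+ 2).

Section Profile.
Variables (b : R -> R) (B : R).
Hypotheses (cb' : continuous (derive1 b)) (bB : forall z, `|derive1 b z| <= B).
Local Notation rho := (slope_density b).

Lemma slope_density_ge1 t z : 0 <= t -> 1 <= rho t z.
Proof.
move=> t0; have h : 0 <= t * derive1 b z ^+ 2 by rewrite mulr_ge0// sqr_ge0.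
by rewrite -[leLHS]sqrtr1 ler_sqrt ?lerDl// addr_ge0.
Qed.

Let b2 z : derive1 b z ^+ 2 <= B ^+ 2.
Proof. by rewrite -real_normK ?num_real// lerXn2r ?nnegrE//; apply: le_trans (bB z). Qed.

Lemma slope_density_lip t t' z : 0 <= t -> 0 <= t' -> `|rho t z - rho t' z| <= `|t - t'| * B ^+ 2.
Proof.
move=> t0 t0'; have h u : 0 <= u -> 0 <= u * derive1 b z ^+ 2 by move=> u0; rewrite mulr_ge0// sqr_ge0.
apply: le_trans (sqrt1_lip (h _ t0) (h _ t0')) _.
by rewrite -mulrBl normrM ler_wpM2l// ger0_norm ?sqr_ge0.
Qed.

Lemma slope_density_le t z : 0 <= t -> rho t z <= 1 + t * B ^+ 2.
Proof.
move=> t0; rewrite -lerBlDl; apply: le_trans (ler_norm _) _.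
have := slope_density_lip z t0 (lexx 0); rewrite subr0 (ger0_norm t0) => h.
by apply: le_trans h; rewrite [rho 0 z](_ : _ = 1)// /slope_density mul0r addr0 sqrtr1.
Qed.

Lemma slope_density_cont t : continuous (rho t).
Proof.
move=> z; apply: (continuous_comp (f := fun z => 1 + t * derive1 b z ^+ 2)); last exact: sqrt_continuous.
apply: cvgD; first exact: cvg_cst.
by apply: cvgMr; rewrite expr2; under eq_fun do rewrite expr2; apply: cvgM; exact: cb'.
Qed.

End Profile.

Lemma arc_osc (eta b : R -> R) (eps y : R) : (forall y, derivable b y 1) ->
  arc_density (osc_curve eta b eps) y = slope_density b (eps ^- 2 * eta eps ^+ 2) (y * eps^-1).
Proof.
move=> db; have dB z : is_derive z 1 b (derive1 b z) by apply: DeriveDef => //; rewrite derive1E.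
have := @isd_comp_aff R b 0 eps^-1 y (derive1 b (0 + eps^-1 * y)) (dB _) => h.
have {}h := is_deriveZ (eta eps) h.
have E : osc_curve eta b eps = fun t => eta eps *: b (0 + eps^-1 * t).
  by apply/funext => t; rewrite /osc_curve add0r (mulrC t).
rewrite /arc_density /slope_density E derive1E; have [_ ->] := h.
rewrite add0r (mulrC y); congr (Num.sqrt (1 + _)).
by rewrite /GRing.scale /= -exprVn; ring.
Qed.

Lemma tf_addk (d K1 K2 : R) gamma (k1 k2 : R -> R) (U V : @sdata R) : HH gamma d U -> HH gamma d V ->
  measurable_fun setT k1 -> (forall y, `|k1 y| <= K1) ->
  measurable_fun setT k2 -> (forall y, `|k2 y| <= K2) ->
  tf (fun y => k1 y + k2 y) U V = tf k1 U V + tf k2 U V.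
Proof.
move=> HU HV m1 b1 m2 b2; rewrite /tf -big_split /=; apply: eq_bigr => c _.
have mT : measurable (setT : set (measurableTypeR R)) by exact: measurableT.
have sU := HH_tsq c HU; have sV := HH_tsq c HV.
have a1 : {ae mu, forall y, (setT : set R) y -> `|k1 y| <= K1} by apply: aeW => y _; exact: b1.
have a2 : {ae mu, forall y, (setT : set R) y -> `|k2 y| <= K2} by apply: aeW => y _; exact: b2.
have s1 := sqi_mulM mT m1 a1 sU; have s2 := sqi_mulM mT m2 a2 sU.
rewrite -(ipDl mT s1 s2 sV); apply: eq_Rintegral => y _.
by rewrite mulrDl.
Qed.

Lemma curve_cont (a : R * R -> R) (delta L : R) gamma : continuous gamma ->
  (forall y, 0 <= gamma y <= delta) ->
  (forall x y : R * R, 0 <= x.2 <= delta -> 0 <= y.2 <= delta -> `|a x - a y| <= L * `|x - y|) ->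
  continuous (fun y => a (y, gamma y)).
Proof.
move=> cg gd aL y; apply/cvgrPdist_le => e e0.
have r0 : 0 < e / (`|L| + 1) by rewrite divr_gt0// ltr_wpDl.
have h1 : \forall z \near y, `|gamma y - gamma z| <= e / (`|L| + 1).
  by have /cvgrPdist_le/(_ _ r0) := cg y.
have h2 : \forall z \near y, `|y - z| <= e / (`|L| + 1).
  have /cvgrPdist_le/(_ _ r0) : (fun z : R => z) @ y --> y by exact: cvg_id.
  by [].
apply: filterS2 h1 h2 => z gz yz; apply: le_trans (aL (y, gamma y) (z, gamma z) (gd _) (gd _)) _.
apply: (@le_trans _ _ ((`|L| + 1) * (e / (`|L| + 1)))); last by rewrite mulrCA divff ?mulr1// gt_eqF// ltr_wpDl.
apply: (@le_trans _ _ ((`|L| + 1) * `|(y, gamma y) - (z, gamma z)|)).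
  by rewrite ler_wpM2r//; apply: le_trans (ler_norm _) _; rewrite lerDl.
by rewrite ler_wpM2l ?addr_ge0// prod_normE /= ge_max yz gz.
Qed.

Lemma at_right_ex (P : R -> Prop) : (\forall e \near 0^'+, P e) ->
  exists2 e0 : R, 0 < e0 & forall e : R, 0 < e -> e < e0 -> P e.
Proof.
move=> [e0 /= e00 H]; exists e0 => // e e1 e2; apply: H => //=.
by rewrite sub0r normrN gtr0_norm.
Qed.

Section Thin.
Variables (alpha : R) (eta : R -> R).
Hypothesis eta_lim : (fun eps : R => eps^-1 * eta eps) @ 0^'+ --> alpha.

Lemma ratio_near (r : R) : 0 < r -> exists2 e0 : R, 0 < e0 &
  forall eps : R, 0 < eps -> eps < e0 -> `|alpha - eps^-1 * eta eps| <= r.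
Proof. by move=> r0; apply: at_right_ex; have /cvgrPdist_le/(_ _ r0) := eta_lim. Qed.

Variables (d B La Ma : R) (b a0 : R -> R).
Hypotheses (d0 : 0 < d) (cb' : continuous (derive1 b)) (bB : forall z, `|derive1 b z| <= B).
Hypothesis pb : forall z, derive1 b (z + 1) = derive1 b z.
Hypothesis aL : forall y z : R, `|a0 y - a0 z| <= La * `|y - z|.
Hypotheses (La0 : 0 <= La) (aM : forall y, `|a0 y| <= Ma) (alpha0 : 0 <= alpha).

Definition mean_density : R := \int[mu]_(t in `[0, 1]) slope_density b (alpha ^+ 2) t.
Local Notation rho := (slope_density b).

Lemma mean_int0 : \int[mu]_(t in `[0, 1]) (mean_density - rho (alpha ^+ 2) t) = 0.
Proof.
have cr : continuous (rho (alpha ^+ 2)) by exact: slope_density_cont.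
rewrite RintegralB//; last 2 first.
- by apply: cont_int; exact: cst_cont.
- exact: cont_int.
by rewrite Rintegral_cst//= lebesgue_measure_itv /= lte_fin ltr01 oppr0 addr0 mulr1 subrr.
Qed.

(* When [alpha = 0] the oscillating part vanishes; otherwise [eps] is controlled by [eta]. *)
Lemma osc_bound : exists2 C : R, 0 <= C & exists2 e0 : R, 0 < e0 &
  forall eps : R, 0 < eps -> eps < e0 -> forall U V : @sdata R, HH (fun=> 0) d U -> HH (fun=> 0) d V ->
  `|tf (fun y => a0 y * (mean_density - rho (alpha ^+ 2) (y * eps^-1))) U V| <=
  C * Num.sqrt (eta eps) * (Num.sqrt (NN (layer (fun=> 0) d) U.1) * Num.sqrt (NN (layer (fun=> 0) d) V.1)).
Proof.
have cr : continuous (rho (alpha ^+ 2)) by exact: slope_density_cont.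
move: alpha0; rewrite le_eqVlt => /predU1P[a00|a_gt0].
  exists 0 => //; exists 1 => // eps _ _ U V _ _; rewrite !mul0r.
  have r1 z : rho (alpha ^+ 2) z = 1.
    by rewrite /slope_density -a00 expr0n/= mul0r addr0 sqrtr1.
  have m1 : mean_density = 1.
    rewrite /mean_density; under eq_Rintegral => z _ do rewrite r1.
    by rewrite Rintegral_cst//= lebesgue_measure_itv /= lte_fin ltr01 oppr0 addr0 mulr1.
  rewrite /tf big1 ?normr0// => c _; rewrite /ip /Rintegral integral0_eq// => y _.
  by rewrite r1 m1 subrr mulr0 !mul0r.
have cg : continuous (fun z => mean_density - rho (alpha ^+ 2) z).
  by move=> z; apply: cvgB; [exact: cvg_cst|exact: cr].
have pg z : mean_density - rho (alpha ^+ 2) (z + 1) = mean_density - rho (alpha ^+ 2) z.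
  by rewrite /slope_density pb.
have [C C0 HC] := osc_tf d0 aL La0 aM cg pg mean_int0.
have a2 : 0 < alpha / 2 by rewrite divr_gt0.
have [e1 e10 He1] := ratio_near a2.
exists (C * Num.sqrt (2 / alpha)); first by rewrite mulr_ge0.
exists (Num.min e1 (Num.min 1 (d / 2))); first by rewrite !lt_min e10 ltr01 divr_gt0.
move=> eps eps0; rewrite !lt_min => /and3P[h1 h2 h3] U V HU HV.
apply: le_trans (HC eps eps0 (ltW h2) (ltW h3) U V HU HV) _.
rewrite ler_wpM2r ?mulr_ge0// -mulrA ler_wpM2l// -sqrtrM ?divr_ge0//.
have ee : eps <= 2 / alpha * eta eps.
  have := He1 _ eps0 h1; rewrite ler_norml => /andP[_]; rewrite lerBlDr -lerBlDl.
  have -> : alpha - alpha / 2 = alpha / 2 by field.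
  rewrite ler_pdivlMl// => h.
  rewrite mulrC mulrA ler_pdivlMr// mulrC; apply: le_trans (_ : eps * (alpha / 2) * 2 <= _).
    by rewrite le_eqVlt; apply/orP; left; apply/eqP; field.
  by rewrite [leRHS]mulrC; apply: ler_wpM2r.
by rewrite ler_sqrt// (le_trans _ ee)// ltW.
Qed.

End Thin.

(** * From the real system back to the resolvents *)

Section Resolvents.
Local Open Scope complex_scope.
Variables (A : 'I_2 -> 'I_2 -> R * R -> R[i]) (A1 : 'I_2 -> R * R -> R[i]) (A0 : R * R -> R).
Local Notation m := (rmat A A1 A0).
Variables (d s Cr Kb M c1 C1 om : R) (gamma kap0 kapg : R -> R).
Hypotheses (d0 : 0 < d) (s0 : 0 <= s) (sd : s <= d / 2).
Hypotheses (cg : continuous gamma) (gs : forall y, 0 <= gamma y <= s).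
Hypotheses (mr : measurable_fun setT (arc_density gamma)) (rC : forall y, arc_density gamma y <= Cr).
Hypotheses (Kb0 : 0 <= Kb) (M0 : 0 <= M) (c1_gt0 : 0 < c1) (C10 : 0 <= C1) (om0 : 0 <= om).
Local Notation kb0 := (fun y => kap0 y * arc_density (fun=> 0) y).
Local Notation kbg := (fun y => kapg y * arc_density gamma y).
Hypotheses (mk0 : measurable_fun setT kb0) (kK0 : forall y, `|kb0 y| <= Kb).
Hypotheses (mkg : measurable_fun setT kbg) (kKg : forall y, `|kbg y| <= Kb).
Local Notation Om := (layer (fun _ : R => 0) d).
Local Notation Og := (layer gamma d).
Hypothesis mm : forall p q, mbnd Om M (m p q).
Hypotheses (ell : bulk_ell d (fun=> 0) c1 C1 m) (bJ : bulk_J d (fun=> 0) m).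
Hypothesis msym : forall p q x, Om x -> m p q x = m q p x.
Hypothesis mlip : forall p q : cidx, ~~ ((p.2 == None) && (q.2 == None)) -> vlip d s M (m p q).
Hypothesis osc : forall U V : @sdata R, HH (fun=> 0) d U -> HH (fun=> 0) d V ->
  `|tf (fun y => kb0 y - kbg y) U V| <= om * (Num.sqrt (NN Om U.1) * Num.sqrt (NN Om V.1)).

(** The real estimate in terms of the original norms; the factor 2 bounds the sum of the norms of
    the real and imaginary parts of f. *)
Lemma resolvent_estimate f : inL2 area Om f ->
  (W12norm Og (fun x => (resolvent (robin_operator A A1 A0 d gamma kapg) (0 +i* 1) f x
      - resolvent (robin_operator A A1 A0 d (fun=> 0) kap0) (0 +i* 1) f x)%R)
   <= (`|CC d Kb M M c1 C1| * (Num.sqrt s + om) * 2)%:E * L2norm Om f)%E.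
Proof.
move=> fL.
have cz : continuous (fun _ : R => 0 : R) by exact: cst_cont.
have d20 : 0 < d / 2 by rewrite divr_gt0.
have dd : d / 2 + d / 2 = d by rewrite -splitr.
have mO := layer_cont_meas d cz; have mG := layer_cont_meas d cg; have oG := layer_open (d := d) cg.
have sub : Og `<=` Om by apply: layer_sub_l => y; have /andP[] := gs y.
have gm y : gamma y + d / 2 <= d.
  by rewrite -[leRHS]dd lerD2r; apply: le_trans sd; have /andP[] := gs y.
have zm (y : R) : 0 + d / 2 <= d by rewrite add0r -[leRHS]dd lerDl ltW.
have mr0 : measurable_fun setT (arc_density (fun _ : R => 0)).
  by rewrite (_ : arc_density _ = fun=> 1)//; apply/funext => y; exact: arc_cst.
have rC0 y : arc_density (fun _ : R => 0) y <= 1 by rewrite arc_cst.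
have mmg p q : mbnd Og M (m p q) by exact: mbnd_sub (mm p q).
have ellg : bulk_ell d gamma c1 C1 m by apply: aeS ell => x h Ox; apply: h; exact: sub.
have bJg : bulk_J d gamma m by move=> x Ox; apply: bJ; exact: sub.
have /(inL2P _ mO) fc := fL.
have fG : inL2 area Og f by apply/(inL2P _ mG) => c; exact: sqi_sub (fc c).
have [_ HU0 E0] := resolvent_data d20 cz zm mr0 rC0 Kb0 M0 c1_gt0 C10 mk0 kK0 mm ell bJ fL.
have [_ HUg Eg] := resolvent_data d20 cg gm mr rC Kb0 M0 c1_gt0 C10 mkg kKg mmg ellg bJg fG.
have key := strip_perturbation_estimate d0 s0 sd cg gs Kb0 M0 M0 c1_gt0 C10 om0 mk0 kK0 mkg kKg mm ell bJ msym mlip osc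
  fc HU0 HUg E0 Eg erefl.
(* Restricting the limit data to the smaller layer shows that the difference has weak derivatives
   there. *)
have [V [HV VE _]] := HH_restr d0 s0 sd cg gs HU0.
have wV := HH_wjet cg HV; rewrite VE in wV.
have wU := wjet_lin oG mG (-1) wV (HH_wjet cg HUg).
rewrite (W12norm_of oG mG wU); last first.
  by move=> c x; rewrite cpartB mulN1r addrC.
have nL : L2norm Om f = (Num.sqrt (\sum_c nn area Om (fun x => cpart c (f x))))%:E.
  rewrite /L2norm (L2normsqE mO fc) poweR_EFin powR12_sqrt// sumr_ge0// => *; exact: nn_ge0.
rewrite nL -EFinM lee_fin; apply: le_trans key _.
set F := Num.sqrt (\sum_c _); set n1 := nrm _ _; set n2 := nrm _ _.
have F1 : n1 <= F by rewrite /n1 /F /nrm ler_wsqrtr// big_bool lerDl nn_ge0.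
have F2 : n2 <= F by rewrite /n2 /F /nrm ler_wsqrtr// big_bool lerDr nn_ge0.
have so : 0 <= Num.sqrt s + om by rewrite addr_ge0.
have F3 : n1 + n2 <= 2 * F by rewrite mulr2n mulrDl !mul1r lerD.
have n0 : 0 <= n1 + n2 by rewrite addr_ge0// /n1 /n2 /nrm.
apply: (@le_trans _ _ (`|CC d Kb M M c1 C1| * (Num.sqrt s + om) * (n1 + n2))).
  by apply: ler_wpM2r => //; apply: ler_wpM2r => //; exact: ler_norm.
rewrite -[leRHS]mulrA; apply: ler_wpM2l => //.
by apply: mulr_ge0.
Qed.

End Resolvents.

End Homogenization.

(** * Decomposition of the boundary error *)

Section BoundaryCoefficients.
Context {R : realType}.
Local Notation mu := (@lebesgue_measure R).

Lemma tf_leN (d K : R) (k : R -> R) (U V : @sdata R) : 0 < d -> 0 <= K ->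
  measurable_fun setT k -> (forall y, `|k y| <= K) -> HH (fun=> 0) d U -> HH (fun=> 0) d V ->
  `|tf k U V| <= 2 * ((d / 2)^-1 + 1) * K *
     (Num.sqrt (NN (layer (fun=> 0) d) U.1) * Num.sqrt (NN (layer (fun=> 0) d) V.1)).
Proof.
move=> d0 K0 mk kK HU HV; apply: le_trans (tf_bound K0 mk kK HU HV) _.
have d20 : 0 < d / 2 by rewrite divr_gt0.
have zm (y : R) : 0 + d / 2 <= d by rewrite add0r ler_pdivrMr// mulr_natr mulr2n lerDl ltW.
have cz : continuous (fun _ : R => 0 : R) by exact: cst_cont.
have C0 : 0 <= (d / 2)^-1 + 1 by rewrite addr_ge0// invr_ge0 ltW.
have t W : HH (fun=> 0) d W -> Num.sqrt (TT W) <= Num.sqrt ((d / 2)^-1 + 1) * Num.sqrt (NN (layer (fun=> 0) d) W.1).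
  by move=> HW; rewrite -sqrtrM// ler_wsqrtr//; exact: (TT_leN d20 cz zm HW).
have q (e x y : R) : 0 <= e -> 2 * e * K * (x * y) = 2 * K * ((Num.sqrt e * x) * (Num.sqrt e * y)).
  by move=> e0; rewrite -[in LHS](sqr_sqrtr e0); ring.
rewrite q//.
apply: ler_wpM2l; first by rewrite mulr_ge0.
by apply: ler_pM => //; exact: t.
Qed.

Variables (d delta L Ma B Cr tau alpha eps s om1 : R) (a : R * R -> R) (b gamma : R -> R).
Hypotheses (d0 : 0 < d) (delta0 : 0 < delta) (Ma0 : 0 <= Ma).
Hypothesis aL : forall x y : R * R, 0 <= x.2 <= delta -> 0 <= y.2 <= delta -> `|a x - a y| <= L * `|x - y|.
Hypothesis aM : forall x : R * R, 0 <= x.2 <= delta -> `|a x| <= Ma.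
Hypotheses (cb' : continuous (derive1 b)) (bB : forall z, `|derive1 b z| <= B).
Hypotheses (cg : continuous gamma) (gs : forall y, 0 <= gamma y <= s) (sd : s <= delta).
Local Notation rho := (slope_density b).
Hypotheses (tau0 : 0 <= tau) (tC : 1 + tau * B ^+ 2 <= Cr) (aC : 1 + alpha ^+ 2 * B ^+ 2 <= Cr).
Local Notation a0 := (fun y : R => a (y, 0)).
Local Notation mean := (mean_density alpha b).

Let z0 (y : R) : 0 <= (y, 0 : R).2 <= delta. Proof. by rewrite /= lexx ltW. Qed.
Let g0 (y : R) : 0 <= (y, gamma y).2 <= delta.
Proof. by have /andP[h1 h2] := gs y; rewrite /= h1 (le_trans h2). Qed.
Let s0 : 0 <= s. Proof. by have /andP[h1 h2] := gs 0; exact: le_trans h2. Qed.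

Lemma robin_lip (y z : R) : `|a0 y - a0 z| <= `|L| * `|y - z|.
Proof.
apply: le_trans (aL (z0 y) (z0 z)) _.
have -> : `|(y, 0 : R) - (z, 0)| = `|y - z|.
  by rewrite prod_normE /= subrr normr0; apply/max_idPl.
by rewrite ler_wpM2r// ler_norm.
Qed.

Lemma robin_graph (y : R) : `|a0 y - a (y, gamma y)| <= `|L| * s.
Proof.
apply: le_trans (aL (z0 y) (g0 y)) _; have /andP[h1 h2] := gs y.
have -> : `|(y, 0) - (y, gamma y)| = gamma y.
  rewrite prod_normE /= subrr normr0 sub0r normrN (ger0_norm h1).
  by apply/max_idPr.
by apply: le_trans (ler_wpM2r h1 (ler_norm L)) _; rewrite ler_wpM2l.
Qed.

Lemma mean_density_bound : `|mean| <= Cr.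
Proof.
have cr : continuous (rho (alpha ^+ 2)) by exact: slope_density_cont.
have a2 : 0 <= alpha ^+ 2 by exact: sqr_ge0.
rewrite ger0_norm; last first.
  by apply: Rintegral_ge0 => z _; apply: le_trans (slope_density_ge1 b z a2).
apply: (@le_trans _ _ (\int[mu]_(t in `[0, 1]) Cr)).
  apply: le_Rintegral => //; [exact: cont_int|by apply: cont_int; exact: cst_cont|].
  by move=> z _; apply: le_trans (slope_density_le bB z a2) _.
by rewrite Rintegral_cst//= lebesgue_measure_itv /= lte_fin ltr01 oppr0 addr0 mulr1.
Qed.

Lemma slope_density_bound t z : 0 <= t -> 1 + t * B ^+ 2 <= Cr -> `|rho t z| <= Cr.
Proof.
move=> t0 h; rewrite ger0_norm; last by apply: le_trans (slope_density_ge1 b z t0).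
exact: le_trans (slope_density_le bB z t0) h.
Qed.

Let cdiv : continuous (fun y : R => y * eps^-1).
Proof. by move=> y; apply: cvgMl; exact: cvg_id. Qed.

Let crho (t : R) : continuous (fun y : R => rho t (y * eps^-1)).
Proof. by move=> y; apply: continuous_comp; [exact: cdiv|exact: slope_density_cont]. Qed.

Let ca0 : continuous a0. Proof. exact: lipschitz_cont robin_lip. Qed.
Let cag : continuous (fun y => a (y, gamma y)).
Proof. by apply: (curve_cont cg _ aL) => y; exact: g0. Qed.

Let Cr0 : 0 <= Cr. Proof. exact: le_trans mean_density_bound. Qed.

Lemma robin_meas0 : measurable_fun setT (fun y => homogenized_coef alpha b a y * arc_density (fun=> 0) y).
Proof.
have -> : (fun y => homogenized_coef alpha b a y * arc_density (fun=> 0) y) = fun y => a0 y * mean.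
  by apply/funext => z; rewrite arc_cst mulr1.
by apply: continuous_measurable_fun => y; apply: cvgMl; exact: ca0.
Qed.

Lemma robin_bound0 (y : R) : `|homogenized_coef alpha b a y * arc_density (fun=> 0) y| <= Ma * Cr.
Proof. by rewrite arc_cst mulr1 normrM; apply: ler_pM => //; [exact: aM|exact: mean_density_bound]. Qed.

Hypothesis arcE : forall y, arc_density gamma y = rho tau (y * eps^-1).

Lemma arc_meas : measurable_fun setT (arc_density gamma).
Proof.
have -> : arc_density gamma = fun y => rho tau (y * eps^-1) by apply/funext => y; exact: arcE.
by apply: continuous_measurable_fun; exact: crho.
Qed.

Lemma arc_bound y : arc_density gamma y <= Cr.
Proof. by rewrite arcE; apply: le_trans (ler_norm _) _; exact: slope_density_bound. Qed.

Lemma robin_meas : measurable_fun setT (fun y => a (y, gamma y) * arc_density gamma y).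
Proof. by apply: measurable_funM; [exact: continuous_measurable_fun|exact: arc_meas]. Qed.

Lemma robin_bound (y : R) : `|a (y, gamma y) * arc_density gamma y| <= Ma * Cr.
Proof.
rewrite normrM; apply: ler_pM => //; first exact: aM.
by rewrite arcE; exact: slope_density_bound.
Qed.

(** The coefficient error telescopes: oscillation about the mean at slope alpha, change of slope
    from alpha to eta / eps, and transport of [a] from the flat boundary to the curve. Only the
    first part needs cancellation; the other two are bounded pointwise. *)
Lemma robin_osc (U V : @sdata R) : HH (fun=> 0) d U -> HH (fun=> 0) d V ->
  `|tf (fun y => a0 y * (mean - rho (alpha ^+ 2) (y * eps^-1))) U V| <= om1 *
    (Num.sqrt (NN (layer (fun=> 0) d) U.1) * Num.sqrt (NN (layer (fun=> 0) d) V.1)) ->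
  `|tf (fun y => homogenized_coef alpha b a y * arc_density (fun=> 0) y - a (y, gamma y) * arc_density gamma y) U V| <=
  (om1 + 2 * ((d / 2)^-1 + 1) * (Ma * (`|tau - alpha ^+ 2| * B ^+ 2)) +
     2 * ((d / 2)^-1 + 1) * (`|L| * s * Cr)) *
    (Num.sqrt (NN (layer (fun=> 0) d) U.1) * Num.sqrt (NN (layer (fun=> 0) d) V.1)).
Proof.
move=> HU HV H1.
have a2 : 0 <= alpha ^+ 2 by exact: sqr_ge0.
pose k1 (y : R) := a0 y * (mean - rho (alpha ^+ 2) (y * eps^-1)).
pose k2 (y : R) := a0 y * (rho (alpha ^+ 2) (y * eps^-1) - rho tau (y * eps^-1)).
pose k3 (y : R) := (a0 y - a (y, gamma y)) * rho tau (y * eps^-1).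
have m1 : measurable_fun setT k1.
  apply: continuous_measurable_fun => y; apply: cvgM; first exact: ca0.
  by apply: cvgB; [exact: cvg_cst|exact: crho].
have m2 : measurable_fun setT k2.
  apply: continuous_measurable_fun => y; apply: cvgM; first exact: ca0.
  by apply: cvgB; exact: crho.
have m3 : measurable_fun setT k3.
  apply: continuous_measurable_fun => y; apply: cvgM; last exact: crho.
  by apply: cvgB; [exact: ca0|exact: cag].
have b1 y : `|k1 y| <= Ma * (Cr + Cr).
  rewrite normrM; apply: ler_pM => //; first exact: aM.
  apply: le_trans (ler_normB _ _) _; apply: lerD; first exact: mean_density_bound.
  exact: slope_density_bound.
have b2 y : `|k2 y| <= Ma * (`|tau - alpha ^+ 2| * B ^+ 2).
  rewrite normrM; apply: ler_pM => //; first exact: aM.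
  by rewrite distrC; apply: slope_density_lip.
have b3 y : `|k3 y| <= `|L| * s * Cr.
  by rewrite normrM; apply: ler_pM => //; [exact: robin_graph|exact: slope_density_bound].
have -> : (fun y => homogenized_coef alpha b a y * arc_density (fun=> 0) y - a (y, gamma y) * arc_density gamma y) =
   fun y => k1 y + (k2 y + k3 y).
  apply/funext => y; rewrite arc_cst arcE /homogenized_coef -/(slope_density b) -/(mean_density alpha b) /k1 /k2 /k3.
  by ring.
have b23 y : `|k2 y + k3 y| <= Ma * (`|tau - alpha ^+ 2| * B ^+ 2) + `|L| * s * Cr.
  by apply: le_trans (ler_normD _ _) _; exact: lerD.
rewrite (tf_addk HU HV m1 b1 (measurable_funD m2 m3) b23) (tf_addk HU HV m2 b2 m3 b3).
have K2 : 0 <= Ma * (`|tau - alpha ^+ 2| * B ^+ 2).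
  by apply: mulr_ge0 => //; apply: mulr_ge0 => //; exact: sqr_ge0.
have K3 : 0 <= `|L| * s * Cr by rewrite !mulr_ge0.
have h2 := tf_leN d0 K2 m2 b2 HU HV; have h3 := tf_leN d0 K3 m3 b3 HU HV.
apply: le_trans (ler_normD _ _) _; rewrite !mulrDl -addrA; apply: lerD => //.
by apply: le_trans (ler_normD _ _) _; rewrite -!mulrDl; apply: le_trans (lerD h2 h3) _; rewrite !mulrDl.
Qed.

End BoundaryCoefficients.

(** * Choice of the constants and conclusion *)

Lemma derive1_periodic {R : realType} (b : R -> R) : (forall y : R, derivable b y 1) ->
  (forall y : R, b (y + 1) = b y) -> forall y : R, derive1 b (y + 1) = derive1 b y.
Proof.
move=> db pb y; have dB (z : R) : is_derive z 1 b (derive1 b z) by apply: DeriveDef => //; rewrite derive1E.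
have h := isd_shift 1 y dB.
have e : (fun t => b (t + 1)) = b by apply/funext => t; exact: pb.
rewrite e in h; have [_ <-] := h; by rewrite derive1E.
Qed.

(** Collects the four contributions: [e] plays eta, [r] its square root, and [x] the defect of the
    squared ratio; the hypothesis e <= r holds because eta <= 1. *)
Lemma rate_bound {R : realType} (r B0 Co K L Cr Ma B2 x e : R) :
  0 <= r -> 0 <= B0 -> 0 <= Co -> 0 <= K -> 0 <= L -> 0 <= Cr -> 0 <= Ma -> 0 <= B2 -> 0 <= x -> 0 <= e -> e <= r ->
  r * Num.sqrt B0 + (Co * r + K * (Ma * (x * B2)) + K * (L * (e * B0) * Cr)) <=
  (Num.sqrt B0 + Co + K * L * B0 * Cr + K * Ma * B2) * (r + x).
Proof.
move=> r0 B00 Co0 K0 L0 Cr0 Ma0 B20 x0 e0 er.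
have s0 := sqrtr_ge0 B0; move: s0; set sb := Num.sqrt B0 => s0.
have p1 : 0 <= K * L * B0 * Cr by rewrite !mulr_ge0.
have p2 : 0 <= K * Ma * B2 by rewrite !mulr_ge0.
have h : K * (L * (e * B0) * Cr) <= K * L * B0 * Cr * r.
  have -> : K * (L * (e * B0) * Cr) = K * L * B0 * Cr * e by ring.
  by apply: ler_wpM2l.
have h2 : K * (Ma * (x * B2)) = K * Ma * B2 * x by ring.
rewrite h2 mulrDr !mulrDl.
have q1 : 0 <= sb * x by rewrite mulr_ge0.
have q2 : 0 <= Co * x by rewrite mulr_ge0.
have q3 : 0 <= K * L * B0 * Cr * x by rewrite mulr_ge0.
have q4 : 0 <= K * Ma * B2 * r by rewrite mulr_ge0.
move: h q1 q2 q3 q4; rewrite (mulrC r); move: (sb * r) (sb * x) (Co * r) (Co * x) (_ * Cr * r) (_ * Cr * x)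
  (K * Ma * B2 * r) (K * Ma * B2 * x) (K * _) => a1 a2 a3 a4 a5 a6 a7 a8 a9.
by move=> *; lra.
Qed.

Local Open Scope complex_scope.

Theorem theorem1p3 (R : realType) (d : R) (eta b : R -> R)
  (A : 'I_2 -> 'I_2 -> R * R -> R[i]) (A1 : 'I_2 -> R * R -> R[i])
  (A0 : R * R -> R) (c0 delta0 alpha : R) (a : R * R -> R)
  (hd : 0 < d)
  (heta_ge0 : forall eps : R, 0 < eps -> 0 <= eta eps)
  (heta_bounded : exists M : R, \forall eps \near 0^'+, eta eps <= M)
  (hb_C2 : [/\ forall y : R, derivable b y 1,
               forall y : R, derivable (derive1 b) y 1 &
               continuous (derive1n 2 b)])
  (hb_ge0 : forall y : R, 0 <= b y)
  (hb_periodic : forall y : R, b (y + 1) = b y)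
  (hA : forall i j, Winf (layer (fun=> 0) d) 2 (A i j))
  (hA1 : forall j, Winf (layer (fun=> 0) d) 1 (A1 j))
  (hA0 : inLinf area (layer (fun=> 0) d) (fun x => (A0 x)%:C))
  (hA_herm : forall i j x, layer (fun=> 0) d x -> A i j x = conjc (A j i x))
  (hc0 : 0 < c0)
  (hA_ell : forall x (z : 'I_2 -> R[i]), layer (fun=> 0) d x ->
     (c0 * (sqmod (z 0) + sqmod (z 1)))%:C
       <= \sum_(i < 2) \sum_(j < 2) A i j x * z i * conjc (z j))
  (hdelta0 : 0 < delta0)
  (ha : Winf (layer (fun=> 0) delta0) 1 (fun x => (a x)%:C))
  (ha_lip : exists L : R, forall x y : R * R,
     0 <= x.2 <= delta0 -> 0 <= y.2 <= delta0 ->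
     `|a x - a y| <= L * `|x - y|)
  (ha_neq0 : exists2 x : R * R, 0 <= x.2 <= delta0 & a x != 0)
  (halpha : 0 <= alpha)
  (heta_lim : (fun eps : R => eps^-1 * eta eps) @ 0^'+ --> alpha) :
  exists eps0 C : R, [/\ 0 < eps0, 0 < C &
    forall eps : R, 0 < eps < eps0 ->
    forall f : R * R -> R[i], inL2 area (layer (fun=> 0) d) f ->
      (W12norm (layer (osc_curve eta b eps) d)
         (fun x : R * R =>
            resolvent (robin_operator_eps A A1 A0 d eta b a eps) (0 +i* 1) f x
            - resolvent
                (robin_operator0 A A1 A0 d (homogenized_coef alpha b a)) (0 +i* 1) f x)%R
       <= (C * (Num.sqrt (eta eps)
                + `|eps ^- 2 * eta eps ^+ 2 - alpha ^+ 2|))%R%:E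
          * L2norm (layer (fun=> 0%R) d) f)%E].
Proof.
have [db db' _] := hb_C2.
have cb : continuous b by move=> y; apply/differentiable_continuous/derivable1_diffP; exact: db.
have cb' : continuous (derive1 b) by move=> y; apply/differentiable_continuous/derivable1_diffP; exact: db'.
have pb' := derive1_periodic db hb_periodic.
have [B0 B00 bB0] := periodic_bounded cb hb_periodic.
have [B B_ge0 bB] := periodic_bounded cb' pb'.
have [Ma Ma0 aM] := Winf_bounded hdelta0 ha ha_lip.
have [L aL] := ha_lip.
have [M M0 [mm ml]] := coef_bounds hA hA1 hA0.
pose c1 := c0 / 2; pose C1 := 16 * M ^+ 2 / c0 + M.
have c10 : 0 < c1 by rewrite divr_gt0.
have C10 : 0 <= C1 by rewrite addr_ge0// divr_ge0 ?(ltW hc0)// mulr_ge0// sqr_ge0.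
have ell := rmat_ell hA_herm hc0 hA_ell mm M0.
have bJ := rmat_J A1 A0 hA_herm; have msym := rmat_sym A1 A0 hA_herm.
(* A common bound for alpha^2 and eta^2 / eps^2 once |eta / eps - alpha| <= 1. *)
pose T := (alpha + 1) ^+ 2; pose Cr := 1 + T * B ^+ 2.
have T0 : 0 <= T by exact: sqr_ge0.
have B20 : 0 <= B ^+ 2 by exact: sqr_ge0.
have Cr0 : 0 <= Cr by rewrite addr_ge0// mulr_ge0.
have a1 : 0 <= alpha + 1 by rewrite addr_ge0.
have aT : alpha ^+ 2 <= T by rewrite /T lerXn2r ?nnegrE// lerDl.
have aC : 1 + alpha ^+ 2 * B ^+ 2 <= Cr by rewrite /Cr lerD2l ler_wpM2r.
have aM0 y : `|a (y, 0)| <= Ma by apply: aM; rewrite /= lexx ltW.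
have [Co Co0 [e2 e20 Ho]] := osc_bound heta_lim hd cb' pb' (robin_lip hdelta0 aL) (normr_ge0 L) aM0 halpha.
have [e1 e10 He1] := ratio_near heta_lim ltr01.
(* Bounds s / eps, so that small eps gives s <= d / 2 and s <= delta0; B0 + 1 keeps the divisor
   positive. *)
pose D := (alpha + 1) * (B0 + 1).
have D0 : 0 < D by rewrite mulr_gt0// ltr_wpDl.
have d20 : 0 < d / 2 by rewrite divr_gt0.
pose K := 2 * ((d / 2)^-1 + 1).
have K0 : 0 <= K by rewrite mulr_ge0// addr_ge0// invr_ge0 ltW.
pose Ct := Num.sqrt B0 + Co + K * `|L| * B0 * Cr + K * Ma * B ^+ 2.
have Ct0 : 0 <= Ct.
  rewrite /Ct; apply: addr_ge0; last by apply: mulr_ge0 => //; exact: mulr_ge0.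
  apply: addr_ge0; first exact: addr_ge0.
  by apply: mulr_ge0 => //; apply: mulr_ge0 => //; exact: mulr_ge0.
pose Kb := Ma * Cr.
have Kb0 : 0 <= Kb by exact: mulr_ge0.
(* The entry (alpha + 1)^-1 ensures eta <= 1, hence eta <= sqrt(eta). *)
pose e0 := Num.min (Num.min e1 e2) (Num.min (alpha + 1)^-1 (Num.min (d / 2 / D) (delta0 / D))).
have al1 : 0 < alpha + 1 by rewrite ltr_wpDl.
(* Adding 1 makes the constant strictly positive. *)
exists e0, (`|CC d Kb M M c1 C1| * Ct * 2 + 1); split.
- by rewrite !lt_min e10 e20 invr_gt0 al1 !divr_gt0.
- by rewrite ltr_wpDl// !mulr_ge0.
move=> eps /andP[eps0]; rewrite /e0 !lt_min => /andP[/andP[h1 h2] /and3P[h3 h4 h5]] f fL.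
set h := eta eps; have h0 : 0 <= h by exact: heta_ge0.
have qa : eps^-1 * h <= alpha + 1.
  have := He1 _ eps0 h1; rewrite distrC ler_norml => /andP[_].
  by rewrite lerBlDl.
have hq : h <= eps * (alpha + 1) by rewrite -ler_pdivrMl.
have hle1 : h <= 1.
  by apply: le_trans hq _; rewrite -ler_pdivlMr// mul1r ltW.
have hr : h <= Num.sqrt h.
  by rewrite -[X in X <= _]sqr_sqrtr// expr2 ler_piMl// -[leRHS]sqrtr1 ler_sqrt.
(* [B0] bounds the profile, so the curve stays between 0 and [s], and sqrt(s) is of the order of
   sqrt(eta). *)
pose s := h * B0.
have s0 : 0 <= s by exact: mulr_ge0.
have sD : s <= eps * D.
  by rewrite /s /D mulrA; apply: ler_pM => //; rewrite lerDl.
have sd : s <= d / 2 by apply: le_trans sD _; rewrite -ler_pdivlMr// ltW.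
have sdl : s <= delta0 by apply: le_trans sD _; rewrite -ler_pdivlMr// ltW.
have sd' : s < d by apply: le_lt_trans sd _; rewrite ltr_pdivrMr// mulr_natr mulr2n ltrDl.
set gamma := osc_curve eta b eps.
have cg : continuous gamma.
  move=> y; apply: cvgMr; apply: (@continuous_comp _ _ _ (fun y : R => y * eps^-1) b); last exact: cb.
  by apply: cvgMl; exact: cvg_id.
have gs y : 0 <= gamma y <= s.
  rewrite /gamma /osc_curve mulr_ge0//= /s; apply: ler_wpM2l => //.
  by apply: le_trans (bB0 _); exact: ler_norm.
pose tau := eps ^- 2 * h ^+ 2.
have tau0 : 0 <= tau by rewrite mulr_ge0// ?invr_ge0 ?sqr_ge0// exprn_ge0// ltW.
have tauT : tau <= T.
  rewrite /tau -exprVn -exprMn /T lerXn2r ?nnegrE//.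
  by rewrite mulr_ge0// invr_ge0 ltW.
have tC : 1 + tau * B ^+ 2 <= Cr by rewrite /Cr lerD2l ler_wpM2r.
have arcE y : arc_density gamma y = slope_density b tau (y * eps^-1) by exact: arc_osc.
pose om := Co * Num.sqrt h + K * (Ma * (`|tau - alpha ^+ 2| * B ^+ 2)) + K * (`|L| * s * Cr).
have om0 : 0 <= om.
  by rewrite !addr_ge0//; [exact: mulr_ge0|apply: mulr_ge0 => //; apply: mulr_ge0 => //; exact: mulr_ge0
    |apply: mulr_ge0 => //; apply: mulr_ge0 => //; exact: mulr_ge0].
have osc U V (HU : HH (fun=> 0) d U) (HV : HH (fun=> 0) d V) :=
  robin_osc hd hdelta0 Ma0 aL aM cb' bB cg gs sdl tau0 tC aC arcE HU HV (Ho eps eps0 h2 U V HU HV).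
have key := resolvent_estimate hd s0 sd cg gs (arc_meas cb' arcE)
  (arc_bound bB tau0 tC arcE)
  Kb0 M0 c10 C10 om0 (robin_meas0 alpha b hdelta0 aL) (robin_bound0 hdelta0 aM cb' bB aC)
  (robin_meas aL cb' cg gs sdl arcE) (robin_bound aM bB gs sdl tau0 tC arcE)
  mm ell bJ msym (fun p q pq => ml p q pq s s0 sd') osc fL.
apply: le_trans key _; apply: lee_wpmul2r; first exact: poweR_ge0.
rewrite lee_fin.
have -> : Num.sqrt s = Num.sqrt h * Num.sqrt B0 by rewrite /s sqrtrM.
set x := `|_ - alpha ^+ 2|.
have x0 : 0 <= x by exact: normr_ge0.
have r0 : 0 <= Num.sqrt h by exact: sqrtr_ge0.
have rb := rate_bound r0 B00 Co0 K0 (normr_ge0 L) Cr0 Ma0 B20 x0 h0 hr.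
set N := `|CC _ _ _ _ _ _|.
have N0 : 0 <= N by exact: normr_ge0.
apply: (@le_trans _ _ (N * (Ct * (Num.sqrt h + x)) * 2)).
  by apply: ler_wpM2r => //; apply: ler_wpM2l.
have -> : N * (Ct * (Num.sqrt h + x)) * 2 = N * Ct * 2 * (Num.sqrt h + x) by ring.
by apply: ler_wpM2r; [exact: addr_ge0|rewrite lerDl].
Qed.
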